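(* Let $b,c\in\mathbb{R}$, let $1\leq q<\infty$, and let $\alpha,\beta\in\mathbb{R}$ with $\beta>-1$. The following are equivalent: (i) $T_{bc}$ is bounded from $\mathcal{L}^\infty_\alpha$ to $L^q_\beta$. (ii) $S_{bc}$ is bounded from $\mathcal{L}^\infty_\alpha$ to $L^q_\beta$. (iii) $\alpha-1<b$ and $c<b+\dfrac{\beta+1}{q}-\alpha$.
   Context: Let $n\geq 2$ be an integer, $\mathbb{B}$ the open unit ball and $\mathbb{S}$ the unit sphere of $\mathbb{R}^n$, and $\nu$, $\sigma$ the volume and surface measures on $\mathbb{B}$, $\mathbb{S}$ normalized so that $\nu(\mathbb{B})=\sigma(\mathbb{S})=1$. For $\alpha\in\mathbb{R}$, $d\nu_\alpha(x)=\frac{1}{V_\alpha}(1-|x|^2)^\alpha d\nu(x)$, where for $\alpha>-1$ the constant $V_\alpha$ is chosen so that $\nu_\alpha(\mathbb{B})=1$, and $V_\alpha=1$ for $\alpha\leq -1$. For $0<p<\infty$, $L^p_\alpha$ is the Lebesgue class $L^p(\mathbb{B},\nu_\alpha)$ with its norm. For $\alpha\in\mathbb{R}$, $\mathcal{L}^\infty_\alpha$ is the space of measurable $\varphi$ on $\mathbb{B}$ with $(1-|x|^2)^\alpha\varphi(x)\in L^\infty(\nu)$, with norm $\|\varphi\|_{\mathcal{L}^\infty_\alpha}=\|(1-|x|^2)^\alpha\varphi(x)\|_{L^\infty}$. The harmonic Bergman-Besov kernel is $R_\alpha(x,y)=\sum_{k=0}^\infty \gamma_k(\alpha)Z_k(x,y)$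 for $\alpha\in\mathbb{R}$, $x,y\in\mathbb{B}$, where $\gamma_k(\alpha)=\frac{(1+n/2+\alpha)_k}{(n/2)_k}$ if $\alpha>-(1+n/2)$ and $\gamma_k(\alpha)=\frac{(k!)^2}{(1-(n/2+\alpha))_k(n/2)_k}$ if $\alpha\leq-(1+n/2)$; here $(a)_k=\Gamma(a+k)/\Gamma(a)$ is the Pochhammer symbol and $Z_k(x,y)$ is the zonal harmonic of degree $k$: a real-valued symmetric function, a homogeneous harmonic polynomial of degree $k$ in each variable, with $f(\eta)=\int_{\mathbb{S}}f(\zeta)Z_k(\zeta,\eta)\,d\sigma(\zeta)$ for every $\eta\in\mathbb{S}$ and every homogeneous harmonic polynomial $f$ of degree $k$ (so $Z_0\equiv1$). For $b,c\in\mathbb{R}$, $T_{bc}f(x)=\int_{\mathbb{B}}R_c(x,y)f(y)(1-|y|^2)^b\,d\nu(y)$ and $S_{bc}f(x)=\int_{\mathbb{B}}|R_c(x,y)|f(y)(1-|y|^2)^b\,d\nu(y)$. An operator is bounded from $X$ to $Y$ if it is defined on all of $X$, maps into $Y$, and $\|Tf\|_Y\leq C\|f\|_X$ for a constant $C$ and all $f\in X$. *)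

(* Defs.v *)
From HB Require Import structures.
From mathcomp Require Import all_boot all_order all_algebra.
From mathcomp.multinomials Require mpoly.

Set Implicit Arguments.
Unset Strict Implicit.
Unset Printing Implicit Defensive.

(* The notations of mpoly clash with those of mathcomp-analysis: mpoly is
   imported in this module only, and mathcomp-analysis after it. *)
Module HarmonicPoly.
Import GRing.Theory mpoly.
Local Open Scope ring_scope.

Definition laplacian (R : comNzRingType) (n : nat) (p : {mpoly R[n]}) :
    {mpoly R[n]} :=
  \sum_(i < n) p^`M(i)^`M(i).

Definition homog_harmonic_poly (R : comNzRingType) (n k : nat)
    (p : {mpoly R[n]}) : Prop :=
  p \is k.-homog /\ laplacian p = 0.

Definition homog_harmonic (R : comNzRingType) (n k : nat)
    (f : n.-tuple R -> R) : Prop :=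
  exists2 p : {mpoly R[n]}, homog_harmonic_poly k p &
    forall x, f x = p.@[tnth x].

End HarmonicPoly.

From mathcomp Require Import all_classical all_reals all_analysis.
From mathcomp Require Import measurable_realfun.

Import Order.TTheory GRing.Theory Num.Theory.
Import numFieldNormedType.Exports.

Local Open Scope classical_set_scope.
Local Open Scope ring_scope.

Section lebesgue_cons.
Context {R : realType} {n : nat}.
Variable mu : {sigma_finite_measure set (n.-tuple R) -> \bar R}.
Local Open Scope ereal_scope.

Let consp (p : R * n.-tuple R) : n.+1.-tuple R := [tuple of p.1 :: p.2].

Let mconsp : measurable_fun [set: R * n.-tuple R] consp.
Proof. exact: measurable_cons. Qed.

Definition lebesgue_cons : set (n.+1.-tuple R) -> \bar R :=
  pushforward (lebesgue_measure \x mu) (fun p => [tuple of p.1 :: p.2]).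

Let lebesgue_cons0 : lebesgue_cons set0 = 0.
Proof. by rewrite /lebesgue_cons /pushforward preimage_set0 measure0. Qed.

Let lebesgue_cons_ge0 A : 0 <= lebesgue_cons A.
Proof. exact: measure_ge0. Qed.

Let lebesgue_cons_sigma_additive : semi_sigma_additive lebesgue_cons.
Proof.
move=> F mF tF mUF; rewrite /lebesgue_cons /pushforward preimage_bigcup.
apply: measure_semi_sigma_additive.
- by move=> k; rewrite -[X in measurable X]setTI; exact: mconsp.
- apply/trivIsetP => /= i j _ _ ij; rewrite -preimage_setI.
  by move/trivIsetP : tF => /(_ _ _ _ _ ij) ->//; rewrite preimage_set0.
- by rewrite -preimage_bigcup -[X in measurable X]setTI; exact: mconsp.
Qed.

HB.instance Definition _ := isMeasure.Build _ _ _ lebesgue_cons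
  lebesgue_cons0 lebesgue_cons_ge0 lebesgue_cons_sigma_additive.

Let beheadE (x : R) (t : n.-tuple R) :
  [tuple of behead [tuple of x :: t]] = t.
Proof. exact/val_inj. Qed.

Let lebesgue_cons_sigma_finite : sigma_finite setT lebesgue_cons.
Proof.
have /sigma_finiteP[F [TF ndF Ffin]] := sigma_finiteT (@lebesgue_measure R).
have /sigma_finiteP[G [TG ndG Gfin]] := sigma_finiteT mu.
exists (fun k => [set t | F k (thead t) /\ G k [tuple of behead t]]).
  apply/seteqP; split => // t _ /=.
  have [i _ Fi] : (\bigcup_k F k) (thead t) by rewrite -TF.
  have [j _ Gj] : (\bigcup_k G k) [tuple of behead t] by rewrite -TG.
  exists (maxn i j) => //; split.
  - by move: Fi; exact/subsetPset/ndF/leq_maxl.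
  - by move: Gj; exact/subsetPset/ndG/leq_maxr.
move=> k; have [mF Ffi] := Ffin k; have [mG Gfi] := Gfin k; split.
  apply: measurableI.
    by rewrite -[X in measurable X]setTI; exact: measurable_tnth.
  by rewrite -[X in measurable X]setTI; exact: measurable_behead.
rewrite /lebesgue_cons /pushforward (_ : _ @^-1` _ = F k `*` G k).
  by rewrite product_measure1E// lte_mul_pinfty// ge0_fin_numE.
apply/seteqP; split => -[x t] /=.
- by rewrite theadE beheadE.
- by rewrite theadE beheadE.
Qed.

HB.instance Definition _ := Measure_isSigmaFinite.Build _ _ _ lebesgue_cons
  lebesgue_cons_sigma_finite.

End lebesgue_cons.

Fixpoint lebesgue_tuple (R : realType) (n : nat) :
    {sigma_finite_measure set (n.-tuple R) -> \bar R} :=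
  match n with
  | 0 => \d_ [tuple]
  | n'.+1 => lebesgue_cons (lebesgue_tuple R n')
  end.

Section ball_sphere.
Context {R : realType} {n : nat}.
Implicit Types (x y : n.-tuple R) (a : R).

Definition enorm x : R := Num.sqrt (\sum_(i < n) tnth x i ^+ 2).

Definition uball : set (n.-tuple R) := [set x | enorm x < 1].

Definition usphere : set (n.-tuple R) := [set x | enorm x = 1].

Definition normalize x : n.-tuple R := [tuple tnth x i / enorm x | i < n].

Lemma measurable_enorm : measurable_fun setT enorm.
Proof.
apply: (@measurableT_comp _ _ _ _ _ _ (@Num.sqrt R)).
  by apply: continuous_measurable_fun; exact: sqrt_continuous.
apply: measurable_sum => i.
by apply: measurable_funX; exact: measurable_tnth.
Qed.

Lemma measurable_uball : measurable uball.
Proof.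
rewrite (_ : uball = enorm @^-1` `]-oo, 1[%classic); last first.
  by apply/seteqP; split => x; rewrite /uball /= in_itv.
by rewrite -[X in measurable X]setTI; exact: measurable_enorm.
Qed.

Lemma measurable_normalize : measurable_fun setT normalize.
Proof.
apply/measurable_fun_tnthP => i.
rewrite (_ : _ \o _ = fun x => tnth x i * enorm x `^ (-1)); last first.
  by apply/funext => x /=; rewrite tnth_mktuple powR_inv1// sqrtr_ge0.
apply: measurable_funM; first exact: measurable_tnth.
exact: measurableT_comp (measurable_powR _) measurable_enorm.
Qed.

Let ball_volume : {nonneg R} :=
  NngNum (fine_ge0 (measure_ge0 (lebesgue_tuple R n) uball)).

Definition nu : {measure set (n.-tuple R) -> \bar R} :=
  mscale (ball_volume%:num^-1)%:nng
    (mrestr (lebesgue_tuple R n) measurable_uball).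

(* The normalized surface measure of a set of directions is the normalized
   volume of the part of the unit ball lying in the cone over this set. *)
Definition sigma : set (n.-tuple R) -> \bar R := pushforward nu normalize.

Let sigma0 : sigma set0 = 0%E.
Proof. by rewrite /sigma /pushforward preimage_set0 measure0. Qed.

Let sigma_ge0 A : (0 <= sigma A)%E.
Proof. by rewrite /sigma /pushforward measure_ge0. Qed.

Let sigma_sigma_additive : semi_sigma_additive sigma.
Proof.
move=> F mF tF mUF; rewrite /sigma /pushforward preimage_bigcup.
apply: measure_semi_sigma_additive.
- by move=> k; rewrite -[X in measurable X]setTI; exact: measurable_normalize.
- apply/trivIsetP => /= i j _ _ ij; rewrite -preimage_setI.
  by move/trivIsetP : tF => /(_ _ _ _ _ ij) ->//; rewrite preimage_set0.
- rewrite -preimage_bigcup -[X in measurable X]setTI.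
  exact: measurable_normalize.
Qed.

HB.instance Definition _ := isMeasure.Build _ _ _ sigma
  sigma0 sigma_ge0 sigma_sigma_additive.

Definition weight a x : R := (1 - enorm x ^+ 2) `^ a.

Lemma weight_ge0 a x : 0 <= weight a x.
Proof. exact: powR_ge0. Qed.

Lemma measurable_weight a : measurable_fun setT (weight a).
Proof.
apply: (measurableT_comp (measurable_powR _)).
by apply: measurable_funB => //; apply: measurable_funX; exact: measurable_enorm.
Qed.

Definition weight_cst a : R :=
  if -1 < a then (\int[nu]_(x in uball) weight a x)%R else 1.

Lemma weight_cst_ge0 a : 0 <= weight_cst a.
Proof.
rewrite /weight_cst; case: ifPn => // _.
by apply: Rintegral_ge0 => x _; exact: weight_ge0.
Qed.

Definition nu_ a : set (n.-tuple R) -> \bar R :=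
  fun A => (\int[nu]_(x in A) (weight a x / weight_cst a)%:E)%E.

Let nu_0 a : nu_ a set0 = 0%E.
Proof. exact: integral_set0. Qed.

Let density_ge0 a x : (0 <= (weight a x / weight_cst a)%:E)%E.
Proof. by rewrite lee_fin divr_ge0 ?weight_ge0 ?weight_cst_ge0. Qed.

Let nu__ge0 a A : (0 <= nu_ a A)%E.
Proof. exact: integral_ge0. Qed.

Let nu__sigma_additive a : semi_sigma_additive (nu_ a).
Proof.
apply: semi_sigma_additive_nng_induced => //.
apply/measurable_EFinP; apply: measurable_funM => //.
exact: measurable_weight.
Qed.

HB.instance Definition _ a := isMeasure.Build _ _ _ (nu_ a)
  (nu_0 a) (@nu__ge0 a) (@nu__sigma_additive a).

End ball_sphere.

Arguments nu {R n}.
Arguments nu_ {R n} a.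
Arguments sigma {R n}.
Arguments uball {R n}.
Arguments usphere {R n}.

Section zonal.
Context {R : realType} {n : nat}.

Definition is_zonal (k : nat) (Z : n.-tuple R -> n.-tuple R -> R) : Prop :=
  [/\ forall x y, Z x y = Z y x,
      forall y, HarmonicPoly.homog_harmonic k (Z ^~ y),
      forall x, HarmonicPoly.homog_harmonic k (Z x) &
      forall f eta, HarmonicPoly.homog_harmonic k f -> usphere eta ->
        f eta = (\int[sigma]_(zeta in usphere) (f zeta * Z zeta eta))%R].

(* [is_zonal k] determines its argument: a reproducing kernel is unique on the
   sphere, and homogeneity extends it to the whole space. *)
Definition zonal (k : nat) : n.-tuple R -> n.-tuple R -> R :=
  xget (fun _ _ => 0) (is_zonal k).

End zonal.

(* Only meaningful for [0 < a], which covers all uses below. *)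
Definition Gamma {R : realType} (a : R) : R :=
  (\int[lebesgue_measure]_(t in `]0%R, +oo[) (t `^ (a - 1) * expR (- t)))%R.

Definition pochhammer {R : realType} (a : R) (k : nat) : R :=
  Gamma (a + k%:R) / Gamma a.

Section operators.
Context {R : realType} {n : nat}.
Implicit Types (a b c q : R) (x y : n.-tuple R).

Definition gamma_coef a (k : nat) : R :=
  if - (1 + n%:R / 2) < a then
    pochhammer (1 + n%:R / 2 + a) k / pochhammer (n%:R / 2) k
  else
    k`!%:R ^+ 2 /
      (pochhammer (1 - (n%:R / 2 + a)) k * pochhammer (n%:R / 2) k).

Definition bergman_besov a x y : R :=
  limn (series (fun k => gamma_coef a k * zonal k x y)).

(* The operators T_bc and S_bc are [integral_op K b] for the kernels
   [K = bergman_besov c] and [K = abs_bergman_besov c]. *)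
Definition abs_bergman_besov a x y : R := `|bergman_besov a x y|.

Definition integrand (K : n.-tuple R -> n.-tuple R -> R) b
    (f : n.-tuple R -> R) x y : R :=
  K x y * f y * weight b y.

Definition integral_op (K : n.-tuple R -> n.-tuple R -> R) b
    (f : n.-tuple R -> R) x : R :=
  (\int[nu]_(y in uball) integrand K b f x y)%R.

(* A function on the ball is represented by a function on the whole space whose
   values off the ball are ignored. *)
Definition cLinfty_norm a (f : n.-tuple R -> R) : \bar R :=
  ('N[nu]_+oo[EFin \o ((fun x => weight a x * f x)%R \_ uball)])%E.

Definition cLinfty a (f : n.-tuple R -> R) : Prop :=
  measurable_fun uball f /\ (cLinfty_norm a f < +oo)%E.

Definition L_norm a q (f : n.-tuple R -> R) : \bar R :=
  ('N[nu_ a]_q%:E[EFin \o (f \_ uball)])%E.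

Definition L_space a q (f : n.-tuple R -> R) : Prop :=
  measurable_fun uball f /\ (L_norm a q f < +oo)%E.

(* Rintegral is total: that [integral_op K b f] is defined almost everywhere
   has to be required separately. *)
Definition bounded_cLinfty_L (K : n.-tuple R -> n.-tuple R -> R)
    b alpha beta q : Prop :=
  (forall f, cLinfty alpha f ->
     {ae nu, forall x, uball x ->
        nu.-integrable uball (EFin \o integrand K b f x)} /\
     L_space beta q (integral_op K b f)) /\
  (exists C : R, forall f, cLinfty alpha f ->
     (L_norm beta q (integral_op K b f) <= C%:E * cLinfty_norm alpha f)%E).

End operators.

(* Main.v *)
Require Import Defs.
From HB Require Import structures.
From mathcomp Require Import all_boot all_order all_algebra.
From mathcomp Require Import ring lra zify.
From mathcomp.multinomials Require mpoly.

Set Implicit Arguments.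
Unset Strict Implicit.
Unset Printing Implicit Defensive.

(** The condition on the exponents compares the growth of the kernel near the
    boundary with the two weights. Throughout, [s = b - alpha], [R_c] is the kernel and
    [gamma_k] are its coefficients.

    Explicit formulas. The zonal harmonics are given by Gegenbauer polynomials in [x.y]
    and [|x| ^ 2 |y| ^ 2]. That these polynomials are harmonic and reproducing, hence
    equal to [zonal], is an algebraic consequence of two properties of the mean over
    the sphere: factors [|x| ^ 2] do not change it, and integration by parts
    on the ball relates it to the Laplacian ([Zonal.Lam_zonal], [smean_laplacian],
    [zonalE]). Their generating function yields the closed form of the Poisson kernel
    ([poisson_closed_form]) and, after differentiation, the bound
    [C (1 - |x||y|) ^ - m P(x, y)] for the kernel whose coefficients are a polynomial of
    degree [m] in [k] ([theta_poisson_le]).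

    Sufficiency. The coefficients [gamma_k] are such a polynomial times the moments of
    a beta density, or products of two moments if [c <= - (1 + n / 2)], so that [R_c] is an
    average of dilates of kernels to which this bound applies. As the Poisson kernel is
    positive with mean 1, the mean of [|R_c|] over spheres is at most a constant times
    [(1 - |x| rho) ^ - e] for every [e >= 0] above [c + 1] ([gamma_kernel_mean]). If [s > - 1]
    and [c < s + (beta + 1) / q], some such [e] is a sum [t1 + t2] of nonnegative numbers with
    [t1 < s + 1] and [t2 < (beta + 1) / q]. Then [t1] can be absorbed by the weight in the
    integral defining the operators, and [t2] by the weight of the norm of the image
    ([kernel_potential_le]). This bounds [S], and [T] is bounded if [S] is, since
    [|T f| <= S |f|].

    Necessity. For [x] near the origin the kernel is close to 1, so that [T] is defined on
    the weight [- alpha] only if the weight [s] is integrable, that is if [s > - 1]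
    ([alpha_lt]). For the other inequality, suppose [c >= s + (beta + 1) / q]. The ball is
    cut near the sphere into cells whose diameter and distance to the sphere are both of
    the order of [h], for each [h] in a geometric sequence, and [T] is tested on sums of
    signed indicators of cells, times a weight. Zonal harmonics are positive
    semidefinite, and [gamma_k] is at least of the order of [h ^ - (c + 1)] times the
    difference [r ^ k - 3/2 r ^ (2 k)] of coefficients of Poisson kernels, with [1 - r] of the
    order of [h]; hence the mean of [R_c] over the square of a cell is at least of the order
    of [h ^ - (c + n)], its size on the diagonal ([double_integral_kernel_ge]). With suitable
    signs the interactions between distinct cells can be ignored ([exists_signs]). Each
    scale [h] then adds [h ^ (beta + 1 - q (c - s))], which is at least 1, to the power [q]
    of the norm of an image of a function of norm 1, up to a constant factor; as there
    are infinitely many scales, [T] is unbounded ([test_inequality], [c_lt]). *)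

(** * Zonal harmonics as explicit polynomials *)

Module Zonal.
Import Order.TTheory GRing.Theory Num.Theory mpoly.
Local Open Scope ring_scope.

Section gegenbauer.
Variables (R : realFieldType) (lam : R).

Definition rising (a : R) (k : nat) : R := \prod_(l < k) (a + l%:R).

Lemma risingS a k : rising a k.+1 = rising a k * (a + k%:R).
Proof. by rewrite /rising big_ord_recr. Qed.

(** The coefficient of [u ^ (k - 2 j) v ^ j] in the homogeneous Gegenbauer polynomial
    [C_k], where [sum_k C_k t ^ k = (1 - 2 u t + v t ^ 2) ^ - lam]. *)
Definition gcoef (k j : nat) : R :=
  if (j.*2 <= k)%N
  then (-1) ^+ j * 2 ^+ (k - j.*2) * rising lam (k - j) / (j`!%:R * (k - j.*2)`!%:R)
  else 0.

Lemma gcoef_big k j : (k < j.*2)%N -> gcoef k j = 0.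
Proof. by rewrite ltnNge /gcoef => /negbTE ->. Qed.

Lemma factN0 k : k`!%:R != 0 :> R.
Proof. by rewrite pnatr_eq0 -lt0n fact_gt0. Qed.

Lemma gcoefSl k j : (j.*2 <= k)%N ->
  (k.+1%:R - j.*2%:R) * gcoef k.+1 j = 2 * (lam + k%:R - j%:R) * gcoef k j.
Proof.
move=> jk; rewrite /gcoef jk (leq_trans jk)// subSn// (subSn (_ : j <= k)%N); last by lia.
rewrite risingS factS natrM exprS.
have -> : (k.+1%:R - j.*2%:R : R) = (k - j.*2).+1%:R.
  by rewrite -natrB ?subSn// (leq_trans jk).
have -> : lam + k%:R - j%:R = lam + (k - j)%:R.
  by rewrite natrB; [rewrite addrA | lia].
have h1 := factN0 j; have h2 := factN0 (k - j.*2).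
have h3 : (k - j.*2).+1%:R != 0 :> R by rewrite pnatr_eq0.
by field; rewrite h1 h2 addrC natr1 h3.
Qed.

Lemma gcoefSr k j : j.+1%:R * gcoef k.+2 j.+1 = - (lam + k%:R - j%:R) * gcoef k j.
Proof.
have [jk|jk] := leqP j.*2 k; last by rewrite !gcoef_big ?mulr0//; lia.
rewrite /gcoef jk doubleS (_ : (j.*2.+2 <= k.+2)%N) ?ltnS// !subSS.
rewrite (subSn (_ : j <= k)%N); last by lia.
rewrite risingS factS natrM exprS.
have -> : lam + k%:R - j%:R = lam + (k - j)%:R.
  by rewrite natrB; [rewrite addrA | lia].
have h1 := factN0 j; have h2 := factN0 (k - j.*2).
have h3 : j.+1%:R != 0 :> R by rewrite pnatr_eq0.
by field; rewrite h1 h2 addrC natr1 h3.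
Qed.

(** The coefficients of [C_k - v C_(k - 2)]. For [lam = n / 2], [u = x.y] and
    [v = |x| ^ 2 |y| ^ 2] this is the zonal harmonic of degree [k], as the Poisson
    kernel is [(1 - v) (1 - 2 u + v) ^ - lam]. *)
Definition zcoef (k j : nat) : R :=
  match k, j with
  | k'.+2, j'.+1 => gcoef k j - gcoef k' j'
  | _, _ => gcoef k j
  end.

Lemma zcoef_big k j : (k < j.*2)%N -> zcoef k j = 0.
Proof.
case: k j => [|[|k]] [|j]//= h; rewrite ?gcoef_big ?subr0//; lia.
Qed.

Lemma zcoefSS k j : j.+1%:R * zcoef k.+2 j.+1 = - (lam + k.+1%:R) * gcoef k j.
Proof. by rewrite /= mulrBr gcoefSr -natr1 -(natr1 k); ring. Qed.

Definition gegenbauer (k : nat) (u v : R) : R :=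
  \sum_(j < k.+1) gcoef k j * u ^+ (k - j.*2) * v ^+ j.

Definition zpoly (k : nat) (u v : R) : R :=
  \sum_(j < k.+1) zcoef k j * u ^+ (k - j.*2) * v ^+ j.

Lemma zpolySS k u v :
  zpoly k.+2 u v = gegenbauer k.+2 u v - v * gegenbauer k u v.
Proof.
rewrite /zpoly /gegenbauer [LHS]big_ord_recl [X in _ = X - _]big_ord_recl.
rewrite -addrA; congr +%R; rewrite (eq_bigr (fun j : 'I_k.+2 =>
   gcoef k.+2 j.+1 * u ^+ (k.+2 - j.+1.*2) * v ^+ j.+1
   - v * (gcoef k j * u ^+ (k - j.*2) * v ^+ j))); last first.
  by move=> j _; rewrite lift0 /= doubleS !subSS exprS; ring.
rewrite sumrB; congr (_ - _); rewrite -mulr_sumr; congr *%R.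
by rewrite big_ord_recr/= gcoef_big ?mul0r ?addr0//; lia.
Qed.

Lemma zpoly0 u v : zpoly 0 u v = 1.
Proof.
rewrite /zpoly big_ord1 /= /gcoef leq0n !expr0 /rising.
by rewrite big_ord0 fact0 !mul1r invr1 !mul1r.
Qed.

Lemma gegenbauer0 u v : gegenbauer 0 u v = 1.
Proof. exact: zpoly0. Qed.

Lemma zpoly1 u v : zpoly 1 u v = gegenbauer 1 u v.
Proof. by []. Qed.

Lemma gegenbauer1 u v : gegenbauer 1 u v = 2 * lam * u.
Proof.
rewrite /gegenbauer !big_ord_recl big_ord0 [gcoef 1 _]/gcoef /=.
rewrite gcoef_big// /rising big_ord1 /= subn0 !fact0 factS fact0.
by field.
Qed.

Hypothesis lam0 : 0 < lam.

Let lamk k : lam + k%:R != 0.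
Proof. by rewrite gt_eqF// ltr_wpDr. Qed.

(** The differential equation of the generating function, read coefficient by
    coefficient. *)
Lemma gegenbauer_rec k u v : k.+2%:R * gegenbauer k.+2 u v =
  2 * (lam + k.+1%:R) * u * gegenbauer k.+1 u v - (k%:R + 2 * lam) * v * gegenbauer k u v.
Proof.
rewrite /gegenbauer !mulr_sumr big_ord_recl [X in _ = X - _]big_ord_recl.
rewrite [X in _ + X = _]big_ord_recr /= {2}/bump /=.
rewrite [X in _ + (_ + X)](_ : _ = 0) ?addr0; last first.
  by rewrite /bump /= gcoef_big ?(mul0r, mulr0)//; lia.
rewrite -addrA; congr +%R.
  have := @gcoefSl k.+1 0 isT; rewrite double0 !subr0 !subn0 expr0 !mulr1 exprS.
  by rewrite mulrA => ->; ring.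
rewrite -sumrB; apply: eq_bigr => j _; rewrite /bump /= !add1n !doubleS !subSS.
have [jk|jk] := ltnP j.*2 k.
  have -> : (k - j.*2 = (k - j.*2.+1).+1)%N by lia.
  rewrite !exprS.
  have E1 := gcoefSr k j.
  have E2 : (k.+2%:R - j.+1.*2%:R) * gcoef k.+2 j.+1 = 2 * (lam + k.+1%:R - j.+1%:R) * gcoef k.+1 j.+1.
    by apply: gcoefSl; lia.
  have L : lam + k%:R - j%:R != 0.
    by rewrite -addrA -natrB//; lia.
  have J : j.+1%:R != 0 :> R by rewrite pnatr_eq0.
  have E1' : gcoef k.+2 j.+1 = - (lam + k%:R - j%:R) * gcoef k j / j.+1%:R.
    by rewrite -E1; field; rewrite addrC natr1.
  have E2' : gcoef k.+1 j.+1 = - (k%:R - j.*2%:R) * gcoef k j / (2 * j.+1%:R).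
    apply: (mulfI (_ : 2 * (lam + k.+1%:R - j.+1%:R) != 0)).
      have -> : lam + k.+1%:R - j.+1%:R = lam + k%:R - j%:R by rewrite -!natr1; ring.
      by rewrite mulf_neq0// pnatr_eq0.
    by rewrite -E2 E1' doubleS -!natr1; field; rewrite natr1.
  rewrite E1' E2' -mul2n natrM -!natr1; field; rewrite natr1//.
rewrite [gcoef k.+1 _]gcoef_big ?(mul0r, mulr0, sub0r); last by lia.
have [jk'|jk'] := eqVneq j.*2 k.
  rewrite jk' subnn !expr0.
  have E1 := gcoefSr k j.
  have kj : k%:R = 2 * j%:R :> R by rewrite -natrM mul2n jk'.
  have J : j.+1%:R != 0 :> R by rewrite pnatr_eq0.
  have E1' : gcoef k.+2 j.+1 = - (lam + k%:R - j%:R) * gcoef k j / j.+1%:R.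
    by rewrite -E1; field; rewrite addrC natr1.
  by rewrite E1' -!natr1 exprS kj; field; rewrite natr1.
by rewrite !gcoef_big ?(mul0r, mulr0, oppr0)//; lia.
Qed.

End gegenbauer.

Section harmonic.
Variables (R : realFieldType) (n : nat).
Implicit Types (p q f g : {mpoly R[n]}) (y : 'I_n -> R).

Local Notation lap := (@HarmonicPoly.laplacian R n).

Definition gdot p q : {mpoly R[n]} := \sum_(i < n) p^`M(i) * q^`M(i).
Definition lin y : {mpoly R[n]} := \sum_(i < n) y i *: 'X_i.
Definition sqX : {mpoly R[n]} := \sum_(i < n) 'X_i ^+ 2.
Definition dotp (x y : 'I_n -> R) : R := \sum_(i < n) x i * y i.

Lemma lapD p q : lap (p + q) = lap p + lap q.
Proof. by rewrite /HarmonicPoly.laplacian -big_split; apply: eq_bigr => i _; rewrite !mderivD. Qed.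

Lemma lapZ (c : R) p : lap (c *: p) = c *: lap p.
Proof. by rewrite /HarmonicPoly.laplacian scaler_sumr; apply: eq_bigr => i _; rewrite !mderivZ. Qed.

Lemma lap0 : lap 0 = 0.
Proof. by rewrite /HarmonicPoly.laplacian big1// => i _; rewrite !mderiv0. Qed.

Lemma lap_sum I (r : seq I) (F : I -> {mpoly R[n]}) :
  lap (\sum_(j <- r) F j) = \sum_(j <- r) lap (F j).
Proof. by elim: r => [|j r ih]; rewrite ?big_nil ?lap0// !big_cons lapD ih. Qed.

Lemma lapM p q : lap (p * q) = lap p * q + 2 *: gdot p q + p * lap q.
Proof.
rewrite /HarmonicPoly.laplacian /gdot mulr_suml mulr_sumr scaler_sumr -!big_split.
apply: eq_bigr => i _ /=; rewrite !mderivM !mderivD !mderivM scaler_nat; ring.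
Qed.

Lemma mderivXn p k i : (p ^+ k)^`M(i) = k%:R *: (p ^+ k.-1 * p^`M(i)).
Proof.
elim: k => [|k ih]; first by rewrite expr0 scale0r -mpolyC1 mderivC.
rewrite exprS mderivM ih /= -[k.+1%:R]natr1 scalerDl scale1r addrC mulrC.
case: k {ih} => [|k]; first by rewrite !scale0r mul0r !add0r mulrC.
by rewrite -scalerAl mulrAC -exprSr /= [p^`M(i) * _]mulrC.
Qed.

Lemma mderiv_lin y i : (lin y)^`M(i) = (y i)%:MP.
Proof.
rewrite /lin raddf_sum (bigD1 i)//= big1 ?addr0.
  rewrite mderivZ mderivX mnm1E eqxx scale1r.
  have -> : (U_(i) - U_(i) = 0 :> 'X_{1..n})%MM by apply/mnmP => j; rewrite mnmBE mnm0E subnn.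
  by rewrite mpolyX0 alg_mpolyC.
move=> j ji; rewrite mderivZ mderivX mnm1E (negbTE ji) scale0r scaler0 //.
Qed.

Lemma mderivXU (j i : 'I_n) : ('X_j : {mpoly R[n]})^`M(i) = ((j == i)%:R)%:MP.
Proof.
rewrite mderivX mnm1E; case: eqVneq => [->|_]; last by rewrite scale0r mpolyC0.
have -> : (U_(i) - U_(i) = 0 :> 'X_{1..n})%MM by apply/mnmP => l; rewrite mnmBE mnm0E subnn.
by rewrite mpolyX0 scale1r.
Qed.

Lemma mderiv_sqX i : sqX^`M(i) = 2 *: 'X_i.
Proof.
rewrite /sqX raddf_sum (bigD1 i)//= big1 ?addr0 => [|j ji].
  by rewrite mderivXn mderivXU eqxx /= expr1 mulr1.
by rewrite mderivXn mderivXU (negbTE ji) mpolyC0 mulr0 scaler0.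
Qed.

Lemma lap_lin y k : lap (lin y ^+ k.+2) =
  (k.+2%:R * k.+1%:R * dotp y y) *: lin y ^+ k.
Proof.
rewrite /HarmonicPoly.laplacian /dotp mulr_sumr scaler_suml; apply: eq_bigr => i _.
rewrite mderivXn mderivZ mderivM mderiv_lin mderivC mulr0 addr0 mderivXn mderiv_lin /=.
rewrite -!mul_mpolyC !mpolyCM; ring.
Qed.

Lemma lap_lin_small y k : (k < 2)%N -> lap (lin y ^+ k) = 0.
Proof.
case: k => [|[|//]] _; rewrite /HarmonicPoly.laplacian big1// => i _.
  by rewrite expr0 -mpolyC1 !mderivC.
by rewrite expr1 mderiv_lin mderivC.
Qed.

Lemma lap_sqX k : lap (sqX ^+ k.+1) = (2 * k.+1%:R * (n%:R + 2 * k%:R)) *: sqX ^+ k.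
Proof.
have E i : (sqX ^+ k.+1)^`M(i)^`M(i) =
    (2 * k.+1%:R) *: sqX ^+ k + (4 * k.+1%:R * k%:R) *: (sqX ^+ k.-1 * 'X_i ^+ 2).
  rewrite mderivXn mderiv_sqX /= mderivZ mderivM mderivXn mderiv_sqX mderivZ mderivXU eqxx mpolyC1.
  by rewrite -!mul_mpolyC !mpolyCM; ring.
rewrite /HarmonicPoly.laplacian (eq_bigr _ (fun i _ => E i)) big_split /= sumr_const card_ord.
rewrite -scaler_sumr -mulr_sumr -/sqX.
case: k {E} => [|k]; rewrite ?mulr0 ?scale0r ?addr0 ?add0r.
  by rewrite -!mul_mpolyC !mpolyCM -mulr_natr; ring.
by rewrite /= -exprSr -scaler_nat scalerA -scalerDl; congr (_ *: _); ring.
Qed.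

Lemma gdot_lin_sqX y k l :
  gdot (lin y ^+ k) (sqX ^+ l) = (2 * k%:R * l%:R) *: (lin y ^+ k * sqX ^+ l.-1).
Proof.
rewrite /gdot (eq_bigr (fun i => (2 * k%:R * l%:R) *: (lin y ^+ k.-1 * sqX ^+ l.-1 * (y i *: 'X_i)))).
  rewrite -scaler_sumr -mulr_sumr -/(lin y); case: k => [|k].
    by rewrite mulr0 mul0r !scale0r.
  by congr (_ *: _); rewrite /= exprSr; ring.
move=> i _; rewrite !mderivXn mderiv_lin mderiv_sqX -!mul_mpolyC !mpolyCM; ring.
Qed.

Definition zonal_mpoly (k : nat) (y : 'I_n -> R) : {mpoly R[n]} :=
  \sum_(j < k.+1) (zcoef (n%:R / 2) k j * dotp y y ^+ j) *: (lin y ^+ (k - j.*2) * sqX ^+ j).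

Lemma meval_lin y x : (lin y).@[x] = dotp x y.
Proof.
rewrite /lin raddf_sum /=; apply: eq_bigr => i _.
by rewrite mevalZ mevalXU mulrC.
Qed.

Lemma meval_sqX x : sqX.@[x] = dotp x x.
Proof.
rewrite /sqX raddf_sum /=; apply: eq_bigr => i _.
by rewrite rmorphXn /= mevalXU expr2.
Qed.

Lemma meval_zonal_mpoly k x y : (zonal_mpoly k y).@[x] =
  zpoly (n%:R / 2) k (dotp x y) (dotp x x * dotp y y).
Proof.
rewrite /zonal_mpoly raddf_sum /=; apply: eq_bigr => j _.
rewrite mevalZ mevalM !rmorphXn /= meval_lin meval_sqX exprMn; ring.
Qed.

Lemma dhomog_lin y : lin y \is 1.-homog.
Proof. by apply: rpred_sum => i _; apply: dhomogZ; rewrite dhomogX /= mdeg1. Qed.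

Lemma dhomog_sqX : sqX \is 2.-homog.
Proof.
apply: rpred_sum => i _; rewrite -[2%N]mul1n; apply: dhomogMn.
by rewrite dhomogX /= mdeg1.
Qed.

Lemma dhomog_zonal_mpoly k y : zonal_mpoly k y \is k.-homog.
Proof.
apply: rpred_sum => j _.
have [kj|jk] := ltnP k j.*2; first by rewrite zcoef_big// mul0r scale0r dhomog0.
apply: dhomogZ.
have := dhomogM (dhomogMn (k - j.*2) (dhomog_lin y)) (dhomogMn j dhomog_sqX).
by rewrite (_ : (1 * (k - j.*2) + 2 * j)%N = k)//; lia.
Qed.

Lemma dhomog_mderiv k p i : p \is k.-homog -> p^`M(i) \is k.-1.-homog.
Proof.
move=> /dhomogP hp; apply/dhomogP => m.
rewrite mcoeff_msupp mcoeff_mderiv => h.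
have : (m + U_(i))%MM \in msupp p.
  by rewrite mcoeff_msupp; apply: contraNneq h => ->; rewrite mul0rn.
by move/hp; rewrite mfD /= mdeg1 addn1 => <-.
Qed.

Lemma dhomog0C p : p \is 0.-homog -> p = (p@_0%MM)%:MP.
Proof.
move=> /dhomogP hp; apply/mpolyP => m; rewrite mcoeffC.
have [->|m0] := eqVneq m 0%MM; first by rewrite mulr1.
rewrite mulr0; apply/eqP; rewrite -[_ == 0]negbK -mcoeff_msupp.
by apply: contra m0 => /hp /eqP; rewrite mdeg_eq0.
Qed.

Lemma mderiv_homog0 p i : p \is 0.-homog -> p^`M(i) = 0.
Proof. by move=> /dhomog0C ->; rewrite mderivC. Qed.

Lemma euler k p : p \is k.-homog -> \sum_(i < n) 'X_i * p^`M(i) = k%:R *: p.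
Proof.
move=> /dhomogP hp.
rewrite [in RHS](mpolyE p) scaler_sumr.
under eq_bigr do rewrite [p in p^`M(_)](mpolyE p) raddf_sum mulr_sumr.
rewrite exchange_big /= big_seq [RHS]big_seq; apply: eq_bigr => m mp.
rewrite (eq_bigr (fun i => (m i)%:R *: (p@_m *: 'X_[m]))).
  by rewrite -scaler_suml -natr_sum; move: (hp _ mp); rewrite /= mdegE => ->.
move=> i _; rewrite mderivZ mderivX -!scalerAr scalerA mulrC -scalerA.
have [m0|m0] := posnP (m i); first by rewrite m0 !scale0r.
rewrite -mpolyXD; congr (_ *: (_ *: 'X_[_])).
by rewrite addmC submK// lep1mP -lt0n.
Qed.

Hypothesis n2 : (2 <= n)%N.

Let lam0 : 0 < n%:R / 2 :> R.
Proof. by rewrite divr_gt0// ltr0n (leq_trans _ n2). Qed.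

Lemma lap_lin_sqX y k j : (j.*2 <= k)%N -> lap (lin y ^+ (k - j.*2) * sqX ^+ j) =
  ((k - j.*2)%:R * (k%:R - j.*2%:R - 1) * dotp y y) *: (lin y ^+ (k - j.*2.+2) * sqX ^+ j)
  + (2 * j%:R * (n%:R + 2 * k%:R - 2 * j%:R - 2)) *: (lin y ^+ (k - j.*2) * sqX ^+ j.-1).
Proof.
move=> jk; rewrite lapM gdot_lin_sqX.
have -> : lap (lin y ^+ (k - j.*2)) =
    ((k - j.*2)%:R * (k%:R - j.*2%:R - 1) * dotp y y) *: lin y ^+ (k - j.*2.+2).
  have -> : k%:R - j.*2%:R = (k - j.*2)%:R :> R by rewrite natrB.
  have -> : (k - j.*2.+2 = (k - j.*2).-2)%N by lia.
  case: (k - j.*2)%N => [|[|l]].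
  - by rewrite !mul0r scale0r lap_lin_small.
  - by rewrite subrr mulr0 mul0r scale0r lap_lin_small.
  - by rewrite lap_lin -[X in _ * (X - 1)]natr1 addrK.
rewrite -scalerAl -addrA; congr +%R.
case: j jk => [|j] jk.
  by rewrite expr0 !mulr0 !mul0r !scale0r scaler0 add0r /HarmonicPoly.laplacian big1 ?mulr0// => i _; rewrite -mpolyC1 !mderivC.
rewrite lap_sqX /= -scalerAr !scalerA -scalerDl; congr (_ *: _).
rewrite natrB// -mul2n natrM -natr1; ring.
Qed.

(** The Laplacian maps the term of index [j] to multiples of two terms, [A j] and
    [B j] below, and [A j] cancels [B (j + 1)] by the recurrences for the
    coefficients. *)
Lemma lap_zonal_mpoly k y : lap (zonal_mpoly k y) = 0.
Proof.
rewrite /zonal_mpoly lap_sum.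
pose A j := (zcoef (n%:R / 2) k j * dotp y y ^+ j.+1 * (k - j.*2)%:R * (k%:R - j.*2%:R - 1)) *:
   (lin y ^+ (k - j.*2.+2) * sqX ^+ j).
pose B j := (zcoef (n%:R / 2) k j * dotp y y ^+ j * (2 * j%:R * (n%:R + 2 * k%:R - 2 * j%:R - 2)))
   *: (lin y ^+ (k - j.*2) * sqX ^+ j.-1).
rewrite (eq_bigr (fun j : 'I_k.+1 => A j + B j)); last first.
  move=> j _; rewrite lapZ /A /B; have [kj|jk] := ltnP k j.*2.
    by rewrite zcoef_big// !mul0r !scale0r addr0.
  rewrite lap_lin_sqX// scalerDr !scalerA; congr (_ *: _ + _ *: _); rewrite exprSr; ring.
rewrite big_split /= [X in X + _]big_ord_recr [X in _ + X]big_ord_recl /=.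
have -> : B 0%N = 0 by rewrite /B !(mulr0, mul0r) scale0r.
have -> : A k = 0.
  rewrite /A; case: k {A B} => [|k]; first by rewrite !(mulr0, mul0r) scale0r.
  by rewrite zcoef_big ?mul0r ?scale0r//; lia.
rewrite addr0 add0r -big_split /= big1// => j _.
rewrite /bump /= add1n /A /B doubleS /= -scalerDl.
set c := (X in X *: _); suff -> : c = 0 by rewrite scale0r.
rewrite /c {c A B}.
rewrite -mulrA -mulrA.
case: k j => [[]//|[|k] j].
  case: j => [[|//] h]/=; rewrite double0 subn0 [gcoef _ 1 1]gcoef_big//.
  by rewrite subr0 subrr !(mulr0, mul0r) addr0.
have Hz := zcoefSS (n%:R / 2 : R) k j.
have [kj|jk] := ltnP k.+2 j.*2.
  rewrite zcoef_big// mul0r add0r (_ : zcoef _ _ _ = 0) ?mul0r// zcoef_big//; lia.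
set L := n%:R / 2 in Hz *.
have Ln : n%:R = 2 * L by rewrite /L; field.
have J1 : (nat_of_ord j).+1%:R != 0 :> R by rewrite pnatr_eq0.
suff E : zcoef L k.+2 j * (k.+2 - j.*2)%:R * (k.+2%:R - j.*2%:R - 1) =
    4 * (L + k%:R - j%:R) * (L + k.+1%:R) * gcoef L k j.
  rewrite [X in _ + X](_ : _ = 2 * dotp y y ^+ j.+1 * (j.+1%:R * zcoef L k.+2 j.+1) *
     (n%:R + 2 * k.+2%:R - 2 * j.+1%:R - 2)); last by ring.
  rewrite Hz [X in X + _](_ : _ = dotp y y ^+ j.+1 * (zcoef L k.+2 j * (k.+2 - j.*2)%:R * (k.+2%:R - j.*2%:R - 1))).
    by rewrite E Ln -!natr1; ring.
  ring.
rewrite natrB// {Hz}.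
case: (nat_of_ord j) jk J1 => {j} [|j] jk J1.
  rewrite double0 !subr0.
  have E1 := @gcoefSl R L k 0 isT; have E2 := @gcoefSl R L k.+1 0 isT.
  rewrite double0 !subr0 in E1 E2.
  have -> : zcoef L k.+2 0 = gcoef L k.+2 0 by [].
  rewrite [X in X * _]mulrC E2.
  transitivity (2 * (L + k.+1%:R) * (k.+1%:R * gcoef L k.+1 0)); last by rewrite E1; ring.
  by rewrite -!natr1; ring.
have Hz := zcoefSS L k j.
have J2 : j.+1%:R != 0 :> R by rewrite pnatr_eq0.
apply: (mulfI J2).
rewrite !mulrA Hz.
have [kj|{}jk] := ltnP k j.+1.*2.
  rewrite [gcoef L k j.+1]gcoef_big// !mulr0.
  have [->|->] : k = j.*2 \/ k = j.*2.+1 by lia.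
    by rewrite doubleS subrr !(mulr0, mul0r).
  by rewrite doubleS -!natr1; ring.
case: k {Hz} jk => [|[|k]]; rewrite ?doubleS ?ltnS// => jk.
have E1 := @gcoefSl R L k j jk.
have E2 := @gcoefSl R L k.+1 j (leqW jk).
have E3 := gcoefSr L k j.
rewrite [RHS](_ : _ = 4 * (L + k.+2%:R - j.+1%:R) * (L + k.+3%:R) * (j.+1%:R * gcoef L k.+2 j.+1)); last by ring.
rewrite E3.
rewrite [LHS](_ : _ = - (L + k.+3%:R) * (k.+2%:R - j.*2%:R - 1) * ((k.+2%:R - j.*2%:R) * gcoef L k.+2 j)).
  rewrite E2.
  rewrite [LHS](_ : _ = - (L + k.+3%:R) * 2 * (L + k.+1%:R - j%:R) * ((k.+1%:R - j.*2%:R) * gcoef L k.+1 j)).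
    by rewrite E1 -!natr1; ring.
  by rewrite -!natr1; ring.
by rewrite -!natr1; ring.
Qed.

(** [Lam] stands for the mean over the sphere. It ignores factors [|x| ^ 2], and
    integration by parts on the ball relates it to the Laplacian; the reproducing
    property of the zonal harmonics follows from these two facts. *)
Section functional.
Variable Lam : {mpoly R[n]} -> R.
Hypothesis LamD : forall p q, Lam (p + q) = Lam p + Lam q.
Hypothesis LamZ : forall c p, Lam (c *: p) = c * Lam p.
Hypothesis Lam1 : Lam 1 = 1.
Hypothesis Lam_sqX : forall p, Lam (sqX * p) = Lam p.
Hypothesis Lam_lap : forall d p, p \is d.-homog ->
  Lam (lap p) = d%:R * (d%:R + n%:R - 2) * Lam p.

Lemma Lam0 : Lam 0 = 0.
Proof. by rewrite -(scale0r 0) LamZ mul0r. Qed.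

Lemma Lam_sum I (r : seq I) (F : I -> {mpoly R[n]}) :
  Lam (\sum_(j <- r) F j) = \sum_(j <- r) Lam (F j).
Proof. by elim: r => [|j r ih]; rewrite ?big_nil ?Lam0// !big_cons LamD ih. Qed.

Lemma dhomog_lap k p : p \is k.-homog -> lap p \is k.-2.-homog.
Proof.
move=> hp; apply: rpred_sum => i _.
exact: dhomog_mderiv (dhomog_mderiv i hp).
Qed.

Lemma lap_mderiv p i : lap p = 0 -> lap p^`M(i) = 0.
Proof.
move=> hp; rewrite -(mderiv0 R i) -hp /HarmonicPoly.laplacian raddf_sum /=.
by apply: eq_bigr => j _; rewrite (mderiv_comm i j) mderiv_comm.
Qed.

Lemma dhomog_small p k : p \is k.-homog -> (k < 2)%N -> lap p = 0.
Proof.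
move=> hp k2; rewrite /HarmonicPoly.laplacian big1// => i _.
apply: mderiv_homog0; have := dhomog_mderiv i hp.
by case: k hp k2 => [|[|]].
Qed.

Lemma Lam_gdot k l f g : f \is k.-homog -> lap f = 0 -> g \is l.-homog ->
  (k + l)%:R * ((k + l)%:R + n%:R - 2) * Lam (f * g) = 2 * Lam (gdot f g) + Lam (f * lap g).
Proof.
move=> hf Hf hg; rewrite -(Lam_lap (dhomogM hf hg)) lapM Hf mul0r add0r.
by rewrite LamD LamZ.
Qed.

(** The factor on the left of [Lam_gdot] is not 0, and on its right [g] has been
    replaced by polynomials of lower degree, so that induction on the degree of [g]
    applies. *)
Lemma Lam_ortho k l f g : f \is k.-homog -> lap f = 0 -> g \is l.-homog ->
  (l < k)%N -> Lam (f * g) = 0.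
Proof.
have [m] := ubnP l.
elim: m => // m ih in k l f g *; rewrite ltnS => lm hf Hf hg lk.
have E := Lam_gdot hf Hf hg.
have kl : (k + l)%:R * ((k + l)%:R + n%:R - 2) != 0 :> R.
  have h2 : 2 <= n%:R :> R by rewrite ler_nat.
  have h1 : 1 <= (k + l)%:R :> R by rewrite ler1n; lia.
  by rewrite gt_eqF// mulr_gt0//; lra.
apply: (mulfI kl); rewrite E mulr0.
have -> : Lam (gdot f g) = 0.
  rewrite /gdot Lam_sum big1// => i _.
  case: l hg lm lk {E kl} => [|l] hg lm lk; first by rewrite (mderiv_homog0 i hg) mulr0 Lam0.
  apply: (ih k.-1 l); first by lia.
  - exact: dhomog_mderiv.
  - exact: lap_mderiv.
  - exact: (dhomog_mderiv i hg).
  - by lia.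
rewrite mulr0 add0r.
have [l2|l2] := ltnP l 2; first by rewrite (dhomog_small hg)// mulr0 Lam0.
by apply: (ih k l.-2) => //; [lia|exact: dhomog_lap|lia].
Qed.

Lemma Lam_harmonic k f : f \is k.-homog -> lap f = 0 -> (0 < k)%N -> Lam f = 0.
Proof.
by move=> hf Hf k0; rewrite -(mulr1 f) (Lam_ortho hf Hf (dhomog1 _ _)).
Qed.

(** [Lam_gdot] trades one factor [lin y] for a derivative of [f] in the direction
    [y]; after [k] steps only the value [f y] remains. *)
Lemma Lam_lin k f y : f \is k.-homog -> lap f = 0 ->
  (\prod_(l < k) (n%:R + 2 * l%:R)) * Lam (f * lin y ^+ k) = k`!%:R * f.@[y].
Proof.
elim: k f => [|k ih] f hf Hf.
  rewrite big_ord0 expr0 mulr1 !mul1r (dhomog0C hf) mevalC.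
  by rewrite -[_%:MP]mulr1 mul_mpolyC LamZ Lam1 mulr1.
have hl : lin y ^+ k.+1 \is k.+1.-homog.
  by have := dhomogMn k.+1 (dhomog_lin y); rewrite mul1n.
have E := Lam_gdot hf Hf hl.
have L0 : Lam (f * lap (lin y ^+ k.+1)) = 0.
  case: k {ih} f hf Hf hl {E} => [|k] f hf Hf hl.
    by rewrite lap_lin_small// mulr0 Lam0.
  apply: (Lam_ortho hf Hf (dhomog_lap hl)); lia.
rewrite L0 addr0 in E.
pose df := \sum_(i < n) y i *: f^`M(i).
have dfh : df \is k.-homog.
  by apply: rpred_sum => i _; apply: dhomogZ; exact: (dhomog_mderiv i hf).
have dfl : lap df = 0.
  by rewrite /df lap_sum big1// => i _; rewrite lapZ lap_mderiv// scaler0.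
have Eg : gdot f (lin y ^+ k.+1) = k.+1%:R *: (df * lin y ^+ k).
  rewrite /gdot /df mulr_suml scaler_sumr; apply: eq_bigr => i _.
  by rewrite mderivXn mderiv_lin /= -!mul_mpolyC; ring.
rewrite Eg LamZ in E.
have E' : (n%:R + 2 * k%:R) * Lam (f * lin y ^+ k.+1) = Lam (df * lin y ^+ k).
  have k1 : 2 * k.+1%:R != 0 :> R by rewrite mulf_neq0// pnatr_eq0.
  apply: (mulfI k1); rewrite -[RHS]mulrA -E natrD -natr1; ring.
have Ef : df.@[y] = k.+1%:R * f.@[y].
  have := euler hf => /(congr1 (fun p => p.@[y])); rewrite mevalZ => <-.
  rewrite /df !raddf_sum /=; apply: eq_bigr => i _.
  by rewrite mevalZ mevalM mevalXU.
by rewrite big_ord_recr /= -mulrA E' ih// Ef factS natrM; ring.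
Qed.

Lemma Lam_sqX_iter j p : Lam (sqX ^+ j * p) = Lam p.
Proof. by elim: j => [|j ih]; rewrite ?expr0 ?mul1r// exprS -mulrA Lam_sqX. Qed.

(** Up to factors [|x| ^ 2], all terms of the zonal polynomial but the first have
    degree less than [k] and are orthogonal to [f]. *)
Lemma Lam_zonal k f y : f \is k.-homog -> lap f = 0 ->
  Lam (f * zonal_mpoly k y) = f.@[y].
Proof.
move=> hf Hf; rewrite /zonal_mpoly mulr_sumr Lam_sum big_ord_recl big1 ?addr0.
  rewrite expr0 mulr1 double0 subn0 expr0 mulr1 -scalerAr LamZ.
  have -> : zcoef (n%:R / 2) k 0 = (\prod_(l < k) (n%:R + 2 * l%:R)) / k`!%:R :> R.
    have -> : zcoef (n%:R / 2) k 0 = gcoef (n%:R / 2) k 0 :> R by case: k {hf} => [|[]].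
    rewrite /gcoef leq0n double0 !subn0 expr0 mul1r fact0 mul1r /rising; congr (_ / _).
    rewrite -[k in 2 ^+ k]card_ord -prodr_const -big_split /=; apply: eq_bigr => l _.
    by field.
  rewrite mulrAC Lam_lin// mulrAC mulfV ?mul1r//; exact: factN0.
move=> j _; rewrite -scalerAr LamZ [f * _]mulrA [_ * sqX ^+ _]mulrC Lam_sqX_iter.
have [kj|jk] := ltnP k (lift ord0 j).*2; first by rewrite zcoef_big// !mul0r.
have := dhomogMn (k - (lift ord0 j).*2) (dhomog_lin y); rewrite mul1n => hl.
rewrite (Lam_ortho hf Hf hl) ?mulr0//.
by rewrite /= /bump /= in jk *; lia.
Qed.

End functional.

End harmonic.

(** ** Zonal harmonics as functions *)

Section tuples.
Variables (R : realFieldType) (n : nat).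
Local Notation T := (n.-tuple R).
Implicit Types (f g : T -> R) (x y : T).

Definition upd x (i : 'I_n) (t : R) : T := [tuple if j == i then t else tnth x j | j < n].

Definition scale (c : R) x : T := [tuple c * tnth x i | i < n].

Definition dot x y : R := dotp (tnth x) (tnth y).

Definition Zf (k : nat) x y : R := zpoly (n%:R / 2) k (dot x y) (dot x x * dot y y).

Definition monomial_sum (s : seq (R * ('I_n -> nat))) x : R :=
  \sum_(ce <- s) ce.1 * \prod_(i < n) tnth x i ^+ ce.2 i.

Definition polynomial_fun f : Prop := exists s, forall x, f x = monomial_sum s x.

(** [g] is the partial derivative of [f] in the direction [i], tested on the
    lines parallel to this direction, where both are polynomials. *)
Definition partial (i : 'I_n) f g : Prop := forall x, exists q : {poly R},
  forall t, f (upd x i t) = q.[t] /\ g (upd x i t) = q^`().[t].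

Let tnth_upd x i t : tnth (upd x i t) =1 fun j => if j == i then t else tnth x j.
Proof. by move=> j; rewrite tnth_mktuple. Qed.

Lemma polynomial_fun_meval (p : {mpoly R[n]}) : polynomial_fun (fun x => p.@[tnth x]).
Proof.
exists [seq (p@_m, fun i => m i) | m <- msupp p] => x.
by rewrite mevalE /monomial_sum [RHS]big_map.
Qed.

Lemma dhomog_meval_scale k (p : {mpoly R[n]}) c x : p \is k.-homog ->
  p.@[tnth (scale c x)] = c ^+ k * p.@[tnth x].
Proof.
move=> /dhomogP hp; rewrite !mevalE mulr_sumr !big_seq; apply: eq_bigr => m /hp mk.
rewrite mulrCA; congr (_ * _).
under eq_bigr do rewrite tnth_mktuple exprMn.
rewrite big_split /=; congr (_ * _).
by rewrite prodrXr -mk /= mdegE.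
Qed.

Lemma partial_meval (p : {mpoly R[n]}) i :
  partial i (fun x => p.@[tnth x]) (fun x => p^`M(i).@[tnth x]).
Proof.
move=> x; elim/mpolyind: p => [|c m p _ _ [q hq]].
  by exists 0 => t; rewrite mderiv0 !meval0 linear0 !horner0.
pose r := \prod_(j < n | j != i) tnth x j ^+ m j.
exists ((c * r) *: 'X^(m i) + q) => t; have [h1 h2] := hq t.
rewrite mderivD mderivZ mderivX !mevalD !mevalZ h1 h2 derivD derivZ derivXn !hornerE.
have mX (m' : 'X_{1..n}) : (forall j, j != i -> m' j = m j) ->
    'X_[m'].@[tnth (upd x i t)] = t ^+ m' i * r.
  move=> mm'; rewrite mevalX (bigD1 i)//= tnth_upd eqxx; congr (_ * _).
  by apply: eq_bigr => j ji; rewrite tnth_upd (negbTE ji) mm'.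
rewrite !mX//; last first.
  by move=> j ji; rewrite mnmBE mnm1E eq_sym (negbTE ji) subn0.
rewrite mnmBE mnm1E eqxx subn1; split; first by ring.
by rewrite hornerMn hornerXn -mulr_natr /=; ring.
Qed.

Lemma dot_upd0 x y : dot x y = dot y x.
Proof. by apply: eq_bigr => i _; rewrite mulrC. Qed.

Lemma ZfC k x y : Zf k x y = Zf k y x.
Proof. by rewrite /Zf dot_upd0 [dot x x * _]mulrC. Qed.

Hypothesis n2 : (2 <= n)%N.

Lemma Zf_harmonic k y : HarmonicPoly.homog_harmonic k (Zf k ^~ y).
Proof.
exists (zonal_mpoly k (tnth y)).
  by split; [exact: dhomog_zonal_mpoly|exact: lap_zonal_mpoly].
by move=> x; rewrite meval_zonal_mpoly.
Qed.

Lemma harmonic_scale k f c x : HarmonicPoly.homog_harmonic k f ->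
  f (scale c x) = c ^+ k * f x.
Proof. by move=> [p [hp _] fp]; rewrite !fp (dhomog_meval_scale _ _ hp). Qed.

Lemma harmonic_polynomial k f : HarmonicPoly.homog_harmonic k f -> polynomial_fun f.
Proof.
move=> [p _ fp]; have [s hs] := polynomial_fun_meval p.
by exists s => x; rewrite fp hs.
Qed.

(** [I] stands for the mean over the sphere. *)
Section reproducing.
Variable I : (T -> R) -> R.
Hypothesis I_ext : forall f g, (forall x, f x = g x) -> I f = I g.
Hypothesis ID : forall f g, polynomial_fun f -> polynomial_fun g ->
  I (fun x => f x + g x) = I f + I g.
Hypothesis IZ : forall c f, polynomial_fun f -> I (fun x => c * f x) = c * I f.
Hypothesis I1 : I (fun=> 1) = 1.
Hypothesis I_sphere : forall f g, (forall x, dot x x = 1 -> f x = g x) -> I f = I g.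
Hypothesis I_laplacian : forall d f (g h : 'I_n -> T -> R),
  polynomial_fun f -> (forall i, polynomial_fun (g i)) -> (forall i, polynomial_fun (h i)) ->
  (forall c x, f (scale c x) = c ^+ d * f x) ->
  (forall c x, \sum_(i < n) h i (scale c x) = c ^+ d.-2 * \sum_(i < n) h i x) ->
  (forall x, \sum_(i < n) tnth x i * g i x = d%:R * f x) ->
  (forall i, partial i f (g i)) -> (forall i, partial i (g i) (h i)) ->
  ((d < 2)%N -> forall x, \sum_(i < n) h i x = 0) ->
  I (fun x => \sum_(i < n) h i x) = d%:R * (d%:R + n%:R - 2) * I f.

Let Lam (p : {mpoly R[n]}) := I (fun x => p.@[tnth x]).

Let LamD p q : Lam (p + q) = Lam p + Lam q.
Proof.
rewrite /Lam -ID; [|exact: polynomial_fun_meval..].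
by apply: I_ext => x; rewrite mevalD.
Qed.

Let LamZ c p : Lam (c *: p) = c * Lam p.
Proof.
rewrite /Lam -IZ; last exact: polynomial_fun_meval.
by apply: I_ext => x; rewrite mevalZ.
Qed.

Let Lam1 : Lam 1 = 1.
Proof. by rewrite /Lam -[RHS]I1; apply: I_ext => x; rewrite meval1. Qed.

Let Lam_sqX p : Lam (sqX R n * p) = Lam p.
Proof. by apply: I_sphere => x x1; rewrite mevalM meval_sqX -/(dot x x) x1 mul1r. Qed.

Let Lam_lap d p : p \is d.-homog ->
  Lam (HarmonicPoly.laplacian p) = d%:R * (d%:R + n%:R - 2) * Lam p.
Proof.
move=> hp; have E x : (HarmonicPoly.laplacian p).@[tnth x] = \sum_(i < n) p^`M(i)^`M(i).@[tnth x].
  by rewrite /HarmonicPoly.laplacian raddf_sum.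
rewrite /Lam (I_ext E).
apply: (@I_laplacian d _ (fun i x => p^`M(i).@[tnth x])).
- exact: polynomial_fun_meval.
- by move=> i; exact: polynomial_fun_meval.
- by move=> i; exact: polynomial_fun_meval.
- by move=> c x; exact: dhomog_meval_scale.
- move=> c x; rewrite mulr_sumr; apply: eq_bigr => i _.
  by rewrite (dhomog_meval_scale _ _ (dhomog_mderiv i (dhomog_mderiv i hp))).
- move=> x; have := congr1 (fun q => q.@[tnth x]) (euler hp).
  rewrite mevalZ raddf_sum => <-; apply: eq_bigr => i _ /=.
  by rewrite mevalM mevalXU.
- by move=> i; exact: partial_meval.
- by move=> i; exact: partial_meval.
- by move=> d2 x; rewrite -E (dhomog_small hp d2) meval0.
Qed.

Lemma Zf_reproducing k f eta : HarmonicPoly.homog_harmonic k f -> 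
  I (fun zeta => f zeta * Zf k zeta eta) = f eta.
Proof.
move=> [p [hp Hp] fp].
rewrite fp -(Lam_zonal n2 LamD LamZ Lam1 Lam_sqX Lam_lap (tnth eta) hp Hp).
by apply: I_ext => x; rewrite mevalM meval_zonal_mpoly fp.
Qed.

Lemma harmonic_mean0 k f : HarmonicPoly.homog_harmonic k f -> (0 < k)%N -> I f = 0.
Proof.
move=> [p [hp Hp] fp] k0; rewrite (I_ext fp).
exact: (Lam_harmonic n2 LamD LamZ Lam_lap hp Hp k0).
Qed.

End reproducing.
End tuples.
End Zonal.

From mathcomp Require Import all_classical all_reals all_analysis.
From mathcomp Require Import measurable_realfun ess_sup_inf.

Import Order.TTheory GRing.Theory Num.Theory.
Import numFieldNormedType.Exports.
Local Open Scope classical_set_scope.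
Local Open Scope ring_scope.

(** * The Gamma function and Beta moments *)

(** [I] is an open interval, exhausted by segments on which the fundamental theorem
    of calculus applies. *)
Section exhaustion.
Context {R : realType}.
Notation mu := (@lebesgue_measure R).
Implicit Types (f F : R -> R) (u v : R).

Lemma integral_segment_derive f F u v : u < v ->
  (forall x, `[u, v]%classic x -> is_derive x 1 F (f x)) ->
  (forall x, `[u, v]%classic x -> {for x, continuous f}) ->
  (\int[mu]_(x in `[u, v]) (f x)%:E = (F v - F u)%:E)%E.
Proof.
move=> uv dF cf; rewrite EFinB.
have cF x : `[u, v]%classic x -> {for x, continuous F}.
  by move=> /dF dFx; apply: differentiable_continuous; apply/derivable1_diffP; apply: ex_derive.
apply: continuous_FTC2 => //.
- by apply: continuous_in_subspaceT => x /set_mem; exact: cf.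
- split.
  + by move=> x /subset_itv_oo_cc /dF dFx; apply: ex_derive.
  + by apply: cvg_at_right_filter; apply: cF; rewrite /= in_itv/= lexx ltW.
  + by apply: cvg_at_left_filter; apply: cF; rewrite /= in_itv/= lexx ltW.
- by move=> x /subset_itv_oo_cc /dF dFx; rewrite derive1E derive_val.
Qed.

Variables (I : set R) (u v : R^nat).
Hypothesis mI : measurable I.
Hypothesis uv : forall k, u k < v k.
Hypothesis uvI : nondecreasing_seq (fun k => `[u k, v k]%classic).
Hypothesis IE : I = \bigcup_k `[u k, v k]%classic.

Let uvS k : `[u k, v k]%classic `<=` I.
Proof. by move=> x kx; rewrite IE; exists k. Qed.

Lemma ge0_integral_exhaustion_le (f : R -> \bar R) (C : \bar R) : measurable_fun I f ->
  (forall x, I x -> 0 <= f x)%E ->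
  (forall k, \int[mu]_(x in `[u k, v k]) f x <= C)%E -> (\int[mu]_(x in I) f x <= C)%E.
Proof.
move=> mf f0 fC; rewrite IE.
have h : (\int[mu]_(x in `[u i, v i]) f x @[i --> \oo] -->
    \int[mu]_(x in \bigcup_i `[u i, v i]%classic) f x)%E.
  apply: ge0_nondecreasing_set_cvg_integral => //.
  - by move=> i; apply: measurable_funS mf.
  - by move=> i x /uvS; exact: f0.
by rewrite -(cvg_lim _ h)//; apply: lime_le; [exact: cvgP h|exact: nearW].
Qed.

Lemma integrable_derive_ge0 f F C : measurable_fun I f ->
  (forall x, I x -> 0 <= f x) ->
  (forall x, I x -> is_derive x 1 F (f x)) ->
  (forall x, I x -> {for x, continuous f}) ->
  (forall k, F (v k) - F (u k) <= C) -> mu.-integrable I (EFin \o f).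
Proof.
move=> mf f0 dF cf FC; apply/integrableP; split; first exact/measurable_EFinP.
apply: (@le_lt_trans _ _ C%:E); last by rewrite ltry.
rewrite (_ : (\int[mu]_(x in I) _ = \int[mu]_(x in I) (f x)%:E)%E); last first.
  by apply: eq_integral => x /set_mem /f0 fx0; rewrite /= ger0_norm.
apply: ge0_integral_exhaustion_le => //; first exact/measurable_EFinP.
move=> k.
by rewrite (integral_segment_derive (uv k) (fun x kx => dF x (uvS kx)) (fun x kx => cf x (uvS kx))) lee_fin.
Qed.

Lemma Rintegral_derive_eq0 f F : mu.-integrable I (EFin \o f) ->
  (forall x, I x -> is_derive x 1 F (f x)) ->
  (forall x, I x -> {for x, continuous f}) ->
  F (v k) - F (u k) @[k --> \oo] --> 0 -> (\int[mu]_(x in I) f x)%R = 0.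
Proof.
move=> intf dF cf F0.
have mf : measurable_fun I (EFin \o f) by case/integrableP: intf.
have h (g : R -> \bar R) : (forall x, 0 <= g x)%E -> measurable_fun I g ->
    (\int[mu]_(x in `[u i, v i]) g x @[i --> \oo] --> \int[mu]_(x in I) g x)%E.
  move=> g0 mg; rewrite IE; apply: ge0_nondecreasing_set_cvg_integral => //.
  by move=> i; apply: measurable_funS mg.
have hp := h _ (funepos_ge0 (EFin \o f)) (measurable_funepos mf).
have hn := h _ (funeneg_ge0 (EFin \o f)) (measurable_funeneg mf).
have hf : (\int[mu]_(x in `[u i, v i]) (f x)%:E @[i --> \oo] --> \int[mu]_(x in I) (f x)%:E)%E.
  rewrite [X in _ --> X]integralE; under eq_cvg do rewrite integralE.
  apply: cvgeB => //; apply: fin_num_adde_defr; rewrite ge0_fin_numE.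
  - by apply: integral_funepos_lt_pinfty.
  - by apply: integral_ge0.
have hf' : (\int[mu]_(x in `[u i, v i]) (f x)%:E @[i --> \oo] --> 0%:E)%E.
  rewrite (_ : (fun i => _) = EFin \o (fun k => F (v k) - F (u k))).
    by apply: cvg_EFin => //; apply: nearW.
  apply/funext => k.
  by rewrite (integral_segment_derive (uv k) (fun x kx => dF x (uvS kx)) (fun x kx => cf x (uvS kx))).
by rewrite /Rintegral (cvg_unique _ hf hf').
Qed.

End exhaustion.

Section positive_integral.
Context {d} {T : measurableType d} {R : realType} (mu : {measure set T -> \bar R}).

Lemma integral_gt0 (D : set T) (f : T -> R) : measurable D -> mu D != 0%E ->
  measurable_fun D f -> (forall x, D x -> 0 < f x) ->
  (0 < \int[mu]_(x in D) (f x)%:E)%E.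
Proof.
move=> mD D0 mf f0; rewrite lt_neqAle; apply/andP; split; last first.
  by apply: integral_ge0 => x /f0 fx; rewrite lee_fin ltW.
apply: contraNneq D0 => /esym int0.
have : (\int[mu]_(x in D) `|(f x)%:E| = 0)%E.
  by rewrite -int0; apply: eq_integral => x /set_mem /f0 fx; rewrite /= gtr0_norm.
have mf' : measurable_fun D (EFin \o f) by exact/measurable_EFinP.
move/(ae_eq_integral_abs _ mD mf') => -[N [mN N0 DN]].
apply/eqP/(subset_measure0 mD mN) => //; apply: subset_trans DN => x Dx /= /(_ Dx) [] /eqP.
by rewrite gt_eqF// f0.
Qed.

Lemma Rintegral_gt0 (D : set T) (f : T -> R) : measurable D -> mu D != 0%E ->
  mu.-integrable D (EFin \o f) -> (forall x, D x -> 0 < f x) ->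
  0 < (\int[mu]_(x in D) f x)%R.
Proof.
move=> mD D0 intf f0; rewrite fine_gt0// integral_gt0//=.
  have := integrable_fin_num mD intf; rewrite ge0_fin_numE//.
  by apply: integral_ge0 => x /f0 fx; rewrite lee_fin ltW.
by apply/measurable_EFinP; case/integrableP: intf.
Qed.

End positive_integral.

Lemma powR_le1 {R : realType} (b x : R) : 0 <= b -> 0 <= x <= 1 -> x `^ b <= 1.
Proof.
move=> b0 /andP[x0 x1]; have -> : 1 = 1 `^ b :> R by rewrite powR1.
by apply: ge0_ler_powR; rewrite ?nnegrE.
Qed.

Lemma powR_ge1 {R : realType} (b x : R) : 0 <= b -> 1 <= x -> 1 <= x `^ b.
Proof.
move=> b0 x1; have -> : 1 = 1 `^ b :> R by rewrite powR1.
by apply: ge0_ler_powR; rewrite ?nnegrE// (le_trans _ x1).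
Qed.

Section gamma_beta.
Context {R : realType}.
Notation mu := (@lebesgue_measure R).
Implicit Types (a d t : R).

Let ou (k : nat) : R := k.+2%:R^-1.
Let ov (k : nat) : R := 1 - k.+3%:R^-1.
Let pv (k : nat) : R := k.+1%:R.

Let ou_gt0 k : 0 < ou k. Proof. by rewrite invr_gt0. Qed.
Let ou_le k : ou k <= 2^-1. Proof. by rewrite lef_pV2 ?posrE// ler_nat. Qed.

Let cvg_ou : ou k @[k --> \oo] --> 0.
Proof. by have := @cvg_harmonic R; rewrite -(cvg_shiftS). Qed.

Let cvg_ov : 1 - ov k @[k --> \oo] --> 0.
Proof.
rewrite (_ : (fun k => 1 - ov k) = (fun k => ou k.+1)).
  by have := cvg_ou; rewrite -(cvg_shiftS).
by apply/funext => k; rewrite /ov opprB addrC subrK.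
Qed.

Let ouv k : ou k < ov k.
Proof.
have h : k.+3%:R^-1 < 2^-1 :> R by rewrite ltf_pV2 ?posrE// ltr_nat.
by have := ou_le k; rewrite /ov; move: h; set w := _.+3%:R^-1; set o := ou k; lra.
Qed.

Let ouv_nd : nondecreasing_seq (fun k => `[ou k, ov k]%classic).
Proof.
move=> m n mn; apply/subsetPset => x /=; rewrite !in_itv/= => /andP[h1 h2].
have h3 : ou n <= ou m by rewrite lef_pV2 ?posrE// ler_nat !ltnS.
have h4 : n.+3%:R^-1 <= m.+3%:R^-1 :> R by rewrite lef_pV2 ?posrE// ler_nat !ltnS.
by rewrite (le_trans h3)//= (le_trans h2)// /ov lerD2l lerN2.
Qed.

Let exists_ou (x : R) : 0 < x -> exists k, ou k <= x /\ k.+3%:R^-1 <= x.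
Proof.
move=> x0; have [k kx] : exists k, ou k <= x.
  exists (Num.bound x^-1); rewrite /ou -[leRHS]invrK lef_pV2 ?posrE ?invr_gt0//.
  apply/ltW/(lt_trans (archi_boundP _)); first by rewrite invr_ge0 ltW.
  by rewrite ltr_nat.
by exists k; split => //; apply: le_trans kx; rewrite lef_pV2 ?posrE// ler_nat.
Qed.

Let ouvE : `]0, 1[%classic = \bigcup_k `[ou k, ov k]%classic.
Proof.
apply/seteqP; split => x /=.
  rewrite in_itv/= => /andP[x0 x1].
  have [k [k1 _]] := exists_ou x0.
  have x1' : 0 < 1 - x by rewrite subr_gt0.
  have [l [_ l1]] := exists_ou x1'.
  exists (maxn k l) => //=; rewrite in_itv/=; apply/andP; split.
    by apply: le_trans k1; rewrite lef_pV2 ?posrE// ler_nat !ltnS leq_maxl.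
  have : (maxn k l).+3%:R^-1 <= l.+3%:R^-1 :> R by rewrite lef_pV2 ?posrE// ler_nat !ltnS leq_maxr.
  by rewrite /ov => h; move: (le_trans h l1); set w := _.+3%:R^-1; lra.
move=> [k _] /=; rewrite !in_itv/= => /andP[h1 h2].
rewrite (lt_le_trans _ h1)//= (le_lt_trans h2)// /ov ltrBlDr ltrDl invr_gt0//.
Qed.

Let opv k : ou k < pv k.
Proof.
rewrite (le_lt_trans (ou_le k))// (@lt_le_trans _ _ 1)//; last by rewrite ler1n.
by rewrite invf_lt1// ltr1n.
Qed.

Let opv_nd : nondecreasing_seq (fun k => `[ou k, pv k]%classic).
Proof.
move=> m n mn; apply/subsetPset => x /=; rewrite !in_itv/= => /andP[h1 h2].
have h3 : ou n <= ou m by rewrite lef_pV2 ?posrE// ler_nat !ltnS.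
by rewrite (le_trans h3)//= (le_trans h2)// ler_nat ltnS.
Qed.

Let opvE : `]0, +oo[%classic = \bigcup_k `[ou k, pv k]%classic.
Proof.
apply/seteqP; split => x /=; rewrite ?in_itv/= ?andbT.
  move=> x0; have [k [k1 _]] := exists_ou x0.
  exists (maxn k (Num.bound x)) => //=; rewrite in_itv/=; apply/andP; split.
    by apply: le_trans k1; rewrite lef_pV2 ?posrE// ler_nat !ltnS leq_maxl.
  apply/ltW/(lt_le_trans (archi_boundP (ltW x0))).
  by rewrite ler_nat; exact: leq_trans (leq_maxr _ _) (leqnSn _).
by move=> [k _] /=; rewrite !in_itv/= => /andP[h1 h2]; rewrite (lt_le_trans _ h1).
Qed.

Lemma is_derive_powR_onem d t : t < 1 ->
  is_derive t 1 (fun x => (1 - x) `^ d) (- (d * (1 - t) `^ (d - 1))).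
Proof.
move=> t1; have h : is_derive t 1 (fun x : R => 1 - x) (-1).
  have : is_derive t (1 : R) ((cst 1 : R -> R) - id) (0 - 1) by exact: is_deriveB.
  by rewrite sub0r.
have h1 : 0 < 1 - t by rewrite subr_gt0.
have := @is_derive1_comp R (fun y => y `^ d) (fun x => 1 - x) t _ _ (is_derive1_powR d h1) h.
by rewrite mulrN1.
Qed.

Lemma continuous_powR_pos a t : 0 < t -> {for t, continuous (fun x : R => x `^ a)}.
Proof.
move=> t0; apply: differentiable_continuous; apply/derivable1_diffP.
by have := is_derive1_powR a t0 => h; apply: ex_derive.
Qed.

Lemma continuous_powR_onem a t : t < 1 -> {for t, continuous (fun x : R => (1 - x) `^ a)}.
Proof.
move=> t1; apply: differentiable_continuous; apply/derivable1_diffP.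
by have := is_derive_powR_onem a t1 => h; apply: ex_derive.
Qed.

Lemma measurable_powR_onem D a : measurable_fun D (fun x : R => (1 - x) `^ a).
Proof.
apply: measurable_funTS; apply: (measurableT_comp (measurable_powR _)).
exact: measurable_funB.
Qed.

Lemma integrable_powR01 a : 0 < a ->
  mu.-integrable `]0, 1[ (EFin \o (fun t => t `^ (a - 1))).
Proof.
move=> a0; apply: (@integrable_derive_ge0 _ _ ou ov _ ouv ouv_nd ouvE _ (fun t => a^-1 * t `^ a) a^-1) => //.
- by apply: measurable_funTS; exact: measurable_powR.
- by move=> x _; exact: powR_ge0.
- move=> x /=; rewrite in_itv/= => /andP[x0 _].
  have h := is_derive1_powR a x0; apply: is_derive_eq.
  by rewrite -[X in X = _]/(a^-1 * (a * x `^ (a - 1))) mulrA mulVf ?mul1r// gt_eqF.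
- by move=> x /=; rewrite in_itv/= => /andP[x0 _]; exact: continuous_powR_pos.
- move=> k; rewrite -mulrBr ler_piMr ?invr_ge0 ?(ltW a0)//.
  rewrite lerBlDr; apply: (@le_trans _ _ 1); last by rewrite lerDl powR_ge0.
  apply: powR_le1; first exact: ltW.
  by rewrite (ltW (lt_trans (ou_gt0 k) (ouv k)))/= /ov lerBlDr lerDl invr_ge0.
Qed.

Lemma integrable_powR_onem01 d : 0 < d ->
  mu.-integrable `]0, 1[ (EFin \o (fun t => (1 - t) `^ (d - 1))).
Proof.
move=> d0; apply: (@integrable_derive_ge0 _ _ ou ov _ ouv ouv_nd ouvE _ (fun t => - d^-1 * (1 - t) `^ d) d^-1) => //.
- exact: measurable_powR_onem.
- by move=> x _; exact: powR_ge0.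
- move=> x /=; rewrite in_itv/= => /andP[_ x1].
  have h := is_derive_powR_onem d x1; apply: is_derive_eq.
  by rewrite -[X in X = _]/(- d^-1 * (- (d * (1 - x) `^ (d - 1)))) mulrNN mulrA mulVf ?mul1r// gt_eqF.
- by move=> x /=; rewrite in_itv/= => /andP[_ x1]; exact: continuous_powR_onem.
- move=> k; rewrite !mulNr opprK addrC -mulrBr ler_piMr ?invr_ge0 ?(ltW d0)//.
  rewrite lerBlDr; apply: (@le_trans _ _ 1); last by rewrite lerDl powR_ge0.
  apply: powR_le1; first exact: ltW.
  by have := ou_gt0 k; have := ou_le k; set o := ou k => h1 h2; apply/andP; split; lra.
Qed.

Let powR_ou_cvg0 (w : R^nat) b : 0 < b -> (forall k, 0 < w k) -> w k @[k --> \oo] --> 0 ->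
  w k `^ b @[k --> \oo] --> 0.
Proof.
move=> b0 w0 cw; have /cvg_at_rightP := @powR_cvg0 R b b0; apply.
by split.
Qed.

Lemma Rintegral_powR01 a : 0 < a -> (\int[mu]_(t in `]0%R, 1%R[) (t `^ (a - 1)))%R = a^-1.
Proof.
move=> a0.
have i1 : mu.-integrable `]0%R, 1%R[ (EFin \o cst (1 : R)).
  have := @integrable_powR01 1 ltr01; rewrite (_ : _ \o _ = EFin \o cst (1 : R))//.
  by apply/funext => t /=; rewrite subrr powRr0.
have i2 := integrable_powR01 a0.
have i3 : mu.-integrable `]0%R, 1%R[ (EFin \o (fun t => a * t `^ (a - 1))).
  rewrite (_ : _ \o _ = (fun t => a%:E * (t `^ (a - 1))%:E)%E); first exact: integrableZl.
  by apply/funext => t.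
have : (\int[mu]_(t in `]0%R, 1%R[) (a * t `^ (a - 1) - 1))%R = 0.
  apply: (@Rintegral_derive_eq0 _ _ ou ov _ ouv ouv_nd ouvE _ (fun t => t `^ a - t)) => //.
  - rewrite (_ : _ \o _ = (fun t => (a * t `^ (a - 1))%:E - (cst (1 : R) t)%:E)%E).
      by apply: integrableB.
    by apply/funext => t.
  - move=> t /=; rewrite in_itv/= => /andP[t0 t1]; have h1 := is_derive1_powR a t0.
    exact: is_deriveB.
  - move=> t /=; rewrite in_itv/= => /andP[t0 t1].
    apply: cvgB; last exact: cvg_cst.
    by apply: cvgM; [exact: cvg_cst|exact: continuous_powR_pos].
  - have cv : ov k @[k --> \oo] --> (1 : R).
      rewrite (_ : ov = fun k => 1 - (1 - ov k)); last by apply/funext => k; rewrite subKr.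
      by rewrite -[X in _ --> X]subr0; apply: cvgB => //; exact: cvg_cst.
    have cva : ov k `^ a @[k --> \oo] --> (1 : R).
      rewrite -[X in _ --> X](congr1 (fun f => f a) (@powR1 R)).
      by apply: (@continuous_cvg _ _ _ _ _ _ (fun x => x `^ a)) => //; exact: continuous_powR_pos.
    rewrite -[X in _ --> X](subrr 0) -[X in _ --> X - _](subrr 1) -[X in _ --> _ - X](subrr 0).
    by apply: cvgB; apply: cvgB => //; exact: powR_ou_cvg0.
have m01 : mu (`]0%R, 1%R[%classic : set R) = 1%E.
  by rewrite lebesgue_measure_itv/= lte_fin ltr01 -EFinD subr0.
have c1 : (\int[mu]_(t in `]0%R, 1%R[) (1 : R))%R = 1.
  transitivity (1 * fine (mu (`]0%R, 1%R[%classic : set R))); last by rewrite m01 mulr1.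
  exact: Rintegral_cst.
rewrite RintegralB// RintegralZl// c1.
move=> /subr0_eq h; apply: (mulfI (lt0r_neq0 a0)).
by rewrite h mulfV// gt_eqF.
Qed.

Lemma powR_le_half a t : 2^-1 <= t -> t <= 1 -> t `^ a <= 2 `^ `|a|.
Proof.
move=> t2 t1; have t0 : 0 < t by lra.

have [a0|a0] := leP 0 a.
  apply: (@le_trans _ _ 1); first by apply: powR_le1; rewrite ?(ltW t0).
  by apply: powR_ge1 => //; rewrite ler1n.
rewrite ltr0_norm// -{1}[a]opprK powRN -[leLHS]div1r ler_pdivrMr ?powR_gt0// -powRM ?(ltW t0)//.
by apply: powR_ge1; rewrite ?oppr_ge0 ?(ltW a0)//; lra.
Qed.

Definition beta_density a d t : R := t `^ (a - 1) * (1 - t) `^ (d - 1).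

Lemma measurable_beta_density D a d : measurable_fun D (beta_density a d).
Proof.
apply: measurable_funM; last exact: measurable_powR_onem.
by apply: measurable_funTS; exact: measurable_powR.
Qed.

Lemma beta_density_ge0 a d t : 0 <= beta_density a d t.
Proof. by rewrite mulr_ge0 ?powR_ge0. Qed.

Lemma integrable_beta_density a d : 0 < a -> 0 < d ->
  mu.-integrable `]0, 1[ (EFin \o beta_density a d).
Proof.
move=> a0 d0.
pose g t : R := 2 `^ `|d - 1| * t `^ (a - 1) + 2 `^ `|a - 1| * (1 - t) `^ (d - 1).
apply: (@le_integrable _ _ R mu `]0, 1[%classic _ _ (EFin \o g)) => //.
- by apply/measurable_EFinP; exact: measurable_beta_density.
- move=> t /=; rewrite in_itv/= => /andP[t0 t1]; rewrite lee_fin.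
  rewrite ger0_norm ?beta_density_ge0// ger0_norm ?addr_ge0 ?mulr_ge0 ?powR_ge0//.
  rewrite /beta_density /g; have [t2|t2] := leP t 2^-1.
    rewrite ler_wpDr ?mulr_ge0 ?powR_ge0// mulrC ler_wpM2r ?powR_ge0//.
    by apply: powR_le_half; lra.
  rewrite ler_wpDl ?mulr_ge0 ?powR_ge0// ler_wpM2r ?powR_ge0//.
  by apply: powR_le_half; lra.
- rewrite (_ : EFin \o g = (fun t => (2 `^ `|d - 1|)%:E * (t `^ (a - 1))%:E + (2 `^ `|a - 1|)%:E * ((1 - t) `^ (d - 1))%:E)%E); last first.
    by apply/funext => t /=; rewrite -!EFinM -EFinD.
  apply: integrableD => //; apply: integrableZl => //.
  + exact: integrable_powR01.
  + exact: integrable_powR_onem01.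
Qed.

Definition beta_moment a d (k : nat) : R :=
  (\int[mu]_(t in `]0%R, 1%R[) (t ^+ k * beta_density a d t))%R.

Lemma integrable_beta_moment a d k : 0 < a -> 0 < d ->
  mu.-integrable `]0, 1[ (EFin \o (fun t => t ^+ k * beta_density a d t)).
Proof.
move=> a0 d0; apply: le_integrable (integrable_beta_density a0 d0) => //.
  apply/measurable_EFinP; apply: measurable_funM; last exact: measurable_beta_density.
  exact: measurable_funX.
move=> t /=; rewrite in_itv/= => /andP[t0 t1]; rewrite lee_fin normrM ler_piMl//.
by rewrite ger0_norm ?exprn_ge0 ?exprn_ile1 ?ltW.
Qed.

Lemma beta_moment_gt0 a d k : 0 < a -> 0 < d -> 0 < beta_moment a d k.
Proof.
move=> a0 d0; apply: Rintegral_gt0 => //.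
- have m1 : mu (`]0, 1[%classic : set R) = 1%E.
    by rewrite lebesgue_measure_itv/= lte_fin ltr01 oppr0 adde0.
  by apply/eqP => /(etrans (esym m1)) /eqP; rewrite eqe oner_eq0.
- exact: integrable_beta_moment.
- move=> t /=; rewrite in_itv/= => /andP[t0 t1].
  by rewrite mulr_gt0 ?exprn_gt0// mulr_gt0 ?powR_gt0// subr_gt0.
Qed.

(** The function [t ^ (a + k) (1 - t) ^ d] vanishes at both ends of the interval, so
    its derivative has integral 0. *)
Lemma beta_momentS a d k : 0 < a -> 0 < d ->
  (a + d + k%:R) * beta_moment a d k.+1 = (a + k%:R) * beta_moment a d k.
Proof.
move=> a0 d0.
pose e := a + k%:R.
have e0 : 0 < e by rewrite ltr_wpDr.
pose f t : R := e * (t ^+ k * beta_density a d t) - (e + d) * (t ^+ k.+1 * beta_density a d t).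
pose F t : R := t `^ e * (1 - t) `^ d.
have fE t : `]0, 1[%classic t -> f t = e * t `^ (e - 1) * (1 - t) `^ d - d * t `^ e * (1 - t) `^ (d - 1).
  rewrite /= in_itv/= => /andP[t0 t1]; rewrite /f /beta_density.
  have t1' : 0 < 1 - t by rewrite subr_gt0.
  have -> : t `^ e = t * t `^ (e - 1) by rewrite mulr_powRB1// ltW.
  have -> : (1 - t) `^ d = (1 - t) * (1 - t) `^ (d - 1) by rewrite mulr_powRB1// ltW.
  have -> : t `^ (e - 1) = t ^+ k * t `^ (a - 1).
    by rewrite -powR_mulrn ?ltW// -powRD ?(gt_eqF t0) ?implybT//; congr (_ `^ _); rewrite /e; ring.
  by rewrite exprS; ring.
have intf : mu.-integrable `]0, 1[ (EFin \o f).
  rewrite (_ : EFin \o f = (fun t => e%:E * (t ^+ k * beta_density a d t)%:E - (e + d)%:E * (t ^+ k.+1 * beta_density a d t)%:E)%E).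
    by apply: integrableB => //; apply: integrableZl => //; exact: integrable_beta_moment.
  by apply/funext => t; rewrite /f /= EFinB !EFinM.
have f0 : (\int[mu]_(t in `]0%R, 1%R[) f t)%R = 0.
  apply: (@Rintegral_derive_eq0 _ _ ou ov _ ouv ouv_nd ouvE f F) => //.
  - move=> t I; rewrite fE//; move: I => /=; rewrite in_itv/= => /andP[t0 t1].
    have h1 := is_derive1_powR e t0; have h2 := is_derive_powR_onem d t1.
    apply: is_derive_eq; rewrite -![_ *: _]/(_ * _); ring.
  - move=> t /=; rewrite in_itv/= => /andP[t0 t1].
    have c1 : {for t, continuous (fun x : R => beta_density a d x)}.
      by apply: cvgM; [exact: continuous_powR_pos|exact: continuous_powR_onem].
    have c2 j : {for t, continuous (fun x : R => x ^+ j * beta_density a d x)}.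
      by apply: cvgM => //; exact: exprn_continuous.
    by apply: cvgB; (apply: cvgM; [exact: cvg_cst|exact: c2]).
  - rewrite -(subr0 0); apply: cvgB.
    + apply: (@squeeze_cvgr _ _ _ _ (cst 0) (fun k => (1 - ov k) `^ d)).
      * apply: nearW => j /=; rewrite mulr_ge0 ?powR_ge0//= ler_piMl ?powR_ge0//.
        apply: powR_le1; first exact: ltW.
        have := ouv j; have := ou_gt0 j => h1 h2.
        by rewrite (ltW (lt_trans h1 h2))/= /ov lerBlDr lerDl invr_ge0.
      * exact: cvg_cst.
      * by apply: powR_ou_cvg0 => // j; rewrite /ov opprB addrC subrK invr_gt0.
    + apply: (@squeeze_cvgr _ _ _ _ (cst 0) (fun k => (ou k) `^ e)).
      * apply: nearW => j /=; rewrite mulr_ge0 ?powR_ge0//= ler_piMr ?powR_ge0//.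
        apply: powR_le1; first exact: ltW.
        by have := ou_gt0 j; have := ou_le j; set o := ou j => h1 h2; apply/andP; split; lra.
      * exact: cvg_cst.
      * by apply: powR_ou_cvg0.
move: f0; rewrite /f RintegralB//; last 2 first.
- rewrite (_ : _ \o _ = fun t => (e%:E * (t ^+ k * beta_density a d t)%:E)%E).
    by apply: integrableZl => //; exact: integrable_beta_moment.
  by apply/funext => t /=; rewrite EFinM.
- rewrite (_ : _ \o _ = fun t => ((e + d)%:E * (t ^+ k.+1 * beta_density a d t)%:E)%E).
    by apply: integrableZl => //; exact: integrable_beta_moment.
  by apply/funext => t /=; rewrite EFinM.
rewrite !RintegralZl//; [|exact: integrable_beta_moment..].
move/subr0_eq; rewrite -!/(beta_moment _ _ _) /e => ->; congr (_ * _); ring.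
Qed.


Lemma powR_le_expR a t : 0 < a -> 0 <= t -> t `^ a <= (2 * a) `^ a * expR (t / 2).
Proof.
move=> a0 t0; have a2 : 0 < 2 * a by rewrite mulr_gt0.
have -> : t / 2 = t / (2 * a) * a by field; rewrite gt_eqF.
rewrite expRM -powRM ?expR_ge0 ?(ltW a2)//.
apply: ge0_ler_powR; rewrite ?nnegrE ?mulr_ge0 ?expR_ge0 ?(ltW a0) ?(ltW a2)//.
rewrite -ler_pdivrMl// mulrC; apply: le_trans (expR_ge1Dx _).
by rewrite lerDr.
Qed.

Lemma is_derive_expRZ c t : is_derive t 1 (fun x => expR (c * x)) (c * expR (c * t)).
Proof.
have h : is_derive t 1 (fun x : R => c * x) c.
  have : is_derive t (1 : R) (c *: (id : R -> R)) (c *: 1) by exact: is_deriveZ.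
  by rewrite [c *: 1]mulr1.
have := @is_derive1_comp R expR (fun x => c * x) t _ _ (is_derive_expR (c * t)) h.
by rewrite mulrC.
Qed.

Lemma is_derive_powR_expRN a t : 0 < t ->
  is_derive t 1 (fun x => x `^ a * expR (- x))
    (a * t `^ (a - 1) * expR (- t) - t `^ a * expR (- t)).
Proof.
move=> t0; have h1 := is_derive1_powR a t0.
have h2 : is_derive t 1 (fun x => expR (- x)) (- expR (- t)).
  have := is_derive_expRZ (-1) t; rewrite !mulN1r.
  by under eq_fun do rewrite mulN1r.
by apply: is_derive_eq; rewrite -![_ *: _]/(_ * _); ring.
Qed.

Lemma continuous_expRZ c t : {for t, continuous (fun x : R => expR (c * x))}.
Proof.
apply: differentiable_continuous; apply/derivable1_diffP.
by have h := is_derive_expRZ c t; apply: ex_derive.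
Qed.

Lemma continuous_powR_expRN a t : 0 < t ->
  {for t, continuous (fun x : R => x `^ a * expR (- x))}.
Proof.
move=> t0; apply: differentiable_continuous; apply/derivable1_diffP.
by have h := is_derive_powR_expRN a t0; apply: ex_derive.
Qed.

Lemma measurable_powR_expRN D a : measurable_fun D (fun t : R => t `^ a * expR (- t)).
Proof.
apply: measurable_funTS; apply: measurable_funM; first exact: measurable_powR.
by apply: measurableT_comp => //; exact: measurable_expR.
Qed.

Lemma integrable_gamma a : 0 < a ->
  mu.-integrable `]0, +oo[ (EFin \o (fun t => t `^ (a - 1) * expR (- t))).
Proof.
move=> a0.
have ar (L A B C D : R) : 0 <= L -> 0 <= D -> L * B <= L * 1 -> 0 <= L * A -> L * A <= L * 1 ->
    C <= L * A -> -2 * L * A + C - (-2 * L * B + D) <= 3 * L by lra.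
pose K := (2 * a) `^ a / a.
have K0 : 0 <= K by rewrite divr_ge0 ?powR_ge0// ltW.
have Ka t : 0 <= t -> t `^ a * expR (- t) / a <= K * expR (- 2^-1 * t).
  move=> t0; rewrite ler_pdivrMr// mulrAC divfK ?gt_eqF//.
  have -> : - 2^-1 * t = t / 2 - t by field.
  rewrite expRD mulrA ler_wpM2r ?expR_ge0//.
  exact: powR_le_expR.
pose h t := K * expR (- 2^-1 * t) + t `^ (a - 1) * expR (- t) - a^-1 * (t `^ a * expR (- t)).
pose G t := (- 2 * K) * expR (- 2^-1 * t) + a^-1 * (t `^ a * expR (- t)).
have hf t : 0 <= t -> t `^ (a - 1) * expR (- t) <= h t.
  by move=> t0; have := Ka t t0; rewrite /h mulrC; lra.
have hg0 t : 0 <= t `^ (a - 1) * expR (- t) by rewrite mulr_ge0 ?powR_ge0 ?expR_ge0.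
have h0 t : 0 <= t -> 0 <= h t by move=> t0; exact: le_trans (hg0 t) (hf t t0).
apply: (@le_integrable _ _ R mu `]0, +oo[%classic _ _ (EFin \o h)) => //.
- by apply/measurable_EFinP; exact: measurable_powR_expRN.
- move=> t /=; rewrite in_itv/= andbT => t0; rewrite lee_fin !ger0_norm ?h0 ?hf ?(ltW t0)//.
apply: (@integrable_derive_ge0 _ _ ou pv (measurable_itv _) opv opv_nd opvE h G (3 * K)).
- apply: measurable_funB; last first.
    by apply: measurable_funM => //; exact: measurable_powR_expRN.
  apply: measurable_funD; last exact: measurable_powR_expRN.
  by apply: measurable_funM => //; apply: measurableT_comp => //; exact: measurable_funM.
- by move=> t /=; rewrite in_itv/= andbT => t0; rewrite h0 ?(ltW t0).
- move=> t /=; rewrite in_itv/= andbT => t0.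
  have h1 := is_derive_powR_expRN a t0.
  have h2 := is_derive_expRZ (- 2^-1) t.
  have : is_derive t (1 : R) ((- 2 * K) *: (fun x : R => expR (- 2^-1 * x)) + a^-1 *: (fun x : R => x `^ a * expR (- x)))
     ((- 2 * K) *: (- 2^-1 * expR (- 2^-1 * t)) + a^-1 *: (a * t `^ (a - 1) * expR (- t) - t `^ a * expR (- t))).
    by apply: is_deriveD; apply: is_deriveZ.
  rewrite -![_ *: (_ * _)]/(_ * _) -[_ *: (_ - _)]/(_ * _).
  rewrite (_ : _ + _ = h t)//; rewrite /h; field; rewrite gt_eqF//.
- move=> t /=; rewrite in_itv/= andbT => t0.
  apply: cvgB; last by apply: cvgM; [exact: cvg_cst|exact: continuous_powR_expRN].
  apply: cvgD; last exact: continuous_powR_expRN.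
  by apply: cvgM; [exact: cvg_cst|exact: continuous_expRZ].
- move=> k; rewrite /G.
  have u0 : 0 <= ou k by exact: ltW.
  have v0 : 0 <= pv k by [].
  have := Ka _ v0; rewrite mulrC.
  have : K * expR (- 2^-1 * pv k) <= K * 1.
    by apply: ler_wpM2l => //; rewrite expR_le1 mulNr oppr_le0 mulr_ge0.
  have : 0 <= K * expR (- 2^-1 * pv k) by rewrite mulr_ge0 ?expR_ge0.
  have : K * expR (- 2^-1 * ou k) <= K * 1.
    by apply: ler_wpM2l => //; rewrite expR_le1 mulNr oppr_le0 mulr_ge0.
  have : 0 <= a^-1 * (ou k `^ a * expR (- ou k)).
    by rewrite !mulr_ge0 ?powR_ge0 ?expR_ge0 ?invr_ge0 ?ltW.
  move: K0; move: (a^-1 * (ou k `^ a * _)) (a^-1 * (pv k `^ a * _)) => D C.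
  by move: (expR (_ * ou k)) (expR (_ * pv k)) => B A; exact: ar.
Qed.

Lemma Gamma_gt0 a : 0 < a -> 0 < Gamma a.
Proof.
move=> a0; apply: Rintegral_gt0 => //.
- have m1 : mu (`]0, +oo[%classic : set R) = +oo%E.
    by rewrite lebesgue_measure_itv/= ltry/=.
  by apply/eqP => /(etrans (esym m1)).
- exact: integrable_gamma.
- move=> t /=; rewrite in_itv/= andbT => t0.
  by rewrite mulr_gt0 ?powR_gt0 ?expR_gt0.
Qed.

(** The function [t ^ a exp (- t)] vanishes at 0 and at infinity, so its derivative
    has integral 0. *)
Lemma GammaD1 a : 0 < a -> Gamma (a + 1) = a * Gamma a.
Proof.
move=> a0.
have a1 : 0 < a + 1 by rewrite ltr_wpDr.
pose f t : R := a * (t `^ (a - 1) * expR (- t)) - t `^ a * expR (- t).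
pose F t : R := t `^ a * expR (- t).
have int1 : mu.-integrable `]0, +oo[ (EFin \o (fun t => a * (t `^ (a - 1) * expR (- t)))).
  rewrite (_ : _ \o _ = fun t => (a%:E * (t `^ (a - 1) * expR (- t))%:E)%E).
    by apply: integrableZl => //; exact: integrable_gamma.
  by apply/funext => t /=; rewrite EFinM.
have int2 : mu.-integrable `]0, +oo[ (EFin \o (fun t => t `^ a * expR (- t))).
  have := integrable_gamma a1; rewrite (_ : a + 1 - 1 = a)//; ring.
have f0 : (\int[mu]_(t in `]0%R, +oo[) f t)%R = 0.
  apply: (@Rintegral_derive_eq0 _ _ ou pv _ opv opv_nd opvE f F) => //.
  - rewrite (_ : EFin \o f = (fun t => (a * (t `^ (a - 1) * expR (- t)))%:E - (t `^ a * expR (- t))%:E)%E).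
      by apply: integrableB.
    by apply/funext => t /=; rewrite -EFinB.
  - move=> t /=; rewrite in_itv/= andbT => t0.
    by have := is_derive_powR_expRN a t0; rewrite -mulrA.
  - move=> t /=; rewrite in_itv/= andbT => t0.
    apply: cvgB; last exact: continuous_powR_expRN.
    by apply: cvgM; [exact: cvg_cst|exact: continuous_powR_expRN].
  - rewrite -(subr0 0); apply: cvgB.
    + pose C := (2 * (a + 1)) `^ (a + 1).
      apply: (@squeeze_cvgr _ _ _ _ (cst 0) (fun k => C * harmonic k)).
      * apply: nearW => k /=; rewrite mulr_ge0 ?powR_ge0 ?expR_ge0//=.
        have p0 : 0 < pv k by [].
        rewrite ler_pdivlMr// mulrAC -[X in _ * X * _]powRr1 ?(ltW p0)//.
        rewrite -powRD ?(gt_eqF p0) ?implybT// expRN ler_pdivrMr ?expR_gt0//.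
        apply: (le_trans (powR_le_expR a1 (ltW p0))); rewrite -/C ler_wpM2l ?powR_ge0// ler_expR.
        by rewrite ler_pdivrMr// ler_peMr ?(ltW p0)// ler1n.
      * exact: cvg_cst.
      * by rewrite -(mulr0 C); apply: cvgM; [exact: cvg_cst|exact: cvg_harmonic].
    + apply: (@squeeze_cvgr _ _ _ _ (cst 0) (fun k => ou k `^ a)).
      * apply: nearW => k /=; rewrite mulr_ge0 ?powR_ge0 ?expR_ge0//=.
        by rewrite ler_piMr ?powR_ge0// expR_le1 oppr_le0 ltW.
      * exact: cvg_cst.
      * by have /cvg_at_rightP := @powR_cvg0 R a a0; apply; split.
move: f0; rewrite /f RintegralB// RintegralZl//; last exact: integrable_gamma.
by move/subr0_eq => h; rewrite /Gamma h; apply: eq_Rintegral => t _; rewrite addrK.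
Qed.

Lemma pochhammerE a k : 0 < a -> pochhammer a k = Zonal.rising a k.
Proof.
move=> a0; rewrite /pochhammer; elim: k => [|k ih].
  by rewrite addr0 /Zonal.rising big_ord0 divff// gt_eqF// Gamma_gt0.
rewrite Zonal.risingS -ih -natr1 addrA GammaD1 ?ltr_wpDr//; ring.
Qed.

(** Both sides satisfy the same first-order recurrence in [k]. *)
Lemma beta_momentE a d k : 0 < a -> 0 < d ->
  Zonal.rising a k / Zonal.rising (a + d) k = beta_moment a d k / beta_moment a d 0.
Proof.
move=> a0 d0; elim: k => [|k ih].
  by rewrite /Zonal.rising !big_ord0 !divff// ?oner_eq0// gt_eqF// beta_moment_gt0.
have adk : a + d + k%:R != 0 by rewrite gt_eqF// ltr_wpDr// addr_gt0.
have -> : beta_moment a d k.+1 = (a + k%:R) / (a + d + k%:R) * beta_moment a d k.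
  by apply: (mulfI adk); rewrite beta_momentS//; field.
rewrite !Zonal.risingS -[RHS]mulrA -ih invfM; ring.
Qed.

End gamma_beta.

(** * Integration over the ball *)

Section lebesgue_tuple_integral.
Context {R : realType}.
Notation leb := (@lebesgue_measure R).
Local Open Scope ereal_scope.

Definition tcons n (p : measurableTypeR R * n.-tuple R) : n.+1.-tuple R :=
  [tuple of p.1 :: p.2].

Lemma measurable_tcons n : measurable_fun setT (@tcons n).
Proof. exact: measurable_cons. Qed.

Lemma ge0_integral_cons n (f : n.+1.-tuple R -> \bar R) :
  measurable_fun setT f -> (forall x, 0 <= f x) ->
  \int[lebesgue_tuple R n.+1]_x f x =
  \int[leb]_t \int[lebesgue_tuple R n]_y f (tcons (t, y)).
Proof.
move=> mf f0.
transitivity (\int[leb \x lebesgue_tuple R n]_(x in @tcons n @^-1` setT) (f \o @tcons n) x).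
  rewrite -(@ge0_integral_pushforward _ _ _ _ R _ (@measurable_tcons n) (leb \x lebesgue_tuple R n)%E setT f measurableT mf (fun x _ => f0 x)).
  by apply: eq_measure_integral; first exact: measurable_tcons.
rewrite preimage_setT fubini_tonelli1//; last by move=> x; exact: f0.
by apply: measurableT_comp => //; exact: measurable_tcons.
Qed.

Lemma integral_cons n (f : n.+1.-tuple R -> \bar R) :
  (lebesgue_tuple R n.+1).-integrable setT f ->
  \int[lebesgue_tuple R n.+1]_x f x =
    \int[leb]_t \int[lebesgue_tuple R n]_y f (tcons (t, y)) /\
  \int[lebesgue_tuple R n.+1]_x f x =
    \int[lebesgue_tuple R n]_y \int[leb]_t f (tcons (t, y)).
Proof.
move=> intf; have [mf _] := integrableP _ _ _ intf.
have mtf : measurable_fun setT (f \o @tcons n).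
  by apply: measurableT_comp => //; exact: measurable_tcons.
have int2 : (leb \x lebesgue_tuple R n).-integrable setT (f \o @tcons n).
  apply/integrableP; split => //.
  case/integrableP: intf => _; rewrite ge0_integral_cons//; last exact: measurableT_comp.
  by rewrite fubini_tonelli1//; exact: measurableT_comp.
have -> : \int[lebesgue_tuple R n.+1]_x f x =
    \int[leb \x lebesgue_tuple R n]_x (f \o @tcons n) x.
  rewrite -[RHS](@integral_pushforward _ _ _ _ R _ (@measurable_tcons n) (leb \x lebesgue_tuple R n)%E setT f mf int2 measurableT).
  by apply: eq_measure_integral; first exact: measurable_tcons.
split; first by rewrite -(integral12_prod_meas1 int2).
by rewrite -(integral21_prod_meas1 int2).
Qed.

End lebesgue_tuple_integral.

Section scaling.
Context {R : realType}.
Notation leb := (@lebesgue_measure R).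

Lemma lebesgue_measure_scale (r : R) (A : set R) : 0 < r -> measurable A ->
  leb A = (r%:E * leb ((fun t : R => r * t)%R @^-1` A))%E.
Proof.
move=> r0 mA.
pose phi (t : measurableTypeR R) : measurableTypeR R := r * t.
have -> : (r%:E * leb ((fun t : R => r * t)%R @^-1` A))%E =
   pushforward (mscale (NngNum (ltW r0)) leb) phi A by [].
apply: lebesgue_measure_unique => //=; first exact: measurable_funM.
move=> _ _ [[a b]] _ <-.
rewrite /pushforward /mscale/= lebesgue_measure_itv/= lte_fin.
have -> : phi @^-1` `]a, b] = `]a / r, b / r]%classic.
  apply/seteqP; split => x /=; rewrite !in_itv/= /phi ltr_pdivrMr// ler_pdivlMr// ![x * r]mulrC//.
rewrite lebesgue_measure_itv/= lte_fin ltr_pM2r ?invr_gt0//.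
case: ifP => ab; rewrite ?mule0// -!EFinD -EFinM; congr EFin.
by field; rewrite gt_eqF.
Qed.

Lemma ge0_integral_scale1 (r : R) (f : R -> \bar R) : 0 < r -> measurable_fun setT f ->
  (forall t, 0 <= f t)%E ->
  (\int[leb]_t f t = r%:E * \int[leb]_t f (r * t)%R)%E.
Proof.
move=> r0 mf f0.
pose phi (t : measurableTypeR R) : measurableTypeR R := r * t.
have mphi : measurable_fun setT phi by exact: measurable_funM.
transitivity (\int[pushforward (mscale (NngNum (ltW r0)) leb) phi]_t f t)%E.
  by apply: eq_measure_integral => // A mA _; apply: lebesgue_measure_scale.
rewrite (@ge0_integral_pushforward _ _ _ _ R _ mphi (mscale (NngNum (ltW r0)) leb) setT f measurableT mf (fun x _ => f0 x)).
rewrite preimage_setT ge0_integral_mscale//=.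
exact: (measurableT_comp mf mphi).
Qed.

Lemma scale_tcons n (r t : R) (y : n.-tuple R) :
  Zonal.scale r (tcons (t, y)) = tcons (r * t, Zonal.scale r y).
Proof.
apply: eq_from_tnth => i; rewrite tnth_mktuple.
by case: (unliftP ord0 i) => [j ->|->]; rewrite ?tnth0 ?tnthS ?tnth_mktuple.
Qed.

Lemma measurable_scale n (r : R) : measurable_fun setT (@Zonal.scale R n r).
Proof.
apply/measurable_fun_tnthP => i.
rewrite (_ : _ \o _ = fun x => r * tnth x i).
  by apply: measurable_funM => //; exact: measurable_tnth.
by apply/funext => x /=; rewrite tnth_mktuple.
Qed.

Lemma ge0_integral_scale n (r : R) (f : n.-tuple R -> \bar R) : 0 < r ->
  measurable_fun setT f -> (forall x, 0 <= f x)%E ->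
  (\int[lebesgue_tuple R n]_x f x =
   (r ^+ n)%:E * \int[lebesgue_tuple R n]_x f (Zonal.scale r x))%E.
Proof.
move=> r0; elim: n f => [|n ih] f mf f0.
  rewrite mul1e; apply: eq_integral => x _; congr f.
  by apply: eq_from_tnth => -[].
have mfs : measurable_fun setT (fun x => f (Zonal.scale r x)).
  by apply: measurableT_comp => //; exact: measurable_scale.
have mcons (g : n.+1.-tuple R -> \bar R) : measurable_fun setT g ->
    measurable_fun setT (fun p => g (@tcons R n p)).
  by move=> mg; apply: measurableT_comp => //; exact: measurable_tcons.
have mslice (g : n.+1.-tuple R -> \bar R) t : measurable_fun setT g ->
    measurable_fun setT (fun y => g (@tcons R n (t, y))).
  move=> /mcons mg; exact: (measurableT_comp mg (pair1_measurable t)).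
pose g t := (\int[lebesgue_tuple R n]_y f (tcons (t, y)))%E.
have mg : measurable_fun setT g.
  apply: (@measurable_fun_fubini_tonelli_F _ _ (measurableTypeR R) _ R (lebesgue_tuple R n) (fun p => f (tcons p))) => [|p]; last exact: f0.
  exact: mcons.
rewrite !ge0_integral_cons//.
rewrite (ge0_integral_scale1 r0 mg); last by move=> t; apply: integral_ge0 => y _; exact: f0.
rewrite exprS EFinM -muleA; congr (_ * _)%E.
rewrite -ge0_integralZl//; last 3 first.
- apply: (@measurable_fun_fubini_tonelli_F _ _ (measurableTypeR R) _ R (lebesgue_tuple R n) (fun p => f (Zonal.scale r (tcons p)))) => [|p]; last exact: f0.
  exact: (mcons _ mfs).
- by move=> t _; apply: integral_ge0 => y _; exact: f0.
- by rewrite lee_fin exprn_ge0 ?ltW.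
apply: eq_integral => t _; rewrite /g ih//; last exact: mslice.
by congr (_ * _)%E; apply: eq_integral => y _; rewrite scale_tcons.
Qed.

End scaling.

Section general_measure.
Context d (T : measurableType d) (R : realType).
Local Open Scope ereal_scope.

Lemma ge0_integral_mrestr (m : {measure set T -> \bar R}) (D : set T) (mD : measurable D)
    (f : T -> \bar R) : measurable_fun setT f -> (forall x, 0 <= f x) ->
  \int[mrestr m mD]_x f x = \int[m]_(x in D) f x.
Proof.
move=> mf f0; rewrite -(setUv D) ge0_integral_setU//; last 3 first.
- exact: measurableC.
- by rewrite setUv.
- by apply/disj_setPCl.
rewrite [X in _ + X](@null_set_integral _ _ _ (mrestr m mD)) ?adde0.
- apply: eq_measure_integral => A mA AD; transitivity (m (A `&` D)) => //.
  by rewrite (setIidl AD).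
- exact: measurableC.
- exact: measurable_funTS.
- by transitivity (m (~` D `&` D)) => //; rewrite setICl measure0.
Qed.

Import HBNNSimple.

Lemma ge0_integral_density (m mu : {measure set T -> \bar R}) (h : T -> \bar R) (f : T -> \bar R) :
  measurable_fun setT h -> (forall x, 0 <= h x) ->
  (forall A, measurable A -> m A = \int[mu]_(x in A) h x) ->
  measurable_fun setT f -> (forall x, 0 <= f x) ->
  \int[m]_x f x = \int[mu]_x (f x * h x).
Proof.
move=> mh h0 mE mf f0.
pose g := nnsfun_approx measurableT mf.
have gf x : (g k x)%:E @[k --> \oo] --> f x by apply: cvg_nnsfun_approx.
have nd x : nondecreasing_seq (fun k => (g k x)%:E).
  by move=> a b ab; rewrite lee_fin; exact/lefP/nd_nnsfun_approx.
transitivity (limn (fun k => \int[m]_x (g k x)%:E)).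
  rewrite -monotone_convergence//.
  - by apply: eq_integral => x _; apply/esym/cvg_lim.
  - by move=> k; exact/measurable_EFinP/measurable_funP.
  - by move=> k x _; rewrite lee_fin.
transitivity (limn (fun k => \int[mu]_x ((g k x)%:E * h x))); last first.
  rewrite -monotone_convergence//.
  - apply: eq_integral => x _; apply/cvg_lim => //.
    have [hx|] := boolP (h x \is a fin_num); first by apply: cvgeZr.
    rewrite ge0_fin_numE// -leNgt leye_eq => /eqP ->.
    have [fx0|fx0] := eqVneq (f x) 0.
      rewrite fx0 mul0e (_ : (fun k => _) = cst 0); first exact: cvg_cst.
      apply/funext => k; apply/eqP; rewrite eq_le; apply/andP; split; last first.
        by rewrite /= mule_ge0 ?lee_fin.
      suff -> : (g k x)%:E = 0 by rewrite mul0e.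
      apply/eqP; rewrite eq_le; apply/andP; split; last by rewrite lee_fin fun_ge0.
      rewrite -fx0.
      rewrite -(cvg_lim _ (gf x))//; apply: lime_ge; first exact: cvgP (gf x).
      by exists k => // l /= kl; exact: nd.
    have fxp : 0 < f x by rewrite lt_def fx0 f0.
    rewrite gt0_muley//.
    have [k0 k0p] : exists k, 0 < (g k x)%:E.
      apply/not_existsP => gk0; move: fxp; rewrite -(cvg_lim _ (gf x))// ltNge => /negP; apply.
      apply: lime_le; first exact: cvgP (gf x).
      by apply: nearW => k; rewrite leNgt; apply/negP; exact: gk0.
    apply: (@cvg_trans _ ((cst +oo : nat -> \bar R) @ \oo)); last exact: cvg_cst.
    apply: near_eq_cvg; exists k0 => // k /= kk; rewrite gt0_muley//.
    by apply: (lt_le_trans k0p); exact: nd.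
  - by move=> k; apply: emeasurable_funM => //; exact/measurable_EFinP/measurable_funP.
  - by move=> k x _; rewrite mule_ge0// lee_fin.
  - by move=> x _ a b ab; apply: lee_wpmul2r => //; exact: nd.
congr (limn _); apply/funext => k.
under eq_integral do rewrite fimfunE -fsumEFin//.
rewrite ge0_integral_fsum//; last 2 first.
- by move=> r; exact/measurable_EFinP/measurableT_comp.
- by move=> r x _; rewrite EFinM nnfun_muleindic_ge0.
under [RHS]eq_integral.
  move=> x _; rewrite fimfunE -fsumEFin// ge0_mule_fsuml; last first.
    by move=> r; rewrite EFinM nnfun_muleindic_ge0.
  over.
rewrite ge0_integral_fsum//; last 2 first.
- by move=> r; apply: emeasurable_funM => //; exact/measurable_EFinP/measurableT_comp.
- by move=> r x _; rewrite mule_ge0// EFinM nnfun_muleindic_ge0.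
apply: eq_fsbigr => r _.
under eq_integral do rewrite EFinM.
under [RHS]eq_integral do rewrite EFinM -muleA.
rewrite integralZl_indic_nnsfun//.
have mA : measurable (g k @^-1` [set r]) by [].
have [r0|r0] := ltP r 0%R.
  have i0 x : (\1_(g k @^-1` [set r]) x)%:E = 0 :> \bar R.
    by rewrite preimage_nnfun0// indicE in_set0.
  rewrite !integral0_eq ?mule0// => x _.
  by rewrite i0 mul0e mule0.
rewrite ge0_integralZl//; last 2 first.
- by apply: emeasurable_funM => //; exact/measurable_EFinP.
- by move=> x _; rewrite mule_ge0// lee_fin.
congr (_ * _); rewrite integral_indic// setIT mE// [LHS]integral_mkcond.
apply: eq_integral => x _; rewrite /patch indicE; case: ifPn => _; rewrite ?mul1e ?mul0e//.
Qed.

Lemma measure_unique_ray (m1 m2 : {measure set (measurableTypeR R) -> \bar R}) :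
  m1 setT < +oo -> (forall a : R, m1 `]-oo, a[%classic = m2 `]-oo, a[%classic) ->
  forall A, measurable A -> m1 A = m2 A.
Proof.
move=> m1oo m12 A mA.
apply: (@measure_unique _ R (measurableTypeR R) (@RGenInftyO.G R) (fun k => `]-oo, k%:R[%classic)) => //.
- exact: RGenInftyO.measurableE.
- move=> _ _ [a ->] [b ->]; exists (Num.min a b).
  by apply/seteqP; split => y /=; rewrite !in_itv/= lt_min => /andP.
- by move=> i; exists i%:R.
- apply/seteqP; split => // y _; exists (Num.bound y) => //=; rewrite in_itv/=.
  have [y0|y0] := leP 0%R y; first exact: archi_boundP.
  by rewrite (lt_le_trans y0).
- by move=> _ [a ->]; exact: m12.
- by move=> k; apply: le_lt_trans m1oo; apply: le_measure; rewrite ?inE.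
Qed.

End general_measure.

Section ball.
Context {R : realType} {n : nat}.
Notation T := (n.-tuple R).
Notation scale := (@Zonal.scale R n).
Notation dot := (@Zonal.dot R n).
Implicit Types (x y : T).

Lemma dotE x : dot x x = \sum_(i < n) tnth x i ^+ 2.
Proof. by apply: eq_bigr => i _; rewrite expr2. Qed.

Lemma dot_ge0 x : 0 <= dot x x.
Proof. by rewrite dotE; apply: sumr_ge0 => i _; exact: sqr_ge0. Qed.

Lemma enorm_ge0 x : 0 <= enorm x. Proof. exact: sqrtr_ge0. Qed.

Lemma enorm_sqr x : enorm x ^+ 2 = dot x x.
Proof. by rewrite sqr_sqrtr ?dotE// -dotE dot_ge0. Qed.

Lemma enorm_eq0 x : (enorm x == 0) = [forall i, tnth x i == 0].
Proof.
rewrite -sqrf_eq0 enorm_sqr dotE psumr_eq0; last by move=> i _; exact: sqr_ge0.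
apply/allP/forallP => h i; first by rewrite -sqrf_eq0; apply: h; rewrite mem_index_enum.
by rewrite sqrf_eq0 h.
Qed.

Lemma dot_scale r x : dot (scale r x) (scale r x) = r ^+ 2 * dot x x.
Proof. by rewrite !dotE mulr_sumr; apply: eq_bigr => i _; rewrite tnth_mktuple exprMn. Qed.

Lemma dot_scalel r x y : dot (scale r x) y = r * dot x y.
Proof. by rewrite /Zonal.dot /Zonal.dotp mulr_sumr; apply: eq_bigr => i _; rewrite tnth_mktuple mulrA. Qed.

Lemma enorm_scale r x : 0 <= r -> enorm (scale r x) = r * enorm x.
Proof.
move=> r0; apply/eqP; rewrite -(@eqrXn2 _ 2)// ?mulr_ge0 ?enorm_ge0//.
by rewrite exprMn !enorm_sqr dot_scale.
Qed.

Lemma uballE x : uball x <-> dot x x < 1.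
Proof.
by rewrite -enorm_sqr expr_lt1 ?enorm_ge0.
Qed.

Lemma usphereE x : usphere x <-> dot x x = 1.
Proof.
rewrite -enorm_sqr /usphere/=; split => [->|]; first by rewrite expr1n.
by move/eqP; rewrite pexpr_eq1 ?enorm_ge0// => /eqP.
Qed.

Lemma scale_normalize x : scale (enorm x) (normalize x) = x.
Proof.
apply: eq_from_tnth => i; rewrite !tnth_mktuple.
have [e0|e0] := eqVneq (enorm x) 0; last by rewrite mulrC divfK.
by move/eqP: (e0); rewrite enorm_eq0 => /forallP /(_ i) /eqP ->; rewrite e0 mul0r.
Qed.

Lemma normalize_scale r x : 0 < r -> normalize (scale r x) = normalize x.
Proof.
move=> r0; apply: eq_from_tnth => i; rewrite !tnth_mktuple enorm_scale ?(ltW r0)//.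
by rewrite -mulf_div divff ?mul1r// gt_eqF.
Qed.

Lemma enorm_normalize x : enorm x != 0 -> enorm (normalize x) = 1.
Proof.
move=> x0; have := congr1 enorm (scale_normalize x).
rewrite enorm_scale ?enorm_ge0// -[RHS]mulr1 => /(mulfI x0) //.
Qed.

End ball.

Lemma measurable_cube {R : realType} n (A : 'I_n -> set R) : (forall i, measurable (A i)) ->
  measurable [set x : n.-tuple R | forall i, A i (tnth x i)].
Proof.
move=> mA; rewrite (_ : [set _ | _] = \bigcap_(i in [set: 'I_n]) ((@tnth n R)^~ i @^-1` A i)).
  apply: fin_bigcap_measurable => [|i _]; first exact: finite_finset.
  by rewrite -[X in measurable X]setTI; exact: measurable_tnth.
by apply/seteqP; split => x h i; [move=> _|]; exact: h.
Qed.

Lemma lebesgue_cube {R : realType} n (A : 'I_n -> set R) (d : R) :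
  (forall i, measurable (A i)) -> (forall i, lebesgue_measure (A i) = d%:E) ->
  lebesgue_tuple R n [set x | forall i, A i (tnth x i)] = (d ^+ n)%:E.
Proof.
elim: n A => [|n IH] A mA Ad.
  rewrite /= /dirac indicE mem_set ?expr0//.
  by move=> [].
pose A' (i : 'I_n) := A (lift ord0 i).
rewrite /= /lebesgue_cons /pushforward.
rewrite (_ : _ @^-1` _ = A ord0 `*` [set y : n.-tuple R | forall i, A' i (tnth y i)]); last first.
  apply/seteqP; split => -[t y] /= h.
    split; first by have := h ord0; rewrite tnth0.
    by move=> i; have := h (lift ord0 i); rewrite tnthS.
  case: h => h0 hS i; case: (unliftP ord0 i) => [j ->|->]; last by rewrite tnth0.
  by rewrite tnthS; exact: hS.
rewrite product_measure1E; [|exact: mA|by apply: measurable_cube => i; exact: mA].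
rewrite exprS EFinM; congr (_ * _)%E; first exact: Ad.
by apply: (IH A') => i; [exact: mA|exact: Ad].
Qed.

Section ball_measure.
Context {R : realType} {n : nat}.
Notation T := (n.-tuple R).
Notation leb := (@lebesgue_measure R).
Notation L := (lebesgue_tuple R n).
Notation scale := (@Zonal.scale R n).
Notation dot := (@Zonal.dot R n).
Implicit Types (x y : T).

Let centered_cube (c : R) : set T := [set x | forall i, `[- c, c]%classic (tnth x i)].

Let measurable_centered_cube c : measurable (centered_cube c).
Proof. by apply: (measurable_cube (A := fun=> `[- c, c]%classic)) => i; exact: measurable_itv. Qed.

Let lebesgue_centered_cube c : 0 <= c -> L (centered_cube c) = ((2 * c) ^+ n)%:E.
Proof.
move=> c0; apply: (lebesgue_cube (A := fun=> `[- c, c]%classic)) => i; first exact: measurable_itv.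
rewrite lebesgue_measure_itv/= lte_fin.
have [cc|cc] := ltP (- c) c; first by rewrite -EFinB opprK; congr EFin; ring.
by have -> : c = 0 by [lra]; rewrite mulr0.
Qed.

Lemma measurable_dot : measurable_fun setT (fun x : T => dot x x).
Proof.
rewrite (_ : (fun x => _) = (fun x => enorm x ^+ 2)).
  by apply: measurable_funX; exact: measurable_enorm.
by apply/funext => x; rewrite enorm_sqr.
Qed.

Lemma tnth_le_enorm x i : `|tnth x i| <= enorm x.
Proof.
rewrite -(@ler_pXn2r _ 2)// ?nnegrE ?enorm_ge0// enorm_sqr real_normK ?num_real// dotE.
by rewrite (bigD1 i)//= lerDl sumr_ge0// => j _; exact: sqr_ge0.
Qed.

Lemma lebesgue_ball_lty (a : R) : (L [set x | (dot x x < a)%R] < +oo)%E.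
Proof.
pose c := Num.sqrt (Num.max a 0).
have mB : measurable [set x | dot x x < a].
  rewrite [X in measurable X](_ : _ = (fun x => dot x x) @^-1` `]-oo, a[%classic).
    by rewrite -[X in measurable X]setTI; exact: measurable_dot.
  by apply/seteqP; split => x /=; rewrite in_itv.
apply: (@le_lt_trans _ _ ((2 * c) ^+ n)%:E); last by rewrite ltry.
rewrite -lebesgue_centered_cube ?sqrtr_ge0//.
apply: le_measure; rewrite ?inE// => x /= xa i.
rewrite /= in_itv/= -ler_norml; apply: (le_trans (tnth_le_enorm x i)).
by apply: ler_wsqrtr; rewrite -dotE le_max (ltW xa).
Qed.

Lemma lebesgue_uball_gt0 : (0 < L uball)%E.
Proof.
pose c : R := (n.+1%:R)^-1.
have c0 : 0 < c by rewrite invr_gt0.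
apply: (@lt_le_trans _ _ ((2 * c) ^+ n)%:E).
  by rewrite lte_fin exprn_gt0// mulr_gt0.
rewrite -lebesgue_centered_cube ?(ltW c0)//.
apply: le_measure; rewrite ?inE//; first exact: measurable_uball.
move=> x xB; apply/uballE; rewrite dotE.
have cb i : tnth x i ^+ 2 <= c.
  have := xB i; rewrite /= in_itv/= -ler_norml => xc.
  rewrite -[tnth x i ^+ 2]ger0_norm ?sqr_ge0// normrX.
  have c1 : c <= 1 by rewrite invf_le1// ler1n.
  rewrite expr2; apply: (@le_trans _ _ (1 * c)); last by rewrite mul1r.
  by apply: ler_pM => //; exact: le_trans xc c1.
apply: (@le_lt_trans _ _ (\sum_(i < n) c)); first exact: ler_sum.
by rewrite sumr_const card_ord -mulr_natl /c ltr_pdivrMr// mul1r ltr_nat.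
Qed.

Definition vol : R := fine (L uball).

Lemma lebesgue_uballE : L uball = vol%:E.
Proof.
rewrite /vol fineK// ge0_fin_numE//; have := lebesgue_ball_lty 1.
by rewrite (_ : [set x | _] = uball)//; apply/seteqP; split => x /= /uballE.
Qed.

Lemma vol_gt0 : 0 < vol.
Proof. by rewrite -lte_fin -lebesgue_uballE lebesgue_uball_gt0. Qed.

Lemma nuE (A : set T) : nu A = (vol^-1%:E * L (A `&` uball))%E.
Proof. by []. Qed.

Lemma nu_uball : nu (uball : set T) = 1%E.
Proof. by rewrite nuE setIid lebesgue_uballE -EFinM mulVf// gt_eqF// vol_gt0. Qed.

Lemma nu_setT : nu (setT : set T) = 1%E.
Proof. by rewrite -nu_uball !nuE setTI setIid. Qed.

Lemma nu_setI (A : set T) : nu (A `&` uball) = nu A.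
Proof. by rewrite !nuE -setIA setIid. Qed.

(** A dilation maps the part of a cone in the unit ball onto its part in a smaller
    ball. *)
Lemma nu_cone (r : R) (E : set T) : 0 < r <= 1 -> measurable E ->
  nu [set x | enorm x < r /\ E (normalize x)] = ((r ^+ n)%:E * sigma E)%E.
Proof.
move=> /andP[r0 r1] mE.
have mC s : measurable [set x : T | enorm x < s /\ E (normalize x)].
  rewrite (_ : [set x | _] = enorm @^-1` `]-oo, s[%classic `&` normalize @^-1` E).
    apply: measurableI; rewrite -[X in measurable X]setTI.
      exact: measurable_enorm.
    exact: measurable_normalize.
  by apply/seteqP; split => x /=; rewrite in_itv.
rewrite /sigma /pushforward !nuE muleCA; congr (_ * _)%E.
rewrite (_ : _ `&` uball = [set x | enorm x < r /\ E (normalize x)]); last first.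
  by apply/seteqP; split => x /= => [[]//|[xr Ex]]; split => //; exact: lt_le_trans r1.
rewrite (_ : _ `&` uball = [set x | enorm x < 1 /\ E (normalize x)]); last first.
  by apply/seteqP; split => x /= => [] [].
have IE s : L [set x | enorm x < s /\ E (normalize x)] =
    (\int[L]_x (\1_[set x | enorm x < s /\ E (normalize x)] x)%:E)%E.
  by rewrite integral_indic// setIT.
rewrite !IE (ge0_integral_scale r0); last 2 first.
- exact/measurable_EFinP.
- by move=> x; rewrite lee_fin.
congr (_ * _)%E; apply: eq_integral => x _; congr EFin; rewrite !indicE.
congr (nat_of_bool _)%:R; apply/idP/idP => /set_mem /= [h1 h2]; apply/mem_set => /=.
  by move: h1 h2; rewrite normalize_scale// enorm_scale ?(ltW r0)// gtr_pMr.
by rewrite normalize_scale// enorm_scale ?(ltW r0)// gtr_pMr.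
Qed.


(** [nu], declared as a finite measure. *)
Definition nuf : set T -> \bar R := nu.

HB.instance Definition _ := Measure.on nuf.

Let nuf_fin : fin_num_fun nuf.
Proof.
move=> A mA; rewrite ge0_fin_numE//; apply: (@le_lt_trans _ _ 1%E); last by rewrite ltry.
by rewrite -nu_setT; apply: le_measure; rewrite ?inE.
Qed.

HB.instance Definition _ := @Measure_isFinite.Build _ _ _ nuf nuf_fin.

Let sigma_fin : fin_num_fun (@sigma R n).
Proof.
move=> A mA; apply: nuf_fin.
by rewrite -[X in measurable X]setTI; exact: measurable_normalize.
Qed.

HB.instance Definition _ := @Measure_isFinite.Build _ _ _ (@sigma R n) sigma_fin.

(** The law of the norm of a point of the ball. *)
Definition rad : set (measurableTypeR R) -> \bar R :=
  pushforward nuf (enorm : T -> measurableTypeR R).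

Let menorm : measurable_fun setT (enorm : T -> measurableTypeR R).
Proof. exact: measurable_enorm. Qed.

Let rad0 : rad set0 = 0%E.
Proof. by rewrite /rad /pushforward preimage_set0 measure0. Qed.

Let rad_ge0 A : (0 <= rad A)%E.
Proof. by rewrite /rad /pushforward measure_ge0. Qed.

Let rad_sigma_additive : semi_sigma_additive rad.
Proof.
move=> F mF tF mUF; rewrite /rad /pushforward preimage_bigcup.
apply: measure_semi_sigma_additive.
- by move=> k; rewrite -[X in measurable X]setTI; exact: menorm.
- apply/trivIsetP => /= i j _ _ ij; rewrite -preimage_setI.
  by move/trivIsetP : tF => /(_ _ _ _ _ ij) ->//; rewrite preimage_set0.
- by rewrite -preimage_bigcup -[X in measurable X]setTI; exact: menorm.
Qed.

HB.instance Definition _ := isMeasure.Build _ _ _ rad rad0 rad_ge0 rad_sigma_additive.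

Let rad_fin : fin_num_fun rad.
Proof.
move=> A mA; apply: nuf_fin.
by rewrite -[X in measurable X]setTI; exact: menorm.
Qed.

HB.instance Definition _ := @Measure_isFinite.Build _ _ _ rad rad_fin.

Lemma ge0_integral_nu (f : T -> \bar R) : measurable_fun setT f -> (forall x, 0 <= f x)%E ->
  (\int[nuf]_x f x = vol^-1%:E * \int[L]_(x in uball) f x)%E.
Proof.
move=> mf f0.
rewrite [LHS](@ge0_integral_mscale _ _ _ (mrestr L measurable_uball) setT measurableT _ f)//=.
by rewrite ge0_integral_mrestr.
Qed.

Let nuf_setCuball : nuf (~` uball) = 0%E.
Proof. by rewrite /nuf -nu_setI setICl measure0. Qed.

Lemma ge0_integral_nu_uball (f : T -> \bar R) : measurable_fun setT f -> (forall x, 0 <= f x)%E ->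
  (\int[nuf]_(x in uball) f x = \int[nuf]_x f x)%E.
Proof.
move=> mf f0; rewrite [RHS](ge0_negligible_integral (N := ~` uball))//.
- by rewrite setTD setCK.
- by apply: measurableC; exact: measurable_uball.
Qed.

Hypothesis n0 : (0 < n)%N.

Lemma rad_itv (x : R) : 0 <= x <= 1 -> rad `]-oo, x[ = (x ^+ n)%:E.
Proof.
move=> /andP[x0 x1]; rewrite /rad /pushforward.
move: x0; rewrite le_eqVlt => /predU1P[<-|x0].
  rewrite expr0n gtn_eqF//= (_ : _ @^-1` _ = set0) ?measure0//.
  by apply/seteqP; split => // y /=; rewrite in_itv/= ltNge enorm_ge0.
have := @nu_cone x setT; rewrite x0 x1 => /(_ isT measurableT).
rewrite /sigma /pushforward preimage_setT nu_setT mule1 => <-.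
rewrite /nuf; congr (nu _); apply/seteqP; split => y /=; rewrite in_itv/=.
  by move=> ?; split.
by case.
Qed.

(** Norm and direction are independent, which is the homogeneity of the volume. *)
Lemma polar_rectangle (A : set (measurableTypeR R)) (E : set T) :
  measurable A -> measurable E ->
  nuf (enorm @^-1` A `&` normalize @^-1` E) = (rad A * sigma E)%E.
Proof.
move=> mA mE.
have mNE : measurable (normalize @^-1` E).
  by rewrite -[X in measurable X]setTI; exact: measurable_normalize.
have sE : sigma E \is a fin_num by exact: sigma_fin.
have sE0 : 0 <= fine (sigma E) by rewrite fine_ge0.
transitivity (pushforward (mrestr nuf mNE) (enorm : T -> measurableTypeR R) A) => //.
transitivity (mscale (NngNum sE0) rad A); last by rewrite /mscale/= fineK// muleC.
apply: measure_unique_ray => // [|a].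
  change (nuf (enorm @^-1` setT `&` normalize @^-1` E) < +oo)%E.
  by rewrite preimage_setT setTI ltey_eq nuf_fin.
transitivity ((fine (sigma E))%:E * rad `]-oo, a[)%E; last by [].
rewrite fineK//; transitivity (nuf (enorm @^-1` `]-oo, a[ `&` normalize @^-1` E)); first by [].
have [a0|a0] := leP a 0.
  rewrite /rad /pushforward (_ : enorm @^-1` _ = set0).
    by rewrite set0I !measure0 mule0.
  by apply/seteqP; split => // y /=; rewrite in_itv/= ltNge (le_trans a0)// enorm_ge0.
have [a1|a1] := leP a 1.
  by rewrite rad_itv ?(ltW a0)// muleC -nu_cone ?a0.
have E1 : uball `<=` (enorm : T -> R) @^-1` `]-oo, a[%classic.
  by move=> y /=; rewrite in_itv/= => /lt_trans; apply.
rewrite /rad /pushforward /nuf.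
rewrite -(nu_setI (_ @^-1` _)) (setIidr E1) nu_uball mule1.
by rewrite -nu_setI setIAC (setIidr E1) setIC nu_setI.
Qed.

Lemma measurable_polar : measurable_fun setT
  (fun x : T => (enorm x, normalize x) : measurableTypeR R * T).
Proof. by apply/measurable_fun_pairP; split; [exact: measurable_enorm|exact: measurable_normalize]. Qed.

Lemma measurable_scale2 : measurable_fun setT
  (fun p : measurableTypeR R * T => scale p.1 p.2).
Proof.
apply/measurable_fun_tnthP => i.
rewrite (_ : _ \o _ = fun p : measurableTypeR R * T => (p.1 : R) * tnth p.2 i).
  apply: measurable_funM; first exact: measurable_fst.
  exact: (measurableT_comp (measurable_tnth i) measurable_snd).
by apply/funext => p /=; rewrite tnth_mktuple.
Qed.

(** The joint law of norm and direction is a product measure, since it is one on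
    rectangles. *)
Lemma ge0_polar (f : T -> \bar R) : measurable_fun setT f -> (forall x, 0 <= f x)%E ->
  (\int[nuf]_x f x = \int[rad]_r \int[@sigma R n]_z f (scale r z))%E.
Proof.
move=> mf f0.
pose g (p : measurableTypeR R * T) := f (scale p.1 p.2).
have mg : measurable_fun setT g by exact: (measurableT_comp mf measurable_scale2).
pose phi (x : T) : measurableTypeR R * T := (enorm x, normalize x).
transitivity (\int[nuf]_x (g \o phi) x)%E.
  by apply: eq_integral => x _; rewrite /g/= scale_normalize.
rewrite -(@ge0_integral_pushforward _ _ _ _ R _ measurable_polar nuf setT g measurableT mg (fun p _ => f0 _)).
transitivity (\int[(rad \x @sigma R n)%E]_p g p)%E; last first.
  by rewrite fubini_tonelli1// => p; exact: f0.
apply/esym/eq_measure_integral; first exact: measurable_polar.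
move=> mphi A mA _; apply: product_measure_unique => // B C mB mC.
exact: polar_rectangle.
Qed.


Let root_lt (a t : R) : 0 < a -> 0 < t -> (t `^ n%:R^-1 < a) = (t < a ^+ n).
Proof.
move=> a0 t0; have n1 : 0 < n%:R^-1 :> R by rewrite invr_gt0 ltr0n.
have -> : a = (a ^+ n) `^ n%:R^-1.
  rewrite -powR_mulrn ?(ltW a0)// -powRrM mulfV ?powRr1 ?(ltW a0)//.
  by rewrite pnatr_eq0 -lt0n.
rewrite -[in RHS]powR_mulrn ?powR_ge0// -powRrM mulVf ?pnatr_eq0 -?lt0n// powRr1; last first.
  by rewrite exprn_ge0// ltW.
apply/idP/idP => h; last by apply: gt0_ltr_powR => //; rewrite nnegrE ?exprn_ge0// ltW.
rewrite ltNge; apply/negP => h'; move: h; rewrite ltNge => /negP; apply.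
by apply: ge0_ler_powR; rewrite ?nnegrE ?exprn_ge0 ?(ltW n1) ?(ltW a0) ?(ltW t0).
Qed.

(** Under [rad], as under the law of the [n]-th root of a uniform variable, the norms
    below [x] have mass [x ^ n]. *)
Lemma radE (A : set (measurableTypeR R)) : measurable A ->
  rad A = leb ((fun t : R => t `^ n%:R^-1) @^-1` A `&` `]0, 1[).
Proof.
move=> mA; pose phi (t : measurableTypeR R) : measurableTypeR R := t `^ n%:R^-1.
have mphi : measurable_fun setT phi by exact: measurable_powR.
have m01 : measurable (`]0, 1[%classic : set (measurableTypeR R)) by exact: measurable_itv.
transitivity (pushforward (mrestr leb m01) phi A); last by [].
apply: measure_unique_ray => //.
  transitivity (nu (setT : set T) < +oo)%E; last by rewrite nu_setT ltry.
  by [].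
move=> a; transitivity (leb (phi @^-1` `]-oo, a[ `&` `]0, 1[)); last by [].
have [a0|a0] := leP a 0.
  rewrite (_ : _ `&` _ = set0) ?measure0; last first.
    apply/seteqP; split => // t /=; rewrite !in_itv/= => -[ta /andP[t0 _]].
    by move: ta; rewrite ltNge (le_trans a0)// powR_ge0.
  change (nuf ((enorm : T -> R) @^-1` `]-oo, a[%classic) = 0%E).
  rewrite (_ : _ @^-1` _ = set0) ?measure0//.
  by apply/seteqP; split => // y /=; rewrite in_itv/= ltNge (le_trans a0)// enorm_ge0.
have [a1|a1] := leP a 1.
  transitivity (rad `]-oo, a[%classic); first by [].
  rewrite rad_itv ?(ltW a0)// (_ : _ `&` _ = `]0, a ^+ n[%classic).
    by rewrite lebesgue_measure_itv/= lte_fin exprn_gt0// oppr0 addr0.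
  apply/seteqP; split => t /=; rewrite !in_itv/=.
    by move=> [ta /andP[t0 _]]; rewrite t0/= -root_lt.
  move=> /andP[t0 ta]; rewrite /phi root_lt// t0 ta; split => //=.
  by apply: (lt_le_trans ta); rewrite exprn_ile1// ltW.
rewrite (_ : _ `&` _ = `]0, 1[%classic); last first.
  apply/seteqP; split => t /=; rewrite !in_itv/=; first by case.
  move=> /andP[t0 t1]; rewrite t0 t1; split => //; rewrite /phi root_lt//.
  by apply: (lt_trans t1); rewrite exprn_egt1// -lt0n.
rewrite lebesgue_measure_itv/= lte_fin ltr01 oppr0 addr0.
change (nu ((enorm : T -> R) @^-1` `]-oo, a[%classic) = 1%E).
rewrite -nu_setI (setIidr _) ?nu_uball//.
by move=> y /=; rewrite in_itv/= => /lt_trans; apply.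
Qed.

Lemma ge0_integral_rad (f : measurableTypeR R -> \bar R) : measurable_fun setT f -> (forall t, 0 <= f t)%E ->
  (\int[rad]_r f r = \int[leb]_(t in `]0%R, 1%R[) f (t `^ n%:R^-1)%R)%E.
Proof.
move=> mf f0.
pose phi (t : measurableTypeR R) : measurableTypeR R := t `^ n%:R^-1.
have mphi : measurable_fun setT phi by exact: measurable_powR.
have m01 : measurable (`]0, 1[%classic : set (measurableTypeR R)) by exact: measurable_itv.
rewrite -(ge0_integral_mrestr leb m01)//; last first.
  exact: (measurableT_comp mf mphi).
pose nu1 : {measure set (measurableTypeR R) -> \bar R} := mrestr leb m01.
rewrite -[RHS](@ge0_integral_pushforward _ _ (measurableTypeR R) (measurableTypeR R) R phi mphi nu1 setT f measurableT mf (fun t _ => f0 t)).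
by apply: eq_measure_integral => // A mA _; exact: radE.
Qed.

Lemma rad_set0 : rad [set 0] = 0%E.
Proof.
rewrite radE// (_ : _ `&` _ = set0) ?measure0//.
apply/seteqP; split => // t /=; rewrite in_itv/= => -[t0 /andP[tp _]].
by have := powR_gt0 n%:R^-1 tp; rewrite t0 ltxx.
Qed.

Lemma measurable_usphere : measurable (usphere : set T).
Proof.
rewrite (_ : usphere = enorm @^-1` [set 1]).
  by rewrite -[X in measurable X]setTI; exact: measurable_enorm.
by apply/seteqP; split.
Qed.

Lemma sigma_setC_usphere : @sigma R n (~` usphere) = 0%E.
Proof.
transitivity (rad [set 0]); last exact: rad_set0.
rewrite /sigma /rad /pushforward /nuf; apply/eqP; rewrite eq_le; apply/andP; split.
  apply: le_measure; rewrite ?inE.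
  - rewrite -[X in measurable X]setTI; apply: measurable_normalize => //.
    by apply: measurableC; exact: measurable_usphere.
  - by rewrite -[X in measurable X]setTI; exact: measurable_enorm.
  - move=> x /= h; apply/eqP; apply: contra_notT h => x0.
    exact: enorm_normalize.
rewrite (_ : nu _ = 0%E) ?measure_ge0//; exact: rad_set0.
Qed.

Lemma sigma_setT : @sigma R n setT = 1%E.
Proof. by rewrite /sigma /pushforward preimage_setT nu_setT. Qed.

Lemma sigma_usphere : @sigma R n usphere = 1%E.
Proof.
have h : (@sigma R n setT = sigma (usphere : set T) + sigma (~` (usphere : set T)))%E.
  rewrite -measureU ?setUv ?setICr//; first exact: measurable_usphere.
  by apply: measurableC; exact: measurable_usphere.
by rewrite -sigma_setT h sigma_setC_usphere adde0.
Qed.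

End ball_measure.

(** ** Integration by parts on the ball *)

Section integration_by_parts_ball.
Context {R : realType}.
Notation leb := (@lebesgue_measure R).

Lemma dot_tcons n t (y : n.-tuple R) :
  Zonal.dot (tcons (t, y)) (tcons (t, y)) = t ^+ 2 + Zonal.dot y y.
Proof.
rewrite !dotE big_ord_recl tnth0; congr (_ + _).
by apply: eq_bigr => i _; rewrite tnthS.
Qed.

Lemma upd_tcons0 n t s (y : n.-tuple R) : Zonal.upd (tcons (t, y)) ord0 s = tcons (s, y).
Proof.
apply: eq_from_tnth => i; rewrite tnth_mktuple.
by case: (unliftP ord0 i) => [j ->|->]; rewrite ?tnth0 ?tnthS.
Qed.

Lemma upd_tconsS n t s (y : n.-tuple R) i :
  Zonal.upd (tcons (t, y)) (lift ord0 i) s = tcons (t, Zonal.upd y i s).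
Proof.
apply: eq_from_tnth => j; rewrite tnth_mktuple.
case: (unliftP ord0 j) => [k ->|->]; rewrite ?tnth0// !tnthS tnth_mktuple.
by rewrite (inj_eq lift_inj).
Qed.

Lemma integrable_bounded d (T : measurableType d) (mu : {measure set T -> \bar R})
    (D : set T) (f : T -> R) (M : R) : measurable D -> (mu D < +oo)%E ->
  measurable_fun setT f -> (forall x, D x -> `|f x| <= M) -> (forall x, ~ D x -> f x = 0) ->
  mu.-integrable setT (EFin \o f).
Proof.
move=> mD Doo mf fM f0.
have : mu.-integrable setT (EFin \o (fun x => M * \1_D x)).
  rewrite (_ : _ \o _ = fun x => (M%:E * (\1_D x)%:E)%E); last by apply/funext => x; rewrite /= EFinM.
  apply: integrableZl => //; apply/integrableP; split; first exact/measurable_EFinP.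
  under eq_integral do rewrite gee0_abs ?lee_fin//.
  by rewrite integral_indic// setIT.
apply: le_integrable => //; first exact/measurable_EFinP.
move=> x _ /=; rewrite lee_fin normrM indicE.
have [xD|xD] := boolP (x \in D).
  by rewrite normr1 mulr1; apply: le_trans (fM x (set_mem xD)) (ler_norm _).
by rewrite f0 ?normr0 ?mulr0 ?normr0 ?mulr0// => /mem_set; exact/negP.
Qed.

(** The integrand is the derivative of [q * (a - t ^ 2)], which vanishes at both ends
    of the interval where [t ^ 2 < a]. *)
Lemma integral_divergence1 (q : {poly R}) (a : R) :
  (\int[leb]_t (if t ^+ 2 < a then q^`().[t] * (a - t ^+ 2) - 2 * t * q.[t] else 0)%:E = 0)%E.
Proof.
have [a0|a0] := leP a 0.
  rewrite integral0_eq// => t _; rewrite ifF//; apply/negbTE; rewrite -leNgt.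
  by rewrite (le_trans a0)// sqr_ge0.
pose l := Num.sqrt a; have l0 : 0 < l by rewrite sqrtr_gt0.
have la : l ^+ 2 = a by rewrite sqr_sqrtr// ltW.
pose Q := q * (a%:P - 'X^2).
have QE t : Q^`().[t] = q^`().[t] * (a - t ^+ 2) - 2 * t * q.[t].
  rewrite /Q derivM derivB derivC derivXn !hornerE /=; ring.
transitivity (\int[leb]_(t in `](- l)%R, l[) (Q^`().[t])%:E)%E.
  rewrite [RHS]integral_mkcond; apply: eq_integral => t _; rewrite /patch.
  have tl : (t ^+ 2 < a) = (t \in (`](- l), l[%classic : set R)).
    rewrite mem_setE in_itv/= -ltr_norml -la -[t ^+ 2]ger0_norm ?sqr_ge0// normrX.
    by rewrite ltr_pXn2r// ?nnegrE// ltW.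
  by rewrite -tl QE; case: ifP.
transitivity (\int[leb]_(t in `[(- l)%R, l]) (Q^`().[t])%:E)%E.
  apply/esym/integral_itv_bndoo/measurable_EFinP/measurable_funTS.
  by apply: continuous_measurable_fun; exact: continuous_horner.
rewrite (@integral_segment_derive _ _ (horner Q)).
- by rewrite /Q !hornerE /= la sqrrN la subrr !mulr0 subrr.
- by move: l0; clear; move: l => l l0; rewrite -subr_gt0 opprK addr_gt0.
- by move=> x _; apply: continuous_horner.
Qed.

(** On each line in the direction [i] the integrand is the derivative of a polynomial
    that vanishes where the line leaves the ball. *)
Lemma integral_divergence n (i : 'I_n) (F G : n.-tuple R -> R) (a M : R) :
  measurable_fun setT F -> measurable_fun setT G ->
  (forall x, Zonal.dot x x < a -> `|F x| <= M /\ `|G x| <= M) ->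
  Zonal.partial i F G ->
  (\int[lebesgue_tuple R n]_x (if (Zonal.dot x x < a)%R then
      G x * (a - Zonal.dot x x) - 2 * tnth x i * F x else 0)%:E = 0)%E.
Proof.
elim: n i F G a => [[]//|n ih] i F G a mF mG FGM dFG.
pose h x := if Zonal.dot x x < a then G x * (a - Zonal.dot x x) - 2 * tnth x i * F x else 0.
have mD : measurable [set x : n.+1.-tuple R | Zonal.dot x x < a].
  rewrite [X in measurable X](_ : _ = (fun x => Zonal.dot x x) @^-1` `]-oo, a[%classic).
    by rewrite -[X in measurable X]setTI; exact: measurable_dot.
  by apply/seteqP; split => x /=; rewrite in_itv.
have inth : (lebesgue_tuple R n.+1).-integrable setT (EFin \o h).
  apply: (@integrable_bounded _ _ _ [set x | Zonal.dot x x < a] h (M * a + 2 * (1 + a) * M)) => //.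
  - exact: lebesgue_ball_lty.
  - apply: measurable_fun_ifT => //.
    + by apply: measurable_fun_ltr => //; exact: measurable_dot.
    + apply: measurable_funB.
        by apply: measurable_funM => //; apply: measurable_funB => //; exact: measurable_dot.
      apply: measurable_funM => //; apply: measurable_funM => //; exact: measurable_tnth.
  - move=> x /= xa; rewrite /h xa; have [Fx Gx] := FGM x xa.
    have M0 : 0 <= M by exact: le_trans Fx.
    apply: (le_trans (ler_normB _ _)); rewrite !normrM; apply: lerD.
      apply: ler_pM => //; rewrite ger0_norm ?subr_ge0 ?(ltW xa)//.
      by rewrite lerBlDr lerDl dot_ge0.
    rewrite ger0_norm//; apply: ler_pM; rewrite ?mulr_ge0//; apply: ler_wpM2l => //.
    have : tnth x i ^+ 2 < a.
      apply: le_lt_trans xa; rewrite dotE (bigD1 i)//= lerDl sumr_ge0// => j _; exact: sqr_ge0.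
    move=> xia; rewrite ler_norml; apply/andP; split; nra.
  - by move=> x /= /negP xa; rewrite /h (negbTE xa).
have [I1 I2] := integral_cons inth.
have mcons (g : n.+1.-tuple R -> R) t : measurable_fun setT g ->
    measurable_fun setT (fun y : n.-tuple R => g (tcons (t, y))).
  move=> mg; have mt := measurableT_comp mg (@measurable_tcons R n).
  exact: (measurableT_comp mt (pair1_measurable t)).
case: (unliftP ord0 i) => [j|] ij.
- rewrite -/(h _) [LHS]I1; apply: integral0_eq => t _.
  have FGM' y : Zonal.dot y y < a - t ^+ 2 -> `|F (tcons (t, y))| <= M /\ `|G (tcons (t, y))| <= M.
    by move=> ya; apply: FGM; rewrite dot_tcons addrC -ltrBrDr.
  have dFG' : Zonal.partial j (fun y => F (tcons (t, y))) (fun y => G (tcons (t, y))).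
    move=> y; have [q hq] := dFG (tcons (t, y)); exists q => s.
    by have := hq s; rewrite ij upd_tconsS.
  rewrite -[RHS](ih j _ _ (a - t ^+ 2) (mcons _ t mF) (mcons _ t mG) FGM' dFG').
  apply: eq_integral => y _; rewrite /h/= dot_tcons ij tnthS addrC -ltrBrDr.
  by case: ifP => // _; congr EFin; ring.
- rewrite -/(h _) [LHS]I2; apply: integral0_eq => y _.
  have [q hq] := dFG (tcons (0, y)).
  rewrite -[RHS](integral_divergence1 q (a - Zonal.dot y y)).
  apply: eq_integral => t _; rewrite /h/= dot_tcons ij tnth0 -ltrBrDr.
  have := hq t; rewrite ij upd_tcons0 => -[-> ->].
  by case: ifP => // _; congr EFin; rewrite /=; ring.
Qed.

End integration_by_parts_ball.

(** * The mean over the sphere *)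

Lemma bounded_integrable d (T : measurableType d) (R : realType) (mu : {measure set T -> \bar R})
    (D : set T) (f : T -> R) (M : R) : measurable D -> (mu D < +oo)%E ->
  measurable_fun D f -> (forall x, D x -> `|f x| <= M) -> mu.-integrable D (EFin \o f).
Proof.
move=> mD Doo mf fM; apply: measurable_bounded_integrable => //.
exists M; split; first exact: num_real.
by move=> c Mc x Dx; exact: le_trans (fM x Dx) (ltW Mc).
Qed.

Section sphere_mean.
Context {R : realType} {n : nat}.
Hypothesis n2 : (2 <= n)%N.
Notation T := (n.-tuple R).
Notation leb := (@lebesgue_measure R).
Notation L := (lebesgue_tuple R n).
Notation scale := (@Zonal.scale R n).
Notation dot := (@Zonal.dot R n).
Notation nuf := (@nuf R n).
Notation sigma := (@sigma R n).
Implicit Types (x y z : T).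

Let n0 : (0 < n)%N. Proof. exact: leq_trans n2. Qed.
Let nR0 : 0 < n%:R :> R. Proof. by rewrite ltr0n. Qed.

Lemma measurable_polynomial f : Zonal.polynomial_fun f -> measurable_fun setT (f : T -> R).
Proof.
move=> [s fs]; rewrite (_ : f = Zonal.monomial_sum s); last exact/funext.
apply: measurable_sum => ce; apply: measurable_funM => //.
apply: measurable_prod => i _; apply: measurable_funX; exact: measurable_tnth.
Qed.

Lemma polynomial_bounded f : Zonal.polynomial_fun f ->
  exists M, forall x, dot x x <= 1 -> `|f x| <= M.
Proof.
move=> [s fs]; exists (\sum_(ce <- s) `|ce.1|) => x x1; rewrite fs.
apply: (le_trans (ler_norm_sum _ _ _)); apply: ler_sum => ce _.
rewrite normrM ler_piMr// normr_prod; apply: prodr_ile1 => i _.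
rewrite normr_ge0 normrX exprn_ile1//; apply: le_trans (tnth_le_enorm _ _) _.
by rewrite -(@expr_le1 _ 2)// ?enorm_ge0// enorm_sqr.
Qed.

Definition smean (f : T -> R) : R := (\int[sigma]_(z in usphere) f z)%R.

Lemma ge0_polar01 (f : T -> \bar R) : measurable_fun setT f -> (forall x, 0 <= f x)%E ->
  (\int[nuf]_x f x =
   \int[leb]_(t in `]0%R, 1%R[) \int[sigma]_(z in usphere) f (scale (t `^ n%:R^-1) z))%E.
Proof.
move=> mf f0.
have mg : measurable_fun setT (fun p : measurableTypeR R * T => f (scale p.1 p.2)).
  exact: (measurableT_comp mf measurable_scale2).
rewrite ge0_polar// (@ge0_integral_rad R n n0 (fun r => \int[sigma]_z f (scale r z))%E); last 2 first.
- by apply: (@measurable_fun_fubini_tonelli_F _ _ (measurableTypeR R) T R sigma (fun p => f (scale p.1 p.2))).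
- by move=> r; exact: integral_ge0.
apply: eq_integral => t _; rewrite [LHS](ge0_negligible_integral (N := ~` usphere))//.
- by rewrite setTD setCK.
- by apply: measurableC; exact: measurable_usphere.
- apply: (measurableT_comp mf); exact: measurable_scale.
- exact: sigma_setC_usphere.
Qed.

Lemma ge0_polar_homog (d : nat) (f : T -> R) (phi : R -> R) :
  measurable_fun setT f -> measurable_fun setT phi ->
  (forall x, 0 <= f x) -> (forall t, 0 <= phi t) ->
  (forall c x, 0 < c -> f (scale c x) = c ^+ d * f x) ->
  (\int[nuf]_x (f x * phi (enorm x))%:E =
   (\int[leb]_(t in `]0%R, 1%R[) ((t `^ n%:R^-1) ^+ d * phi (t `^ n%:R^-1))%:E) *
   \int[sigma]_(z in usphere) (f z)%:E)%E.
Proof.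
move=> mf mphi f0 phi0 fh.
have mroot : measurable_fun setT (fun t : R => t `^ n%:R^-1) by exact: measurable_powR.
have mE : measurable_fun setT (fun t : R => ((t `^ n%:R^-1) ^+ d * phi (t `^ n%:R^-1))%:E).
  apply/measurable_EFinP/measurable_funM; first exact: measurable_funX.
  exact: (measurableT_comp mphi mroot).
rewrite ge0_polar01; last 2 first.
- apply/measurable_EFinP/measurable_funM => //.
  exact: (measurableT_comp mphi measurable_enorm).
- by move=> x; rewrite lee_fin mulr_ge0.
rewrite -ge0_integralZr//; last 3 first.
- exact: measurable_funTS.
- by move=> t _; rewrite lee_fin mulr_ge0// exprn_ge0// powR_ge0.
- by apply: integral_ge0 => z _; rewrite lee_fin.
apply: eq_integral => t; rewrite inE/= in_itv/= => /andP[t0 _].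
have r0 : 0 < t `^ n%:R^-1 by exact: powR_gt0.
rewrite -ge0_integralZl//; last 4 first.
- exact: measurable_usphere.
- exact/measurable_EFinP/measurable_funTS.
- by move=> z _; rewrite lee_fin.
- by rewrite lee_fin mulr_ge0// exprn_ge0// ltW.
apply: eq_integral => z; rewrite inE => z1; rewrite -EFinM; congr EFin.
by rewrite fh// enorm_scale ?(ltW r0)// z1 mulr1 mulrAC.
Qed.

(** For a homogeneous function the radial and the spherical integral separate. *)
Lemma polar_homog (d : nat) (f : T -> R) (phi : R -> R) m :
  measurable_fun setT f -> measurable_fun setT phi -> (forall t, 0 <= phi t) ->
  (forall c x, 0 < c -> f (scale c x) = c ^+ d * f x) ->
  sigma.-integrable usphere (EFin \o f) ->
  (\int[leb]_(t in `]0%R, 1%R[) ((t `^ n%:R^-1) ^+ d * phi (t `^ n%:R^-1))%:E = m%:E)%E ->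
  (\int[nuf]_x (f x * phi (enorm x))%:E = m%:E * \int[sigma]_(z in usphere) (f z)%:E)%E.
Proof.
move=> mf mphi phi0 fh intf mE.
have fp0 x : 0 <= Num.max (f x) 0 by rewrite le_max lexx orbT.
have fn0 x : 0 <= Num.max (- f x) 0 by rewrite le_max lexx orbT.
have E : (\int[nuf]_x (Num.max (f x) 0 * phi (enorm x))%:E =
    m%:E * \int[sigma]_(z in usphere) (Num.max (f z) 0)%:E)%E.
  rewrite -mE; apply: ge0_polar_homog => //; first exact: measurable_maxr.
  move=> c x c0; rewrite fh//.
  by rewrite maxr_pMr ?exprn_ge0 ?(ltW c0)// mulr0.
have E' : (\int[nuf]_x (Num.max (- f x) 0 * phi (enorm x))%:E =
    m%:E * \int[sigma]_(z in usphere) (Num.max (- f z) 0)%:E)%E.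
  rewrite -mE; apply: ge0_polar_homog => //.
    by apply: measurable_maxr => //; exact: measurable_funN.
  move=> c x c0; rewrite fh//.
  by rewrite maxr_pMr ?exprn_ge0 ?(ltW c0)// mulr0 mulrN.
rewrite [LHS]integralE [in RHS]integralE.
rewrite muleBr//; last first.
  by apply: fin_num_adde_defr; apply: (integrable_pos_fin_num _ intf); exact: measurable_usphere.
congr (_ - _)%E.
  transitivity (\int[nuf]_x (Num.max (f x) 0 * phi (enorm x))%:E)%E.
    by apply: eq_integral => x _; rewrite funeposE -EFin_max maxr_pMl ?mul0r.
  by rewrite E; congr (_ * _)%E; apply: eq_integral => x _; rewrite funeposE EFin_max.
transitivity (\int[nuf]_x (Num.max (- f x) 0 * phi (enorm x))%:E)%E.
  by apply: eq_integral => x _; rewrite funenegE -EFinN -EFin_max maxr_pMl ?mul0r ?mulNr.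
by rewrite E'; congr (_ * _)%E; apply: eq_integral => x _; rewrite funenegE -EFinN EFin_max.
Qed.

Lemma integrable_root_moment (a : R) : 0 <= a ->
  leb.-integrable `]0%R, 1%R[ (EFin \o (fun t : R => (t `^ n%:R^-1) `^ a)).
Proof.
move=> a0; have b0 : 0 < a / n%:R + 1 by rewrite ltr_wpDl// divr_ge0// ltW.
have := integrable_powR01 b0; rewrite (_ : _ \o _ = EFin \o (fun t : R => (t `^ n%:R^-1) `^ a))//.
by apply/funext => t /=; rewrite -powRrM addrK mulrC.
Qed.

Lemma root_moment (a : R) : 0 <= a ->
  (\int[leb]_(t in `]0%R, 1%R[) ((t `^ n%:R^-1) `^ a))%R = n%:R / (n%:R + a).
Proof.
move=> a0; have b0 : 0 < a / n%:R + 1 by rewrite ltr_wpDl// divr_ge0// ltW.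
have := Rintegral_powR01 b0.
under eq_Rintegral do rewrite addrK [a / _]mulrC powRrM.
move=> ->; field; rewrite !gt_eqF//; by rewrite ltr_pwDl.
Qed.

Lemma integral_nu (f : T -> R) : measurable_fun setT f -> L.-integrable uball (EFin \o f) ->
  (\int[nuf]_x (f x)%:E = (@vol R n)^-1%:E * \int[L]_(x in uball) (f x)%:E)%E.
Proof.
move=> mf intf; have mEf : measurable_fun setT (EFin \o f) by exact/measurable_EFinP.
rewrite [LHS]integralE [in RHS]integralE muleBr//; last first.
  by apply: fin_num_adde_defr; apply: (integrable_pos_fin_num _ intf); exact: measurable_uball.
congr (_ - _)%E.
  by rewrite ge0_integral_nu//; exact: measurable_funepos.
by rewrite ge0_integral_nu//; exact: measurable_funeneg.
Qed.

Lemma nuf_integrable (f : T -> R) M : measurable_fun setT f ->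
  (forall x, uball x -> `|f x| <= M) -> nuf.-integrable setT (EFin \o f).
Proof.
move=> mf fM; apply/integrableP; split; first exact/measurable_EFinP.
have mf' : measurable_fun setT (fun x => `|(EFin \o f) x|%E).
  by apply: measurableT_comp => //; exact/measurable_EFinP.
rewrite -ge0_integral_nu_uball//.
apply: (@le_lt_trans _ _ (\int[nuf]_(x in uball) M%:E)%E).
  apply: ge0_le_integral => //.
  - exact: measurable_uball.
  - exact: measurable_funTS.
rewrite integral_cst//; last exact: measurable_uball.
by rewrite [X in (_ * X)%E]nu_uball// mule1 ltry.
Qed.

Lemma sphere_integrable (f : T -> R) M : measurable_fun setT f ->
  (forall x, usphere x -> `|f x| <= M) -> sigma.-integrable usphere (EFin \o f).
Proof.
move=> mf fM; apply: bounded_integrable fM; first exact: measurable_usphere.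
- have : (sigma usphere < +oo)%E by rewrite sigma_usphere// ltry.
  by [].
- exact: measurable_funTS.
Qed.

Lemma polynomial_sphere_integrable f : Zonal.polynomial_fun f ->
  sigma.-integrable usphere (EFin \o (f : T -> R)).
Proof.
move=> pf; have [M fM] := polynomial_bounded pf.
apply: (@sphere_integrable _ M); first exact: measurable_polynomial.
by move=> x /usphereE x1; apply: fM; rewrite x1.
Qed.

Lemma homog_moment (d e : nat) (f : T -> R) : measurable_fun setT f ->
  (forall c x, 0 < c -> f (scale c x) = c ^+ d * f x) ->
  sigma.-integrable usphere (EFin \o f) ->
  (\int[nuf]_x (f x * enorm x ^+ e))%R = n%:R / (n%:R + (d + e)%:R) * smean f.
Proof.
move=> mf fh intf.
have E : (\int[nuf]_x (f x * enorm x ^+ e)%:E =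
    (n%:R / (n%:R + (d + e)%:R))%:E * \int[sigma]_(z in usphere) (f z)%:E)%E.
  under eq_integral do rewrite -[enorm _]ger0_norm ?enorm_ge0//.
  apply: (@polar_homog d f (fun t => `|t| ^+ e)) => //.
  - by apply: measurable_funX; exact: normr_measurable.
  - rewrite -(root_moment (ler0n R (d + e))) fineK; last first.
      have := integrable_root_moment (ler0n R (d + e)).
      by apply: integrable_fin_num; exact: measurable_itv.
    apply: eq_integral => t _; congr EFin.
    by rewrite ger0_norm ?powR_ge0// -exprD powR_mulrn// powR_ge0.
rewrite /Rintegral E /smean fineM//.
by apply: integrable_fin_num intf; exact: measurable_usphere.
Qed.

Lemma measurable_dot_self : measurable_fun setT (fun x : T => dot x x).
Proof. exact: measurable_dot. Qed.

(** By integration by parts the integral of [1 - |x| ^ 2] times the Laplacian of [f]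
    is that of [2 x.grad f = 2 d f]. Both integrands are homogeneous up to a radial
    factor, so each integral is a radial moment times a mean over the sphere. *)
Lemma smean_laplacian d f (g h : 'I_n -> T -> R) :
  Zonal.polynomial_fun f -> (forall i, Zonal.polynomial_fun (g i)) ->
  (forall i, Zonal.polynomial_fun (h i)) ->
  (forall c x, f (scale c x) = c ^+ d * f x) ->
  (forall c x, \sum_(i < n) h i (scale c x) = c ^+ d.-2 * \sum_(i < n) h i x) ->
  (forall x, \sum_(i < n) tnth x i * g i x = d%:R * f x) ->
  (forall i, Zonal.partial i f (g i)) -> (forall i, Zonal.partial i (g i) (h i)) ->
  ((d < 2)%N -> forall x, \sum_(i < n) h i x = 0) ->
  smean (fun x => \sum_(i < n) h i x) = d%:R * (d%:R + n%:R - 2) * smean f.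
Proof.
move=> pf pg ph fd hd euler fg gh h0.
have mf := measurable_polynomial pf.
have mg i := measurable_polynomial (pg i).
have mh i := measurable_polynomial (ph i).
pose H x := \sum_(i < n) h i x.
have mH : measurable_fun setT H by exact: measurable_sum.
have ball1 x : uball x -> dot x x <= 1 by move=> /uballE /ltW.
have dot1 x : uball x -> `|dot x x| <= 1 by move=> /ball1; rewrite ger0_norm ?dot_ge0.
have [Mf fM] := polynomial_bounded pf.
have [Mg gM] : exists M, forall i x, dot x x <= 1 -> `|g i x| <= M.
  have /choice[M gM] : forall i, exists M, forall x, dot x x <= 1 -> `|g i x| <= M.
    by move=> i; exact: polynomial_bounded.
  exists (\sum_i `|M i|) => i x x1; apply: (le_trans (gM i x x1)).
  by rewrite (bigD1 i)//= (le_trans (ler_norm _))// lerDl sumr_ge0.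
have [Mh hM] : exists M, forall i x, dot x x <= 1 -> `|h i x| <= M.
  have /choice[M hM] : forall i, exists M, forall x, dot x x <= 1 -> `|h i x| <= M.
    by move=> i; exact: polynomial_bounded.
  exists (\sum_i `|M i|) => i x x1; apply: (le_trans (hM i x x1)).
  by rewrite (bigD1 i)//= (le_trans (ler_norm _))// lerDl sumr_ge0.
have HM x : dot x x <= 1 -> `|H x| <= \sum_(i < n) Mh.
  by move=> x1; apply: (le_trans (ler_norm_sum _ _ _)); apply: ler_sum => i _; exact: hM.
have md := measurable_dot_self.
pose k i x := h i x * (1 - dot x x) - 2 * tnth x i * g i x.
have mk i : measurable_fun setT (k i).
  apply: measurable_funB; first by apply: measurable_funM => //; exact: measurable_funB.
  by apply: measurable_funM => //; apply: measurable_funM => //; exact: measurable_tnth.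
have kM i x : uball x -> `|k i x| <= Mh + 2 * Mg.
  move=> xB; have x1 := ball1 x xB; apply: (le_trans (ler_normB _ _)).
  rewrite !normrM; apply: lerD.
    rewrite -[leRHS]mulr1; apply: ler_pM => //; first exact: hM.
    by have := dot_ge0 x; rewrite ler_norml => d0; apply/andP; split; lra.
  rewrite ger0_norm// -mulrA; apply: ler_wpM2l => //.
  rewrite -[leRHS]mul1r; apply: ler_pM => //; last exact: gM.
  by apply: le_trans (tnth_le_enorm _ _) _; exact: ltW.
have ik i : nuf.-integrable setT (EFin \o k i) by exact: nuf_integrable (kM i).
have k0 i : (\int[nuf]_x (k i x)%:E = 0)%E.
  rewrite integral_nu//; last first.
    apply: bounded_integrable (kM i); first exact: measurable_uball.
      have : (L uball < +oo)%E by rewrite (@lebesgue_uballE R n) ltry.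
      by [].
    exact: measurable_funTS.
  have Mp x : dot x x < 1 -> `|g i x| <= Num.max Mg Mh /\ `|h i x| <= Num.max Mg Mh.
    move=> /ltW x1; rewrite !le_max; split; apply/orP; [left|right]; [exact: gM|exact: hM].
  have := integral_divergence (mg i) (mh i) Mp (gh i).
  rewrite [X in (_ * X)%E]integral_mkcond => E.
  rewrite (_ : (\int[L]_x _ = 0)%E) ?mule0// -[RHS]E.
  apply: eq_integral => x _; rewrite /patch.
  have -> : (x \in uball) = (dot x x < 1) by apply/idP/idP => [/set_mem/uballE|/uballE/mem_set].
  by case: ifP.
have kS : (\int[nuf]_x (H x * enorm x ^+ 0 - H x * enorm x ^+ 2 - 2 * d%:R * (f x * enorm x ^+ 0)))%R = 0.
  rewrite /Rintegral (_ : (\int[nuf]_x _)%E = (\sum_(i < n) \int[nuf]_x (k i x)%:E)%E).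
    by rewrite big1.
  rewrite -integral_sum//; apply: eq_integral => x _.
  rewrite sumEFin; congr EFin; rewrite /k sumrB -mulr_suml -/(H x).
  under [X in _ = _ - X]eq_bigr do rewrite -mulrA.
  by rewrite -mulr_sumr euler enorm_sqr; ring.
have enormM x (F : T -> R) M e : (dot x x <= 1 -> `|F x| <= M) -> uball x -> `|F x * enorm x ^+ e| <= M.
  move=> FM xB; rewrite normrM; apply: le_trans (FM (ball1 x xB)).
  by rewrite ler_piMr// normrX exprn_ile1// ger0_norm ?enorm_ge0// ltW.
have mX (F : T -> R) e : measurable_fun setT F -> measurable_fun setT (fun x => F x * enorm x ^+ e).
  by move=> mF; apply: measurable_funM => //; apply: measurable_funX; exact: measurable_enorm.
have iH e : nuf.-integrable setT (EFin \o (fun x => H x * enorm x ^+ e)).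
  by apply: (nuf_integrable (mX _ e mH)) => x; apply: enormM => x1; exact: HM.
have iF e : nuf.-integrable setT (EFin \o (fun x => f x * enorm x ^+ e)).
  by apply: (nuf_integrable (mX _ e mf)) => x; apply: enormM => x1; exact: fM.
have ish : sigma.-integrable usphere (EFin \o H).
  apply: (sphere_integrable mH) => x /usphereE x1; apply: HM; by rewrite x1.
have isf := polynomial_sphere_integrable pf.
have iHH : nuf.-integrable setT (EFin \o (fun x => H x * enorm x ^+ 0 - H x * enorm x ^+ 2)).
  rewrite (_ : _ \o _ = (fun x => (H x * enorm x ^+ 0)%:E - (H x * enorm x ^+ 2)%:E)%E).
    by apply: integrableB => //; [exact: iH|exact: iH].
  by apply/funext.
have iFF : nuf.-integrable setT (EFin \o (fun x => 2 * d%:R * (f x * enorm x ^+ 0))).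
  rewrite (_ : _ \o _ = (fun x => (2 * d%:R)%:E * (f x * enorm x ^+ 0)%:E)%E).
    by apply: integrableZl => //; exact: iF.
  by apply/funext.
move: kS; rewrite RintegralB// RintegralB//.
rewrite RintegralZl//.
rewrite (homog_moment 0 mf (fun c x _ => fd c x) isf).
rewrite !(homog_moment _ mH (fun c x _ => hd c x) ish) addn0.
have nd : n%:R + d%:R != 0 :> R by rewrite -natrD pnatr_eq0 -lt0n addn_gt0 n0.
have [d2|d2] := ltnP d 2.
  have -> : smean H = 0.
    by rewrite /smean /H; under eq_Rintegral do rewrite h0//; rewrite Rintegral_cst ?mul0r//; exact: measurable_usphere.
  rewrite !mulr0 subr0 sub0r addn0 => /eqP; rewrite oppr_eq0 => /eqP E0.
  have -> : d%:R * (d%:R + n%:R - 2) * smean f = (d%:R + n%:R - 2) * (n%:R + d%:R) / (2 * n%:R) *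
      (2 * d%:R * (n%:R / (n%:R + d%:R) * smean f)) by field; rewrite nd gt_eqF.
  by rewrite E0 mulr0.
case: d d2 nd {fd hd h0 iFF euler} => [|[|d]]// _ nd /=.
rewrite addn0 addn2 => E.
have nd' : n%:R + d%:R != 0 :> R by rewrite -natrD pnatr_eq0 -lt0n addn_gt0 n0.
apply: (mulfI (_ : 2 * n%:R / ((n%:R + d%:R) * (n%:R + d.+2%:R)) != 0)).
  by rewrite mulf_neq0 ?invr_neq0// mulf_neq0// gt_eqF.
have d2E : d.+2%:R = d%:R + 2 :> R by rewrite -[d.+2]addn2 natrD.
rewrite d2E in nd E *.
rewrite (_ : _ * smean H = n%:R / (n%:R + d%:R) * smean H - n%:R / (n%:R + (d%:R + 2)) * smean H).
  by rewrite (subr0_eq E); field; rewrite nd nd'.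
by field; rewrite nd nd'.
Qed.

Lemma smean_ext f g : (forall x, f x = g x) -> smean f = smean g.
Proof. by move=> fg; congr smean; exact/funext. Qed.

Lemma smeanD f g : Zonal.polynomial_fun f -> Zonal.polynomial_fun g ->
  smean (fun x => f x + g x) = smean f + smean g.
Proof.
move=> pf pg; rewrite /smean RintegralD//; first exact: measurable_usphere.
- exact: polynomial_sphere_integrable.
- exact: polynomial_sphere_integrable.
Qed.

Lemma smeanZ c f : Zonal.polynomial_fun f -> smean (fun x => c * f x) = c * smean f.
Proof.
move=> pf; rewrite /smean RintegralZl//; first exact: measurable_usphere.
exact: polynomial_sphere_integrable.
Qed.

Lemma smean1 : smean (fun=> 1) = 1.
Proof.
transitivity (1 * fine (sigma usphere)); last by rewrite sigma_usphere// mulr1.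
by apply: Rintegral_cst; exact: measurable_usphere.
Qed.

Lemma smean_sphere f g : (forall x, dot x x = 1 -> f x = g x) -> smean f = smean g.
Proof. by move=> fg; apply: eq_Rintegral => x; rewrite inE => /usphereE; exact: fg. Qed.

Lemma Zf_smean k f y : HarmonicPoly.homog_harmonic k f ->
  smean (fun z => f z * Zonal.Zf k z y) = f y.
Proof. exact: (Zonal.Zf_reproducing n2 smean_ext smeanD smeanZ smean1 smean_sphere smean_laplacian). Qed.

Lemma harmonic_smean0 k f : HarmonicPoly.homog_harmonic k f -> (0 < k)%N -> smean f = 0.
Proof. exact: (Zonal.harmonic_mean0 n2 smean_ext smeanD smeanZ smean_laplacian). Qed.

End sphere_mean.

(** * Series with coefficients of polynomial growth *)

Section growth.
Context {R : realType}.
Implicit Types (c a b : nat -> R) (r : R).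

(** Coefficients of at most polynomial growth; their kernels converge on the ball. *)
Definition growth c := exists C p, forall k, `|c k| <= C * k.+1%:R ^+ p.

Let growth_cst_ge0 c C p : (forall k, `|c k| <= C * k.+1%:R ^+ p) -> 0 <= C.
Proof. by move=> /(_ 0); rewrite expr1n mulr1; exact: le_trans. Qed.

Lemma growthM a b : growth a -> growth b -> growth (fun k => a k * b k).
Proof.
move=> [C [p aC]] [D [q bD]]; exists (C * D), (p + q)%N => k.
by rewrite normrM exprD mulrACA; apply: ler_pM.
Qed.

Lemma growthD a b : growth a -> growth b -> growth (fun k => a k + b k).
Proof.
move=> [C [p aC]] [D [q bD]]; exists (C + D), (p + q)%N => k.
have C0 := growth_cst_ge0 aC; have D0 := growth_cst_ge0 bD.
apply: (le_trans (ler_normD _ _)); rewrite mulrDl; apply: lerD.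
  apply: (le_trans (aC k)); apply: ler_wpM2l => //.
  by apply: ler_weXn2l; [rewrite ler1n|exact: leq_addr].
apply: (le_trans (bD k)); apply: ler_wpM2l => //.
by apply: ler_weXn2l; [rewrite ler1n|exact: leq_addl].
Qed.

Lemma growth_cst r : growth (fun=> r).
Proof. by exists `|r|, 0%N => k; rewrite expr0 mulr1. Qed.

Lemma growth_nat : growth (fun k => k%:R).
Proof. by exists 1, 1%N => k; rewrite mul1r expr1 ger0_norm// ler_nat. Qed.

Lemma growth_poly (p : {poly R}) : growth (fun k => p.[k%:R]).
Proof.
elim/poly_ind: p => [|p c ih].
  by under eq_fun do rewrite horner0; exact: growth_cst.
under eq_fun do rewrite hornerMXaddC.
by apply: growthD; [apply: growthM => //; exact: growth_nat|exact: growth_cst].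
Qed.

Lemma growth_le a b : growth b -> (forall k, `|a k| <= b k) -> growth a.
Proof.
move=> [C [p bC]] ab; exists C, p => k; apply: le_trans (ab k) (le_trans _ (bC k)).
exact: ler_norm.
Qed.

Lemma growth_norm a : growth a -> growth (fun k => `|a k|).
Proof. by move=> [C [p aC]]; exists C, p => k; rewrite normr_id. Qed.

Lemma growth_shift a : growth a -> growth (fun k => a k.+1).
Proof.
move=> [C [p aC]]; exists (C * 2 ^+ p), p => k; apply: (le_trans (aC _)).
rewrite -mulrA; apply: ler_wpM2l; first exact: growth_cst_ge0 aC.
rewrite -exprMn; apply: lerXn2r; rewrite ?nnegrE// ?mulr_ge0//.
by rewrite -natrM ler_nat; lia.
Qed.

(** The binomial coefficients [C(k + N, N)] satisfy this recurrence with equality. *)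
Lemma growth_rec a N : (forall k, 0 <= a k) ->
  (forall k, k.+1%:R * a k.+1 <= (k.+1 + N)%:R * a k) -> growth a.
Proof.
move=> a0 arec; exists (a 0%N), N => k; rewrite ger0_norm//.
have pow_le (x : nat) : ((x + N) * x ^ N <= x * x.+1 ^ N)%N.
  elim: N {arec} => [|N ih]; first by rewrite addn0 !expn0.
  rewrite !expnS mulnCA [X in (_ <= X)%N]mulnCA.
  have : (x.+1 * ((x + N) * x ^ N) <= x.+1 * (x * x.+1 ^ N))%N by rewrite leq_mul2l ih orbT.
  apply: leq_trans; rewrite mulnA [X in (_ <= X)%N]mulnA leq_mul2r; apply/orP; right; nia.
elim: k => [|k ih]; first by rewrite expr1n mulr1.
have k0 : 0 < k.+1%:R :> R by rewrite ltr0n.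
rewrite -(ler_pM2l k0); apply: (le_trans (arec k)).
apply: (@le_trans _ _ ((k.+1 + N)%:R * (a 0%N * k.+1%:R ^+ N))).
  by apply: ler_wpM2l.
rewrite mulrCA [leRHS]mulrCA; apply: ler_wpM2l => //.
by rewrite -!natrX -!natrM ler_nat.
Qed.

Lemma sum_bin_le p K r : 0 <= r < 1 ->
  \sum_(0 <= k < K) ('C(k + p, p))%:R * r ^+ k <= ((1 - r) ^+ p.+1)^-1.
Proof.
move=> /andP[r0 r1]; have r1' : 0 < 1 - r by rewrite subr_gt0.
elim: p K => [|p ih] K.
  rewrite expr1 -[leRHS]mul1r ler_pdivlMr// mulr_suml.
  have : \sum_(0 <= k < K) (('C(k + 0, 0))%:R * r ^+ k * (1 - r)) = 1 - r ^+ K.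
    elim: K => [|K ih]; first by rewrite big_nil expr0 subrr.
    by rewrite big_nat_recr//= ih bin0 exprSr; ring.
  by move=> ->; rewrite gerBl exprn_ge0.
rewrite exprSr invfM ler_pdivlMr//; apply: le_trans (ih K).
case: K => [|K]; first by rewrite !big_nil mul0r.
suff <- : (\sum_(0 <= k < K.+1) 'C(k + p.+1, p.+1)%:R * r ^+ k) * (1 - r)
   + ('C(K + p.+1, p.+1))%:R * r ^+ K.+1 = \sum_(0 <= k < K.+1) 'C(k + p, p)%:R * r ^+ k.
  by rewrite lerDl mulr_ge0// exprn_ge0.
elim: K => [|K ihK]; first by rewrite !big_nat1 !add0n !binn; ring.
rewrite big_nat_recr//= [RHS]big_nat_recr//= -ihK.
rewrite (_ : K.+1 + p.+1 = (K + p.+1).+1)%N// binS natrD addSnnS !exprSr; ring.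
Qed.

Lemma pow_le_bin k p : (k.+1 ^ p <= p`! * 'C(k + p, p))%N.
Proof.
rewrite mulnC bin_ffact; elim: p => [|p ih]; first by rewrite ffactn0.
rewrite addnS ffactSS expnS; apply: leq_mul => //; lia.
Qed.

Lemma growth_sum c r : growth c -> 0 <= r < 1 ->
  exists M, forall K, \sum_(0 <= k < K) `|c k| * r ^+ k <= M.
Proof.
move=> [C [p cC]] r01; exists (C * p`!%:R * ((1 - r) ^+ p.+1)^-1) => K.
have C0 := growth_cst_ge0 cC.
apply: (@le_trans _ _ (C * p`!%:R * \sum_(0 <= k < K) ('C(k + p, p))%:R * r ^+ k)).
  rewrite mulr_sumr; apply: ler_sum => k _; rewrite mulrA; apply: ler_wpM2r.
    by rewrite exprn_ge0//; case/andP: r01.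
  apply: (le_trans (cC k)); rewrite -mulrA; apply: ler_wpM2l => //.
  by rewrite -natrX -natrM ler_nat pow_le_bin.
by apply: ler_wpM2l; [rewrite mulr_ge0|exact: sum_bin_le].
Qed.

Lemma growth_cvg c r : growth c -> 0 <= r < 1 -> cvgn (series (fun k => `|c k| * r ^+ k)).
Proof.
move=> gc r01; have [M cM] := growth_sum gc r01; apply: nondecreasing_is_cvgn.
  apply/nondecreasing_seqP => k; rewrite /series /= big_nat_recr//= lerDl.
  by rewrite mulr_ge0// exprn_ge0//; case/andP: r01.
by exists M => _ [K _ <-]; exact: cM.
Qed.

Lemma series_dominated a b : (forall k, `|a k| <= b k) -> cvgn (series b) ->
  cvgn (series a) /\
  forall K, `|limn (series a) - series a K| <= limn (series b) - series b K.
Proof.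
move=> ab cb.
have b0 k : 0 <= b k by exact: le_trans (ab k).
have ca : cvgn (series a).
  by apply: normed_cvg; apply: (series_le_cvg _ b0 ab cb) => k; exact: normr_ge0.
split => // K.
have hK M : (K <= M)%N -> `|series a M - series a K| <= series b M - series b K.
  by move=> KM; rewrite !sub_series_geq//; apply: (le_trans (ler_norm_sum _ _ _)); exact: ler_sum.
have c1 : `|series a M - series a K| @[M --> \oo] --> `|limn (series a) - series a K|.
  by apply: cvg_norm; apply: cvgB => //; exact: cvg_cst.
have c2 : series b M - series b K @[M --> \oo] --> limn (series b) - series b K.
  by apply: cvgB => //; exact: cvg_cst.
rewrite -(cvg_lim _ c1)// -(cvg_lim _ c2)//; apply: ler_lim; [exact: cvgP c1|exact: cvgP c2|].
by exists K => // M /= KM; exact: hK.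
Qed.

End growth.

(** * Zonal harmonics *)

Section zonal_harmonics.
Context {R : realType} {n : nat}.
Hypothesis n2 : (2 <= n)%N.
Notation T := (n.-tuple R).
Notation scale := (@Zonal.scale R n).
Notation dot := (@Zonal.dot R n).
Notation Zf := (@Zonal.Zf R n).
Notation sigma := (@sigma R n).
Notation smean := (@smean R n).
Implicit Types (x y z : T).

Lemma usphere_nonempty : exists e : T, usphere e.
Proof.
have n0 : (0 < n)%N by exact: leq_trans n2.
exists [tuple (i == Ordinal n0)%:R | i < n]; apply/usphereE.
rewrite dotE (bigD1 (Ordinal n0))//= tnth_mktuple eqxx expr1n big1 ?addr0// => i i0.
by rewrite tnth_mktuple (negbTE i0) expr0n.
Qed.

Lemma polar_point x : exists2 z, usphere z & x = scale (enorm x) z.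
Proof.
have [x0|x0] := eqVneq (enorm x) 0.
  have [e e1] := usphere_nonempty; exists e => //; rewrite x0.
  apply: eq_from_tnth => i; rewrite tnth_mktuple mul0r.
  by move/eqP: x0; rewrite enorm_eq0 => /forallP/(_ i)/eqP.
by exists (normalize x); [exact: enorm_normalize|rewrite scale_normalize].
Qed.

Lemma is_zonal_Zf k : is_zonal k (Zf k).
Proof.
split.
- by move=> x y; exact: Zonal.ZfC.
- by move=> y; exact: Zonal.Zf_harmonic.
- move=> x; rewrite (_ : Zf k x = Zf k ^~ x); first exact: Zonal.Zf_harmonic.
  by apply/funext => y; exact: Zonal.ZfC.
- by move=> f eta hf _; exact/esym/(Zf_smean n2 eta hf).
Qed.

(** Each of two reproducing kernels reproduces the other on the sphere, and
    homogeneity extends the equality. *)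
Lemma is_zonal_unique k Z x y : is_zonal k Z -> Z x y = Zf k x y.
Proof.
move=> [ZC Zl Zr Zrep]; have hl f c z : HarmonicPoly.homog_harmonic k f ->
  f (scale c z) = c ^+ k * f z by exact: Zonal.harmonic_scale.
have E a b : usphere a -> usphere b -> Z a b = Zf k a b.
  move=> a1 b1; rewrite -(Zf_smean n2 a (Zl b)) Zonal.ZfC.
  rewrite (Zrep _ _ (Zonal.Zf_harmonic n2 k a) b1).
  by apply: eq_Rintegral => z _; rewrite mulrC.
have [a a1 xE] := polar_point x; have [b b1 yE] := polar_point y.
rewrite xE yE (hl _ _ _ (Zl _)) (hl _ _ _ (Zr _)).
rewrite (hl _ _ _ (Zonal.Zf_harmonic n2 k _)) Zonal.ZfC (hl _ _ _ (Zonal.Zf_harmonic n2 k _)).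
by rewrite E// Zonal.ZfC.
Qed.

Lemma zonalE k x y : zonal k x y = Zf k x y.
Proof.
rewrite /zonal; case: xgetP => [Z _ hZ|h]; first exact: is_zonal_unique.
by have := h (Zf k) (is_zonal_Zf k).
Qed.

(** The value of [Z_k] on the diagonal of the sphere, which is the dimension of the
    space of harmonics of degree [k]. *)
Definition hdim k : R := Zonal.zpoly (n%:R / 2) k 1 1.

Lemma Zf_sphere k x : usphere x -> Zf k x x = hdim k.
Proof. by move=> /usphereE x1; rewrite /Zonal.Zf x1 mulr1. Qed.

Lemma Zf_scale k r s x y : Zf k (scale r x) (scale s y) = (r * s) ^+ k * Zf k x y.
Proof.
rewrite (Zonal.harmonic_scale _ _ (Zonal.Zf_harmonic n2 k _)) Zonal.ZfC.
by rewrite (Zonal.harmonic_scale _ _ (Zonal.Zf_harmonic n2 k _)) Zonal.ZfC exprMn mulrA.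
Qed.

Lemma Zf_polynomial k y : Zonal.polynomial_fun (Zf k ^~ y).
Proof. exact: Zonal.harmonic_polynomial (Zonal.Zf_harmonic n2 k y). Qed.

Lemma smean_Zf k x y : smean (fun z => Zf k z x * Zf k z y) = Zf k x y.
Proof. by rewrite (Zf_smean n2 y (Zonal.Zf_harmonic n2 k x)) Zonal.ZfC. Qed.

Lemma integrable_ZfM k x y :
  sigma.-integrable usphere (EFin \o (fun z => Zf k z x * Zf k z y)).
Proof.
have [M xM] := polynomial_bounded (Zf_polynomial k x).
have [N yN] := polynomial_bounded (Zf_polynomial k y).
apply: (@sphere_integrable _ _ n2 _ (M * N)).
  by apply: measurable_funM; apply: measurable_polynomial; exact: Zf_polynomial.
by move=> z /usphereE z1; rewrite normrM; apply: ler_pM => //; [apply: xM|apply: yN]; rewrite z1.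
Qed.

(** Zonal harmonics are reproducing kernels, hence largest on the diagonal. *)
Lemma Zf_le_hdim k x y : usphere x -> usphere y -> `|Zf k x y| <= hdim k.
Proof.
move=> x1 y1.
have key (s : R) : s ^+ 2 = 1 -> 0 <= hdim k + s * Zf k x y.
  move=> s1.
  have : 0 <= smean (fun z => (Zf k z x * Zf k z x + Zf k z y * Zf k z y) + (2 * s) * (Zf k z x * Zf k z y)).
    apply: Rintegral_ge0 => z _.
    rewrite (_ : _ + _ = (Zf k z x + s * Zf k z y) ^+ 2); first exact: sqr_ge0.
    by rewrite sqrrD exprMn s1; ring.
  have mS := @measurable_usphere R n.
  rewrite /smean RintegralD//; last 2 first.
  - rewrite (_ : _ \o _ = (fun z => (Zf k z x * Zf k z x)%:E + (Zf k z y * Zf k z y)%:E)%E).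
      by apply: integrableD => //; exact: integrable_ZfM.
    by apply/funext.
  - rewrite (_ : _ \o _ = (fun z => (2 * s)%:E * (Zf k z x * Zf k z y)%:E)%E).
      by apply: integrableZl => //; exact: integrable_ZfM.
    by apply/funext.
  rewrite RintegralD//; [|exact: integrable_ZfM..].
  rewrite RintegralZl//; last exact: integrable_ZfM.
  rewrite -!/(smean _) !smean_Zf !Zf_sphere// => h.
  by rewrite -(pmulr_rge0 _ (ltr0n R 2)); move: h; congr (_ <= _); ring.
have h1 := key 1 (expr1n _ _); have h2 := key (-1) (sqrr_sign _ 1).
by rewrite ler_norml; apply/andP; split; lra.
Qed.

Lemma hdim_ge0 k : 0 <= hdim k.
Proof.
have [e e1] := usphere_nonempty; exact: le_trans (Zf_le_hdim k e1 e1).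
Qed.

Lemma Zf_le k x y : `|Zf k x y| <= hdim k * (enorm x * enorm y) ^+ k.
Proof.
have [a a1 xE] := polar_point x; have [b b1 yE] := polar_point y.
rewrite {1}xE {1}yE Zf_scale normrM ger0_norm ?exprn_ge0 ?mulr_ge0 ?enorm_ge0//.
by rewrite mulrC; apply: ler_wpM2r; [rewrite exprn_ge0// mulr_ge0 ?enorm_ge0|exact: Zf_le_hdim].
Qed.

(** The Cauchy-Schwarz inequality, read off the bound for the zonal harmonic of
    degree 1. *)
Lemma dot_le_enorm x y : `|dot x y| <= enorm x * enorm y.
Proof.
have n0 : 0 < n%:R :> R by rewrite ltr0n (leq_trans _ n2).
have := Zf_le 1 x y; rewrite /Zonal.Zf /hdim !Zonal.zpoly1 !Zonal.gegenbauer1 expr1 mulr1.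
have lam0 : 0 < n%:R / 2 :> R by rewrite divr_gt0.
rewrite normrM -mulrA ger0_norm; last by rewrite mulr_ge0// ltW.
by rewrite mulrA ler_pM2l// mulr_gt0.
Qed.

Let geg k : R := Zonal.gegenbauer (n%:R / 2) k 1 1.

Let gegS k : k.+1%:R * geg k.+1 = (k + n)%:R * geg k.
Proof.
have lam0 : 0 < n%:R / 2 :> R by rewrite divr_gt0// ltr0n; exact: leq_trans n2.
rewrite natrD /geg; elim: k => [|k ih].
  by rewrite Zonal.gegenbauer1 Zonal.gegenbauer0; field.
rewrite (Zonal.gegenbauer_rec lam0); move: ih.
set a := Zonal.gegenbauer _ _ _ _; set b := Zonal.gegenbauer _ _ _ _.
move=> ih; rewrite (_ : (k%:R + 2 * (n%:R / 2)) * 1 * b = (k%:R + n%:R) * b); last by field.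
by rewrite -ih -natr1; field.
Qed.

Let geg_ge0 k : 0 <= geg k.
Proof.
elim: k => [|k ih]; first by rewrite /geg Zonal.gegenbauer0.
have k0 : 0 < k.+1%:R :> R by rewrite ltr0n.
by rewrite -(pmulr_rge0 _ k0) gegS mulr_ge0.
Qed.

Lemma growth_gegenbauer1 : growth geg.
Proof.
apply: (@growth_rec _ _ n.-1) geg_ge0 _ => k.
by rewrite gegS addSnnS prednK// (leq_trans _ n2).
Qed.

Lemma growth_hdim : growth hdim.
Proof.
have E k : hdim k = if k is k'.+2 then geg k - geg k' else geg k.
  case: k => [|[|k]]; rewrite /hdim.
  - by rewrite Zonal.zpoly0 /geg Zonal.gegenbauer0.
  - by rewrite Zonal.zpoly1.
  - by rewrite Zonal.zpolySS mul1r.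
apply: (growth_le growth_gegenbauer1) => k; rewrite ger0_norm ?hdim_ge0// E.
by case: k => [|[|k]]//; rewrite gerBl geg_ge0.
Qed.

Definition zkernel (c : nat -> R) x y : R := limn (series (fun k => c k * Zf k x y)).

Lemma Zf_term_le c k x y tau : enorm x * enorm y <= tau ->
  `|c k * Zf k x y| <= `|c k * hdim k| * tau ^+ k.
Proof.
move=> xyt; rewrite !normrM -mulrA; apply: ler_wpM2l => //.
apply: (le_trans (Zf_le k x y)); rewrite ger0_norm ?hdim_ge0//.
apply: ler_wpM2l; first exact: hdim_ge0.
have xy0 : 0 <= enorm x * enorm y by rewrite mulr_ge0 ?enorm_ge0.
by apply: lerXn2r; rewrite ?nnegrE// (le_trans xy0).
Qed.

Lemma zkernel_cvg c x y : growth c -> enorm x * enorm y < 1 ->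
  cvgn (series (fun k => c k * Zf k x y)).
Proof.
move=> gc xy1; have g := growthM gc growth_hdim.
have xy01 : 0 <= enorm x * enorm y < 1 by rewrite xy1 mulr_ge0 ?enorm_ge0.
have [] := series_dominated (fun k => Zf_term_le c k (lexx (enorm x * enorm y))) (growth_cvg g xy01).
by [].
Qed.

(** The series defining a kernel converges uniformly when [|x||y|] stays away
    from 1. *)
Lemma zkernel_tail c tau : growth c -> 0 <= tau < 1 ->
  exists2 e : nat -> R, e k @[k --> \oo] --> 0 &
    forall x y K, enorm x * enorm y <= tau ->
      `|zkernel c x y - \sum_(0 <= k < K) c k * Zf k x y| <= e K.
Proof.
move=> gc t01; have g := growth_cvg (growthM gc growth_hdim) t01.
pose b k := `|c k * hdim k| * tau ^+ k.
exists (fun K => limn (series b) - series b K).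
  rewrite -[X in _ --> X](subrr (limn (series b))); apply: cvgB => //; exact: cvg_cst.
move=> x y K xyt; have [_] := series_dominated (fun k => Zf_term_le c k xyt) g.
exact.
Qed.

End zonal_harmonics.

(** * The Poisson kernel and its derivatives *)

(** The coefficients will be the Gegenbauer polynomials and the zonal harmonics at two
    points [x] and [y], with [tau = |x||y|]; their series in [t] can be differentiated
    term by term for [|t| tau < 1]. *)
Section power_series.
Context {R : realType}.
Variable tau : R.
Hypothesis tau0 : 0 <= tau.
Implicit Types (a b : nat -> R) (t : R).

Definition tgrowth a := exists2 b, growth b & forall k, `|a k| <= b k * tau ^+ k.

Definition psum a t : R := limn (pseries a t).

Lemma tgrowth_mul b a : growth b -> tgrowth a -> tgrowth (fun k => b k * a k).
Proof.
move=> gb [c gc ac]; exists (fun k => `|b k| * c k).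
  by apply: growthM => //; exact: growth_norm.
by move=> k; rewrite normrM -mulrA; exact: ler_wpM2l.
Qed.

Lemma tgrowthZ r a : tgrowth a -> tgrowth (fun k => r * a k).
Proof. exact/(@tgrowth_mul (fun=> r))/growth_cst. Qed.

Lemma tgrowthD a b : tgrowth a -> tgrowth b -> tgrowth (fun k => a k + b k).
Proof.
move=> [c gc ac] [d gd bd]; exists (fun k => c k + d k); first exact: growthD.
by move=> k; rewrite mulrDl (le_trans (ler_normD _ _))// lerD.
Qed.

Lemma tgrowth_shift a : tgrowth a -> tgrowth (fun k => a k.+1).
Proof.
move=> [c gc ac]; exists (fun k => c k.+1 * tau).
  by apply: growthM; [exact: growth_shift|exact: growth_cst].
by move=> k; rewrite -mulrA -exprS.
Qed.

Lemma tgrowth_diffs a : tgrowth a -> tgrowth (pseries_diffs a).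
Proof.
move=> /tgrowth_shift; apply: tgrowth_mul.
exact: (growth_shift growth_nat).
Qed.

Lemma tgrowth_cvg a t : tgrowth a -> `|t| * tau < 1 -> cvgn (pseries a t).
Proof.
move=> [c gc ac] t1.
have r01 : 0 <= `|t| * tau < 1 by rewrite t1 mulr_ge0.
have H k : `|a k * t ^+ k| <= `|c k| * (`|t| * tau) ^+ k.
  rewrite normrM normrX exprMn [leRHS]mulrCA [leRHS]mulrC; apply: ler_wpM2r; first exact: exprn_ge0.
  by apply: (le_trans (ac k)); apply: ler_wpM2r; [exact: exprn_ge0|exact: ler_norm].
by have [] := series_dominated H (growth_cvg gc r01).
Qed.

Lemma is_derive_psum a t : tgrowth a -> `|t| * tau < 1 ->
  is_derive t (1 : R) (psum a) (psum (pseries_diffs a) t).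
Proof.
move=> ga t1.
pose K := `|t| + (1 - `|t| * tau) / (1 + tau).
have p1 : 0 < 1 + tau by rewrite ltr_pwDl.
have tK : `|t| < K by rewrite ltrDl divr_gt0// subr_gt0.
have K0 : 0 <= K by rewrite (le_trans _ (ltW tK)).
have K1 : `|K| * tau < 1.
  rewrite ger0_norm// /K -subr_gt0.
  have -> : 1 - (`|t| + (1 - `|t| * tau) / (1 + tau)) * tau = (1 - `|t| * tau) / (1 + tau).
    by field; rewrite gt_eqF.
  by rewrite divr_gt0// subr_gt0.
apply: (@pseries_snd_diffs _ a K); rewrite ?(ger0_norm K0)//; apply: tgrowth_cvg => //.
- exact: tgrowth_diffs.
- by apply: tgrowth_diffs; exact: tgrowth_diffs.
Qed.

Lemma psumD a b t : tgrowth a -> tgrowth b -> `|t| * tau < 1 ->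
  psum (fun k => a k + b k) t = psum a t + psum b t.
Proof.
move=> ga gb t1; rewrite /psum -limD; [|exact: tgrowth_cvg..].
congr (limn _); apply/funext => K; rewrite /pseries /series /= -[RHS]big_split /=.
by apply: eq_bigr => k _; rewrite mulrDl.
Qed.

Lemma psumZ r a t : tgrowth a -> `|t| * tau < 1 ->
  psum (fun k => r * a k) t = r * psum a t.
Proof.
move=> ga t1; apply/cvg_lim => //.
rewrite (_ : pseries _ t = (fun K => r * pseries a t K)); last first.
  by apply/funext => K; rewrite /pseries /series /= mulr_sumr; apply: eq_bigr => k _; rewrite mulrA.
by apply: cvgM; [exact: cvg_cst|exact: tgrowth_cvg].
Qed.

Lemma psum_shift a t : tgrowth a -> `|t| * tau < 1 ->
  psum a t = a 0%N + t * psum (fun k => a k.+1) t.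
Proof.
move=> ga t1; apply/cvg_lim => //; rewrite -cvg_shiftS.
rewrite (_ : (fun _ => _) = (fun K => a 0%N + t * pseries (fun k => a k.+1) t K)); last first.
  apply/funext => K; rewrite /pseries /series /= big_nat_recl//= expr0 mulr1; congr (_ + _).
  by rewrite mulr_sumr; apply: eq_bigr => k _; rewrite exprS mulrCA.
apply: cvgD; first exact: cvg_cst.
by apply: cvgM; [exact: cvg_cst|apply: tgrowth_cvg => //; exact: tgrowth_shift].
Qed.

Lemma psum_theta a t : tgrowth a -> `|t| * tau < 1 ->
  psum (fun k => k%:R * a k) t = t * psum (pseries_diffs a) t.
Proof.
move=> ga t1; rewrite psum_shift//; first by rewrite mul0r add0r.
by apply: tgrowth_mul => //; exact: growth_nat.
Qed.

End power_series.

Lemma constant_of_derive0 (R : realType) (q : R -> R) :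
  (forall t : R, 0 <= t <= 1 -> is_derive t (1 : R) q 0) -> q 1 = q 0.
Proof.
move=> dq.
have cq : {within `[0, 1]%classic, continuous q}.
  apply: derivable_within_continuous => t; rewrite in_itv/= => tI.
  by have := dq t tI => h; apply: ex_derive.
have dq' (t : R) : t \in `]0, 1[%R -> is_derive t (1 : R) q 0.
  by rewrite in_itv/= => /andP[t0 t1]; apply: dq; rewrite !ltW.
have [c _] := @MVT_segment R q (fun=> 0) 0 1 ler01 dq' cq.
by rewrite mul0r => /subr0_eq.
Qed.

Section closed_form.
Context {R : realType} {n : nat}.
Hypothesis n2 : (2 <= n)%N.
Notation T := (n.-tuple R).
Notation dot := (@Zonal.dot R n).
Notation Zf := (@Zonal.Zf R n).
Notation lam := (n%:R / 2 : R).
Implicit Types (x y : T).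

Let lam0 : 0 < lam.
Proof. by rewrite divr_gt0// ltr0n (leq_trans _ n2). Qed.

(** The triple [(c, (i, j))] stands for the term [c * A ^ i * D ^ - j * G]. The
    differential equation writes [t d/dt] of such a term as a combination of three
    others, those listed here. *)
Definition theta_term (w : R * (nat * nat)) : seq (R * (nat * nat)) :=
  let: (c, (i, j)) := w in
  [:: (c * (2 * i%:R - j%:R - lam), (i, j)); (c * (- 2 * i%:R), (i.-1, j));
      (c * (j%:R + lam), (i.+1, j.+1))].

Fixpoint theta_terms m : seq (R * (nat * nat)) :=
  if m is m'.+1 then flatten [seq theta_term w | w <- theta_terms m'] else [:: (1, (1%N, 0%N))].


(** [G] is the generating function of the Gegenbauer polynomials and [A G] that of the
    zonal harmonics, the Poisson kernel of the dilated point. *)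
Section fixed_points.
Variables x y : T.
Let tau := enorm x * enorm y.
Let u := dot x y.
Let v := dot x x * dot y y.
Hypothesis tau1 : tau < 1.

Let tau0 : 0 <= tau. Proof. by rewrite mulr_ge0 ?enorm_ge0. Qed.
Let vE : v = tau ^+ 2. Proof. by rewrite exprMn !enorm_sqr. Qed.

Let z k := Zf k x y.
Let g k := Zonal.gegenbauer lam k u v.

Let zgrowth : tgrowth tau z.
Proof. by exists (@hdim R n); [exact: growth_hdim|move=> k; exact: Zf_le]. Qed.

Let u_le : `|u| <= tau. Proof. exact: dot_le_enorm. Qed.

Let zSS k : z k.+2 = g k.+2 - v * g k.
Proof. exact: Zonal.zpolySS. Qed.

Let ggrowth : tgrowth tau g.
Proof.
exists (fun k => Zonal.gegenbauer lam k 1 1); first exact: growth_gegenbauer1.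
suff H k : `|g k| <= Zonal.gegenbauer lam k 1 1 * tau ^+ k /\
    `|g k.+1| <= Zonal.gegenbauer lam k.+1 1 1 * tau ^+ k.+1 by move=> k; case: (H k).
elim: k => [|k [ih1 ih2]].
  split; first by rewrite /g !Zonal.gegenbauer0 normr1 mulr1.
  by have := Zf_le n2 1 x y; rewrite /Zonal.Zf /hdim !Zonal.zpoly1.
split=> //; have -> : g k.+2 = z k.+2 + v * g k by rewrite zSS subrK.
apply: (le_trans (ler_normD _ _)).
have -> : Zonal.gegenbauer lam k.+2 1 1 = @hdim R n k.+2 + Zonal.gegenbauer lam k 1 1 :> R.
  by rewrite /hdim Zonal.zpolySS mul1r subrK.
rewrite mulrDl; apply: lerD; first exact: Zf_le.
rewrite normrM ger0_norm ?vE ?sqr_ge0//.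
rewrite [tau ^+ k.+2](_ : _ = tau ^+ k * tau ^+ 2); last by rewrite -exprD addn2.
rewrite mulrA mulrC.
by apply: ler_wpM2r; rewrite ?sqr_ge0.
Qed.

Let G := psum g.
Let A t := 1 - v * t ^+ 2.
Let D t := 1 - 2 * u * t + v * t ^+ 2.
Let G' := psum (pseries_diffs g).

Let D_ge t : (1 - `|t| * tau) ^+ 2 <= D t.
Proof.
rewrite /D vE; have : u * t <= `|t| * tau.
  by apply: (le_trans (ler_norm _)); rewrite normrM mulrC; apply: ler_wpM2l.
have := real_normK (num_real t) => t2 h.
rewrite sqrrB expr1n mul1r exprMn t2; lra.
Qed.

Let D_gt0 t : `|t| * tau < 1 -> 0 < D t.
Proof. by move=> t1; apply: lt_le_trans (D_ge t); rewrite exprn_gt0// subr_gt0. Qed.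

(** The three-term recurrence, summed. *)
Let ode t : `|t| * tau < 1 -> D t * G' t = 2 * lam * (u - v * t) * G t.
Proof.
move=> t1; pose d := pseries_diffs g.
have gd : tgrowth tau d by exact: tgrowth_diffs.
have gs := tgrowth_shift ggrowth.
have gn : tgrowth tau (fun k => k%:R * g k) by apply: tgrowth_mul => //; exact: growth_nat.
have dS k : d k.+1 = 2 * u * d k + (2 * lam * u * g k.+1 + (- v * (k%:R * g k) + - (2 * lam * v) * g k)).
  by rewrite /d /pseries_diffs /g (Zonal.gegenbauer_rec lam0) -natr1; ring.
have E1 : G' t = d 0%N + t * psum (fun k => d k.+1) t by rewrite -(psum_shift tau0 gd t1).
have E2 : G t = 1 + t * psum (fun k => g k.+1) t.
  by rewrite /G (psum_shift tau0 ggrowth t1) {1}/g Zonal.gegenbauer0.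
have E3 := psum_theta tau0 ggrowth t1.
have E4 : psum (fun k => d k.+1) t = 2 * u * G' t + (2 * lam * u * psum (fun k => g k.+1) t
    + (- v * (t * G' t) + - (2 * lam * v) * G t)).
  rewrite (_ : (fun k => d k.+1) = (fun k => 2 * u * d k + (2 * lam * u * g k.+1 + (- v * (k%:R * g k) + - (2 * lam * v) * g k)))); last exact/funext.
  rewrite !(psumD tau0)//; do ?[by apply: tgrowthZ | apply: tgrowthD].
  by rewrite !(psumZ tau0)// E3.
have d0 : d 0%N = 2 * lam * u by rewrite /d /pseries_diffs mul1r /g Zonal.gegenbauer1.
move: E1; rewrite E4 d0 => E1.
have E5 : t * (2 * lam * u * psum (fun k => g k.+1) t) = 2 * lam * u * (G t - 1) by rewrite E2; ring.
rewrite /D; move: E1 E5; set a := psum _ _; set b := G' t; set c := G t => E1 E5.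
by rewrite mulrDl mulrBl mul1r {1}E1 !mulrDr E5; ring.
Qed.

Let is_derive_G t : `|t| * tau < 1 -> is_derive t (1 : R) G (G' t).
Proof. exact: is_derive_psum. Qed.

Let is_derive_A t : is_derive t (1 : R) A (- (2 * v * t)).
Proof.
rewrite /A; have h : is_derive t (1 : R) (fun t : R => t ^+ 2) (2 * t).
  have := @is_deriveX R R id 2 t 1 1 _; rewrite /= expr1 => /(_ _).
  move=> h; apply: is_derive_eq; rewrite -[LHS]/(2 * t * 1); ring.
apply: is_derive_eq; rewrite -![_ *: _]/(_ * _); ring.
Qed.

Let is_derive_D t : is_derive t (1 : R) D (2 * (v * t - u)).
Proof.
rewrite /D; apply: is_derive_eq; rewrite -![_ *: _]/(_ * _) /= ?expr1; ring.
Qed.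

(** By the differential equation, [G * D ^ lam] does not depend on [t]. *)
Let GD1 : G 1 * D 1 `^ lam = 1.
Proof.
have t1 (t : R) : 0 <= t <= 1 -> `|t| * tau < 1.
  move=> /andP[t0 t1]; rewrite ger0_norm//; apply: le_lt_trans tau1.
  by rewrite ler_piMl.
pose q t := G t * D t `^ lam.
have dq (t : R) : 0 <= t <= 1 -> is_derive t (1 : R) q 0.
  move=> /t1 h; have D0 := D_gt0 h.
  have h1 := is_derive_G h; have h2 := is_derive_D t.
  have h3 := @is_derive1_comp R (fun s => s `^ lam) D t _ _ (is_derive1_powR lam D0) h2.
  have h4 : is_derive t (1 : R) (fun s => D s `^ lam) (lam * D t `^ (lam - 1) * (2 * (v * t - u))) by [].
  rewrite /q; apply: is_derive_eq; rewrite -![_ *: _]/(_ * _).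
  have -> : D t `^ lam = D t * D t `^ (lam - 1) by rewrite mulr_powRB1// ltW.
  have -> : D t * D t `^ (lam - 1) * G' t = D t `^ (lam - 1) * (D t * G' t) by ring.
  by rewrite ode//; field.
have := constant_of_derive0 dq.
have G0 : G 0 = 1.
  rewrite /G (psum_shift tau0 ggrowth) ?normr0 ?mul0r ?ltr01//.
  by rewrite addr0 /g Zonal.gegenbauer0.
have -> : q 0 = 1 by rewrite /q G0 /D !mulr0 subr0 expr0n mulr0 addr0 mul1r powR1.
by [].
Qed.

Lemma poisson_positive : 0 < G 1.
Proof.
have Dp : 0 < D 1 `^ lam by apply: powR_gt0; apply: D_gt0; rewrite normr1 mul1r.
by rewrite -(pmulr_lgt0 _ Dp) GD1.
Qed.

Definition term_value t (w : R * (nat * nat)) : R :=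
  w.1 * (A t ^+ w.2.1 * (D t)^-1 ^+ w.2.2 * G t).

Definition terms_value t (l : seq (R * (nat * nat))) : R := \sum_(w <- l) term_value t w.

Let is_derive_term t w : `|t| * tau < 1 ->
  exists2 d, is_derive t (1 : R) (term_value ^~ w) d & t * d = terms_value t (theta_term w).
Proof.
case: w => c [i j] t1; have D0 := D_gt0 t1.
have DN0 : D t != 0 by rewrite gt_eqF.
have h1 := is_derive_G t1; have h2 := is_derive_D t; have h3 := is_derive_A t.
have h4 : is_derive t (1 : R) (fun s => (D s)^-1) (- (D t)^-1 ^+ 2 * (2 * (v * t - u))).
  have := @is_deriveV R D t _ 1 DN0 h2; rewrite exprVn; exact.
pose dA := i%:R * A t ^+ i.-1 * (- (2 * v * t)).
pose dD := j%:R * (D t)^-1 ^+ j.-1 * (- (D t)^-1 ^+ 2 * (2 * (v * t - u))).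
have h5 : is_derive t (1 : R) (fun s => A s ^+ i) dA.
  rewrite (_ : (fun s => A s ^+ i) = A ^+ i); last by apply/funext => s; rewrite exprfctE.
  exact: is_deriveX.
have h6 : is_derive t (1 : R) (fun s => (D s)^-1 ^+ j) dD.
  rewrite (_ : (fun s => (D s)^-1 ^+ j) = (fun s => (D s)^-1) ^+ j); last by apply/funext => s; rewrite exprfctE.
  exact: is_deriveX.
exists (c * ((A t ^+ i * (D t)^-1 ^+ j) * G' t + G t * (A t ^+ i * dD + (D t)^-1 ^+ j * dA))).
  rewrite /term_value /=; apply: is_derive_eq; rewrite -![_ *: _]/(_ * _); ring.
rewrite /terms_value /theta_term !big_cons big_nil /term_value /= addr0.
have tG : t * G' t = lam * (A t - D t) * (D t)^-1 * G t.
  apply: (mulfI DN0); rewrite mulrCA ode// /A.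
  rewrite (_ : D t * (_ * _ * _ * _) = (D t * (D t)^-1) * (lam * (1 - v * t ^+ 2 - D t) * G t)); last by ring.
  by rewrite mulfV// /D; ring.
have tA : t * dA = i%:R * (2 * A t ^+ i - 2 * A t ^+ i.-1).
  rewrite /dA; case: i {dA h5} => [|i]; first by rewrite !mul0r mulr0.
  by rewrite /= exprS /A; ring.
have tD : t * dD = - (j%:R * ((D t)^-1 ^+ j - A t * (D t)^-1 ^+ j.+1)).
  rewrite /dD; case: j {dD h6} => [|j]; first by rewrite !mul0r mulr0 oppr0.
  rewrite /= (_ : (D t)^-1 ^+ j.+1 = D t * (D t)^-1 ^+ j.+2); last by rewrite [in RHS]exprS mulrA mulfV// mul1r.
  by rewrite !exprS expr0 /D /A; ring.
rewrite (_ : t * _ = c * (A t ^+ i * (D t)^-1 ^+ j * (t * G' t) + G t * (A t ^+ i * (t * dD) + (D t)^-1 ^+ j * (t * dA)))); last by ring.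
rewrite tG tA tD !exprS.
rewrite (_ : lam * (A t - D t) * (D t)^-1 * G t = lam * G t * (A t * (D t)^-1 - D t * (D t)^-1)); last by ring.
by rewrite mulfV//; ring.
Qed.

Let is_derive_terms t l : `|t| * tau < 1 ->
  exists2 d, is_derive t (1 : R) (terms_value ^~ l) d &
    t * d = terms_value t (flatten [seq theta_term w | w <- l]).
Proof.
move=> t1; elim: l => [|w l [d hd dE]].
  exists 0; last by rewrite /terms_value big_nil mulr0.
  rewrite (_ : terms_value ^~ [::] = cst 0); first exact: is_derive_cst.
  by apply/funext => s; rewrite /terms_value big_nil.
have [e he eE] := is_derive_term w t1; exists (e + d).
  rewrite (_ : terms_value ^~ (w :: l) = term_value ^~ w + terms_value ^~ l); first exact: is_deriveD.
  by apply/funext => s; rewrite /terms_value big_cons.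
by rewrite mulrDr eE dE /terms_value /= big_cat.
Qed.

Let psum_terms m t : `|t| * tau < 1 ->
  psum (fun k => k%:R ^+ m * z k) t = terms_value t (theta_terms m).
Proof.
elim: m t => [|m ih] t t1.
  have gS := tgrowth_shift ggrowth; have gSS := tgrowth_shift gS.
  have zS := tgrowth_shift zgrowth.
  rewrite (_ : (fun k => _) = z); last by apply/funext => k; rewrite expr0 mul1r.
  rewrite /terms_value big_seq1 /term_value /= expr0 expr1 mul1r mulr1.
  rewrite (psum_shift tau0 zgrowth)// (psum_shift tau0 zS)//.
  rewrite (_ : (fun k => z k.+2) = (fun k => g k.+2 + - v * g k)); last first.
    by apply/funext => k; rewrite zSS mulNr.
  rewrite (psumD tau0)//; last exact: tgrowthZ.
  rewrite (psumZ tau0)// -/(G t) /A.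
  rewrite (_ : z 0%N = g 0%N); last by rewrite /z /Zonal.Zf Zonal.zpoly0 /g Zonal.gegenbauer0.
  rewrite (_ : z 1%N = g 1%N); last by rewrite /z /Zonal.Zf Zonal.zpoly1.
  rewrite [in RHS]mulrBl mul1r {2}/G (psum_shift tau0 ggrowth)// (psum_shift tau0 gS)//.
  by ring.
pose a k : R := k%:R ^+ m * z k.
have ga : tgrowth tau a.
  apply: tgrowth_mul => //; exists 1, m => k; rewrite mul1r ger0_norm ?exprn_ge0//.
  by apply: lerXn2r; rewrite ?nnegrE// ler_nat.
rewrite (_ : (fun k => _) = (fun k => k%:R * a k)); last by apply/funext => k; rewrite /a exprS mulrA.
rewrite (psum_theta tau0 ga t1) /=.
have [d hd <-] := is_derive_terms (theta_terms m) t1; congr (t * _).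
have nt : \forall s \near t, psum a s = terms_value s (theta_terms m).
  have nt1 : \forall s \near t, `|s| * tau < 1.
    have c : `|s| * tau @[s --> t] --> `|t| * tau.
      by apply: cvgM; [exact: cvg_norm|exact: cvg_cst].
    exact: (cvgr_lt _ c _ t1).
  by near=> s; rewrite /a ih//; near: s.
have h1 := near_eq_is_derive nt (is_derive_psum tau0 ga t1).
by rewrite -(@derive_val _ _ _ _ _ _ _ h1) (@derive_val _ _ _ _ _ _ _ hd).
Unshelve. all: by end_near.
Qed.

Let A1 : A 1 = 1 - tau ^+ 2. Proof. by rewrite /A vE expr1n mulr1. Qed.

Let A1_ge : 1 - tau <= A 1.
Proof. by rewrite A1 lerD2l lerN2 expr2 ler_piMl// ltW. Qed.

Let A1_le : A 1 <= 2 * (1 - tau).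
Proof. by rewrite A1; have := tau1; have := tau0; nra. Qed.

Lemma psum_kernel c : psum (fun k => c k * z k) 1 = zkernel c x y.
Proof. by congr (limn _); apply/funext => K; rewrite /pseries /series /=; apply: eq_bigr => k _; rewrite expr1n mulr1. Qed.

Lemma poissonE : zkernel (fun=> 1) x y = A 1 * G 1.
Proof.
have t1 : `|1| * tau < 1 by rewrite normr1 mul1r.
rewrite -psum_kernel -[A 1]expr1; have := psum_terms 0 t1.
rewrite /terms_value big_seq1 /term_value /= expr0 mul1r mulr1 => <-.
by [].
Qed.

(** The series sums to [A G] at 1, and [G D ^ lam = 1] there. *)
Lemma poisson_closed_form : zkernel (fun=> 1) x y * (1 - 2 * u + v) `^ lam = 1 - v.
Proof.
have D1 : D 1 = 1 - 2 * u + v by rewrite /D expr1n !mulr1.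
by rewrite poissonE -D1 -mulrA GD1 mulr1 /A expr1n mulr1.
Qed.

Lemma poisson_ge0 : 0 <= zkernel (fun=> 1) x y.
Proof. by rewrite poissonE mulr_ge0 ?(ltW poisson_positive)// (le_trans _ A1_ge)// subr_ge0 ltW. Qed.

(** Since [A <= 2 (1 - tau)] and [D >= (1 - tau) ^ 2], the term is bounded by
    [(1 - tau) ^ (i - 1 - 2 j)] times the Poisson kernel [A G]. *)
Lemma term_value_le m w : (2 * w.2.2 + 1 <= w.2.1 + m)%N ->
  `|term_value 1 w| <= (`|w.1| * 2 ^+ w.2.1) * ((1 - tau) ^+ m)^-1 * zkernel (fun=> 1) x y.
Proof.
case: w => c [i j] /= ijm; rewrite /term_value /= poissonE.
have s0 : 0 < 1 - tau by rewrite subr_gt0.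
have G0 := poisson_positive.
have A0 : 0 < A 1 := lt_le_trans s0 A1_ge.
have t1 : `|1| * tau < 1 by rewrite normr1 mul1r.
have D0 := D_gt0 t1; have := D_ge 1; rewrite normr1 mul1r => Dge.
have Di0 : 0 <= (D 1)^-1 by rewrite invr_ge0 ltW.
rewrite !normrM (gtr0_norm G0) (ger0_norm (exprn_ge0 i (ltW A0))) (ger0_norm (exprn_ge0 j Di0)).
rewrite -!mulrA; apply: ler_wpM2l => //; rewrite !mulrA; apply: ler_wpM2r; first exact: ltW.
have Dj : (D 1)^-1 ^+ j <= ((1 - tau) ^+ (2 * j))^-1.
  rewrite exprVn lef_pV2 ?posrE ?exprn_gt0// exprM.
  by apply: lerXn2r; rewrite ?nnegrE ?(ltW D0)// exprn_ge0// ltW.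
apply: (@le_trans _ _ (A 1 ^+ i * ((1 - tau) ^+ (2 * j))^-1)).
  by apply: ler_wpM2l => //; rewrite exprn_ge0// ltW.
rewrite ler_pdivrMr ?exprn_gt0//.
rewrite [leRHS](_ : _ = 2 ^+ i * A 1 * (1 - tau) ^+ (2 * j) / (1 - tau) ^+ m); last by ring.
rewrite ler_pdivlMr ?exprn_gt0//.
case: i ijm => [|i] ijm.
  rewrite !expr0 !mul1r; apply: (@le_trans _ _ ((1 - tau) ^+ (2 * j).+1)).
    have jm : ((2 * j).+1 <= m)%N by move: ijm; clear; lia.
    by apply: ler_wiXn2l; [exact: ltW|rewrite gerBl|exact: jm].
  by rewrite exprS; apply: ler_wpM2r => //; rewrite exprn_ge0// ltW.
apply: (@le_trans _ _ (A 1 * (2 ^+ i * ((1 - tau) ^+ i * (1 - tau) ^+ m)))).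
  rewrite exprS -mulrA; apply: ler_wpM2l; first exact: ltW.
  rewrite mulrA -exprMn; apply: ler_wpM2r; first by rewrite exprn_ge0// ltW.
  by apply: lerXn2r; rewrite ?nnegrE ?(ltW A0)// mulr_ge0// ltW.
rewrite [leLHS](_ : _ = (2 ^+ i * A 1) * ((1 - tau) ^+ i * (1 - tau) ^+ m)); last by ring.
apply: ler_pM; rewrite ?mulr_ge0 ?exprn_ge0 ?(ltW A0) ?(ltW s0)//.
  apply: ler_wpM2r; first exact: ltW.
  by rewrite exprS ler_peMl ?exprn_ge0// ler1n.
have jm : (2 * j <= i + m)%N by move: ijm; clear; lia.
by rewrite -exprD; apply: ler_wiXn2l; [exact: ltW|rewrite gerBl|exact: jm].
Qed.

Lemma theta_terms_le m l : all (fun w => 2 * w.2.2 + 1 <= w.2.1 + m)%N l ->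
  `|terms_value 1 l| <= (\sum_(w <- l) `|w.1| * 2 ^+ w.2.1) * ((1 - tau) ^+ m)^-1 * zkernel (fun=> 1) x y.
Proof.
elim: l => [|w l ih] /=; first by rewrite /terms_value !big_nil normr0 !mul0r.
move=> /andP[hw /ih hl]; rewrite /terms_value !big_cons !mulrDl.
by apply: (le_trans (ler_normD _ _)); apply: lerD => //; exact: term_value_le.
Qed.

Lemma theta_kernelE m : zkernel (fun k => k%:R ^+ m) x y = terms_value 1 (theta_terms m).
Proof. by rewrite -psum_kernel psum_terms// normr1 mul1r. Qed.

End fixed_points.

(** Among the three terms produced by [t d/dt] only the last two change [i - 2 j], and
    they lower it by 1. *)
Lemma theta_terms_weight m : all (fun w => 2 * w.2.2 + 1 <= w.2.1 + m)%N (theta_terms m).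
Proof.
elim: m => [|m ih] //=; apply/allP => w /flatten_mapP[[c [i j]] /(allP ih) /= ijm].
by rewrite !inE => /or3P[] /eqP -> /=; lia.
Qed.

Lemma theta_poisson_le m : exists C, forall x y, enorm x * enorm y < 1 ->
  `|zkernel (fun k => k%:R ^+ m) x y| <=
    C * ((1 - enorm x * enorm y) ^+ m)^-1 * zkernel (fun=> 1) x y.
Proof.
exists (\sum_(w <- theta_terms m) `|w.1| * 2 ^+ w.2.1) => x y xy1.
by rewrite theta_kernelE//; apply: theta_terms_le => //; exact: theta_terms_weight.
Qed.

End closed_form.

(** * Integral means of kernels over spheres *)

Lemma ge0_fubini_domain d1 d2 (T1 : measurableType d1) (T2 : measurableType d2) (R : realType)
    (m1 : {sigma_finite_measure set T1 -> \bar R}) (m2 : {sigma_finite_measure set T2 -> \bar R})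
    (A : set T1) (B : set T2) (f : T1 * T2 -> \bar R) :
  measurable A -> measurable B -> measurable_fun setT f -> (forall p, 0 <= f p)%E ->
  (\int[m1]_(x in A) \int[m2]_(y in B) f (x, y) = \int[m2]_(y in B) \int[m1]_(x in A) f (x, y))%E.
Proof.
move=> mA mB mf f0.
pose g p := (f p * (\1_A p.1 * \1_B p.2)%:E)%E.
have i0 d (T : measurableType d) (D : set T) x : 0 <= \1_D x :> R by rewrite indicE ler0n.
have g0 p : (0 <= g p)%E by rewrite mule_ge0// lee_fin mulr_ge0.
have mg : measurable_fun setT g.
  apply: emeasurable_funM => //; apply/measurable_EFinP/measurable_funM.
    by apply: (measurableT_comp _ measurable_fst); exact: measurable_indic.
  by apply: (measurableT_comp _ measurable_snd); exact: measurable_indic.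
transitivity (\int[m1]_x \int[m2]_y g (x, y))%E.
  rewrite [LHS]integral_mkcond; apply: eq_integral => x _; rewrite /patch.
  case: ifPn => xA; last first.
    by apply/esym/integral0_eq => y _; rewrite /g /= indicE (negbTE xA) mul0r mule0.
  rewrite integral_mkcond; apply: eq_integral => y _; rewrite /patch /g /= !indicE xA mul1r.
  by case: ifPn; rewrite ?mule1 ?mule0.
rewrite fubini_tonelli//.
rewrite [RHS]integral_mkcond; apply: eq_integral => y _; rewrite /patch.
case: ifPn => yB; last first.
  by apply: integral0_eq => x _; rewrite /g /= !indicE (negbTE yB) mulr0 mule0.
rewrite [RHS]integral_mkcond; apply: eq_integral => x _; rewrite /patch /g /= !indicE yB mulr1.
by case: ifPn; rewrite ?mule1 ?mule0.
Qed.

Section kernel_means.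
Context {R : realType} {n : nat}.
Hypothesis n2 : (2 <= n)%N.
Notation T := (n.-tuple R).
Notation leb := (@lebesgue_measure R).
Notation scale := (@Zonal.scale R n).
Notation dot := (@Zonal.dot R n).
Notation Zf := (@Zonal.Zf R n).
Notation sigma := (@sigma R n).
Notation smean := (@smean R n).
Implicit Types (x y z : T) (c : nat -> R).

Let n0 : (0 < n)%N. Proof. exact: leq_trans n2. Qed.

Lemma measurable_dot2 : measurable_fun setT (fun p : T * T => dot p.1 p.2).
Proof.
apply: measurable_sum => i; apply: measurable_funM.
  exact: (measurableT_comp (measurable_tnth i) measurable_fst).
exact: (measurableT_comp (measurable_tnth i) measurable_snd).
Qed.

Lemma measurable_Zf2 k : measurable_fun setT (fun p : T * T => Zf k p.1 p.2).
Proof.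
have md1 : measurable_fun setT (fun p : T * T => dot p.1 p.1).
  exact: (measurableT_comp measurable_dot measurable_fst).
have md2 : measurable_fun setT (fun p : T * T => dot p.2 p.2).
  exact: (measurableT_comp measurable_dot measurable_snd).
apply: measurable_sum => j; apply: measurable_funM.
  by apply: measurable_funM => //; apply: measurable_funX; exact: measurable_dot2.
by apply: measurable_funX; exact: measurable_funM.
Qed.

(** The kernel, made 0 where its series may diverge: in this form it is jointly
    measurable. *)
Definition zk c x y : R := if enorm x * enorm y < 1 then zkernel c x y else 0.

Lemma zkE c x y : enorm x * enorm y < 1 -> zk c x y = zkernel c x y.
Proof. by rewrite /zk => ->. Qed.

Lemma measurable_zk c : growth c -> measurable_fun setT (fun p : T * T => zk c p.1 p.2).
Proof.
move=> gc.
pose h K (p : T * T) := if enorm p.1 * enorm p.2 < 1 then \sum_(0 <= k < K) c k * Zf k p.1 p.2 else 0.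
apply: (@measurable_fun_cvg _ _ _ _ h) => [K|p _].
  apply: measurable_fun_ifT => //.
    apply: measurable_fun_ltr => //; apply: measurable_funM.
      exact: (measurableT_comp measurable_enorm measurable_fst).
    exact: (measurableT_comp measurable_enorm measurable_snd).
  apply: measurable_sum => k; apply: measurable_funM => //; exact: measurable_Zf2.
rewrite /h /zk; case: ifPn => [p1|_]; last exact: cvg_cst.
exact: zkernel_cvg.
Qed.

(** Zonal harmonics of positive degree have mean 0, so every partial sum has mean 1. *)
Lemma poisson_mean_le1 x rho : 0 <= rho -> enorm x * rho < 1 ->
  (\int[sigma]_(z in usphere) (zk (fun=> 1%R) x (scale rho z))%:E <= 1)%E.
Proof.
move=> r0 xr1; have xr0 : 0 <= enorm x * rho by rewrite mulr_ge0 ?enorm_ge0.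
have xz z : usphere z -> enorm x * enorm (scale rho z) = enorm x * rho.
  by move=> z1; rewrite enorm_scale// z1 mulr1.
have xr01 : 0 <= enorm x * rho < 1 by rewrite xr0.
have [e e0 He] := zkernel_tail n2 (growth_cst 1) xr01.
apply/lee_addgt0Pr => eps eps0.
have /cvgrPdist_lt /(_ _ eps0) [K0 _ HK0] := e0.
pose K := (maxn K0 1); have := HK0 K (leq_maxl _ _); rewrite sub0r normrN => eK.
have K1 : (0 < K)%N by rewrite /K leq_max orbT.
have mS := @measurable_usphere R n.
have pZ k : Zonal.polynomial_fun (fun z => Zf k x (scale rho z)).
  have [s hs] := Zf_polynomial n2 k x.
  exists [seq (rho ^+ k * w.1, w.2) | w <- s] => z.
  rewrite Zonal.ZfC (Zonal.harmonic_scale _ _ (Zonal.Zf_harmonic n2 k x)) hs.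
  rewrite /Zonal.monomial_sum big_map mulr_sumr; apply: eq_bigr => w _.
  by rewrite mulrA.
have iZ k := polynomial_sphere_integrable n2 (pZ k).
have iE : (\int[sigma]_(z in usphere) (\sum_(0 <= k < K) Zf k x (scale rho z))%:E = 1)%E.
  under eq_integral do rewrite -sumEFin.
  rewrite integral_sum//.
  have iZE k : (\int[sigma]_(z in usphere) (Zf k x (scale rho z))%:E)%E = (smean (fun z => Zf k x (scale rho z)))%:E.
    by rewrite /smean /Rintegral fineK//; apply: integrable_fin_num (iZ k).
  rewrite (eq_bigr _ (fun k _ => iZE k)) sumEFin; congr EFin.
  rewrite big_ltn// (_ : smean _ = 1) ?big1_seq ?addr0//; last first.
    rewrite -[RHS](smean1 n2); apply: smean_ext => z.
    by rewrite /Zonal.Zf Zonal.zpoly0.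
  move=> k /andP[_]; rewrite mem_index_iota => /andP[k1 _].
  transitivity (smean (fun z => rho ^+ k * Zf k z x)).
    apply: smean_ext => z; rewrite Zonal.ZfC.
    by rewrite (Zonal.harmonic_scale _ _ (Zonal.Zf_harmonic n2 k x)).
  rewrite (smeanZ n2 _ (Zf_polynomial n2 k x)).
  by rewrite (harmonic_smean0 n2 (Zonal.Zf_harmonic n2 k x))// mulr0.
apply: (@le_trans _ _ (\int[sigma]_(z in usphere) ((\sum_(0 <= k < K) Zf k x (scale rho z))%:E + eps%:E))%E).
  have iS : sigma.-integrable usphere (fun z => (\sum_(0 <= k < K) Zf k x (scale rho z))%:E).
    under eq_fun do rewrite -sumEFin.
    by apply: integrable_sum => // k _; exact: iZ.
  have ie : sigma.-integrable usphere (fun=> eps%:E).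
    apply: (@sphere_integrable _ _ n2 (fun=> eps) `|eps|) => //.
  have mzk : measurable_fun setT (fun z => zk (fun=> 1) x (scale rho z)).
    have h := measurable_zk (growth_cst 1).
    exact: (measurableT_comp (measurableT_comp h (pair1_measurable x)) (measurable_scale rho)).
  have zke z : usphere z -> zk (fun=> 1) x (scale rho z) <= \sum_(0 <= k < K) Zf k x (scale rho z) + eps.
    move=> z1; rewrite zkE ?xz//; have := He x (scale rho z) K; rewrite xz// => /(_ (lexx _)).
    under eq_bigr do rewrite mul1r.
    move=> h; rewrite -lerBlDl; apply: le_trans (ler_norm _) (le_trans h _).
    exact: le_trans (ler_norm _) (ltW eK).
  apply: ge0_le_integral => //.
  - by move=> z z1; rewrite lee_fin zkE ?xz//; apply: (poisson_ge0 n2); rewrite xz.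
  - by apply/measurable_EFinP; exact: measurable_funTS.
  - by apply: measurable_int (integrableD _ iS ie).
rewrite integralD//; last 2 first.
- under eq_fun do rewrite -sumEFin.
  by apply: integrable_sum => // k _; exact: iZ.
- by apply: (@sphere_integrable _ _ n2 (fun=> eps) `|eps|).
rewrite iE integral_cst// [X in (_ + _ * X)%E](_ : _ = 1%E) ?mule1//.
exact: sigma_usphere.
Qed.

Definition kernel_mean c x (rho : R) : \bar R :=
  (\int[sigma]_(z in usphere) `|zk c x (scale rho z)|%:E)%E.

Lemma measurable_zk_scale c x rho : growth c ->
  measurable_fun setT (fun z => zk c x (scale rho z)).
Proof.
move=> gc; have h := measurable_zk gc.
exact: (measurableT_comp (measurableT_comp h (pair1_measurable x)) (measurable_scale rho)).
Qed.

Lemma zkernelD c1 c2 x y : growth c1 -> growth c2 -> enorm x * enorm y < 1 ->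
  zkernel (fun k => c1 k + c2 k) x y = zkernel c1 x y + zkernel c2 x y.
Proof.
move=> g1 g2 xy; rewrite /zkernel -limD; [|exact: zkernel_cvg..].
congr (limn _); apply/funext => K; rewrite /series /= -[RHS]big_split /=.
by apply: eq_bigr => k _; rewrite mulrDl.
Qed.

Lemma zkernelZ a c x y : growth c -> enorm x * enorm y < 1 ->
  zkernel (fun k => a * c k) x y = a * zkernel c x y.
Proof.
move=> gc xy; apply/cvg_lim => //.
rewrite (_ : series _ = (fun K => a * series (fun k => c k * Zf k x y) K)); last first.
  by apply/funext => K; rewrite /series /= mulr_sumr; apply: eq_bigr => k _; rewrite mulrA.
by apply: cvgM; [exact: cvg_cst|exact: zkernel_cvg].
Qed.

Lemma poly_kernel_le (p : {poly R}) m : (size p <= m.+1)%N ->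
  exists2 C, 0 <= C & forall x y, enorm x * enorm y < 1 ->
    `|zkernel (fun k => p.[k%:R]) x y| <=
      C * ((1 - enorm x * enorm y) ^+ m)^-1 * zkernel (fun=> 1) x y.
Proof.
move=> sp.
suff H K : (K <= m.+1)%N -> exists2 C, 0 <= C & forall x y, enorm x * enorm y < 1 ->
    `|zkernel (fun k => \sum_(i < K) p`_i * k%:R ^+ i) x y| <=
      C * ((1 - enorm x * enorm y) ^+ m)^-1 * zkernel (fun=> 1) x y.
  have [C C0 hC] := H m.+1 (leqnn _); exists C => // x y xy; rewrite (_ : (fun k => _) = (fun k => \sum_(i < m.+1) p`_i * k%:R ^+ i)); first exact: hC.
  by apply/funext => k; exact: horner_coef_wide.
elim: K => [_|K ih Km].
  exists 0 => // x y xy; under eq_fun do rewrite big_ord0.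
  rewrite !mul0r /zkernel (_ : series _ = fun=> 0); last first.
    by apply/funext => K; rewrite /series /= big1// => k _; rewrite mul0r.
  by rewrite lim_cst// normr0.
have [C C0 hC] := ih (ltnW Km); have [D hD] := @theta_poisson_le R n n2 K.
exists (C + `|p`_K| * `|D|) => [|x y xy]; first by rewrite addr_ge0// mulr_ge0.
have gpow i : growth (fun k => k%:R ^+ i : R).
  exists 1, i => k; rewrite mul1r ger0_norm ?exprn_ge0//.
  by apply: lerXn2r; rewrite ?nnegrE// ler_nat.
have gsum : growth (fun k => \sum_(i < K) p`_i * k%:R ^+ i).
  elim: {ih Km hC hD} K => [|K ih].
    by under eq_fun do rewrite big_ord0; exact: growth_cst.
  under eq_fun do rewrite big_ord_recr /=.
  by apply: growthD => //; apply: growthM => //; exact: growth_cst.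
under eq_fun do rewrite big_ord_recr /=.
have P0 := poisson_ge0 n2 xy.
rewrite zkernelD//; last by apply: growthM => //; exact: growth_cst.
rewrite zkernelZ// !mulrDl; apply: (le_trans (ler_normD _ _)); apply: lerD; first exact: hC.
rewrite normrM -!mulrA; apply: ler_wpM2l => //; apply: (le_trans (hD x y xy)).
rewrite mulrA; apply: ler_wpM2r => //.
have s0 : 0 < 1 - enorm x * enorm y by rewrite subr_gt0.
apply: (@le_trans _ _ (`|D| * ((1 - enorm x * enorm y) ^+ K)^-1)).
  by apply: ler_wpM2r; [rewrite invr_ge0 exprn_ge0// ltW|exact: ler_norm].
apply: ler_wpM2l => //; rewrite lef_pV2 ?posrE ?exprn_gt0//.
apply: ler_wiXn2l => //; first exact: ltW.
by rewrite gerBl mulr_ge0 ?enorm_ge0.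
Qed.

Lemma poly_kernel_mean (p : {poly R}) m : (size p <= m.+1)%N ->
  exists2 C, 0 <= C & forall x rho, 0 <= rho -> enorm x * rho < 1 ->
    (kernel_mean (fun k => p.[k%:R]) x rho <= (C * ((1 - enorm x * rho) ^+ m)^-1)%:E)%E.
Proof.
move=> sp; have [C C0 hC] := poly_kernel_le sp; exists C => // x rho r0 xr1.
have xz z : usphere z -> enorm x * enorm (scale rho z) = enorm x * rho.
  by move=> z1; rewrite enorm_scale// z1 mulr1.
have s0 : 0 < 1 - enorm x * rho by rewrite subr_gt0.
have c0 : 0 <= C * ((1 - enorm x * rho) ^+ m)^-1 by rewrite mulr_ge0// invr_ge0 exprn_ge0// ltW.
have gp := growth_poly p.
have P0 z : usphere z -> 0 <= zk (fun=> 1) x (scale rho z).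
  by move=> z1; rewrite zkE ?xz//; apply: (poisson_ge0 n2); rewrite xz.
have mS := @measurable_usphere R n.
apply: (@le_trans _ _ (\int[sigma]_(z in usphere) ((C * ((1 - enorm x * rho) ^+ m)^-1)%:E * (zk (fun=> 1) x (scale rho z))%:E))%E).
  apply: ge0_le_integral => //.
  - apply/measurable_EFinP/measurable_funTS/measurableT_comp => //; exact: measurable_zk_scale.
  - apply: emeasurable_funM => //; apply/measurable_EFinP/measurable_funTS.
    by apply: measurable_zk_scale; exact: growth_cst.
  - move=> z z1; rewrite -EFinM lee_fin !zkE ?xz//; have := hC x (scale rho z).
    by rewrite xz//; exact.
rewrite ge0_integralZl//; last first.
  apply/measurable_EFinP/measurable_funTS.
  by apply: measurable_zk_scale; exact: growth_cst.
rewrite -[leRHS]mule1; apply: lee_wpmul2l; first by rewrite lee_fin.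
exact: poisson_mean_le1.
Qed.

(** Multiplying the coefficients by the moments of a density amounts to averaging
    dilates of the kernel. *)
Section moments.
Variable beta : R -> R.
Hypothesis beta_ge0 : forall t, 0 <= beta t.
Hypothesis measurable_beta : measurable_fun setT beta.
Hypothesis integrable_beta : leb.-integrable `]0%R, 1%R[ (EFin \o beta).

Definition moment k : R := (\int[leb]_(t in `]0%R, 1%R[) (t ^+ k * beta t))%R.

Let integrable_moment k : leb.-integrable `]0%R, 1%R[ (EFin \o (fun t => t ^+ k * beta t)).
Proof.
apply: le_integrable integrable_beta => //.
  apply/measurable_EFinP/measurable_funTS/measurable_funM => //; exact: exprn_measurable.
move=> t /=; rewrite in_itv/= => /andP[t0 t1]; rewrite lee_fin normrM ler_piMl//.
by rewrite normrX exprn_ile1// ger0_norm ltW.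
Qed.

Lemma moment_bounds k : 0 <= moment k <= moment 0.
Proof.
apply/andP; split.
  apply: Rintegral_ge0 => t /=; rewrite in_itv/= => /andP[t0 _].
  by rewrite mulr_ge0// exprn_ge0// ltW.
apply: le_Rintegral => // t /=; rewrite in_itv/= => /andP[t0 t1].
by apply: ler_wpM2r => //; rewrite expr0 exprn_ile1 ?ltW.
Qed.

Lemma growth_moment : growth moment.
Proof.
apply: (growth_le (growth_cst (moment 0))) => k.
by have /andP[m0 m1] := moment_bounds k; rewrite ger0_norm.
Qed.

Lemma enorm_scale_itv t x : 0 < t < 1 -> enorm (scale t x) <= enorm x.
Proof.
by move=> /andP[t0 t1]; rewrite enorm_scale ?(ltW t0)// ler_piMl ?enorm_ge0// ltW.
Qed.

Lemma measurable_zk_dilate c x y : growth c ->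
  measurable_fun setT (fun t : R => zk c (scale t x) y).
Proof.
move=> gc; have h := measurable_zk gc.
have mt : measurable_fun setT (fun t : measurableTypeR R => (scale t x, y)).
  apply/measurable_fun_pairP; split; last exact: measurable_cst.
  exact: (measurableT_comp measurable_scale2 (pair2_measurable x)).
exact: (measurableT_comp h mt).
Qed.

Lemma moment_kernel_le c x y : growth c -> enorm x * enorm y < 1 ->
  (`|zkernel (fun k => c k * moment k) x y|%:E <=
   \int[leb]_(t in `]0%R, 1%R[) (`|zk c (scale t x) y| * beta t)%:E)%E.
Proof.
move=> gc xy1; have xy0 : 0 <= enorm x * enorm y by rewrite mulr_ge0 ?enorm_ge0.
have xy01 : 0 <= enorm x * enorm y < 1 by rewrite xy0.
have [e e0 He] := zkernel_tail n2 gc xy01.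
have [e' e0' He'] := zkernel_tail n2 (growthM gc growth_moment) xy01.
have ee0 : e k * moment 0 + e' k @[k --> \oo] --> 0.
  rewrite -[X in _ --> X]addr0 -[X in _ --> X + _](mul0r (moment 0)).
  by apply: cvgD => //; apply: cvgM => //; exact: cvg_cst.
apply/lee_addgt0Pr => eps eps0.
have /cvgrPdist_lt /(_ _ eps0) [K _ /(_ K (leqnn _))] := ee0; rewrite sub0r normrN => eK.
have mD : measurable (`]0, 1[%classic : set (measurableTypeR R)) by exact: measurable_itv.
pose S t := \sum_(0 <= k < K) c k * Zf k (scale t x) y.
have SE t : S t * beta t = \sum_(0 <= k < K) c k * Zf k x y * (t ^+ k * beta t).
  rewrite mulr_suml; apply: eq_bigr => k _.
  by rewrite (Zonal.harmonic_scale _ _ (Zonal.Zf_harmonic n2 k y)); ring.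
have iS k : leb.-integrable `]0%R, 1%R[ (fun t => (c k * Zf k x y * (t ^+ k * beta t))%:E).
  rewrite (_ : (fun t => _) = (fun t => (c k * Zf k x y)%:E * (t ^+ k * beta t)%:E)%E).
    by apply: integrableZl => //; exact: integrable_moment.
  by apply/funext => t; rewrite EFinM.
have ES : (\int[leb]_(t in `]0%R, 1%R[) (S t * beta t)%:E =
    (\sum_(0 <= k < K) c k * moment k * Zf k x y)%:E)%E.
  under eq_integral do rewrite SE -sumEFin.
  rewrite integral_sum// -sumEFin; apply: eq_bigr => k _.
  under eq_integral do rewrite EFinM.
  rewrite integralZl//; last exact: integrable_moment.
  rewrite [in RHS]mulrAC [in RHS]EFinM; congr (_ * _)%E; rewrite /moment /Rintegral fineK//.
  by apply: integrable_fin_num (integrable_moment k).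
have mz : measurable_fun setT (fun t : measurableTypeR R => zk c (scale t x) y) by exact: measurable_zk_dilate.
have mS : measurable_fun setT (fun t : R => S t * beta t).
  under eq_fun do rewrite SE; apply: measurable_sum => k; apply: measurable_funM => //.
  by apply: measurable_funM => //; exact: exprn_measurable.
have Sle t : 0 < t < 1 -> `|S t| <= `|zk c (scale t x) y| + e K.
  move=> t01; have txy := ler_wpM2r (enorm_ge0 y) (enorm_scale_itv x t01).
  have := He (scale t x) y K txy; rewrite zkE ?(le_lt_trans txy)// -/(S t).
  set a := zkernel _ _ _ => h.
  have -> : S t = a - (a - S t) by rewrite opprB addrC subrK.
  by apply: (le_trans (ler_normB _ _)); rewrite lerD2l.
have eK0 : 0 <= e K by apply: le_trans (He x y K (lexx _)); exact: normr_ge0.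
have iM : (\int[leb]_(t in `]0%R, 1%R[) (beta t)%:E = (moment 0)%:E)%E.
  rewrite /moment /Rintegral fineK; first by apply: eq_integral => t _; rewrite expr0 mul1r.
  by apply: integrable_fin_num (integrable_moment 0).
have Sint : (`|\sum_(0 <= k < K) c k * moment k * Zf k x y|%:E <=
    \int[leb]_(t in `]0%R, 1%R[) (`|zk c (scale t x) y| * beta t)%:E + (e K * moment 0)%:E)%E.
  rewrite -abse_EFin -ES; apply: (le_trans (le_abse_integral _ _ _)) => //.
    by apply/measurable_EFinP; exact: measurable_funTS.
  rewrite EFinM -iM -ge0_integralZl//; last 2 first.
  - by apply/measurable_EFinP; exact: measurable_funTS.
  - by move=> t _; rewrite lee_fin.
  rewrite -ge0_integralD//; last 4 first.
  - by move=> t _; rewrite lee_fin mulr_ge0.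
  - apply/measurable_EFinP/measurable_funTS/measurable_funM => //; exact: measurableT_comp.
  - by move=> t _; rewrite mule_ge0// lee_fin.
  - apply: emeasurable_funM => //; apply/measurable_EFinP; exact: measurable_funTS.
  apply: ge0_le_integral => //.
  - apply: measurableT_comp => //; apply/measurable_EFinP; exact: measurable_funTS.
  - apply: emeasurable_funD; last first.
      apply: emeasurable_funM => //; apply/measurable_EFinP; exact: measurable_funTS.
    apply/measurable_EFinP/measurable_funTS/measurable_funM => //; exact: measurableT_comp.
  - move=> t /=; rewrite in_itv/= => t01; rewrite lee_fin normrM (ger0_norm (beta_ge0 t)) -mulrDl.
    by apply: ler_wpM2r => //; exact: Sle.
apply: (@le_trans _ _ (`|\sum_(0 <= k < K) c k * moment k * Zf k x y|%:E + (e' K)%:E)%E).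
  rewrite -EFinD lee_fin; have := He' x y K (lexx _); set a := zkernel _ _ _; set s := \sum_(_ <= _ < _) _ => h.
  have -> : a = s + (a - s) by rewrite addrC subrK.
  by apply: (le_trans (ler_normD _ _)); rewrite lerD2l.
apply: (le_trans (leeD2r _ Sint)); rewrite -addeA leeD2l// -EFinD lee_fin.
exact: le_trans (ler_norm _) (ltW eK).
Qed.

Lemma moment_kernel_mean c x rho : growth c -> 0 <= rho -> enorm x * rho < 1 ->
  (kernel_mean (fun k => c k * moment k)%R x rho <=
   \int[leb]_(t in `]0%R, 1%R[) ((beta t)%:E * kernel_mean c (scale t x) rho))%E.
Proof.
move=> gc r0 xr1.
have xz z : usphere z -> enorm x * enorm (scale rho z) = enorm x * rho.
  by move=> z1; rewrite enorm_scale// z1 mulr1.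
have mD : measurable (`]0, 1[%classic : set (measurableTypeR R)) by exact: measurable_itv.
have mS := @measurable_usphere R n.
have mF : measurable_fun setT (fun p : T * measurableTypeR R => (`|zk c (scale p.2 x) (scale rho p.1)| * beta p.2)%:E).
  apply/measurable_EFinP/measurable_funM; last exact: (measurableT_comp measurable_beta measurable_snd).
  apply: measurableT_comp => //.
  have mp : measurable_fun setT (fun p : T * measurableTypeR R => (scale p.2 x, scale rho p.1)).
    apply/measurable_fun_pairP; split.
      exact: (measurableT_comp (measurableT_comp measurable_scale2 (pair2_measurable x)) measurable_snd).
    exact: (measurableT_comp (measurable_scale rho) measurable_fst).
  exact: (measurableT_comp (measurable_zk gc) mp).
have F0 (p : T * measurableTypeR R) : (0 <= (`|zk c (scale p.2 x) (scale rho p.1)| * beta p.2)%:E)%E.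
  by rewrite lee_fin mulr_ge0.
apply: (@le_trans _ _ (\int[sigma]_(z in usphere) \int[leb]_(t in `]0%R, 1%R[)
    (`|zk c (scale t x) (scale rho z)| * beta t)%:E)%E).
  apply: ge0_le_integral => //.
  - apply/measurable_EFinP/measurable_funTS/measurableT_comp => //.
    by apply: measurable_zk_scale; apply: growthM => //; exact: growth_moment.
  - apply: measurable_funTS.
    pose F2 (p : T * measurableTypeR R) := ((`|zk c (scale p.2 x) (scale rho p.1)| * beta p.2)%:E * (\1_(`]0, 1[%classic : set R) p.2)%:E)%E.
    rewrite (_ : (fun z => _) = (fun z => \int[leb]_t F2 (z, t))%E).
      apply: (@measurable_fun_fubini_tonelli_F _ _ T (measurableTypeR R) R leb F2).
        apply: emeasurable_funM => //; apply/measurable_EFinP.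
        by apply: (measurableT_comp _ measurable_snd); exact: measurable_indic.
      by move=> p; rewrite mule_ge0// lee_fin indicE ler0n.
    apply/funext => z; rewrite integral_mkcond; apply: eq_integral => t _.
    by rewrite /patch /F2 /= indicE; case: ifPn; rewrite ?mule1 ?mule0.
  - move=> z z1; rewrite zkE ?xz//; apply: moment_kernel_le => //; by rewrite xz.
rewrite (@ge0_fubini_domain _ _ _ _ _ sigma leb _ _ _ mS mD mF F0).
rewrite le_eqVlt; apply/orP; left; apply/eqP; apply: eq_integral => t _.
rewrite /kernel_mean -ge0_integralZl//; last 2 first.
- apply/measurable_EFinP/measurable_funTS/measurableT_comp => //; exact: measurable_zk_scale.
- by rewrite lee_fin.
by apply: eq_integral => z _; rewrite -EFinM mulrC.
Qed.

End moments.

End kernel_means.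

(** * The coefficients of the Bergman-Besov kernels *)

Section rising.
Context {R : realType}.
Implicit Types (a b : R) (k m : nat).

Lemma rising_gt0 a k : 0 < a -> 0 < Zonal.rising a k.
Proof. by move=> a0; apply: prodr_gt0 => i _; rewrite ltr_pwDl. Qed.

Lemma rising1 k : Zonal.rising (1 : R) k = k`!%:R.
Proof.
elim: k => [|k ih]; first by rewrite /Zonal.rising big_ord0.
by rewrite Zonal.risingS ih factS natrM mulrC nat1r.
Qed.

Lemma rising_addn1 a k : 0 < a ->
  Zonal.rising (a + 1) k / Zonal.rising a k = (a + k%:R) / a.
Proof.
move=> a0; elim: k => [|k ih].
  by rewrite /Zonal.rising !big_ord0 addr0 divr1 mulfV// gt_eqF.
have h1 := rising_gt0 k a0; have ak : 0 < a + k%:R by rewrite ltr_pwDl.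
rewrite !Zonal.risingS -mulf_div ih -natr1; field.
by rewrite !gt_eqF.
Qed.

(** The polynomial in [k] equal to the ratio of the rising factorials [(a + m)_k]
    and [(a)_k]. *)
Definition rising_ratio_poly a m : {poly R} := \prod_(j < m) ((a + j%:R)^-1 *: ('X + (a + j%:R)%:P)).

Lemma size_rising_ratio_poly a m : (size (rising_ratio_poly a m) <= m.+1)%N.
Proof.
rewrite /rising_ratio_poly; elim: m => [|m ih]; first by rewrite big_ord0 size_poly1.
rewrite big_ord_recr /=; apply: leq_trans (size_polyMleq _ _) _.
have h : (size ((a + m%:R)^-1 *: ('X + (a + m%:R)%:P)) <= 2)%N.
  by apply: leq_trans (size_scale_leq _ _) _; rewrite size_XaddC.
move: ih h; set u := size _; set v := size _; clearbody u v; clear; lia.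
Qed.

Lemma rising_ratioE a m k : 0 < a ->
  (rising_ratio_poly a m).[k%:R] = Zonal.rising (a + m%:R) k / Zonal.rising a k.
Proof.
move=> a0; rewrite /rising_ratio_poly; elim: m => [|m ih].
  by rewrite big_ord0 hornerC addr0 mulfV// gt_eqF// rising_gt0.
rewrite big_ord_recr /= hornerM ih hornerZ hornerD hornerX hornerC -[m.+1%:R]natr1 [a + (m%:R + 1)]addrA.
have am : 0 < a + m%:R by rewrite ltr_pwDl.
have h1 := rising_gt0 k am; have h2 := rising_gt0 k a0.
have := rising_addn1 k am; set u := Zonal.rising (a + m%:R + 1) k => h.
have -> : u = (a + m%:R + k%:R) / (a + m%:R) * Zonal.rising (a + m%:R) k.
  by rewrite -h divfK// gt_eqF.
by field; rewrite !gt_eqF.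
Qed.

End rising.

Section gamma.
Context {R : realType} {n : nat}.
Hypothesis n2 : (2 <= n)%N.
Notation T := (n.-tuple R).
Notation leb := (@lebesgue_measure R).
Notation scale := (@Zonal.scale R n).
Notation lam := (n%:R / 2 : R).
Notation gamma := (@gamma_coef R n).
Implicit Types (x y z : T) (c e : R).

Let lam0 : 0 < lam. Proof. by rewrite divr_gt0// ltr0n (leq_trans _ n2). Qed.
Let lam1 : 1 <= lam. Proof. by rewrite ler_pdivlMr// mul1r ler_nat. Qed.

Lemma gamma_coefE c k : gamma c k =
  if - (1 + lam) < c then Zonal.rising (1 + lam + c) k / Zonal.rising lam k
  else (Zonal.rising 1 k / Zonal.rising (1 - lam - c) k) * (Zonal.rising 1 k / Zonal.rising lam k).
Proof.
rewrite /gamma_coef; case: ifPn => hc.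
  by rewrite !pochhammerE//; move: hc; set l := lam; lra.
have h : 0 < 1 - (lam + c) by move: hc lam1; rewrite -leNgt; set l := lam; lra.
rewrite !pochhammerE// -rising1 opprD addrA expr2 mulf_div.
by [].
Qed.

Let betaM a d t : R := beta_density a d t / beta_moment a d 0.

Let betaM_ge0 a d t : 0 < a -> 0 < d -> 0 <= betaM a d t.
Proof. by move=> a0 d0; rewrite divr_ge0 ?beta_density_ge0// ltW// beta_moment_gt0. Qed.

Let measurable_betaM a d : measurable_fun setT (betaM a d).
Proof. by apply: measurable_funM => //; exact: measurable_beta_density. Qed.

Let integrable_betaM a d : 0 < a -> 0 < d -> leb.-integrable `]0%R, 1%R[ (EFin \o betaM a d).
Proof.
move=> a0 d0.
rewrite (_ : _ \o _ = (fun t => (beta_moment a d 0)^-1%:E * (beta_density a d t)%:E)%E).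
  by apply: integrableZl => //; exact: integrable_beta_density.
by apply/funext => t; rewrite /= /betaM mulrC EFinM.
Qed.

Let moment_betaM a d k : 0 < a -> 0 < d ->
  moment (betaM a d) k = Zonal.rising a k / Zonal.rising (a + d) k.
Proof.
move=> a0 d0; rewrite beta_momentE// /moment /betaM.
under eq_Rintegral do rewrite mulrA mulrC.
by rewrite RintegralZl// 1?mulrC//; exact: integrable_beta_moment.
Qed.

Let growth_betaM a d : 0 < a -> 0 < d -> growth (moment (betaM a d)).
Proof.
by move=> a0 d0; apply: growth_moment => //; [move=> t; exact: betaM_ge0|exact: integrable_betaM].
Qed.

(** For [c] above [- (1 + n / 2)] the coefficients are moments of a beta density
    times a polynomial of degree [m]. *)
Lemma gamma_coef_factor c m : - (1 + lam) < c -> c + 1 < m%:R ->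
  gamma c = (fun k => (rising_ratio_poly lam m).[k%:R] *
    moment (betaM (1 + lam + c) (m%:R - 1 - c)) k).
Proof.
move=> hc hm; apply/funext => k; rewrite gamma_coefE hc rising_ratioE//.
have a0 : 0 < 1 + lam + c by move: hc; set l := lam; lra.
have d0 : 0 < m%:R - 1 - c by move: hm; set l := m%:R; lra.
rewrite moment_betaM//.
have -> : 1 + lam + c + (m%:R - 1 - c) = lam + m%:R by ring.
have lm : 0 < lam + m%:R by rewrite ltr_pwDl.
have h1 := rising_gt0 k lm; have h2 := rising_gt0 k lam0.
by field; rewrite !gt_eqF.
Qed.

(** For [c] up to [- (1 + n / 2)] each of the two ratios of factorials is a moment of a beta density; for
    [n = 2] the second density would be degenerate, but the ratio is 1. *)
Lemma gamma_coef_factor_low c : ~~ (- (1 + lam) < c) ->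
  gamma c = (fun k => (1 * moment (betaM 1 (- lam - c)) k) *
    (if n == 2%N then 1 else moment (betaM 1 (lam - 1)) k)).
Proof.
move=> hc; apply/funext => k; rewrite gamma_coefE (negbTE hc) mul1r.
have d0 : 0 < - lam - c by move: hc; rewrite -leNgt; set l := lam; lra.
rewrite moment_betaM// addrA; congr (_ * _).
case: eqVneq => [->|nn2].
  by rewrite mulfV// mulfV// gt_eqF// rising_gt0.
rewrite moment_betaM//; last first.
  by rewrite subr_gt0 ltr_pdivlMr// mul1r ltr_nat ltn_neqAle eq_sym nn2.
by rewrite addrC subrK.
Qed.

Lemma growth_gamma c : growth (gamma c).
Proof.
have [hc|hc] := boolP (- (1 + lam) < c).
  pose m := Num.bound (c + 1).
  have hm : c + 1 < m%:R.
    have [c0|c0] := leP 0 (c + 1); first exact: archi_boundP.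
    by apply: lt_le_trans c0 _.
  rewrite (gamma_coef_factor hc hm); apply: growthM; first exact: growth_poly.
  by apply: growth_betaM; [move: hc; set l := lam; lra|move: hm; set l := m%:R; lra].
have d0 : 0 < - lam - c by move: hc; rewrite -leNgt; set l := lam; lra.
rewrite (gamma_coef_factor_low hc); apply: growthM.
  by apply: growthM; [exact: growth_cst|exact: growth_betaM].
case: eqVneq => [_|nn2]; first exact: growth_cst.
apply: growth_betaM => //.
by rewrite subr_gt0 ltr_pdivlMr// mul1r ltr_nat ltn_neqAle eq_sym nn2.
Qed.

Lemma bergman_besovE c x y : bergman_besov c x y = zkernel (gamma c) x y.
Proof.
by congr (limn _); apply/funext => K; rewrite /series /=; apply: eq_bigr => k _; rewrite zonalE.
Qed.

Let onem_split (t tau e m : R) : 0 < t < 1 -> 0 <= tau < 1 -> 0 <= e <= m ->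
  (1 - t * tau) `^ (- m) <= (1 - tau) `^ (- e) * (1 - t) `^ (e - m).
Proof.
move=> /andP[t0 t1] /andP[tau0 tau1] /andP[e0 em].
have p1 : 0 < 1 - t * tau by rewrite subr_gt0 mulr_ilt1// ltW.
have -> : (1 - t * tau) `^ (- m) = (1 - t * tau) `^ (- e) * (1 - t * tau) `^ (- (m - e)).
  rewrite -powRD; first by congr (_ `^ _); ring.
  by rewrite [_ == 0 in X in _ ==> X]gt_eqF// implybT.
have -> : e - m = - (m - e) by ring.
rewrite !powRN.
apply: ler_pM; rewrite ?invr_ge0 ?powR_ge0// lef_pV2 ?posrE ?powR_gt0 ?p1 ?subr_gt0//.
  apply: ge0_ler_powR; rewrite ?nnegrE ?(ltW p1) ?subr_ge0 ?(ltW tau1)//.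
  by rewrite lerD2l lerN2 ler_piMl// ltW.
apply: ge0_ler_powR; rewrite ?nnegrE ?(ltW p1) ?subr_ge0 ?(ltW t1)//.
by rewrite lerD2l lerN2 ler_piMr// ltW.
Qed.

Lemma measurable_kernel_mean (c : nat -> R) x rho : growth c ->
  measurable_fun setT (fun t : measurableTypeR R => kernel_mean c (scale t x) rho).
Proof.
move=> gc.
pose F (p : measurableTypeR R * T) := (`|zk c (scale p.1 x) (scale rho p.2)|%:E * (\1_(usphere : set T) p.2)%:E)%E.
rewrite (_ : (fun t => _) = (fun t => \int[@sigma R n]_z F (t, z))%E).
  apply: (@measurable_fun_fubini_tonelli_F _ _ (measurableTypeR R) T R (@sigma R n) F).
    apply: emeasurable_funM.
      apply/measurable_EFinP; apply: measurableT_comp => //.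
      have mp : measurable_fun setT (fun p : measurableTypeR R * T => (scale p.1 x, scale rho p.2)).
        apply/measurable_fun_pairP; split.
          exact: (measurableT_comp (measurableT_comp measurable_scale2 (pair2_measurable x)) measurable_fst).
        exact: (measurableT_comp (measurable_scale rho) measurable_snd).
      exact: (measurableT_comp (measurable_zk n2 gc) mp).
    apply/measurable_EFinP; apply: (measurableT_comp _ measurable_snd).
    by apply: measurable_indic; exact: measurable_usphere.
  by move=> p; rewrite mule_ge0// lee_fin ?indicE ?ler0n.
apply/funext => t; rewrite /kernel_mean integral_mkcond; apply: eq_integral => z _.
by rewrite /patch /F /= indicE; case: ifPn; rewrite ?mule1 ?mule0.
Qed.

Let average_le (beta phi : R -> R) (c : nat -> R) x rho : (forall t, 0 <= beta t) ->
  measurable_fun setT beta -> leb.-integrable `]0%R, 1%R[ (EFin \o beta) -> growth c ->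
  measurable_fun setT phi -> 0 <= rho -> enorm x * rho < 1 ->
  (forall t, 0 < t < 1 -> (kernel_mean c (scale t x) rho <= (phi t)%:E)%E) ->
  (kernel_mean (fun k => c k * moment beta k)%R x rho <=
   \int[leb]_(t in `]0%R, 1%R[) (phi t * beta t)%:E)%E.
Proof.
move=> b0 mb ib gc mphi r0 xr hc.
have mD : measurable (`]0, 1[%classic : set (measurableTypeR R)) by exact: measurable_itv.
apply: (le_trans (moment_kernel_mean n2 b0 mb ib gc r0 xr)).
apply: ge0_le_integral => //.
- by move=> t _; rewrite mule_ge0// ?lee_fin// integral_ge0// => z _; rewrite lee_fin.
- apply: measurable_funTS; apply: emeasurable_funM; first exact/measurable_EFinP.
  exact: measurable_kernel_mean.
- by apply/measurable_EFinP/measurable_funTS/measurable_funM.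
- move=> t /=; rewrite in_itv/= => t01; rewrite mulrC EFinM; apply: lee_wpmul2l; first by rewrite lee_fin.
  exact: hc.
Qed.

Let average_cst (beta : R -> R) (c : nat -> R) C : (forall t, 0 <= beta t) ->
  measurable_fun setT beta -> leb.-integrable `]0%R, 1%R[ (EFin \o beta) -> growth c ->
  (forall x rho, 0 <= rho -> enorm x * rho < 1 -> (kernel_mean c x rho <= C%:E)%E) ->
  forall x rho, 0 <= rho -> enorm x * rho < 1 ->
  (kernel_mean (fun k => c k * moment beta k)%R x rho <= (C * moment beta 0)%:E)%E.
Proof.
move=> b0 mb ib gc hc x rho r0 xr.
apply: (le_trans (@average_le beta (fun=> C) c x rho b0 mb ib gc _ r0 xr _)) => //.
  move=> t t01; apply: hc => //; apply: le_lt_trans xr; apply: ler_wpM2r => //.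
  exact: enorm_scale_itv.
under eq_integral do rewrite EFinM.
rewrite integralZl// EFinM; rewrite /moment; under [X in (_ <= _ * X%:E)%E]eq_Rintegral do rewrite expr0 mul1r.
by rewrite /Rintegral fineK//; exact: integrable_fin_num.
Qed.

(** The mean of [|R_c|] over spheres grows like [(1 - |x| rho) ^ - (c + 1)], up to an
    arbitrarily small loss in the exponent. The polynomial factor of the coefficients
    costs [(1 - tau) ^ - m]; averaging over the dilates by [t] wins back [m - e], since
    [(1 - t) ^ (e - m)] is integrable against the beta density. *)
Theorem gamma_kernel_mean c e : 0 <= e -> c + 1 < e ->
  exists2 C, 0 <= C & forall x rho, 0 <= rho -> enorm x * rho < 1 ->
    (kernel_mean (gamma c) x rho <= (C * (1 - enorm x * rho) `^ (- e))%:E)%E.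
Proof.
move=> e0 ce.
have s1 x rho : 0 <= rho -> enorm x * rho < 1 -> 1 <= (1 - enorm x * rho) `^ (- e).
  move=> r0 xr; rewrite powRN invf_ge1 ?powR_gt0 ?subr_gt0//; apply: powR_le1 => //.
  by rewrite subr_ge0 (ltW xr)/= gerBl mulr_ge0 ?enorm_ge0.
have [hc|hc] := boolP (- (1 + lam) < c).
  pose m := Num.bound e.
  have em : e < m%:R by exact: archi_boundP.
  have hm : c + 1 < m%:R by exact: lt_trans em.
  pose a := 1 + lam + c; pose d := m%:R - 1 - c; pose d' := e - 1 - c.
  have a0 : 0 < a by rewrite /a; move: hc; set l := lam; lra.
  have d0 : 0 < d by rewrite /d; move: hm; set l := m%:R; lra.
  have d'0 : 0 < d' by rewrite /d'; move: ce; lra.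
  have [C C0 hC] := poly_kernel_mean n2 (size_rising_ratio_poly lam m).
  have B0 := beta_moment_gt0 0 a0 d0; have B0' := beta_moment_gt0 0 a0 d'0.
  exists (C / beta_moment a d 0 * beta_moment a d' 0) => [|x rho r0 xr].
    by apply: mulr_ge0; [apply: divr_ge0; [exact: C0|exact: ltW B0]|exact: ltW B0'].
  have t0 : 0 <= enorm x * rho by rewrite mulr_ge0 ?enorm_ge0.
  set tau := enorm x * rho; pose K := C * (1 - tau) `^ (- e).
  rewrite (gamma_coef_factor hc hm).
  have gp := growth_poly (rising_ratio_poly lam m).
  apply: (le_trans (@average_le (betaM a d) (fun t => K * (1 - t) `^ (e - m%:R)) _ x rho
    (fun t => betaM_ge0 t a0 d0) (measurable_betaM a d) (integrable_betaM a0 d0) gp _ r0 xr _)).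
  - by apply: measurable_funM => //; exact: measurable_powR_onem.
  - move=> t t01; have xt : enorm (scale t x) * rho < 1.
      by apply: le_lt_trans xr; apply: ler_wpM2r => //; exact: enorm_scale_itv.
    apply: (le_trans (hC _ _ r0 xt)); rewrite lee_fin /K -mulrA; apply: ler_wpM2l => //.
    have -> : enorm (scale t x) * rho = t * tau.
      by rewrite enorm_scale ?mulrA//; case/andP: t01 => /ltW.
    have p1 : 0 <= 1 - t * tau.
      case/andP: t01 => t0' t1; rewrite subr_ge0; apply/ltW/(le_lt_trans _ xr).
      by rewrite ler_piMl// ltW.
    rewrite -powR_mulrn// -powRN; apply: onem_split => //; first by rewrite t0.
    by rewrite e0 ltW.
  rewrite (_ : (\int[leb]_(t in _) _ = \int[leb]_(t in `]0%R, 1%R[) ((K / beta_moment a d 0)%:E * (t ^+ 0 * beta_density a d' t)%:E))%E); last first.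
    apply: eq_integral => t; rewrite inE/= in_itv/= => /andP[t0' t1]; rewrite -EFinM; congr EFin.
    rewrite /betaM /beta_density expr0 mul1r.
    have -> : d' - 1 = (e - m%:R) + (d - 1) by rewrite /d' /d; ring.
    rewrite [(1 - t) `^ (_ + (d - 1))]powRD; last by apply/implyP => _; rewrite gt_eqF// subr_gt0.
    by rewrite /K; ring.
  rewrite integralZl//; last exact: integrable_beta_moment.
  rewrite (_ : (\int[leb]_(t in _) _ = (beta_moment a d' 0)%:E)%E); last first.
    rewrite /beta_moment /Rintegral fineK//.
    by apply: integrable_fin_num (integrable_beta_moment 0 a0 d'0).
  by rewrite -EFinM lee_fin /K le_eqVlt; apply/orP; left; apply/eqP; ring.
have d0 : 0 < - lam - c by move: hc; rewrite -leNgt; set l := lam; lra.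
have sz1 : (size (1%R : {poly R}) <= 1)%N by rewrite size_poly1.
have [C C0 hC] := @poly_kernel_mean R n n2 1 0 sz1.
have h0 x rho : 0 <= rho -> enorm x * rho < 1 -> (kernel_mean (fun=> 1%R) x rho <= C%:E)%E.
  move=> r0 xr; have := hC x rho r0 xr; rewrite expr0 invr1 mulr1.
  by under eq_fun do rewrite hornerC.
have b1 := fun t => betaM_ge0 t (@ltr01 R) d0.
have i1 := integrable_betaM (@ltr01 R) d0.
have h1 := average_cst b1 (measurable_betaM _ _) i1 (growth_cst 1) h0.
have g1 : growth (fun k => 1 * moment (betaM 1 (- lam - c)) k).
  by apply: growthM; [exact: growth_cst|exact: growth_betaM].
have [D D0 hD] : exists2 D, 0 <= D & forall x rho, 0 <= rho -> enorm x * rho < 1 ->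
    (kernel_mean (gamma c) x rho <= D%:E)%E.
  have cm x rho (f : nat -> R) : (0 <= kernel_mean f x rho)%E.
    by apply: integral_ge0 => z _; rewrite lee_fin.
  have D0 (D : R) f : (forall x rho, 0 <= rho -> enorm x * rho < 1 ->
      (kernel_mean f x rho <= D%:E)%E) -> 0 <= D.
    move=> h; rewrite -lee_fin; apply: le_trans (cm [tuple 0 | i < n] 0 f) (h _ _ _ _) => //.
    by rewrite mulr0.
  rewrite (gamma_coef_factor_low hc); case: eqVneq => [_|nn2].
    under [X in exists2 D, 0 <= D & X D]eq_fun do under eq_fun do rewrite mulr1.
    by exists (C * moment (betaM 1 (- lam - c)) 0) => //; exact: D0 h1.
  have d1 : 0 < lam - 1 by rewrite subr_gt0 ltr_pdivlMr// mul1r ltr_nat ltn_neqAle eq_sym nn2.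
  have h2 := average_cst (fun t => betaM_ge0 t (@ltr01 R) d1) (measurable_betaM _ _)
    (integrable_betaM (@ltr01 R) d1) g1 h1.
  by exists (C * moment (betaM 1 (- lam - c)) 0 * moment (betaM 1 (lam - 1)) 0) => //; exact: D0 h2.
exists D => // x rho r0 xr; apply: (le_trans (hD x rho r0 xr)).
by rewrite lee_fin ler_peMr// s1.
Qed.

End gamma.

(** * Sufficiency of the exponent conditions *)

Section weights.
Context {R : realType} {n : nat}.
Notation T := (n.-tuple R).
Notation leb := (@lebesgue_measure R).
Notation scale := (@Zonal.scale R n).
Notation nuf := (@nuf R n).
Implicit Types (x y z : T) (a b r : R).

Lemma uball_gt0 x : uball x -> 0 < 1 - enorm x ^+ 2.
Proof. by move=> x1; rewrite subr_gt0 expr_lt1 ?enorm_ge0. Qed.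

Lemma weight_gt0 a x : uball x -> 0 < weight a x.
Proof. by move=> /uball_gt0; exact: powR_gt0. Qed.

Lemma weightD a b x : uball x -> weight (a + b) x = weight a x * weight b x.
Proof. by move=> /uball_gt0 x1; rewrite /weight powRD//; apply/implyP => _; rewrite gt_eqF. Qed.

Lemma weight0 x : weight 0 x = 1.
Proof. exact: powRr0. Qed.

Lemma weight_scale a r z : 0 <= r -> usphere z -> weight a (scale r z) = (1 - r ^+ 2) `^ a.
Proof. by move=> r0 z1; rewrite /weight enorm_scale// z1 mulr1. Qed.

(** On the ball [1 - |x|] and [1 - |x| ^ 2] are comparable. *)
Lemma onem_enorm_le_weight a x : 0 <= a -> uball x ->
  (1 - enorm x) `^ (- a) <= 2 `^ a * weight (- a) x.
Proof.
move=> a0 x1; have h := uball_gt0 x1; have e0 := enorm_ge0 x.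
have x1' : 0 < 1 - enorm x by rewrite subr_gt0.
rewrite /weight !powRN -[2 `^ a]invrK -invfM lef_pV2 ?posrE ?mulr_gt0 ?invr_gt0 ?powR_gt0//.
rewrite mulrC ler_pdivrMr ?powR_gt0// -powRM ?(ltW x1')//.
apply: ge0_ler_powR; rewrite ?nnegrE ?mulr_ge0 ?(ltW h) ?(ltW x1')//.
by move: x1; rewrite /uball /=; move: e0; set e := enorm x; nra.
Qed.

Hypothesis n2 : (2 <= n)%N.

Let n0 : (0 < n)%N. Proof. exact: leq_trans n2. Qed.

Lemma root_itv01 (t : R) : 0 < t < 1 -> 0 < t `^ n%:R^-1 < 1.
Proof.
move=> /andP[t0 t1]; rewrite powR_gt0//=.
have ni : 0 < n%:R^-1 :> R by rewrite invr_gt0 ltr0n.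
have := @gt0_ltr_powR R _ ni t 1; rewrite powR1; apply => //; rewrite nnegrE//.
exact: ltW.
Qed.

Lemma weight_integrable a : -1 < a -> nuf.-integrable setT (EFin \o (weight a)).
Proof.
move=> a1; have mw : measurable_fun setT (fun x : T => (weight a x)%:E).
  by apply/measurable_EFinP; exact: measurable_weight.
apply/integrableP; split=> //.
under eq_integral do rewrite /= ger0_norm ?weight_ge0//.
rewrite (ge0_polar01 n2)//; last by move=> x; rewrite lee_fin weight_ge0.
have inn (t : R) : 0 < t < 1 -> (\int[@sigma R n]_(z in usphere) (weight a (scale (t `^ n%:R^-1) z))%:E =
   ((1 - (t `^ n%:R^-1) ^+ 2) `^ a)%:E)%E.
  move=> t01; have /andP[r0 r1] := root_itv01 t01.
  transitivity (\int[@sigma R n]_(z in usphere) ((1 - (t `^ n%:R^-1) ^+ 2) `^ a)%:E)%E.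
    by apply: eq_integral => z; rewrite inE => z1; rewrite weight_scale// ltW.
  rewrite integral_cst; last exact: measurable_usphere.
  by rewrite [X in (_ * X)%E](_ : _ = 1%E) ?mule1//; exact: sigma_usphere.
have onem_r (t : R) : 0 < t < 1 -> 0 < 1 - (t `^ n%:R^-1) ^+ 2 <= 1.
  move=> t01; have /andP[r0 r1] := root_itv01 t01.
  apply/andP; split; first by rewrite subr_gt0 expr_lt1 ?ltW.
  by rewrite gerBl sqr_ge0.
have mroot : measurable_fun setT (fun t : R => (1 - (t `^ n%:R^-1) ^+ 2) `^ a).
  apply: (measurableT_comp (measurable_powR _)); apply: measurable_funB => //.
  by apply: measurable_funX; exact: measurable_powR.
pose B := n%:R `^ `|a|.
have key (t : R) : 0 < t < 1 -> (1 - (t `^ n%:R^-1) ^+ 2) `^ a <= B * ((1 - t) `^ (a + 1 - 1) + (1 - t) `^ (1 - 1)).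
  move=> t01; have /andP[r0 r1] := root_itv01 t01; have /andP[w0 w1] := onem_r t t01.
  have t1 : 0 < 1 - t by rewrite subr_gt0; case/andP: t01.
  have B1 : 1 <= B by apply: powR_ge1 => //; rewrite ler1n.
  rewrite addrK subrr powRr0.
  have [a0|a0] := leP 0 a.
    apply: (@le_trans _ _ 1); first by apply: powR_le1 => //; rewrite (ltW w0).
    by rewrite -[leLHS]mul1r; apply: ler_pM => //; rewrite lerDr powR_ge0.
  apply: (@le_trans _ _ (B * (1 - t) `^ a)); last first.
    by apply: ler_wpM2l; [exact: powR_ge0|rewrite lerDl].
  have -> : a = - `|a| by rewrite ltr0_norm// opprK.
  rewrite !powRN /B -[n%:R `^ _]invrK -invfM lef_pV2 ?posrE ?mulr_gt0 ?invr_gt0 ?powR_gt0 ?ltr0n//.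
  rewrite mulrC ler_pdivrMr ?powR_gt0 ?ltr0n// -powRM ?(ltW w0)//.
  apply: ge0_ler_powR; rewrite ?nnegrE ?mulr_ge0 ?(ltW w0) ?(ltW t1)//.
  set r := t `^ n%:R^-1.
  have -> : t = r ^+ n.
    rewrite -powR_mulrn ?powR_ge0// -powRrM mulVf ?powRr1 ?pnatr_eq0 -?lt0n//.
    by case/andP: t01 => /ltW.
  have bern k : 1 - r ^+ k <= k%:R * (1 - r).
    elim: k => [|k ih]; first by rewrite expr0 subrr mul0r.
    have rk : r ^+ k <= 1 by rewrite exprn_ile1 ?ltW.
    have : r ^+ k * (1 - r) <= 1 * (1 - r) by apply: ler_wpM2r => //; rewrite subr_ge0 ltW.
    by rewrite -natr1 exprSr mulrDl; move: ih; set A := k%:R * _; lra.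
  apply: (le_trans (bern n)); rewrite mulrC; apply: ler_wpM2r => //.
  by rewrite lerD2l lerN2 expr2 ler_piMl// ltW.
apply: (@le_lt_trans _ _ (\int[leb]_(t in `]0%R, 1%R[) (B%:E * (((1 - t) `^ (a + 1 - 1))%:E + ((1 - t) `^ (1 - 1))%:E)))%E).
  rewrite (_ : (\int[leb]_(t in _) _ = \int[leb]_(t in `]0%R, 1%R[) ((1 - (t `^ n%:R^-1) ^+ 2) `^ a)%:E)%E); last first.
    by apply: eq_integral => t; rewrite inE/= in_itv/= => t01; exact: inn.
  apply: ge0_le_integral => //.
  - by move=> t _; rewrite lee_fin powR_ge0.
  - by apply/measurable_EFinP; exact: measurable_funTS.
  - apply: emeasurable_funM => //; apply: emeasurable_funD; apply/measurable_EFinP; exact: measurable_powR_onem.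
have i1 : leb.-integrable `]0%R, 1%R[ (EFin \o (fun t : R => (1 - t) `^ (a + 1 - 1))).
  by apply: integrable_powR_onem01; rewrite -ltrBlDr sub0r.
have i2 : leb.-integrable `]0%R, 1%R[ (EFin \o (fun t : R => (1 - t) `^ (1 - 1))).
  by apply: integrable_powR_onem01.
have mD : measurable (`]0%R, 1%R[%classic : set (measurableTypeR R)) by exact: measurable_itv.
have i3 := integrableZl mD B (integrableD mD i1 i2).
by rewrite ltey_eq; apply/orP; left; exact: (integrable_fin_num mD i3).
Qed.

End weights.

Section norms.
Context {R : realType} {n : nat}.
Hypothesis n2 : (2 <= n)%N.
Notation T := (n.-tuple R).
Notation nuf := (@nuf R n).
Notation nu := (@nu R n).
Implicit Types (x y z : T) (a b r : R) (f g : T -> R).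

Lemma cLinfty_normE a f : cLinfty_norm a f =
  ess_sup nu (abse \o (EFin \o ((fun x => weight a x * f x) \_ uball))).
Proof.
rewrite /cLinfty_norm unlock ifT//.
by rewrite [X in (0 < X)%E](_ : _ = 1%E) ?lte01//; exact: nu_setT.
Qed.

Lemma cLinfty_norm_leP a f (M : R) : 0 <= M ->
  (cLinfty_norm a f <= M%:E)%E <-> {ae nu, forall x, uball x -> weight a x * `|f x| <= M}.
Proof.
move=> M0; rewrite cLinfty_normE.
split=> [/ess_supP|] h; last apply/ess_supP; apply: filterS h => x; rewrite /= /patch.
  by move=> + xB; rewrite mem_set// lee_fin normrM ger0_norm ?weight_ge0.
move=> h; rewrite lee_fin; case: ifPn => [/set_mem xB|_]; last by rewrite normr0.
by rewrite normrM ger0_norm ?weight_ge0// h.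
Qed.

Lemma cLinfty_norm_ge0 a f : (0 <= cLinfty_norm a f)%E.
Proof.
rewrite cLinfty_normE; apply: ess_sup_gee; last by apply: aeW => x; exact: abse_ge0.
by rewrite [X in (0 < X)%E](_ : _ = 1%E) ?lte01//; exact: nu_setT.
Qed.

Lemma L_normE a q f : measurable_fun uball f -> L_norm a q f =
  ((\int[nuf]_x ((`|(f \_ uball) x| `^ q)%:E * (weight a x / @weight_cst R n a)%:E)) `^ q^-1)%E.
Proof.
move=> mf; have mf' : measurable_fun setT (f \_ uball).
  by apply/(measurable_restrictT f measurable_uball).
rewrite /L_norm unlock; congr poweR.
apply: (@ge0_integral_density _ _ _ (nu_ a) nu (fun x => (weight a x / weight_cst a)%:E)
    (fun x => (`|(f \_ uball) x| `^ q)%:E)) => //.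
- by apply/measurable_EFinP; apply: measurable_funM => //; exact: measurable_weight.
- by move=> x; rewrite lee_fin divr_ge0 ?weight_ge0 ?weight_cst_ge0.
- apply/measurable_EFinP; apply: (measurableT_comp (measurable_powR _)).
  exact: measurableT_comp.
Qed.

End norms.

Section sufficiency.
Context {R : realType} {n : nat}.
Hypothesis n2 : (2 <= n)%N.
Notation T := (n.-tuple R).
Notation leb := (@lebesgue_measure R).
Notation scale := (@Zonal.scale R n).
Notation nuf := (@nuf R n).
Notation nu := (@nu R n).
Notation sigma := (@sigma R n).
Notation gamma := (@gamma_coef R n).
Implicit Types (x y z : T) (a b c r s : R) (f g : T -> R).

(** The spherical means of the kernel grow at most like [(1 - |x||y|) ^ - (t1 + t2)]. The
    factor of exponent [t1] is absorbed by the weight in [y], the one of exponent [t2]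
    is at most [(1 - |x|) ^ - t2]. *)
Lemma kernel_potential_le c s t1 t2 : 0 <= t1 < s + 1 -> 0 <= t2 -> c + 1 < t1 + t2 ->
  exists2 C, 0 <= C & forall x, uball x ->
    (\int[nuf]_y (`|zk (gamma c) x y| * weight s y)%:E <= (C * weight (- t2) x)%:E)%E.
Proof.
move=> /andP[t10 t1s] t20 ct.
have [C C0 hC] := gamma_kernel_mean n2 (addr_ge0 t10 t20) ct.
have s1 : -1 < s - t1 by move: t1s; lra.
have iw := @weight_integrable R n n2 _ s1.
have iwE : (\int[nuf]_y (weight (s - t1) y)%:E = (\int[nuf]_y weight (s - t1) y)%R%:E)%E.
  by rewrite /Rintegral fineK//; exact: integrable_fin_num iw.
have W0 : 0 <= (\int[nuf]_y weight (s - t1) y)%R by apply: Rintegral_ge0 => y _; exact: weight_ge0.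
exists (C * 2 `^ t1 * 2 `^ t2 * (\int[nuf]_y weight (s - t1) y)%R).
  by rewrite !mulr_ge0 ?powR_ge0.
move=> x x1; have gg := growth_gamma n2 c.
have mzx : measurable_fun setT (fun y => zk (gamma c) x y).
  exact: (measurableT_comp (measurable_zk n2 gg) (pair1_measurable x)).
rewrite (ge0_polar01 n2); last 2 first.
- apply/measurable_EFinP/measurable_funM; first exact: measurableT_comp.
  exact: measurable_weight.
- by move=> y; rewrite lee_fin mulr_ge0 ?weight_ge0.
pose K := C * (1 - enorm x) `^ (- t2) * 2 `^ t1.
have K0 : 0 <= K by rewrite !mulr_ge0 ?powR_ge0.
apply: (@le_trans _ _ (K%:E * \int[nuf]_y (weight (s - t1) y)%:E)%E); last first.
  rewrite iwE -EFinM lee_fin /K.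
  have h := @onem_enorm_le_weight R n t2 x t20 x1.
  rewrite [leRHS](_ : _ = C * (2 `^ t2 * weight (- t2) x) * 2 `^ t1 * (\int[nuf]_y weight (s - t1) y)%R); last by ring.
  apply: ler_wpM2r => //; apply: ler_wpM2r; first exact: powR_ge0.
  exact: ler_wpM2l.
rewrite (ge0_polar01 n2); last 2 first.
- by apply/measurable_EFinP; exact: measurable_weight.
- by move=> y; rewrite lee_fin weight_ge0.
have mroot : measurable_fun setT (fun t : R => t `^ n%:R^-1) by exact: measurable_powR.
have mw a : measurable_fun setT (fun t : R => (1 - (t `^ n%:R^-1) ^+ 2) `^ a).
  apply: (measurableT_comp (measurable_powR _)); apply: measurable_funB => //.
  exact: measurable_funX.
have inn a (t : R) : 0 < t < 1 -> (\int[sigma]_(z in usphere) (weight a (scale (t `^ n%:R^-1) z))%:E =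
   ((1 - (t `^ n%:R^-1) ^+ 2) `^ a)%:E)%E.
  move=> t01; have /andP[r0 r1] := root_itv01 n2 t01.
  transitivity (\int[sigma]_(z in usphere) ((1 - (t `^ n%:R^-1) ^+ 2) `^ a)%:E)%E.
    by apply: eq_integral => z; rewrite inE => z1; rewrite weight_scale// ltW.
  rewrite integral_cst; last exact: measurable_usphere.
  rewrite [X in (_ * X)%E](_ : _ = 1%E) ?mule1//; apply: sigma_usphere; exact: leq_trans n2.
rewrite [X in (_ <= _ * X)%E](_ : _ = \int[leb]_(t in `]0%R, 1%R[) ((1 - (t `^ n%:R^-1) ^+ 2) `^ (s - t1))%:E)%E; last first.
  by apply: eq_integral => t; rewrite inE/= in_itv/= => t01; exact: inn.
rewrite -ge0_integralZl//; last 2 first.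
- by apply/measurable_EFinP/measurable_funTS; exact: mw.
- by move=> t _; rewrite lee_fin powR_ge0.
have mD : measurable (`]0, 1[%classic : set (measurableTypeR R)) by exact: measurable_itv.
apply: ge0_le_integral => //.
- by move=> t _; apply: integral_ge0 => z _; rewrite lee_fin mulr_ge0 ?weight_ge0.
- apply: measurable_funTS.
  pose F (p : measurableTypeR R * T) := ((`|zk (gamma c) x (scale (p.1 `^ n%:R^-1) p.2)| * weight s (scale (p.1 `^ n%:R^-1) p.2))%:E * (\1_(usphere : set T) p.2)%:E)%E.
  rewrite (_ : (fun t => _) = (fun t => \int[sigma]_z F (t, z))%E).
    have ms : measurable_fun setT (fun p : measurableTypeR R * T => scale (p.1 `^ n%:R^-1) p.2).
      have mp : measurable_fun setT (fun p : measurableTypeR R * T => ((p.1 : R) `^ n%:R^-1 : measurableTypeR R, p.2)).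
        apply/measurable_fun_pairP; split; last exact: measurable_snd.
        exact: (measurableT_comp mroot measurable_fst).
      exact: (measurableT_comp measurable_scale2 mp).
    apply: (@measurable_fun_fubini_tonelli_F _ _ (measurableTypeR R) T R sigma F).
      apply: emeasurable_funM.
        apply/measurable_EFinP; apply: measurable_funM.
          apply: measurableT_comp => //; exact: (measurableT_comp mzx ms).
        exact: (measurableT_comp (measurable_weight s) ms).
      apply/measurable_EFinP; apply: (measurableT_comp _ measurable_snd).
      by apply: measurable_indic; exact: measurable_usphere.
    by move=> p; rewrite mule_ge0// lee_fin ?mulr_ge0 ?weight_ge0// indicE ler0n.
  apply/funext => t; rewrite integral_mkcond; apply: eq_integral => z _.
  by rewrite /patch /F /= indicE; case: ifPn; rewrite ?mule1 ?mule0.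
- apply: emeasurable_funM => //; apply/measurable_EFinP/measurable_funTS; exact: mw.
- move=> t /=; rewrite in_itv/= => t01; have /andP[r0 r1] := root_itv01 n2 t01.
  set r := t `^ n%:R^-1 in r0 r1 *.
  have xr : enorm x * r < 1 by rewrite mulr_ilt1 ?enorm_ge0 ?(ltW r0).
  have r21 : 0 < 1 - r ^+ 2 by rewrite subr_gt0 expr_lt1 ?ltW.
  apply: (@le_trans _ _ (((1 - r ^+ 2) `^ s)%:E * kernel_mean (gamma c) x r)%E).
    rewrite /kernel_mean -ge0_integralZl//; last 3 first.
    - exact: measurable_usphere.
    - apply/measurable_EFinP/measurable_funTS/measurableT_comp => //; exact: measurable_zk_scale.
    - by rewrite lee_fin powR_ge0.
    rewrite le_eqVlt; apply/orP; left; apply/eqP; apply: eq_integral => z; rewrite inE => z1.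
    by rewrite weight_scale ?(ltW r0)// mulrC EFinM.
  apply: (@le_trans _ _ (((1 - r ^+ 2) `^ s)%:E * (C * (1 - enorm x * r) `^ (- (t1 + t2)))%:E)%E).
    by apply: lee_wpmul2l; [rewrite lee_fin powR_ge0|apply: hC => //; exact: ltW].
  rewrite -EFinM lee_fin /K.
  have p0 : 0 < 1 - enorm x * r by rewrite subr_gt0.
  have x0 : 0 < 1 - enorm x by rewrite subr_gt0.
  have e1 : (1 - enorm x * r) `^ (- t2) <= (1 - enorm x) `^ (- t2).
    rewrite !powRN lef_pV2 ?posrE ?powR_gt0//.
    apply: ge0_ler_powR; rewrite ?nnegrE ?(ltW p0) ?(ltW x0)//.
    by rewrite lerD2l lerN2 ler_piMr ?enorm_ge0// ltW.
  have e2 : (1 - enorm x * r) `^ (- t1) <= 2 `^ t1 * (1 - r ^+ 2) `^ (- t1).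
    rewrite !powRN -ler_pdivrMl ?powR_gt0// -invfM lef_pV2 ?posrE ?mulr_gt0 ?powR_gt0//.
    rewrite -powRM ?(ltW p0)//; apply: ge0_ler_powR; rewrite ?nnegrE ?mulr_ge0 ?(ltW p0) ?(ltW r21)//.
    have h1 : enorm x * r <= r by rewrite ler_piMl ?(ltW r0)// ltW.
    by move: h1 r0 r1; set e := enorm x * r; nra.
  have -> : (1 - enorm x * r) `^ (- (t1 + t2)) = (1 - enorm x * r) `^ (- t1) * (1 - enorm x * r) `^ (- t2).
    rewrite -powRD; first by congr (_ `^ _); ring.
    by apply/implyP => _; rewrite gt_eqF.
  have -> : (1 - r ^+ 2) `^ (s - t1) = (1 - r ^+ 2) `^ s * (1 - r ^+ 2) `^ (- t1).
    by rewrite -powRD//; apply/implyP => _; rewrite gt_eqF.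
  rewrite [leRHS](_ : _ = ((1 - r ^+ 2) `^ s * C) * ((2 `^ t1 * (1 - r ^+ 2) `^ (- t1)) * (1 - enorm x) `^ (- t2))); last by ring.
  rewrite [leLHS]mulrA; apply: ler_wpM2l; first by rewrite mulr_ge0 ?powR_ge0.
  by apply: ler_pM; rewrite ?powR_ge0.
Qed.

(** [K'] is a version of the kernel [K] of the operator that is jointly measurable on
    the whole space. *)
Section operator.
Variables (c b : R) (K K' : T -> T -> R).
Hypothesis mK' : measurable_fun setT (fun p : T * T => K' p.1 p.2).
Hypothesis KE : forall x y, uball x -> uball y -> K x y = K' x y.
Hypothesis K'le : forall x y, `|K' x y| <= `|zk (gamma c) x y|.

Let F f x y : R := K' x y * (f \_ uball) y * weight b y.

Let mF f : measurable_fun uball f -> measurable_fun setT (fun p : T * T => F f p.1 p.2).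
Proof.
move=> mf; have mf' : measurable_fun setT (f \_ uball).
  by apply/(measurable_restrictT f measurable_uball).
apply: measurable_funM; last exact: (measurableT_comp (measurable_weight b) measurable_snd).
by apply: measurable_funM => //; exact: (measurableT_comp mf' measurable_snd).
Qed.

Let integrandE f x : uball x -> (EFin \o integrand K b f x) \_ uball = EFin \o F f x.
Proof.
move=> x1; apply/funext => y; rewrite /patch /F /=; case: ifPn => [yB|yB].
  by rewrite /integrand /patch yB KE//; exact: set_mem.
by rewrite /patch (negbTE yB) mulr0 mul0r.
Qed.

Let integral_opE f x : uball x -> integral_op K b f x = (\int[nuf]_y F f x y)%R.
Proof.
by move=> x1; rewrite /integral_op /Rintegral integral_mkcond integrandE.
Qed.

Lemma measurable_integral_op f : measurable_fun uball f -> measurable_fun uball (integral_op K b f).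
Proof.
move=> mf; have mFf := mF mf.
have mEF : measurable_fun setT (fun p : T * T => (F f p.1 p.2)%:E) by exact/measurable_EFinP.
pose g x : R := fine (\int[nuf]_y ((fun p : T * T => (F f p.1 p.2)%:E)^\+%E (x, y)) - \int[nuf]_y ((fun p : T * T => (F f p.1 p.2)%:E)^\-%E (x, y)))%E.
apply: (@eq_measurable_fun _ _ _ _ uball g) => [x /set_mem x1|].
  rewrite integral_opE// /Rintegral integralE /g; congr (fine (_ - _)%E).
    by apply: eq_integral => y _; rewrite !funeposE.
  by apply: eq_integral => y _; rewrite !funenegE.
apply: measurable_funTS; apply: (measurableT_comp (fine_measurable measurableT)).
apply: emeasurable_funB.
  apply: (@measurable_fun_fubini_tonelli_F _ _ T T R nuf (fun p : T * T => (F f p.1 p.2)%:E)^\+%E) => //.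
  exact: measurable_funepos.
apply: (@measurable_fun_fubini_tonelli_F _ _ T T R nuf (fun p : T * T => (F f p.1 p.2)%:E)^\-%E) => //.
exact: measurable_funeneg.
Qed.

Lemma measurable_integrand f x : measurable_fun uball f -> uball x ->
  measurable_fun uball (integrand K b f x).
Proof.
move=> mf x1; have mFx : measurable_fun setT (F f x).
  exact: (measurableT_comp (mF mf) (pair1_measurable x)).
apply: (@eq_measurable_fun _ _ _ _ uball (F f x)) => [y /set_mem yB|]; last exact: measurable_funTS.
by rewrite /F /integrand /patch mem_set// KE.
Qed.

Variables (alpha beta q : R).
Hypothesis q1 : 1 <= q.
Hypothesis beta1 : -1 < beta.

Let potential_bound M C t2 f : measurable_fun uball f -> 0 <= M -> 0 <= C ->
  (cLinfty_norm alpha f <= M%:E)%E ->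
  (forall x, uball x ->
    (\int[nuf]_y (`|zk (gamma c) x y| * weight (b - alpha) y)%:E <= (C * weight (- t2) x)%:E)%E) ->
  forall x, uball x -> (\int[nuf]_y `|F f x y|%:E <= (M * (C * weight (- t2) x))%:E)%E.
Proof.
move=> mf M0 C0 /(cLinfty_norm_leP alpha f M0) aef hC x x1.
have mz : measurable_fun setT (fun y => zk (gamma c) x y).
  exact: (measurableT_comp (measurable_zk n2 (growth_gamma n2 c)) (pair1_measurable x)).
have mzw : measurable_fun setT (fun y => (`|zk (gamma c) x y| * weight (b - alpha) y)%:E).
  apply/measurable_EFinP; apply: measurable_funM; first exact: measurableT_comp.
  exact: measurable_weight.
apply: (@le_trans _ _ (\int[nuf]_y (M%:E * (`|zk (gamma c) x y| * weight (b - alpha) y)%:E))%E).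
  apply: ae_ge0_le_integral => //.
  - apply/measurable_EFinP; apply: measurableT_comp => //.
    exact: (measurableT_comp (mF mf) (pair1_measurable x)).
  - by move=> y _; rewrite mule_ge0// lee_fin mulr_ge0// weight_ge0.
  - by apply: emeasurable_funM.
  - apply: filterS aef => y hy _; rewrite -EFinM lee_fin /F /patch; case: ifPn => [/set_mem yB|_].
      have -> : weight b y = weight (b - alpha) y * weight alpha y by rewrite -weightD// subrK.
      rewrite !normrM !(ger0_norm (weight_ge0 _ _)).
      rewrite [leLHS](_ : _ = (weight alpha y * `|f y|) * (`|K' x y| * weight (b - alpha) y)); last by ring.
      apply: ler_pM => //; rewrite ?mulr_ge0 ?weight_ge0//; first exact: hy.
      by apply: ler_wpM2r; [exact: weight_ge0|exact: K'le].
    by rewrite mulr0 mul0r normr0 !mulr_ge0// weight_ge0.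
rewrite ge0_integralZl//; last by move=> y _; rewrite lee_fin mulr_ge0 ?weight_ge0.
rewrite EFinM; apply: lee_wpmul2l; rewrite ?lee_fin//.
exact: hC.
Qed.

Theorem bounded_of_exponents : alpha - 1 < b -> c < b + (beta + 1) / q - alpha ->
  bounded_cLinfty_L K b alpha beta q.
Proof.
move=> hs hc; have q0 : 0 < q by exact: lt_le_trans q1.
pose A := b - alpha + 1; pose B := (beta + 1) / q.
have A0 : 0 < A by rewrite /A; move: hs; lra.
have B0 : 0 < B by rewrite divr_gt0//; move: beta1; lra.
(* an exponent between [c + 1] and [A + B], divided in the ratio of [A] to [B] *)
pose e := (Num.max (c + 1) 0 + (A + B)) / 2.
have cAB : c + 1 < A + B.
  by rewrite /A /B; move: hc; set u := (beta + 1) / q; lra.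
have mAB : Num.max (c + 1) 0 < A + B by rewrite gt_max cAB addr_gt0.
have m1 : c + 1 <= Num.max (c + 1) 0 by rewrite le_max lexx.
have m2 : 0 <= Num.max (c + 1) 0 by rewrite le_max lexx orbT.
have ce : c + 1 < e by rewrite /e; move: m1 mAB; set m := Num.max _ _; lra.
have eAB : e < A + B by rewrite /e; move: mAB; set m := Num.max _ _; lra.
have e0 : 0 <= e by rewrite /e divr_ge0// addr_ge0// ltW// addr_gt0.
have AB0 : 0 < A + B by rewrite addr_gt0.
pose t1 := e * A / (A + B); pose t2 := e * B / (A + B).
have t10 : 0 <= t1 by apply: divr_ge0; [apply: mulr_ge0 => //; exact: ltW|exact: ltW].
have t20 : 0 <= t2 by apply: divr_ge0; [apply: mulr_ge0 => //; exact: ltW|exact: ltW].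
have t1A : t1 < A by rewrite /t1 ltr_pdivrMr// mulrC ltr_pM2l.
have t2B : t2 < B by rewrite /t2 ltr_pdivrMr// mulrC ltr_pM2l.
have t12 : t1 + t2 = e by rewrite /t1 /t2; field; rewrite gt_eqF.
have t1s : 0 <= t1 < b - alpha + 1 by rewrite t10.
have ct : c + 1 < t1 + t2 by rewrite t12.
have [C C0 hC] := kernel_potential_le t1s t20 ct.
have bt : -1 < beta - t2 * q.
  by move: t2B; rewrite /B ltr_pdivlMr// => h; move: h; set u := t2 * q; lra.
have iw := @weight_integrable R n n2 _ bt.
pose V := (\int[nuf]_y weight (beta - t2 * q) y)%R.
have V0 : 0 <= V by apply: Rintegral_ge0 => y _; exact: weight_ge0.
have VE : (\int[nuf]_y (weight (beta - t2 * q) y)%:E = V%:E)%E.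
  by rewrite /V /Rintegral fineK//; exact: integrable_fin_num iw.
pose W := @weight_cst R n beta; have W0 : 0 <= W by exact: weight_cst_ge0.
have key f M : measurable_fun uball f -> 0 <= M -> (cLinfty_norm alpha f <= M%:E)%E ->
    (forall x, uball x -> nu.-integrable uball (EFin \o integrand K b f x)) /\
    (L_norm beta q (integral_op K b f) <= (C * (V / W) `^ q^-1 * M)%:E)%E.
  move=> mf M0 fM; have hF := potential_bound mf M0 C0 fM hC.
  have mFx x : measurable_fun setT (EFin \o F f x).
    by apply/measurable_EFinP; exact: (measurableT_comp (mF mf) (pair1_measurable x)).
  have iF x : uball x -> nuf.-integrable setT (EFin \o F f x).
    by move=> x1; apply/integrableP; split => //; apply: le_lt_trans (hF x x1) _; rewrite ltry.
  split.
    move=> x x1; apply/(integrable_mkcond _ measurable_uball).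
    by rewrite integrandE//; exact: iF.
  have mop := measurable_integral_op mf.
  have opM x : uball x -> `|integral_op K b f x| <= M * (C * weight (- t2) x).
    move=> x1; rewrite integral_opE//; apply: (le_trans (le_normr_Rintegral _ (iF x x1))) => //.
    rewrite -lee_fin /Rintegral fineK; first exact: hF.
    apply: (integrable_fin_num _ (_ : nuf.-integrable setT (EFin \o (fun y => `|F f x y|)))) => //.
    by have := integrable_abse (iF x x1).
  have MC0 : 0 <= M * C by rewrite mulr_ge0.
  rewrite L_normE//.
  have -> : (C * (V / W) `^ q^-1 * M) = ((M * C) `^ q * (V / W)) `^ q^-1.
    rewrite powRM ?powR_ge0 ?divr_ge0// -powRrM mulfV ?gt_eqF// powRr1//; ring.
  rewrite -poweR_EFin; apply: gt0_ler_poweR.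
  - by rewrite invr_ge0 ltW.
  - rewrite in_itv/= leey andbT; apply: integral_ge0 => x _.
    by rewrite mule_ge0// lee_fin ?powR_ge0// divr_ge0// weight_ge0.
  - by rewrite in_itv/= leey andbT lee_fin mulr_ge0 ?powR_ge0// divr_ge0.
  have mop' : measurable_fun setT (integral_op K b f \_ uball).
    by apply/(measurable_restrictT _ measurable_uball).
  apply: (@le_trans _ _ (\int[nuf]_x (((M * C) `^ q / W)%:E * (weight (beta - t2 * q) x)%:E))%E); last first.
    rewrite integralZl// VE -EFinM lee_fin le_eqVlt; apply/orP; left; apply/eqP; ring.
  apply: ge0_le_integral => //.
  - by move=> x _; rewrite mule_ge0// lee_fin ?powR_ge0// divr_ge0// weight_ge0.
  - apply: emeasurable_funM; apply/measurable_EFinP.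
      apply: (measurableT_comp (measurable_powR _)); exact: measurableT_comp.
    by apply: measurable_funM => //; exact: measurable_weight.
  - by apply: emeasurable_funM => //; apply/measurable_EFinP; exact: measurable_weight.
  - move=> x _; rewrite -!EFinM lee_fin /patch; case: ifPn => [/set_mem x1|_]; last first.
      by rewrite normr0 powR0 ?gt_eqF// mul0r !mulr_ge0 ?powR_ge0 ?weight_ge0// invr_ge0.
    apply: (@le_trans _ _ ((M * C * weight (- t2) x) `^ q * (weight beta x / W))).
      apply: ler_wpM2r; first by rewrite divr_ge0// weight_ge0.
      apply: ge0_ler_powR; rewrite ?nnegrE ?mulr_ge0 ?weight_ge0 ?(ltW q0)//.
      by rewrite -mulrA; exact: opM.
    rewrite powRM ?weight_ge0//.
    have -> : weight (- t2) x `^ q = weight (- (t2 * q)) x by rewrite /weight -powRrM mulNr.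
    rewrite weightD// le_eqVlt; apply/orP; left; apply/eqP; ring.
split.
  move=> f [mf fin]; have [M ME] : exists M, cLinfty_norm alpha f = M%:E.
    exists (fine (cLinfty_norm alpha f)); rewrite fineK// ge0_fin_numE//.
    exact: cLinfty_norm_ge0.
  have M0 : 0 <= M by rewrite -lee_fin -ME; exact: cLinfty_norm_ge0.
  have ML : (cLinfty_norm alpha f <= M%:E)%E by rewrite ME.
  have [k1 k2] := key f M mf M0 ML.
  split; first by apply: aeW.
  split; first exact: measurable_integral_op.
  by apply: le_lt_trans k2 _; rewrite ltry.
exists (C * (V / W) `^ q^-1) => f [mf fin].
have [M ME] : exists M, cLinfty_norm alpha f = M%:E.
  exists (fine (cLinfty_norm alpha f)); rewrite fineK// ge0_fin_numE//.
  exact: cLinfty_norm_ge0.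
have M0 : 0 <= M by rewrite -lee_fin -ME; exact: cLinfty_norm_ge0.
have ML : (cLinfty_norm alpha f <= M%:E)%E by rewrite ME.
have [_ k2] := key f M mf M0 ML.
by rewrite ME -EFinM.
Qed.

End operator.

Lemma bergman_besov_zk c x y : uball x -> uball y -> bergman_besov c x y = zk (gamma c) x y.
Proof.
move=> x1 y1; rewrite (bergman_besovE n2) zkE//.
by apply: mulr_ilt1; rewrite ?enorm_ge0.
Qed.

Theorem bounded_T_of_exponents (b c q alpha beta : R) : 1 <= q -> -1 < beta ->
  alpha - 1 < b -> c < b + (beta + 1) / q - alpha ->
  bounded_cLinfty_L (n := n) (bergman_besov c) b alpha beta q.
Proof.
move=> q1 b1; apply: (@bounded_of_exponents c b _ (zk (gamma c))) => //.
- exact: measurable_zk (growth_gamma n2 c).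
- exact: bergman_besov_zk.
Qed.

Theorem bounded_S_of_exponents (b c q alpha beta : R) : 1 <= q -> -1 < beta ->
  alpha - 1 < b -> c < b + (beta + 1) / q - alpha ->
  bounded_cLinfty_L (n := n) (abs_bergman_besov c) b alpha beta q.
Proof.
move=> q1 b1; apply: (@bounded_of_exponents c b _ (fun x y => `|zk (gamma c) x y|)) => //.
- apply: measurableT_comp => //; exact: measurable_zk (growth_gamma n2 c).
- by move=> x y x1 y1; rewrite /abs_bergman_besov bergman_besov_zk.
- by move=> x y; rewrite normr_id.
Qed.

(** [|T f| <= S |f|]. *)
Theorem bounded_T_of_S (b c q alpha beta : R) : 1 <= q -> -1 < beta ->
  bounded_cLinfty_L (n := n) (abs_bergman_besov c) b alpha beta q ->
  bounded_cLinfty_L (n := n) (bergman_besov c) b alpha beta q.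
Proof.
move=> q1 b1 [hS [C hC]]; have q0 : 0 < q by exact: lt_le_trans q1.
have mzk := measurable_zk n2 (growth_gamma n2 c).
have KE := @bergman_besov_zk c.
have mT f : measurable_fun uball f -> measurable_fun uball (integral_op (bergman_besov c) b f).
  exact: (@measurable_integral_op b (bergman_besov c) (zk (gamma c)) mzk KE f).
have mabs f : measurable_fun uball f -> measurable_fun uball (fun x => `|f x|).
  by move=> mf; exact: measurableT_comp.
have nabs f : cLinfty_norm alpha (fun x => `|f x|) = cLinfty_norm alpha f.
  rewrite !cLinfty_normE; congr (ess_sup _ _); apply/funext => x; rewrite /= /patch.
  by case: ifP => // _; rewrite !normrM normr_id.
have habs f : cLinfty alpha f -> cLinfty alpha (fun x => `|f x|).
  by move=> [mf fin]; split; [exact: mabs|rewrite nabs].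
have absE f x y : integrand (abs_bergman_besov c) b (fun x => `|f x|) x y =
    `|integrand (bergman_besov c) b f x y|.
  by rewrite /integrand !normrM (ger0_norm (weight_ge0 _ _)).
have key f : cLinfty alpha f ->
    {ae nu, forall x, uball x -> nu.-integrable uball (EFin \o integrand (bergman_besov c) b f x)} /\
    (L_norm beta q (integral_op (bergman_besov c) b f) <=
     L_norm beta q (integral_op (abs_bergman_besov c) b (fun x => `|f x|)%R))%E.
  move=> hf; have [mf _] := hf; have [hS1 [mS _]] := hS _ (habs f hf).
  have ae1 : {ae nu, forall x, uball x -> nu.-integrable uball (EFin \o integrand (bergman_besov c) b f x)}.
    apply: filterS hS1 => x hx x1; apply: le_integrable (hx x1); first exact: measurable_uball.
      apply/measurable_EFinP; exact: (@measurable_integrand b (bergman_besov c) (zk (gamma c)) mzk KE f x).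
    by move=> y _; rewrite /= absE normr_id.
  split; first exact: ae1.
  rewrite (@L_normE R n beta q _ (mT f mf)) (@L_normE R n beta q _ mS).
  have mr g : measurable_fun uball g -> measurable_fun setT (g \_ uball).
    by move=> mg; apply/(measurable_restrictT _ measurable_uball).
  have mI g : measurable_fun uball g ->
      measurable_fun setT (fun x => ((`|(g \_ uball) x| `^ q)%:E * (weight beta x / @weight_cst R n beta)%:E)%E).
    move=> mg; apply: emeasurable_funM; apply/measurable_EFinP.
      by apply: (measurableT_comp (measurable_powR _)); apply: measurableT_comp => //; exact: mr.
    by apply: measurable_funM => //; exact: measurable_weight.
  have w0 x : (0 <= (weight beta x / @weight_cst R n beta)%:E)%E.
    by rewrite lee_fin divr_ge0 ?weight_ge0 ?weight_cst_ge0.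
  have I0 g : (0 <= \int[nuf]_x ((`|(g \_ uball) x| `^ q)%:E * (weight beta x / @weight_cst R n beta)%:E))%E.
    by apply: integral_ge0 => x _; rewrite mule_ge0// lee_fin powR_ge0.
  apply: gt0_ler_poweR.
  - by rewrite invr_ge0 ltW.
  - by rewrite in_itv/= leey andbT; exact: I0.
  - by rewrite in_itv/= leey andbT; exact: I0.
  apply: ae_ge0_le_integral; first exact: measurableT.
  - by move=> x _; rewrite mule_ge0// lee_fin powR_ge0.
  - by apply: mI; exact: mT.
  - by move=> x _; rewrite mule_ge0// lee_fin powR_ge0.
  - exact: mI.
  - apply: filterS ae1 => x hx _; apply: lee_wpmul2r; first exact: w0.
    rewrite lee_fin; apply: ge0_ler_powR; [exact: ltW|exact: normr_ge0|exact: normr_ge0|].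
    rewrite /patch; case: ifPn => [/set_mem x1|_]; last by rewrite normr0.
    rewrite /integral_op; apply: (le_trans (le_normr_Rintegral measurable_uball (hx x1))).
    apply: le_trans (ler_norm _); rewrite le_eqVlt; apply/orP; left; apply/eqP.
    by apply: eq_Rintegral => y _; rewrite absE.
split.
  move=> f hf; have [k1 k2] := key f hf; split => //; split; first by apply: mT; case: hf.
  by apply: le_lt_trans k2 _; have [_ [_]] := hS _ (habs f hf).
exists C => f hf; have [_ k2] := key f hf; apply: le_trans k2 _.
by rewrite -(nabs f); exact: hC (habs f hf).
Qed.

End sufficiency.

(** * Iterated integrals of bounded functions *)

Section bounded_fubini.
Context d1 d2 (T1 : measurableType d1) (T2 : measurableType d2) (R : realType).
Variables (m1 : {finite_measure set T1 -> \bar R}) (m2 : {finite_measure set T2 -> \bar R}).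
Variables (A : set T1) (B : set T2) (F : T1 * T2 -> R) (M : R).
Hypotheses (mA : measurable A) (mB : measurable B) (mF : measurable_fun setT F).
Hypothesis FM : forall x y, A x -> B y -> `|F (x, y)| <= M.

(** A nonnegative shift of [F], cut off outside the rectangle where the bound holds,
    to which the theorem of Tonelli applies. *)
Definition shifted p : R := if `|F p| <= M then F p + M else 0.

Lemma measurable_shifted : measurable_fun setT shifted.
Proof.
apply: measurable_fun_ifT => //; last exact: measurable_funD.
by apply: measurable_fun_ler => //; exact: measurableT_comp.
Qed.

Lemma shifted_ge0 p : 0 <= shifted p.
Proof. by rewrite /shifted; case: ifPn => // h; move: h; rewrite ler_norml => /andP[]; lra. Qed.

Lemma shifted_le p : shifted p <= 2 * `|M|.
Proof.
rewrite /shifted; case: ifPn => [h|_]; last by rewrite mulr_ge0.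
by have := ler_norm M; move: h; rewrite ler_norml => /andP[]; lra.
Qed.

Let g x : \bar R := (\int[m2]_(y in B) (shifted (x, y))%:E)%E.

Let m2B : (m2 B < +oo)%E. Proof. by rewrite ltey_eq fin_num_measure. Qed.
Let m1A : (m1 A < +oo)%E. Proof. by rewrite ltey_eq fin_num_measure. Qed.

Let measurable_section (G : T1 * T2 -> R) x : measurable_fun setT G ->
  measurable_fun B (fun y => G (x, y)).
Proof. by move=> mG; apply: measurable_funTS; exact: (measurableT_comp mG (pair1_measurable x)). Qed.

Let integrable_shifted x : m2.-integrable B (EFin \o (fun y => shifted (x, y))).
Proof.
apply: (@bounded_integrable _ _ _ _ _ _ (2 * `|M|)) => //.
  by apply: measurable_section; exact: measurable_shifted.
by move=> y _; rewrite ger0_norm ?shifted_ge0// shifted_le.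
Qed.

Let mg : measurable_fun setT g.
Proof.
pose G (p : T1 * T2) := ((shifted p)%:E * (\1_B p.2)%:E)%E.
rewrite (_ : g = (fun x => \int[m2]_y G (x, y))%E).
  apply: (@measurable_fun_fubini_tonelli_F _ _ T1 T2 R m2 G).
    apply: emeasurable_funM; first by apply/measurable_EFinP; exact: measurable_shifted.
    apply/measurable_EFinP.
    by apply: (measurableT_comp _ measurable_snd); exact: measurable_indic.
  by move=> p; rewrite mule_ge0// lee_fin ?shifted_ge0// indicE ler0n.
apply/funext => x; rewrite /g integral_mkcond; apply: eq_integral => y _.
by rewrite /patch /G /= indicE; case: ifPn; rewrite ?mule1 ?mule0.
Qed.

Let g_ge0 x : (0 <= g x)%E.
Proof. by apply: integral_ge0 => y _; rewrite lee_fin shifted_ge0. Qed.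

Let g_fin x : g x \is a fin_num.
Proof. by apply: integrable_fin_num => //; exact: integrable_shifted. Qed.

Let gE x : (fine (g x))%:E = g x. Proof. exact: fineK. Qed.

Let g_le x : fine (g x) <= 2 * `|M| * fine (m2 B).
Proof.
rewrite -Rintegral_cst//; apply: le_Rintegral => //.
  by apply: (@bounded_integrable _ _ _ _ _ _ (2 * `|M|)) => // y _; rewrite ger0_norm ?mulr_ge0.
by move=> y _; exact: shifted_le.
Qed.

Lemma inner_integralE x : A x ->
  (\int[m2]_(y in B) F (x, y))%R = fine (g x) - M * fine (m2 B).
Proof.
move=> Ax; rewrite -[X in _ - X]Rintegral_cst// -RintegralB//; last first.
  by apply: (@bounded_integrable _ _ _ _ _ _ `|M|) => // y _.
by apply: eq_Rintegral => y /set_mem By; rewrite /shifted FM// addrK.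
Qed.

Lemma measurable_inner_integral : measurable_fun A (fun x => \int[m2]_(y in B) F (x, y))%R.
Proof.
apply: (eq_measurable_fun (fun x => fine (g x) - M * fine (m2 B))).
  by move=> x /set_mem Ax; rewrite inner_integralE.
apply: measurable_funB => //; apply: measurable_funTS.
by apply: (measurableT_comp _ mg).
Qed.

Lemma integrable_inner : forall x, A x -> m2.-integrable B (EFin \o (fun y => F (x, y))).
Proof.
move=> x Ax; apply: (@bounded_integrable _ _ _ _ _ _ M) => //.
  exact: measurable_section.
by move=> y; exact: FM.
Qed.

Lemma inner_integral_le x : A x -> `|\int[m2]_(y in B) F (x, y)|%R <= M * fine (m2 B).
Proof.
move=> Ax; apply: (le_trans (le_normr_Rintegral mB (integrable_inner Ax))).
have i0 : m2.-integrable B (EFin \o (fun y => `|F (x, y)|)).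
  exact: (integrable_norm (integrable_inner Ax)).
rewrite -Rintegral_cst//; apply: le_Rintegral => //.
  by apply: (@bounded_integrable _ _ _ _ _ _ `|M|) => // y _.
by move=> y; exact: FM.
Qed.

Lemma integrable_inner_integral :
  m1.-integrable A (EFin \o (fun x => \int[m2]_(y in B) F (x, y))%R).
Proof.
apply: (@bounded_integrable _ _ _ _ _ _ (M * fine (m2 B))) => //.
  exact: measurable_inner_integral.
by move=> x; exact: inner_integral_le.
Qed.

Lemma iterated_integralE :
  (\int[m1]_(x in A) \int[m2]_(y in B) F (x, y))%R =
  fine (\int[m1]_(x in A) \int[m2]_(y in B) (shifted (x, y))%:E)%E - M * fine (m2 B) * fine (m1 A).
Proof.
rewrite (@eq_Rintegral _ _ _ m1 A (fun x => fine (g x) - M * fine (m2 B))); last first.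
  by move=> x /set_mem Ax; rewrite inner_integralE.
rewrite RintegralB ?Rintegral_cst//; last 2 first.
- apply: (@bounded_integrable _ _ _ _ _ _ (2 * `|M| * fine (m2 B))) => //.
    apply: measurable_funTS.
    by apply: (measurableT_comp _ mg).
  by move=> x _; rewrite ger0_norm ?g_le// fine_ge0.
- by apply: (@bounded_integrable _ _ _ _ _ _ `|M * fine (m2 B)|) => // x _.
congr (fine _ - _); apply: eq_integral => x _; exact: gE.
Qed.

End bounded_fubini.

Lemma bounded_fubini d1 d2 (T1 : measurableType d1) (T2 : measurableType d2) (R : realType)
    (m1 : {finite_measure set T1 -> \bar R}) (m2 : {finite_measure set T2 -> \bar R})
    (A : set T1) (B : set T2) (F : T1 * T2 -> R) (M : R) :
  measurable A -> measurable B -> measurable_fun setT F ->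
  (forall x y, A x -> B y -> `|F (x, y)| <= M) ->
  (\int[m1]_(x in A) \int[m2]_(y in B) F (x, y))%R =
  (\int[m2]_(y in B) \int[m1]_(x in A) F (x, y))%R.
Proof.
move=> mA mB mF FM.
rewrite (iterated_integralE m1 m2 mA mB mF FM).
pose F' (p : T2 * T1) := F (p.2, p.1).
have mF' : measurable_fun setT F'.
  apply: (measurableT_comp mF); apply/measurable_fun_pairP; split.
    exact: measurable_snd.
  exact: measurable_fst.
rewrite (iterated_integralE m2 m1 mB mA mF' (M := M)); last by move=> y x By Ax; exact: FM.
congr (fine _ - _); last by rewrite -!mulrA (mulrC (fine _)).
rewrite (@ge0_fubini_domain _ _ _ _ _ m1 m2 A B (EFin \o shifted F M) mA mB)//.
  by apply/measurable_EFinP; exact: measurable_shifted.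
by move=> p; rewrite lee_fin shifted_ge0.
Qed.

Definition double_integral d (T : measurableType d) (R : realType)
    (m : {measure set T -> \bar R}) (A B : set T) (F : T * T -> R) : R :=
  (\int[m]_(x in A) \int[m]_(y in B) F (x, y))%R.

Section iterated_integral.
Context d (T : measurableType d) (R : realType) (m : {finite_measure set T -> \bar R}).
Variable Q : set T.
Hypothesis mQ : measurable Q.

Definition bounded_kernel (F : T * T -> R) :=
  measurable_fun setT F /\ exists M, forall x y, Q x -> Q y -> `|F (x, y)| <= M.

Notation form F := (double_integral m Q Q F).

Lemma double_integralD F G : bounded_kernel F -> bounded_kernel G ->
  bounded_kernel (fun p => F p + G p) /\ form (fun p => F p + G p) = form F + form G.
Proof.
move=> [mF [M FM]] [mG [N GN]]; split.
  split; first exact: measurable_funD.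
  by exists (M + N) => x y Qx Qy; apply: (le_trans (ler_normD _ _)); apply: lerD; auto.
rewrite /double_integral -RintegralD//; first last.
- exact: (integrable_inner_integral _ _ _ _ _ GN).
- exact: (integrable_inner_integral _ _ _ _ _ FM).
apply: eq_Rintegral => x /set_mem Qx; rewrite RintegralD//.
- exact: (integrable_inner _ _ _ FM).
- exact: (integrable_inner _ _ _ GN).
Qed.

Lemma double_integralZ a F : bounded_kernel F ->
  bounded_kernel (fun p => a * F p) /\ form (fun p => a * F p) = a * form F.
Proof.
move=> [mF [M FM]]; split.
  split; first exact: measurable_funM.
  by exists (`|a| * M) => x y Qx Qy; rewrite normrM ler_wpM2l//; exact: FM.
rewrite /double_integral -RintegralZl//; last exact: (integrable_inner_integral _ _ _ _ _ FM).
apply: eq_Rintegral => x /set_mem Qx; rewrite RintegralZl//.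
exact: (integrable_inner _ _ _ FM).
Qed.

Lemma double_integral_cst a : bounded_kernel (fun=> a) /\ form (fun=> a) = a * fine (m Q) ^+ 2.
Proof.
split; first by split => //; exists `|a|.
by rewrite /double_integral !Rintegral_cst// expr2 mulrA.
Qed.

Lemma le_double_integral F G : bounded_kernel F -> bounded_kernel G ->
  (forall x y, Q x -> Q y -> F (x, y) <= G (x, y)) -> form F <= form G.
Proof.
move=> [mF [M FM]] [mG [N GN]] FG; apply: le_Rintegral => //.
- exact: (integrable_inner_integral _ _ _ _ _ FM).
- exact: (integrable_inner_integral _ _ _ _ _ GN).
move=> x Qx; apply: le_Rintegral => //.
- exact: (integrable_inner _ _ _ FM).
- exact: (integrable_inner _ _ _ GN).
by move=> y; exact: FG.
Qed.

End iterated_integral.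

(** * Signs for quadratic forms *)

(** Choosing the signs one after the other, each so that the cross terms with its
    predecessors add up to a nonnegative number, loses nothing of the diagonal. *)
Lemma exists_signs {R : realDomainType} (I : eqType) (b : I -> I -> R) (s : seq I) : uniq s ->
  exists eps : I -> R, (forall i, `|eps i| = 1) /\
    \sum_(i <- s) b i i <= \sum_(i <- s) \sum_(j <- s) eps i * eps j * b i j.
Proof.
elim: s => [_|x s IH /= /andP[xs us]].
  by exists (fun=> 1); split => [i|]; rewrite ?normr1// !big_nil.
have [eps [e1 he]] := IH us.
pose S := \sum_(j <- s) eps j * (b x j + b j x).
pose e : R := if 0 <= S then 1 else -1.
have ee : e * e = 1 by rewrite /e; case: ifP => _; ring.
exists (fun i => if i == x then e else eps i); split.
  by move=> i; case: ifP => // _; rewrite /e; case: ifP => _; rewrite ?normrN normr1.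
have eS : 0 <= e * S.
  by rewrite /e; case: ifPn => h; rewrite ?mul1r// mulN1r oppr_ge0 ltW// ltNge.
have E j : j \in s -> (if j == x then e else eps j) = eps j.
  by move=> js; case: eqP => // jx; move: xs; rewrite -jx js.
rewrite big_cons [leRHS]big_cons [\sum_(j <- x :: s) _]big_cons !eqxx ee mul1r -addrA lerD2l.
under [X in _ <= _ + X]eq_bigr do rewrite big_cons eqxx.
rewrite big_split /=.
rewrite [X in _ <= X + _](eq_big_seq (fun j => e * (eps j * b x j))); last first.
  by move=> j js; rewrite E// mulrA.
rewrite [X in _ <= _ + (X + _)](eq_big_seq (fun j => e * (eps j * b j x))); last first.
  by move=> j js; rewrite E//; ring.
rewrite [X in _ <= _ + (_ + X)](eq_big_seq (fun i => \sum_(j <- s) eps i * eps j * b i j)); last first.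
  by move=> i si; rewrite E//; apply: eq_big_seq => j sj; rewrite E.
rewrite addrA -big_split /= -[leLHS]add0r; apply: lerD => //.
under eq_bigr do rewrite -mulrDr -mulrDr.
by rewrite -mulr_sumr.
Qed.

(** * Lower bound for the coefficients *)

Section gamma_lower_bound.
Context {R : realType} {n : nat}.
Hypothesis n2 : (2 <= n)%N.
Notation lam := (n%:R / 2 : R).
Notation gamma := (@gamma_coef R n).

Let lam1 : 1 <= lam. Proof. by rewrite ler_pdivlMr// mul1r ler_nat. Qed.

(** A step of the ratio of rising factorials multiplies it by [y / (y - a)] with
    [y = lam + a + k], and [y / (y - a) >= exp (a / y) >= ((y + 1) / y) ^ a]. *)
Lemma powR_step_le (a y : R) : 0 < a -> a < y -> (y + 1) `^ a <= y / (y - a) * y `^ a.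
Proof.
move=> a0 ay; have y0 : 0 < y by lra.
have ya : 0 < y - a by rewrite subr_gt0.
have -> : y + 1 = (1 + y^-1) * y by rewrite mulrDl mul1r mulVf ?gt_eqF.
have yV : 0 < y^-1 by rewrite invr_gt0.
rewrite powRM ?(ltW y0)//; last by rewrite addr_ge0// ltW.
apply: ler_wpM2r; first exact: powR_ge0.
apply: (@le_trans _ _ (expR (a / y))).
  rewrite mulrC expRM.
  by apply: ge0_ler_powR; rewrite ?nnegrE ?expR_ge1Dx ?expR_ge0 ?ltW ?addr_gt0.
have h : 1 - a / y <= expR (- (a / y)) by have := expR_ge1Dx (- (a / y)).
rewrite expRN in h.
have -> : y / (y - a) = (1 - a / y)^-1.
  by rewrite -[1](divff (lt0r_neq0 y0)) -mulrBl invf_div.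
rewrite -[leLHS]invrK lef_pV2 ?posrE ?invr_gt0 ?expR_gt0//.
by rewrite subr_gt0 ltr_pdivrMr// mul1r.
Qed.

Lemma rising_ratio_ge (l a : R) k : 0 < l -> 0 < a ->
  (l + a) `^ (- a) * (l + a + k%:R) `^ a <= Zonal.rising (l + a) k / Zonal.rising l k.
Proof.
move=> l0 a0.
elim: k => [|k ih].
  rewrite /Zonal.rising !big_ord0 addr0 divr1 -powRD ?addNr ?powRr0//.
  by apply/implyP => _; rewrite gt_eqF// addr_gt0.
have k0 : 0 <= k%:R :> R by [].
rewrite !Zonal.risingS -mulf_div.
have /(powR_step_le a0) h : a < l + a + k%:R by lra.
apply: (@le_trans _ _ ((l + a) `^ (- a) * (l + a + k%:R) `^ a *
    ((l + a + k%:R) / (l + k%:R)))); last first.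
  by apply: ler_wpM2r => //; rewrite divr_ge0//; lra.
rewrite -mulrA ler_wpM2l ?powR_ge0//.
rewrite -[k.+1%:R]natr1 addrA mulrC.
by apply: (le_trans h); rewrite (_ : l + a + k%:R - a = l + k%:R)//; lra.
Qed.

(** For [r = 1 - h] the difference [r ^ k - 3/2 r ^ 2k] is positive only if
    [r ^ k < 2/3], that is for [k] at least of the order of [1 / h]. *)
Lemma gamma_ge_poisson_difference c : -1 < c -> exists2 kappa, 0 < kappa &
  forall h k, 0 < h < 1 ->
    kappa * h `^ (- (c + 1)) * ((1 - h) ^+ k - 3 / 2 * (1 - h) ^+ (2 * k)) <= gamma c k.
Proof.
move=> c1; pose a := c + 1; have a0 : 0 < a by rewrite /a; lra.
exists ((lam + a) `^ (- a) * 3 `^ (- a)).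
  by rewrite mulr_gt0 ?powR_gt0// (lt_le_trans a0)// lerDr (le_trans ler01).
move=> h k /andP[h0 h1].
have -> : gamma c k = Zonal.rising (lam + a) k / Zonal.rising lam k.
  rewrite gamma_coefE// ifT; last by apply: le_lt_trans c1; rewrite lerN2 lerDl (le_trans ler01).
  by rewrite /a (_ : 1 + lam + c = lam + (c + 1))//; ring.
have l0 : 0 < lam by exact: lt_le_trans lam1.
apply: le_trans (rising_ratio_ge k l0 a0); rewrite -!mulrA ler_wpM2l ?powR_ge0//.
set t := (1 - h) ^+ k.
have t0 : 0 <= t by rewrite exprn_ge0//; lra.
rewrite mulnC exprM -/t.
have [t1|t1] := leP (2 / 3) t.
  apply: (@le_trans _ _ 0); last exact: powR_ge0.
  by rewrite mulrA mulr_ge0_le0 ?mulr_ge0 ?powR_ge0//; nra.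
have kh : 1 - k%:R * h <= t.
  rewrite /t; elim: (k) => [|m ih]; first by rewrite expr0 mul0r subr0.
  rewrite exprS -natr1; have m0 : 0 <= m%:R :> R by [].
  have hh : 0 <= h * h * m%:R by rewrite !mulr_ge0// ltW.
  apply: (@le_trans _ _ ((1 - h) * (1 - m%:R * h))); first by lra.
  by apply: ler_wpM2l => //; lra.
apply: (@le_trans _ _ ((3 * h)^-1 `^ a)).
  have h30 : 0 <= 3 * h by rewrite mulr_ge0// ltW.
  rewrite -[(3 * h)^-1]powR_inv1//.
  rewrite -powRrM mulN1r powRM//; last exact: ltW.
  rewrite mulrA -[leRHS]mulr1; apply: ler_wpM2l; first by rewrite mulr_ge0 ?powR_ge0.
  nra.
have h3 : 0 < 3 * h by lra.
apply: ge0_ler_powR; rewrite ?nnegrE ?invr_ge0 ?(ltW a0) ?(ltW h3)//.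
  by rewrite addr_ge0// addr_ge0// ltW.
rewrite -[leLHS]mul1r ler_pdivrMr//.
apply: (@le_trans _ _ (k%:R * (3 * h))); first by nra.
by apply: ler_wpM2r; [exact: ltW|rewrite lerDr addr_ge0// ltW].
Qed.

End gamma_lower_bound.

(** * The kernels near the diagonal *)

(** Here [D1] and [A1] are the denominator and the numerator of the Poisson kernel
    dilated by [r], and [D2], [A2] those for [r ^ 2]. Near the diagonal [D1] is almost the
    square of [1 - r * tau], and passing from [r] to [r ^ 2] almost doubles the latter. *)
Lemma poisson_terms_bounds {R : realFieldType} (h tau u : R) :
  let r := 1 - h in
  let D1 := 1 - 2 * (r * u) + r ^+ 2 * tau ^+ 2 in
  let D2 := 1 - 2 * (r ^+ 2 * u) + (r ^+ 2) ^+ 2 * tau ^+ 2 in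
  let A1 := 1 - r ^+ 2 * tau ^+ 2 in let A2 := 1 - (r ^+ 2) ^+ 2 * tau ^+ 2 in
  0 < h -> 20 * h <= 1 -> 1 - h / 20 <= tau -> tau < 1 -> 0 <= tau - u <= h ^+ 2 / 800 ->
  [/\ h ^+ 2 <= D1, D1 <= 2 * h ^+ 2, 17 / 5 * D1 <= D2, h <= A1 & A2 <= 2 * A1].
Proof.
move=> r D1 D2 A1 A2 h0 h20 tau0 tau1 /andP[cs0 cs1].
have r0 : 0 <= r by rewrite /r; lra.
have r1 : r <= 1 by rewrite /r; lra.
have rt : 1 - r * tau <= 21 / 20 * h by rewrite /r; nra.
have rt0 : h <= 1 - r * tau by rewrite /r; nra.
have D1E : D1 = (1 - r * tau) ^+ 2 + 2 * r * (tau - u) by rewrite /D1; ring.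
have D2E : D2 = (1 - r ^+ 2 * tau) ^+ 2 + 2 * r ^+ 2 * (tau - u) by rewrite /D2; ring.
have re : 0 <= r * (tau - u) <= h ^+ 2 / 800.
  by rewrite mulr_ge0//=; apply: le_trans cs1; rewrite ler_piMl.
have D1le : D1 <= 221 / 200 * h ^+ 2.
  have : (1 - r * tau) ^+ 2 <= (21 / 20 * h) ^+ 2 by rewrite ler_sqr ?nnegrE//; lra.
  by rewrite D1E; move: re => /andP[_]; clear; lra.
have D1ge : h ^+ 2 <= D1.
  have : h ^+ 2 <= (1 - r * tau) ^+ 2 by rewrite ler_sqr ?nnegrE//; lra.
  by rewrite D1E; move: re => /andP[+ _]; clear; lra.
split=> //; first by move: D1le D1ge (sqr_ge0 h); clear; lra.
- have s0 : 39 / 20 * h <= 1 - r ^+ 2 * tau.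
    have : r ^+ 2 <= 1 - 39 / 20 * h by rewrite /r; move: h0 h20; clear; nra.
    have : r ^+ 2 * tau <= r ^+ 2 by rewrite ler_piMr ?sqr_ge0// ltW.
    by clear; lra.
  have : (39 / 20 * h) ^+ 2 <= D2.
    rewrite D2E -[leLHS]addr0; apply: lerD; last by rewrite !mulr_ge0.
    by rewrite ler_sqr ?nnegrE ?(le_trans _ s0) ?mulr_ge0 ?divr_ge0 ?(ltW h0).
  by move: D1le (sqr_ge0 h); clear; lra.
- have t0 : 0 <= r * tau by rewrite mulr_ge0//; lra.
  by rewrite /A1 -exprMn; move: t0 rt0 h0; clear; nra.
(* with [p = r ^ 2] and [s = tau ^ 2], this is [s * p * (2 - p) <= 1] *)
have s1 : tau ^+ 2 <= 1 by rewrite expr_le1 ?ltW//; lra.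
have p1 : r ^+ 2 <= 1 by rewrite expr_le1.
have p0 : 0 <= r ^+ 2 by exact: sqr_ge0.
have ps : r ^+ 2 * tau ^+ 2 <= r ^+ 2 by rewrite ler_piMr.
rewrite /A1 /A2; move: p0 p1 s1 ps; set p := r ^+ 2; set s := tau ^+ 2.
by clear; nra.
Qed.

(** The quotient [D2 / D1] exceeds [A2 / A1] by a factor greater than 3/2, and the exponent
    is at least 1. *)
Lemma quotient_difference_ge {R : realType} (l h P1 P2 D1 D2 A1 A2 : R) :
  1 <= l -> 0 < h -> 0 <= P2 -> P1 * D1 `^ l = A1 -> P2 * D2 `^ l = A2 ->
  h ^+ 2 <= D1 -> D1 <= 2 * h ^+ 2 -> 17 / 5 * D1 <= D2 -> h <= A1 -> A2 <= 2 * A1 ->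
  (10 * 2 `^ l)^-1 * (h / (h ^+ 2) `^ l) <= P1 - 3 / 2 * P2.
Proof.
move=> l1 h0 P20 E1 E2 D1ge D1le D2ge A1ge A2le.
have l0 : 0 <= l by lra.
have h2 : 0 < h ^+ 2 by rewrite exprn_gt0.
have D10 : 0 < D1 by exact: lt_le_trans D1ge.
pose B1 := D1 `^ l; have B10 : 0 < B1 by rewrite powR_gt0.
have B2 : 17 / 5 * B1 <= D2 `^ l.
  have k0 : 0 <= 17 / 5 :> R by rewrite divr_ge0.
  apply: (@le_trans _ _ ((17 / 5 * D1) `^ l)); last first.
    apply: ge0_ler_powR => //; first by rewrite nnegrE mulr_ge0// ltW.
    by rewrite nnegrE; apply: le_trans D2ge; rewrite mulr_ge0// ltW.
  rewrite powRM ?(ltW D10)//; apply: ler_wpM2r; first exact: ltW.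
  by rewrite -[leLHS]powRr1//; apply: ler_powR l1; lra.
have P12 : 17 / 5 * P2 <= 2 * P1.
  rewrite -(ler_pM2r B10) -[2 * P1 * B1]mulrA E1; apply: le_trans A2le; rewrite -E2.
  by move: (ler_wpM2l P20 B2); clear; lra.
apply: (@le_trans _ _ (P1 / 10)); last by move: P12 P20; clear; lra.
have B1le : B1 <= 2 `^ l * (h ^+ 2) `^ l.
  rewrite -powRM ?(ltW h2)//; apply: ge0_ler_powR => //; first by rewrite nnegrE ltW.
  by rewrite nnegrE mulr_ge0// ltW.
have P1E : P1 = A1 / B1 by rewrite -E1 mulfK// gt_eqF.
have K0 : 0 < 2 `^ l :> R by rewrite powR_gt0.
have H0 : 0 < (h ^+ 2) `^ l by rewrite powR_gt0.
rewrite invfM -mulrA mulrC ler_pM2r ?invr_gt0// P1E mulrCA -invfM.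
apply: ler_pM => //; [exact: ltW|by rewrite invr_ge0 mulr_ge0// ltW|].
by rewrite lef_pV2 ?posrE ?mulr_gt0.
Qed.

Section near_diagonal.
Context {R : realType} {n : nat}.
Hypothesis n2 : (2 <= n)%N.
Notation T := (n.-tuple R).
Notation lam := (n%:R / 2 : R).
Notation gamma := (@gamma_coef R n).
Notation dot := (@Zonal.dot R n).
Notation scale := (@Zonal.scale R n).
Notation Zf := (@Zonal.Zf R n).
Notation nuf := (@nuf R n).
Notation sigma := (@sigma R n).
Implicit Types (x y : T) (c : R) (d : nat -> R).

Let lam1 : 1 <= lam. Proof. by rewrite ler_pdivlMr// mul1r ler_nat. Qed.

Lemma zkernel_powE r x y : zkernel (fun k => r ^+ k) x y = zkernel (fun=> 1) (scale r x) y.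
Proof.
rewrite /zkernel; congr (limn (series _)); apply/funext => k; rewrite mul1r.
have <- : scale 1 y = y by apply: eq_from_tnth => i; rewrite tnth_mktuple mul1r.
have := @Zf_scale R n n2 k r 1 x y; have := @Zf_scale R n n2 k 1 1 x y.
by rewrite !mulr1 expr1n mul1r => <- ->; congr (_ * Zf k _ _); apply: eq_from_tnth => i; rewrite tnth_mktuple mul1r.
Qed.

Lemma poisson_difference_ge : exists2 kappa, 0 < kappa & forall h x y,
  0 < h <= 20^-1 -> 1 - h / 40 <= enorm x < 1 -> 1 - h / 40 <= enorm y < 1 ->
  dot x x + dot y y - 2 * dot x y <= h ^+ 2 / 400 ->
  kappa * h `^ (1 - n%:R) <=
    zkernel (fun k => (1 - h) ^+ k) x y - 3 / 2 * zkernel (fun k => (1 - h) ^+ (2 * k)) x y.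
Proof.
exists ((10 * 2 `^ lam)^-1); first by rewrite invr_gt0 mulr_gt0// powR_gt0.
move=> h x y /andP[h0 h20] /andP[x0 x1] /andP[y0 y1] xy.
have h20' : 20 * h <= 1 by rewrite -[20]invrK mulrC ler_pdivrMr// mul1r.
pose r : R := 1 - h.
have -> : (fun k => r ^+ (2 * k)) = (fun k => (r ^+ 2) ^+ k).
  by apply/funext => k; rewrite exprM.
rewrite !zkernel_powE.
pose tau := enorm x * enorm y.
have r0 : 0 <= r by rewrite /r; lra.
have r1 : r <= 1 by rewrite /r; lra.
have r20 : 0 <= r ^+ 2 by rewrite exprn_ge0.
have r21 : r ^+ 2 <= 1 by rewrite expr_le1.
have tau1 : tau < 1 by rewrite mulr_ilt1 ?enorm_ge0.
have tau00 : 0 <= tau by rewrite mulr_ge0 ?enorm_ge0.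
have tau0 : 1 - h / 20 <= tau by rewrite /tau; move: (enorm x) (enorm y) x0 x1 y0 y1 => a b *; nra.
have tauE : dot x x * dot y y = tau ^+ 2 by rewrite exprMn !enorm_sqr.
have cs : 0 <= tau - dot x y <= h ^+ 2 / 800.
  have := dot_le_enorm n2 x y; rewrite -/tau => /ler_normlW ut.
  have : 0 <= (enorm x - enorm y) ^+ 2 by exact: sqr_ge0.
  by move: xy; rewrite -!enorm_sqr /tau => xy; rewrite subr_ge0 ut /=; lra.
have st t : 0 <= t -> t <= 1 -> enorm (scale t x) * enorm y < 1.
  by move=> t0 t1; rewrite enorm_scale// -mulrA; apply: le_lt_trans tau1; rewrite ler_piMl.
have closed t : 0 <= t -> t <= 1 -> zkernel (fun=> 1) (scale t x) y *
    (1 - 2 * (t * dot x y) + t ^+ 2 * tau ^+ 2) `^ lam = 1 - t ^+ 2 * tau ^+ 2.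
  move=> t0 t1; have := @poisson_closed_form R n n2 (scale t x) y (st t t0 t1).
  by rewrite dot_scale dot_scalel -mulrA tauE.
have P20 : 0 <= zkernel (fun=> 1) (scale (r ^+ 2) x) y.
  by apply: poisson_ge0 => //; exact: st.
have hn : (h ^+ 2) `^ lam = h ^+ n.
  by rewrite -!powR_mulrn ?(ltW h0)// -powRrM [_ * lam]mulrC divfK.
have -> : h `^ (1 - n%:R) = h / (h ^+ 2) `^ lam.
  rewrite hn powRD; last by apply/implyP => _; rewrite gt_eqF.
  by rewrite powRr1 ?(ltW h0)// powRN powR_mulrn ?(ltW h0).
have [b1 b2 b3 b4 b5] := poisson_terms_bounds h0 h20' tau0 tau1 cs.
exact: quotient_difference_ge lam1 h0 P20 (closed r r0 r1) (closed _ r20 r21) b1 b2 b3 b4 b5.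
Qed.

(** Integrated against two copies of an indicator function, a zonal harmonic gives
    the square of the norm of its projection on the harmonics of degree [k]. *)
Lemma Zf_positive_semidefinite k (Q : set T) : measurable Q -> Q `<=` uball ->
  0 <= double_integral nuf Q Q (fun p => Zf k p.1 p.2).
Proof.
move=> mQ Q1; rewrite /double_integral.
have mS := @measurable_usphere R n.
have mZ := @measurable_Zf2 R n k.
have Zle x z : enorm x <= 1 -> enorm z <= 1 -> `|Zf k z x| <= @hdim R n k.
  move=> x1 z1; apply: (le_trans (Zf_le n2 _ _ _)).
  apply: ler_piMr; first exact: hdim_ge0.
  by apply: exprn_ile1; rewrite ?mulr_ge0 ?mulr_ile1 ?enorm_ge0.
have Qe x : Q x -> enorm x <= 1 by move=> /Q1 /ltW.
have Se z : usphere z -> enorm z <= 1 by move=> ->.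
have H0 := @hdim_ge0 R n n2 k.
have mZs : measurable_fun setT (fun p : T * T => Zf k p.2 p.1).
  rewrite (_ : (fun _ => _) = (fun p : T * T => Zf k p.1 p.2)) //.
  by apply/funext => p; rewrite Zonal.ZfC.
pose B := [set z : T | enorm z <= 1].
have mB : measurable B.
  rewrite (_ : B = enorm @^-1` `]-oo, 1]%classic); last first.
    by apply/seteqP; split => z; rewrite /B /= in_itv.
  by rewrite -[X in measurable X]setTI; exact: measurable_enorm.
have Zle' x y : B x -> Q y -> `|Zf k x y| <= @hdim R n k by move=> Bx /Qe Qy; exact: Zle.
(* the inner integral, set to 0 outside the closed ball so as to be measurable everywhere *)
pose g := (fun z => \int[nuf]_(y in Q) Zf k z y)%R \_ B.
have gE z : B z -> g z = (\int[nuf]_(y in Q) Zf k z y)%R by move=> Bz; rewrite /g patchE mem_set.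
have mg : measurable_fun setT g.
  apply/(measurable_restrictT _ mB).
  exact: (@measurable_inner_integral _ _ _ _ _ nuf B Q (fun p => Zf k p.1 p.2) (@hdim R n k)).
have gle z : B z -> `|g z| <= @hdim R n k * fine (nuf Q).
  move=> Bz; rewrite gE//.
  exact: (@inner_integral_le _ _ _ _ _ nuf B Q (fun p => Zf k p.1 p.2) (@hdim R n k)).
have iZ (m : {finite_measure set T -> \bar R}) (C : set T) (z : T) : measurable C -> enorm z <= 1 ->
    (forall y, C y -> enorm y <= 1) -> m.-integrable C (EFin \o (Zf k z)).
  move=> mC z1 C1; apply: (@bounded_integrable _ _ _ _ _ _ (@hdim R n k)) => //.
  - by rewrite ltey_eq fin_num_measure.
  - by apply: measurable_funTS; exact: (measurableT_comp mZ (pair1_measurable z)).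
  - by move=> y /C1 Cy; exact: Zle.
rewrite (@eq_Rintegral _ _ _ nuf Q (fun x => \int[sigma]_(z in usphere) (Zf k z x * g z))%R).
  rewrite (@bounded_fubini _ _ _ _ _ nuf sigma Q usphere (fun p => Zf k p.2 p.1 * g p.2)
    (@hdim R n k * (@hdim R n k * fine (nuf Q)))) //=.
  - apply: Rintegral_ge0 => z /Se z1.
    rewrite RintegralZr//; last exact: iZ.
    by rewrite -gE//; exact: sqr_ge0.
  - apply: measurable_funM; last exact: (measurableT_comp mg measurable_snd).
    exact: mZs.
  - move=> x z Qx /Se Sz; rewrite normrM; apply: ler_pM => //; first by apply: Zle; auto.
    exact: gle.
move=> x /set_mem Qx /=.
transitivity (\int[nuf]_(y in Q) \int[sigma]_(z in usphere) (Zf k z x * Zf k z y))%R.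
  by apply: eq_Rintegral => y _; rewrite -[LHS](smean_Zf n2).
rewrite (@bounded_fubini _ _ _ _ _ nuf sigma Q usphere (fun p => Zf k p.2 x * Zf k p.2 p.1)
  (@hdim R n k * @hdim R n k)) //=.
- by apply: eq_Rintegral => z /set_mem /Se z1; rewrite RintegralZl ?gE//; exact: iZ.
- apply: measurable_funM.
    exact: (measurableT_comp (measurable_polynomial (Zf_polynomial n2 k x)) measurable_snd).
  exact: mZs.
- by move=> y z Qy /Se Sz; rewrite normrM; apply: ler_pM => //; apply: Zle; auto.
Qed.

(** Nonnegative coefficients make the kernel positive semidefinite. *)
Lemma zk_positive_semidefinite d (Q : set T) (rho : R) : growth d -> (forall k, 0 <= d k) -> rho < 1 ->
  measurable Q -> (forall x, Q x -> enorm x <= rho) ->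
  0 <= double_integral nuf Q Q (fun p => zk d p.1 p.2).
Proof.
move=> gd d0 rho1 mQ Qrho.
have [Q0|/set0P[x0 Qx0]] := eqVneq Q set0.
  by rewrite /double_integral Q0 Rintegral_set0.
have rho0 : 0 <= rho by apply: le_trans (Qrho _ Qx0); exact: enorm_ge0.
have QQ x y : Q x -> Q y -> enorm x * enorm y <= rho.
  move=> Qx Qy; rewrite -[leRHS]mulr1; apply: ler_pM; rewrite ?enorm_ge0//; first exact: Qrho.
  exact: le_trans (Qrho _ Qy) (ltW rho1).
have QQ1 x y : Q x -> Q y -> enorm x * enorm y < 1.
  by move=> Qx Qy; exact: le_lt_trans (QQ _ _ Qx Qy) rho1.
have tau1 : 0 <= rho < 1 by rewrite rho0.
have [e e0 he] := zkernel_tail n2 gd tau1.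
pose S K (p : T * T) := \sum_(0 <= k < K) d k * Zf k p.1 p.2.
have bZ k : bounded_kernel Q (fun p : T * T => Zf k p.1 p.2).
  split; first exact: measurable_Zf2.
  exists (@hdim R n k) => x y Qx Qy; apply: (le_trans (Zf_le n2 _ _ _)).
  apply: ler_piMr; first exact: hdim_ge0.
  by apply: exprn_ile1; rewrite ?mulr_ge0 ?enorm_ge0// ltW// QQ1.
have hS K : bounded_kernel Q (S K) /\ 0 <= double_integral nuf Q Q (S K).
  elim: K => [|K [bS IH]].
    have -> : S 0%N = (fun=> 0) by apply/funext => p; rewrite /S big_geq.
    by have [b0 ->] := double_integral_cst nuf mQ 0; rewrite mul0r.
  have -> : S K.+1 = (fun p => S K p + d K * Zf K p.1 p.2).
    by apply/funext => p; rewrite /S big_nat_recr.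
  have [bd Ed] := double_integralZ nuf mQ (d K) (bZ K).
  have [bs ->] := double_integralD nuf mQ bS bd; split => //.
  rewrite Ed; apply: addr_ge0 IH (mulr_ge0 (d0 K) _); apply: Zf_positive_semidefinite mQ _ => x /Qrho xr.
  by rewrite /uball /=; exact: le_lt_trans rho1.
have bk : bounded_kernel Q (fun p => zk d p.1 p.2).
  split; first exact: measurable_zk.
  exists (e 0%N) => x y Qx Qy; rewrite zkE ?QQ1//.
  by have := he x y 0%N (QQ _ _ Qx Qy); rewrite big_geq// subr0.
have hK K : - e K * fine (nuf Q) ^+ 2 <= double_integral nuf Q Q (fun p => zk d p.1 p.2).
  have [bS S0] := hS K; have [be Ee] := double_integral_cst nuf mQ (- e K).
  have [bD ED] := double_integralD nuf mQ bS be.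
  apply: (@le_trans _ _ (double_integral nuf Q Q (fun p => S K p - e K))); first by rewrite ED Ee lerDr.
  apply: (le_double_integral nuf mQ bD bk) => x y Qx Qy /=; rewrite zkE ?QQ1//.
  have := he x y K (QQ _ _ Qx Qy); rewrite ler_norml => /andP[h _].
  by rewrite -lerBrDl.
have h : - e K * fine (nuf Q) ^+ 2 @[K --> \oo] --> - 0 * fine (nuf Q) ^+ 2.
  by apply: cvgM; [exact: cvgN|exact: cvg_cst].
rewrite oppr0 mul0r in h.
by apply: (ler_cvg_to h (cvg_cst _)); apply: nearW => K; exact: hK.
Qed.

(** On a set of diameter small compared with its distance to the sphere the kernel
    has, in the mean, the size it has on the diagonal: up to a positive
    semidefinite kernel it is a difference of two Poisson kernels, and of these the
    one closer to the sphere dominates there. *)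
Lemma double_integral_kernel_ge c : -1 < c -> exists2 kappa, 0 < kappa & forall h (Q : set T),
  0 < h <= 20^-1 -> measurable Q ->
  (forall x, Q x -> 1 - h / 40 <= enorm x <= 1 - h / 400) ->
  (forall x y, Q x -> Q y -> dot x x + dot y y - 2 * dot x y <= h ^+ 2 / 400) ->
  kappa * h `^ (- (c + n%:R)) * fine (nuf Q) ^+ 2 <=
    double_integral nuf Q Q (fun p => zk (gamma c) p.1 p.2).
Proof.
move=> c1; have [k1 k10 hk1] := gamma_ge_poisson_difference n2 c1.
have [k2 k20 hk2] := poisson_difference_ge.
exists (k1 * k2); first exact: mulr_gt0.
move=> h Q h20 mQ Qh Qd; have /andP[h0 h1] := h20.
have h11 : 0 < h < 1 by rewrite h0; apply: (le_lt_trans h1); rewrite invf_lt1// ltr1n.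
pose w := k1 * h `^ (- (c + 1)).
pose p1 k := (1 - h) ^+ k; pose p2 k := (1 - h) ^+ (2 * k).
have rh : 0 <= 1 - h <= 1 by lra.
have gp (g : nat -> nat) : growth (fun k => (1 - h) ^+ (g k)).
  apply: (growth_le (growth_cst 1)) => k; rewrite ger0_norm ?exprn_ge0 ?exprn_ile1//; lra.
have g1 : growth p1 := gp id; have g2 : growth p2 := gp (muln 2).
pose d k := gamma c k + (- w) * (p1 k + (- (3 / 2)) * p2 k).
have gc : growth (gamma c) by exact: growth_gamma.
have gq : growth (fun k => p1 k + (- (3 / 2)) * p2 k).
  by apply: growthD => //; apply: growthM => //; exact: growth_cst.
have gd : growth d.
  by apply: growthD => //; apply: growthM => //; exact: growth_cst.
have d0 k : 0 <= d k.
  by rewrite /d mulNr subr_ge0 mulNr; exact: hk1.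
have Q1 x : Q x -> enorm x < 1 by move=> /Qh /andP[_]; lra.
have QQ1 x y : Q x -> Q y -> enorm x * enorm y < 1.
  by move=> /Q1 x1 /Q1 y1; rewrite -[ltRHS]mulr1; apply: ltr_pM; rewrite ?enorm_ge0.
have wE : h `^ (- (c + n%:R)) = h `^ (- (c + 1)) * h `^ (1 - n%:R).
  rewrite -powRD; last by apply/implyP => _; rewrite gt_eqF.
  by congr (_ `^ _); ring.
have bk e : growth e -> bounded_kernel Q (fun p : T * T => zk e p.1 p.2).
  move=> ge; split; first exact: measurable_zk.
  have tau1 : 0 <= 1 - h / 400 < 1 by lra.
  have [E _ hE] := zkernel_tail n2 ge tau1.
  exists (E 0%N) => x y Qx Qy /=; rewrite zkE ?QQ1//.
  have : enorm x * enorm y <= 1 - h / 400.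
    rewrite -[leRHS]mulr1; apply: ler_pM; rewrite ?enorm_ge0// ?(ltW (Q1 _ Qy))//.
    by have /andP[] := Qh _ Qx.
  by move=> /(hE x y 0%N); rewrite big_geq// subr0.
have [bK EK] := double_integral_cst nuf mQ (w * (k2 * h `^ (1 - n%:R))).
have [bD ED] := double_integralD nuf mQ (bk _ gd) bK.
apply: (@le_trans _ _ (double_integral nuf Q Q (fun p => zk d p.1 p.2 + w * (k2 * h `^ (1 - n%:R))))).
  rewrite ED EK (_ : k1 * k2 * _ * _ = w * (k2 * h `^ (1 - n%:R)) * fine (nuf Q) ^+ 2); last first.
    by rewrite wE /w; ring.
  have rho1 : 1 - h / 400 < 1 by rewrite gtrBl divr_gt0 ?ltr0n.
  rewrite lerDr; apply: (zk_positive_semidefinite gd d0 rho1 mQ) => x /Qh /andP[_ h2]; exact: h2.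
apply: (le_double_integral nuf mQ bD (bk _ gc)) => x y Qx Qy /=.
rewrite !zkE ?QQ1//.
have -> : zkernel d x y = zkernel (gamma c) x y +
    (- w) * (zkernel p1 x y + (- (3 / 2)) * zkernel p2 x y).
  rewrite /d zkernelD ?QQ1//; last by apply: growthM => //; exact: growth_cst.
  rewrite zkernelZ ?QQ1// zkernelD ?QQ1//; last by apply: growthM => //; exact: growth_cst.
  by rewrite zkernelZ ?QQ1.
have Qx' : 1 - h / 40 <= enorm x < 1 by rewrite Q1// andbT; have /andP[] := Qh _ Qx.
have Qy' : 1 - h / 40 <= enorm y < 1 by rewrite Q1// andbT; have /andP[] := Qh _ Qy.
have := hk2 h x y h20 Qx' Qy' (Qd _ _ Qx Qy).
have w0 : 0 <= w by rewrite mulr_ge0 ?powR_ge0// ltW.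
move=> /(ler_wpM2l w0) hw.
by rewrite -addrA gerDl mulNr addrC subr_le0 mulNr.
Qed.

End near_diagonal.

(** * Cells near the sphere *)

Lemma measure_bigsetU_le d (T : measurableType d) (R : realType) (m : {measure set T -> \bar R})
    (I : Type) (s : seq I) (F : I -> set T) : (forall i, measurable (F i)) ->
  (m (\big[setU/set0]_(i <- s) F i) <= \sum_(i <- s) m (F i))%E.
Proof.
move=> mF; elim: s => [|i s IH]; first by rewrite !big_nil measure0.
rewrite !big_cons; apply: (@le_trans _ _ (m (F i) + m (\big[setU/set0]_(j <- s) F j))%E).
  by apply: measureU2 => //; apply: bigsetU_measurable => j _; exact: mF.
by rewrite leeD2l.
Qed.

Lemma sum_integral_disjoint_le d (T : measurableType d) (R : realType)
    (m : {measure set T -> \bar R}) (I : finType) (Q : I -> set T) (g : T -> \bar R) :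
  (forall i, measurable (Q i)) -> (forall i j x, Q i x -> Q j x -> i = j) ->
  measurable_fun setT g -> (forall x, 0 <= g x)%E ->
  (\sum_i \int[m]_(x in Q i) g x <= \int[m]_x g x)%E.
Proof.
move=> mQ dQ mg g0.
have mr i : measurable_fun setT (g \_ (Q i)).
  by apply/(measurable_restrictT _ (mQ i)); exact: measurable_funTS.
have r0 i x : (0 <= (g \_ (Q i)) x)%E by rewrite /patch; case: ifP.
under eq_bigr do rewrite integral_mkcond.
rewrite -ge0_integral_sum//.
apply: ge0_le_integral => //; first by move=> x _; exact: sume_ge0.
  exact: emeasurable_sum.
move=> x _; have [[i Qi]|nQ] := pselect (exists i, Q i x).
  rewrite (bigD1 i)//= big1 ?adde0; first by rewrite patchE mem_set.
  move=> j ji; rewrite patchE memNset// => Qj.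
  by move/eqP: ji; apply; exact: dQ Qj Qi.
rewrite big1// => i _; rewrite patchE memNset// => Qi.
by apply: nQ; exists i.
Qed.

Section cells.
Context {R : realType} {n : nat}.
Hypothesis n2 : (2 <= n)%N.
Notation T := (n.-tuple R).
Notation dot := (@Zonal.dot R n).
Notation nuf := (@nuf R n).
Implicit Types (x y : T).

Let n0 : (0 < n)%N. Proof. exact: leq_trans n2. Qed.
Let nR : 2 <= n%:R :> R. Proof. by rewrite ler_nat. Qed.

Variable m : nat.
Hypothesis m2 : (2 <= m)%N.
Let s : R := m%:R^-1.
Let mR : 2 <= m%:R :> R. Proof. by rewrite ler_nat. Qed.
Let s0 : 0 < s. Proof. by rewrite invr_gt0; apply: lt_le_trans mR. Qed.
Let s2 : s <= 2^-1. Proof. by rewrite lef_pV2 ?posrE//; apply: lt_le_trans mR. Qed.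

Definition shell : set T := [set x | 1 - s <= enorm x < 1 - s / 2].

Lemma measurable_shell : measurable shell.
Proof.
rewrite (_ : shell = enorm @^-1` `[1 - s, 1 - s / 2[%classic); last first.
  by apply/seteqP; split => x; rewrite /shell /= in_itv.
by rewrite -[X in measurable X]setTI; exact: measurable_enorm.
Qed.

Let nu_centered r : 0 < r <= 1 -> nuf [set x | enorm x < r] = (r ^+ n)%:E.
Proof.
move=> r01; rewrite -[RHS]mule1 -(@sigma_setT R n) -(nu_cone r01 (@measurableT _ _)).
by congr (nuf _); apply/seteqP; split => x /=; [split|case].
Qed.

Lemma nu_shell_ge : (2 ^- n.+1 * s) <= fine (nuf shell).
Proof.
have mle r : measurable [set x : T | enorm x < r].
  rewrite (_ : mkset _ = enorm @^-1` `]-oo, r[%classic).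
    by rewrite -[X in measurable X]setTI; exact: measurable_enorm.
  by apply/seteqP; split => x; rewrite /= in_itv.
have r1 : 0 < 1 - s <= 1 by move: s0 s2; lra.
have r2 : 0 < 1 - s / 2 <= 1 by move: s0 s2; lra.
have shE : shell = [set x | enorm x < 1 - s / 2] `\` [set x | enorm x < 1 - s].
  apply/seteqP; split => x /=; first by move=> /andP[h1 h2]; split => //; apply/negP; rewrite -leNgt.
  by move=> [h1 /negP]; rewrite -leNgt => h2; rewrite /shell /= h1 h2.
have -> : nuf shell = ((1 - s / 2) ^+ n - (1 - s) ^+ n)%:E.
  rewrite shE measureD//; last by rewrite ltey_eq fin_num_measure.
  rewrite setIidr; first by rewrite EFinB; congr (_ - _)%E; exact: nu_centered.
  by move=> x /= h; apply: lt_le_trans h _; move: s0; lra.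
rewrite /=; move: r1 r2 => /andP[r10 r11] /andP[r20 r21].
have ab : (1 - s) ^+ n + 2 ^- n.-1 * (s / 2) <= (1 - s / 2) ^+ n.
  rewrite -(prednK n0) !exprS.
  have h1 : 2 ^- n.-1 <= (1 - s / 2) ^+ n.-1.
    by rewrite -exprVn; apply: lerXn2r; rewrite ?nnegrE; move: s0 s2; lra.
  have h2 : (1 - s) ^+ n.-1 <= (1 - s / 2) ^+ n.-1.
    by apply: lerXn2r; rewrite ?nnegrE; move: s0; lra.
  move: h1 h2 => /=; set u := 2 ^- n.-1; set v := _ ^+ n.-1; set w := (1 - s / 2) ^+ n.-1.
  move: s0 r10; set t := s; nra.
apply: (@le_trans _ _ (2 ^- n.-1 * (s / 2))); last by lra.
rewrite [leRHS]mulrCA [leRHS]mulrC; apply: ler_wpM2r; first exact: ltW.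
rewrite -invfM -exprSr prednK// lef_pV2 ?posrE ?exprn_gt0//.
by rewrite ler_weXn2l// ler1n.
Qed.

(** The number of cubes per unit of length, large enough for the diameter of a cube not
    to exceed [s / 4]. *)
Definition mesh : nat := (4 * n * m)%N.

Let meshE : mesh%:R = 4 * n%:R / s :> R.
Proof. by rewrite /mesh !natrM /s invrK. Qed.

Let mesh0 : 0 < mesh%:R :> R.
Proof. by rewrite meshE divr_gt0// mulr_gt0//; move: nR; lra. Qed.

Notation label := {ffun 'I_n -> 'I_(2 * mesh)}.

Definition cube (l : label) : set T :=
  [set x | forall i, `[(l i)%:R / mesh%:R - 1, ((l i)%:R + 1) / mesh%:R - 1[%classic (tnth x i)].

(** Cubes that miss the shell are replaced by the empty set, so that all cells stay
    close to the shell. *)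
Definition cell (l : label) : set T :=
  if `[< (shell `&` cube l) !=set0 >] then cube l else set0.

Lemma measurable_cell l : measurable (cell l).
Proof. by rewrite /cell; case: ifP => // _; apply: (@measurable_cube R n (fun i => `[(l i)%:R / mesh%:R - 1, ((l i)%:R + 1) / mesh%:R - 1[%classic)) => i; exact: measurable_itv. Qed.

Lemma shell_covered : shell `<=` \big[setU/set0]_(l : label) cell l.
Proof.
move=> x Sx; have /andP[_ x1] := Sx.
have xi i : -1 < tnth x i < 1.
  by rewrite -ltr_norml; apply: le_lt_trans (tnth_le_enorm x i) _; move: s0; lra.
have t0 i : 0 <= mesh%:R * (tnth x i + 1).
  by rewrite mulr_ge0 ?(ltW mesh0)//; have /andP[] := xi i; lra.
have lt i : (Num.trunc (mesh%:R * (tnth x i + 1)) < 2 * mesh)%N.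
  rewrite -(ltr_nat R); have /andP[h _] := truncn_itv (t0 i).
  apply: (le_lt_trans h); rewrite natrM mulrC ltr_pM2r//; have /andP[] := xi i; lra.
pose l : label := [ffun i => Ordinal (lt i)].
have cx : cube l x.
  move=> i; rewrite /= in_itv /= ffunE /=; have /andP[h1 h2] := truncn_itv (t0 i).
  rewrite lerBlDr ltrBrDr ler_pdivrMr// ltr_pdivlMr//.
  by rewrite ![(tnth x i + 1) * _]mulrC h1 natr1 h2.
rewrite (bigD1 l)//=; left; rewrite /cell asboolT//.
by exists x.
Qed.

Lemma sum_nu_cell_ge : 2 ^- n.+1 * s <= \sum_(l : label) fine (nuf (cell l)).
Proof.
apply: (le_trans nu_shell_ge); rewrite -lee_fin fineK ?fin_num_measure//; last exact: measurable_shell.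
have mU : measurable (\big[setU/set0]_(l : label) cell l).
  by apply: bigsetU_measurable => l _; exact: measurable_cell.
apply: (@le_trans _ _ (nuf (\big[setU/set0]_(l : label) cell l))).
  by apply: le_measure; rewrite ?inE//; [exact: measurable_shell|exact: shell_covered].
apply: (le_trans (measure_bigsetU_le _ _ measurable_cell)).
rewrite -sumEFin; apply: lee_sum => l _; rewrite fineK ?fin_num_measure//.
exact: measurable_cell.
Qed.

Lemma cell_sub_cube l x : cell l x -> cube l x.
Proof. by rewrite /cell; case: ifP. Qed.

Lemma cell_disjoint l l' x : cell l x -> cell l' x -> l = l'.
Proof.
move=> /cell_sub_cube lx /cell_sub_cube l'x; apply/ffunP => i; apply/val_inj/eqP.
have := l'x i; have := lx i; rewrite /= !in_itv /= => /andP[a1 a2] /andP[b1 b2].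
have := le_lt_trans a1 b2; have := le_lt_trans b1 a2.
rewrite !ltrD2r !ltr_pM2r ?invr_gt0// !natr1 !ltr_nat !ltnS => h1 h2.
by rewrite eqn_leq h1 h2.
Qed.

Lemma cell_diameter l x y : cell l x -> cell l y ->
  dot x x + dot y y - 2 * dot x y <= s ^+ 2 / 16.
Proof.
move=> /cell_sub_cube lx /cell_sub_cube ly.
have -> : dot x x + dot y y - 2 * dot x y = \sum_(i < n) (tnth x i - tnth y i) ^+ 2.
  rewrite /Zonal.dot /Zonal.dotp mulr_sumr -big_split -sumrB /=.
  by apply: eq_bigr => i _; ring.
apply: (@le_trans _ _ (\sum_(i < n) (mesh%:R^-1) ^+ 2)).
  apply: ler_sum => i _; have := ly i; have := lx i; rewrite /= !in_itv /=.
  rewrite mulrDl mul1r; set u := (l i)%:R / _; move=> /andP[a1 a2] /andP[b1 b2].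
  rewrite -[leLHS]real_normK ?num_real//; apply: lerXn2r; rewrite ?nnegrE ?invr_ge0//.
  by rewrite ler_norml; apply/andP; split; lra.
rewrite sumr_const card_ord meshE -[_ *+ n]mulr_natl invf_div expr_div_n exprMn.
rewrite mulrA [_ * s ^+ 2]mulrC -mulrA ler_wpM2l ?exprn_ge0 ?(ltW s0)//.
rewrite invfM mulrA -[leRHS]mul1r (_ : 4 ^+ 2 = 16); last by ring.
rewrite mulrAC ler_wpM2r// ler_pdivrMr; move: nR; set N := n%:R; nra.
Qed.

Lemma cell_shell l x : cell l x -> 1 - 5 / 4 * s <= enorm x <= 1 - s / 4.
Proof.
move=> lx; have : (shell `&` cube l) !=set0.
  by move: lx; rewrite /cell; case: ifPn => // /asboolP.
move=> [y [/andP[y1 y2] cy]].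
have ly : cell l y.
  by move: lx; rewrite /cell; case: ifP.
have := cell_diameter lx ly; have := dot_le_enorm n2 x y.
rewrite -!enorm_sqr => /ler_normlW xy d.
have e : (enorm x - enorm y) ^+ 2 <= (s / 4) ^+ 2.
  by rewrite (_ : (s / 4) ^+ 2 = s ^+ 2 / 16); [nra|field].
have : `|enorm x - enorm y| <= s / 4.
  have h4 : 0 <= s / 4 by move: s0; lra.
  by rewrite -(ger0_norm h4) -ler_sqr ?nnegrE// !real_normK ?num_real.
rewrite ler_norml => /andP[h1 h2]; apply/andP; split; lra.
Qed.

Lemma nu_cell_ge l : cell l !=set0 ->
  (@vol R n)^-1 * (4 * n%:R) ^- n * s ^+ n <= fine (nuf (cell l)).
Proof.
move=> [x lx]; have lE : cell l = cube l by move: lx; rewrite /cell; case: ifP.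
have lU : cell l `<=` uball.
  by move=> y /cell_shell /andP[_ h]; rewrite /uball /=; move: s0; lra.
have -> : nuf (cell l) = ((@vol R n)^-1 * mesh%:R^-1 ^+ n)%:E.
  rewrite [LHS]nuE setIidl// lE EFinM; congr (_ * _)%E.
  apply: (@lebesgue_cube R n (fun i => `[(l i)%:R / mesh%:R - 1, ((l i)%:R + 1) / mesh%:R - 1[%classic)) => i; first exact: measurable_itv.
  rewrite lebesgue_measure_itv /= lte_fin ltrD2r ltr_pM2r ?invr_gt0// ltrDl ltr01.
  by rewrite -EFinB; congr EFin; rewrite mulrDl; ring.
rewrite /= meshE invf_div expr_div_n -mulrA ler_wpM2l ?invr_ge0 ?(ltW (@vol_gt0 R n))//.
by rewrite mulrC.
Qed.

End cells.

(** * Necessity of the exponent conditions *)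

Lemma Rintegral_sum d (T : measurableType d) (R : realType) (m : {measure set T -> \bar R})
    (D : set T) (I : Type) (s : seq I) (f : I -> T -> R) : measurable D ->
  (forall i, m.-integrable D (EFin \o f i)) ->
  (\int[m]_(x in D) (\sum_(i <- s) f i x))%R = \sum_(i <- s) (\int[m]_(x in D) f i x)%R.
Proof.
move=> mD iF.
have iS : m.-integrable D (EFin \o (fun x => \sum_(i <- s) f i x)).
  apply: (eq_integrable mD (fun x => \sum_(i <- s) (EFin \o f i) x)%E).
    by move=> x _; rewrite /= sumEFin.
  by apply: integrable_sum => // i _; exact: iF.
elim: s iS => [|i s IH] iS.
  by under eq_Rintegral do rewrite big_nil; rewrite big_nil Rintegral_cst// mul0r.
have iS' : m.-integrable D (EFin \o (fun x => \sum_(i <- s) f i x)).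
  apply: (eq_integrable mD (fun x => \sum_(i <- s) (EFin \o f i) x)%E).
    by move=> x _; rewrite /= sumEFin.
  by apply: integrable_sum => // j _; exact: iF.
by under eq_Rintegral do rewrite big_cons; rewrite big_cons RintegralD// IH.
Qed.

Lemma natmul_unbounded {R : realType} (K W : R) : 0 < K -> ~ (forall J : nat, J%:R * K <= W).
Proof.
move=> K0 h; have := h (Num.trunc (W / K)).+1.
rewrite -ler_pdivlMr// leNgt => /negP; apply.
have W0 : 0 <= W / K by rewrite divr_ge0 ?(ltW K0)//; have := h 0%N; rewrite mul0r.
by have /andP[] := truncn_itv W0.
Qed.

Lemma signed_sum_ge {R : realDomainType} (I : finType) (a theta tau v eps : I -> R) (D : I -> I -> R) :
  \sum_i a i * theta i * D i i <= \sum_i \sum_j eps i * eps j * (a i * theta j * D i j) ->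
  \sum_i a i * (theta i * D i i - tau i * v i) <=
  \sum_i a i * (eps i * (\sum_j eps j * theta j * D i j) - tau i * v i).
Proof.
move=> h; under eq_bigr do rewrite mulrBr mulrA.
under [leRHS]eq_bigr do rewrite mulrBr.
rewrite !sumrB lerD2r; apply: (le_trans h); apply: ler_sum => i _; rewrite !mulr_sumr.
by apply: ler_sum => j _; rewrite le_eqVlt; apply/orP; left; apply/eqP; ring.
Qed.

Section scales.
Context {R : realType} {n : nat}.
Notation T := (n.-tuple R).
Notation nuf := (@nuf R n).
Implicit Types (x : T).

(** The [j]-th shell lies between the distances [s / 2] and [s] from the sphere, with [s]
    the inverse of this number. The ratio 8 keeps the cells of consecutive shells
    apart. *)
Definition scale_nat (j : nat) : nat := (8 ^ (j + 4))%N.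
Notation s j := ((scale_nat j)%:R^-1 : R).

Lemma scale_nat_ge2 j : (2 <= scale_nat j)%N.
Proof. by rewrite /scale_nat addnS expnS (leq_trans _ (leq_pmulr _ _))// expn_gt0. Qed.

Lemma scale_gt0 j : 0 < s j.
Proof. by rewrite invr_gt0 ltr0n (leq_trans _ (scale_nat_ge2 j)). Qed.

Lemma scale_le j : 64 * s j <= 20^-1.
Proof.
rewrite /scale_nat addnC expnD natrM invfM mulrA.
have h : (8 ^ j)%:R^-1 <= 1 :> R by rewrite invf_le1 ?ltr0n ?expn_gt0// ler1n expn_gt0.
have e : 64 * (8 ^ 4)%:R^-1 <= 20^-1 :> R.
  by rewrite natrX !exprS expr0; lra.
apply: le_trans e; rewrite -[leRHS]mulr1; exact: ler_wpM2l.
Qed.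

Lemma scale_step i j : (i < j)%N -> s j <= s i / 8.
Proof.
move=> ij; rewrite -invfM lef_pV2 ?posrE ?mulr_gt0 ?ltr0n ?expn_gt0//.
rewrite -natrM ler_nat /scale_nat -expnSr leq_pexp2l//.
by rewrite -addSn leq_add2r.
Qed.

(** Both the shell of a scale and its cells lie in this annulus; the annuli of
    different scales are disjoint. *)
Definition annulus j : set T := [set x | 1 - 5 / 4 * s j <= enorm x <= 1 - s j / 4].

Lemma annulus_disjoint i j x : annulus i x -> annulus j x -> i = j.
Proof.
have key k l : (k < l)%N -> annulus k x -> annulus l x -> False.
  move=> /scale_step h /andP[_ h1] /andP[h2 _]; have := scale_gt0 k.
  by move: h h1 h2; set u := s k; set v := s l; lra.
by move=> hi hj; case: (ltngtP i j) => // ij; [case: (key i j)|case: (key j i)].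
Qed.

Lemma shell_annulus j x : shell (scale_nat j) x -> annulus j x.
Proof.
rewrite /annulus /shell /=; have := scale_gt0 j; set u := s j => h /andP[h1 h2].
by apply/andP; split; lra.
Qed.

Lemma weight_annulus_ge a j x : annulus j x -> 4 `^ (- `|a|) * s j `^ a <= weight a x.
Proof.
move=> /andP[]; have := scale_gt0 j; have := scale_le j; set u := s j => u1 u0 h1 h2.
have w1 : u / 4 <= 1 - enorm x ^+ 2 by move: (enorm_ge0 x) h1 h2; set e := enorm x; nra.
have w2 : 1 - enorm x ^+ 2 <= 4 * u by move: (enorm_ge0 x) h1 h2; set e := enorm x; nra.
have w0 : 0 < 1 - enorm x ^+ 2 by lra.
rewrite /weight; case: (lerP 0 a) => a0.
  rewrite ger0_norm//.
  have -> : 4 `^ (- a) = 4^-1 `^ a by rewrite -powR_inv1// -powRrM mulN1r.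
  rewrite -powRM ?invr_ge0 ?(ltW u0)//; apply: ge0_ler_powR => //.
  - by rewrite nnegrE mulr_ge0 ?invr_ge0// ltW.
  - by rewrite nnegrE ltW.
  - by rewrite mulrC.
have a1 : 0 <= - a by rewrite oppr_ge0 ltW.
have u4 : 0 < 4 * u by lra.
rewrite ltr0_norm// opprK -powRM ?(ltW u0)// -[a]opprK [leLHS]powRN [leRHS]powRN.
rewrite lef_pV2 ?posrE ?powR_gt0//; apply: ge0_ler_powR => //.
- by rewrite nnegrE ltW.
- by rewrite nnegrE ltW.
Qed.

End scales.

Section necessity.
Context {R : realType} {n : nat}.
Hypothesis n2 : (2 <= n)%N.
Notation T := (n.-tuple R).
Notation gamma := (@gamma_coef R n).
Notation Zf := (@Zonal.Zf R n).
Notation nuf := (@nuf R n).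
Implicit Types (x y : T).

Let n0 : (0 < n)%N. Proof. exact: leq_trans n2. Qed.

Lemma weight_cst_gt0 a : -1 < a -> 0 < @weight_cst R n a.
Proof.
move=> a1; rewrite /weight_cst a1.
apply: (@Rintegral_gt0 _ _ _ nuf); first exact: measurable_uball.
- by rewrite [X in X != _](_ : _ = 1%E) ?oner_neq0//; exact: nu_uball.
- apply: integrableS (@weight_integrable R n n2 _ a1) => //; exact: measurable_uball.
- by move=> x; exact: weight_gt0.
Qed.

Section bounded_operator.
Variables (b c alpha beta q : R).
Hypothesis q1 : 1 <= q.
Hypothesis beta1 : -1 < beta.
Hypothesis hT : bounded_cLinfty_L (n := n) (bergman_besov c) b alpha beta q.
Notation K := (zk (gamma c)).
Notation op f := (integral_op (bergman_besov c) b f).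

Let q0 : 0 < q. Proof. exact: lt_le_trans q1. Qed.
Let W0 : 0 < @weight_cst R n beta. Proof. exact: weight_cst_gt0. Qed.

Let cLinfty_of_le f : @measurable_fun _ _ T R uball f -> (cLinfty_norm alpha f <= 1)%E -> @cLinfty R n alpha f.
Proof. by move=> mf f1; split => //; apply: (le_lt_trans f1); rewrite ltry. Qed.

Lemma bounded_integral_le : exists2 C : R, 0 <= C & forall f, measurable_fun uball f ->
  (cLinfty_norm alpha f <= 1)%E -> measurable_fun uball (op f) /\
  (\int[nuf]_x ((`|(op f \_ uball) x| `^ q) * (weight beta x / @weight_cst R n beta))%:E <= C%:E)%E.
Proof.
have [hD [C hC]] := hT; exists (`|C| `^ q); first exact: powR_ge0.
move=> f mf f1; have [_ [mop _]] := hD f (cLinfty_of_le mf f1); split; first exact: mop.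
have := hC f (cLinfty_of_le mf f1).
rewrite L_normE; last exact: mop.
set J := (\int[_]_x _)%E => hJ.
have J0 : (0 <= J)%E.
  by apply: integral_ge0 => x _; rewrite mule_ge0// lee_fin ?powR_ge0// divr_ge0 ?weight_ge0 ?weight_cst_ge0.
have hJ1 : (J `^ q^-1 <= `|C|%:E)%E.
  apply: (le_trans hJ); apply: (@le_trans _ _ (`|C|%:E * cLinfty_norm alpha f)%E).
    by apply: lee_wpmul2r; rewrite ?cLinfty_norm_ge0// lee_fin ler_norm.
  by rewrite -[leRHS]mule1; apply: lee_wpmul2l; rewrite ?lee_fin.
have -> : J = ((J `^ q^-1) `^ q)%E.
  by rewrite -poweRrM mulVf ?gt_eqF// poweRe1.
rewrite -poweR_EFin; apply: gt0_ler_poweR; rewrite ?in_itv /= ?poweR_ge0 ?leey ?lee_fin ?normr_ge0//.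
exact: ltW.
Qed.

(** The operator is tested on the function equal to [eps i * theta i] times the weight
    [- b] on [Q i]. The signs [eps] are those for which the quadratic form of the kernel
    dominates its diagonal. *)
Lemma test_inequality : exists W : R,
  forall (I : finType) (Q : I -> set T) (theta tau omega : I -> R) (rho : R), rho < 1 ->
  (forall i, measurable (Q i)) -> (forall i x, Q i x -> enorm x <= rho) ->
  (forall i j x, Q i x -> Q j x -> i = j) ->
  (forall i, [/\ 0 <= theta i, 0 < tau i & 0 <= omega i]) ->
  (forall i x, Q i x -> theta i <= weight (b - alpha) x) ->
  (forall i x, Q i x -> omega i <= weight beta x) ->
  \sum_i omega i * tau i `^ (q - 1) *
    (theta i * double_integral nuf (Q i) (Q i) (fun p => K p.1 p.2) - tau i * fine (nuf (Q i))) <= W.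
Proof.
have [C C0 hC] := bounded_integral_le; clear hT.
exists (@weight_cst R n beta * C) => I Q theta tau omega rho rho1 mQ Qrho dQ pos thW omW.
have gK : growth (gamma c) by exact: growth_gamma.
have mK := measurable_zk n2 gK.
have QU i x : Q i x -> uball x by move=> /Qrho h; exact: le_lt_trans h rho1.
have [M hM] : exists M, forall i j x y, Q i x -> Q j y -> `|K x y| <= M.
  have [rho0|rho0] := leP 0 rho; last first.
    by exists 0 => i j x y /Qrho xr; have := lt_le_trans rho0 (le_trans (enorm_ge0 x) xr); rewrite ltxx.
  have t1 : 0 <= rho < 1 by rewrite rho0.
  have [e _ he] := zkernel_tail n2 gK t1; exists (e 0%N) => i j x y /Qrho xr /Qrho yr.
  have xy : enorm x * enorm y <= rho.
    rewrite -[leRHS]mulr1; apply: ler_pM; rewrite ?enorm_ge0//.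
    exact: le_trans yr (ltW rho1).
  rewrite zkE; last exact: le_lt_trans xy rho1.
  by have := he x y 0%N xy; rewrite big_geq// subr0.
pose a i := omega i * tau i `^ (q - 1).
have a0 i : 0 <= a i by have [_ _ o0] := pos i; rewrite mulr_ge0 ?powR_ge0.
pose D i j := double_integral nuf (Q i) (Q j) (fun p => K p.1 p.2).
change (\sum_i a i * (theta i * D i i - tau i * fine (nuf (Q i))) <= @weight_cst R n beta * C).
have [eps [e1 heps]] := exists_signs (fun i j => a i * theta j * D i j) (index_enum_uniq I).
pose f x := \sum_j eps j * theta j * weight (- b) x * \1_(Q j) x.
have mf : measurable_fun setT f.
  apply: measurable_sum => j; apply: measurable_funM; last exact: measurable_indic.
  by apply: measurable_funM => //; exact: measurable_weight.
have f_on i x : Q i x -> f x = eps i * theta i * weight (- b) x.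
  move=> Qx; rewrite /f (bigD1 i)//= big1 ?addr0; first by rewrite indicE mem_set// mulr1.
  move=> j ji; rewrite indicE memNset ?mulr0// => Qj.
  by move/eqP: ji; apply; exact: dQ Qj Qx.
have f_off x : (forall i, ~ Q i x) -> f x = 0.
  by move=> h; rewrite /f big1// => j _; rewrite indicE memNset ?mulr0.
have fU : measurable_fun uball f by exact: measurable_funTS.
have f1 : (cLinfty_norm alpha f <= 1)%E.
  apply/(cLinfty_norm_leP alpha f ler01); apply: aeW => x x1.
  have [[i Qi]|nQ] := pselect (exists i, Q i x); last first.
    by rewrite f_off ?normr0 ?mulr0// => i Qi; apply: nQ; exists i.
  have [t0 _ _] := pos i; rewrite (f_on i)// !normrM e1 mul1r ger0_norm// ger0_norm ?weight_ge0//.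
  rewrite mulrCA mulrC -weightD//.
  have -> : (1 : R) = weight (alpha - b) x * weight (b - alpha) x.
    by rewrite -weightD// (_ : alpha - b + (b - alpha) = 0) ?weight0//; ring.
  by apply: ler_wpM2l; rewrite ?weight_ge0//; exact: thW.
have [mF hF] := hC f fU f1; set F := op f in mF hF.
pose G j x := (\int[nuf]_(y in Q j) K x y)%R.
have iK i j x : Q i x -> nuf.-integrable (Q j) (EFin \o K x).
  by move=> Qx; apply: (integrable_inner (F := fun p => K p.1 p.2) nuf (mQ j) mK (hM i j) Qx).
have iG i j : nuf.-integrable (Q i) (EFin \o G j).
  exact: (integrable_inner_integral nuf nuf (mQ i) (mQ j) mK (hM i j)).
have F_on i x : Q i x -> F x = \sum_j eps j * theta j * G j x.
  move=> Qx; have x1 := QU _ _ Qx.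
  have mU := @measurable_uball R n.
  transitivity (\int[nuf]_(y in uball) \sum_j (eps j * theta j * (K x \_ (Q j)) y))%R.
    apply: eq_Rintegral => y /set_mem y1; rewrite /integrand bergman_besov_zk// mulrAC.
    rewrite /f mulr_sumr; apply: eq_bigr => j _.
    have ww : weight (- b) y * weight b y = 1 by rewrite -weightD// addNr weight0.
    rewrite indicE patchE; case: ifPn => [_|_]; last by rewrite !mulr0.
    by rewrite mulr1 -[RHS]mulr1 -ww; ring.
  have iKU j : nuf.-integrable uball (EFin \o (K x \_ (Q j))).
    apply: integrableS (_ : nuf.-integrable setT _) => //.
    by rewrite -restrict_EFin; apply/(integrable_mkcond _ (mQ j)); exact: iK Qx.
  rewrite Rintegral_sum//.
    apply: eq_bigr => j _; rewrite RintegralZl//.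
    by rewrite -Rintegral_mkcondr setIidr//; exact: QU.
  by move=> j; apply: (eq_integrable mU _ _ _ (integrableZl mU (eps j * theta j) (iKU j))).
have iGZ i j : nuf.-integrable (Q i) (EFin \o (fun x => eps j * theta j * G j x)).
  by apply: (eq_integrable (mQ i) _ _ _ (integrableZl (mQ i) (eps j * theta j) (iG i j))).
have FB i : exists B, forall x, Q i x -> `|F x| <= B.
  exists (\sum_j `|eps j * theta j| * (M * fine (nuf (Q j)))) => x Qx; rewrite (F_on i)//.
  apply: (le_trans (ler_norm_sum _ _ _)); apply: ler_sum => j _; rewrite normrM.
  apply: ler_wpM2l => //.
  exact: (inner_integral_le (F := fun p => K p.1 p.2) nuf (mQ j) mK (hM i j) Qx).
have mFQ i : measurable_fun (Q i) F.
  by apply: measurable_funS mF; [exact: measurable_uball|exact: QU].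
have finQ i : (nuf (Q i) < +oo)%E by rewrite ltey_eq fin_num_measure.
have iF i : nuf.-integrable (Q i) (EFin \o F).
  by have [B hB] := FB i; exact: (bounded_integrable (mQ i) (finQ i) (mFQ i) hB).
have iC i r : nuf.-integrable (Q i) (EFin \o (fun=> r)).
  apply: (@bounded_integrable _ _ _ _ _ _ `|r| (mQ i) (finQ i)) => //; exact: measurable_cst.
have sF i : (\int[nuf]_(x in Q i) F x)%R =
    \sum_j eps j * theta j * D i j.
  rewrite (@eq_Rintegral _ _ _ nuf (Q i) (fun x => \sum_j eps j * theta j * G j x)%R); last first.
    by move=> x /set_mem; exact: F_on.
  rewrite Rintegral_sum//.
  by apply: eq_bigr => j _; rewrite RintegralZl.
pose W := @weight_cst R n beta.
pose N i x : R := omega i * `|F x| `^ q.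
have mN i : measurable_fun (Q i) (N i).
  apply: measurable_funM => //; apply: (measurableT_comp (measurable_powR q)).
  exact: measurableT_comp.
have iN i : nuf.-integrable (Q i) (EFin \o N i).
  have [B hB] := FB i; have [_ _ o0] := pos i.
  apply: (@bounded_integrable _ _ _ _ _ _ (omega i * B `^ q) (mQ i) (finQ i)) => // x Qx.
  rewrite ger0_norm ?mulr_ge0 ?powR_ge0//; apply: ler_wpM2l => //.
  have B0 : 0 <= B by apply: le_trans (hB x Qx).
  apply: ge0_ler_powR; rewrite ?nnegrE//; [exact: ltW|exact: hB].
apply: (le_trans (signed_sum_ge tau (fun i => fine (nuf (Q i))) heps)).
apply: (@le_trans _ _ (\sum_i (\int[nuf]_(x in Q i) N i x)%R)).
  apply: ler_sum => i _; rewrite -sF.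
  have iZ : nuf.-integrable (Q i) (EFin \o (fun x => eps i * F x)).
    by apply: (eq_integrable (mQ i) _ _ _ (integrableZl (mQ i) (eps i) (iF i))).
  have iB : nuf.-integrable (Q i) (EFin \o (fun x => eps i * F x - tau i)).
    by apply: (eq_integrable (mQ i) _ _ _ (integrableB (mQ i) iZ (iC i (tau i)))).
  have iA : nuf.-integrable (Q i) (EFin \o (fun x => a i * (eps i * F x - tau i))).
    by apply: (eq_integrable (mQ i) _ _ _ (integrableZl (mQ i) (a i) iB)).
  rewrite -Rintegral_cst// -RintegralZl// -RintegralB// -RintegralZl//.
  apply: le_Rintegral (mQ i) iA (iN i) _ => x Qx.
  have [_ t0 o0] := pos i; rewrite /a /N -mulrA; apply: ler_wpM2l => //.
  (* the inequality [a ^ q >= tau ^ (q - 1) * (a - tau)], in place of that of Hoelder *)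
  have h1 : eps i * F x <= `|F x| by rewrite (le_trans (ler_norm _))// normrM e1 mul1r.
  have [h2|h2] := leP `|F x| (tau i).
    by apply: le_trans (powR_ge0 _ _); rewrite mulr_ge0_le0 ?powR_ge0// subr_le0 (le_trans h1).
  have F0 : 0 < `|F x| by exact: lt_trans h2.
  rewrite -[leRHS]mulr_powRB1// [leLHS]mulrC.
  apply: (@le_trans _ _ (`|F x| * tau i `^ (q - 1))).
    apply: ler_wpM2r; first exact: powR_ge0.
    by rewrite lerBlDr (le_trans h1)// lerDl ltW.
  apply: ler_wpM2l => //; apply: ge0_ler_powR; rewrite ?nnegrE ?subr_ge0//; exact: ltW.
rewrite mulrC -ler_pdivrMr// mulr_suml -lee_fin -sumEFin; apply: le_trans hF.
set g := (X in (\int[_]_x X x)%E).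
have mg : measurable_fun setT g.
  apply/measurable_EFinP; apply: measurable_funM.
    apply: (measurableT_comp (measurable_powR q)); apply: measurableT_comp => //.
    by apply/(measurable_restrictT _ (@measurable_uball R n)).
  by apply: measurable_funM => //; exact: measurable_weight.
have g0 x : (0 <= g x)%E.
  by rewrite lee_fin mulr_ge0 ?powR_ge0// divr_ge0 ?weight_ge0 ?weight_cst_ge0.
apply: le_trans (sum_integral_disjoint_le nuf mQ dQ mg g0); apply: lee_sum => i _.
have iNW : nuf.-integrable (Q i) (EFin \o (fun x => N i x * W^-1)).
  by apply: (eq_integrable (mQ i) _ _ _ (integrableZr (mQ i) W^-1 (iN i))).
rewrite -RintegralZr// /Rintegral fineK; last exact: integrable_fin_num iNW.
have [_ _ o0] := pos i.
apply: ge0_le_integral => //.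
- by move=> x Qx; rewrite lee_fin mulr_ge0 ?invr_ge0 ?weight_cst_ge0// mulr_ge0 ?powR_ge0.
- exact: measurable_int iNW.
- exact: measurable_funTS.
- move=> x Qx; rewrite lee_fin /N patchE mem_set; last exact: QU Qx.
  rewrite mulrA ler_wpM2r ?invr_ge0 ?weight_cst_ge0// [leRHS]mulrC.
  by apply: ler_wpM2r; [exact: powR_ge0|exact: omW].
Qed.

(** The term of degree 0 is 1, and all others carry a factor [|x|]. *)
Lemma kernel_near_origin : exists2 delta : R, 0 < delta <= 1 & forall x y,
  enorm x < delta -> uball y -> 2^-1 <= K x y.
Proof.
have gK : growth (gamma c) by exact: growth_gamma.
have gH : growth (fun k => gamma c k * @hdim R n k) by apply: growthM => //; exact: growth_hdim.
have h2 : 0 <= (2^-1 : R) < 1 by lra.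
have [M hM] := growth_sum gH h2.
pose delta : R := (4 * (`|M| + 1))^-1.
have d0 : 0 < delta by rewrite invr_gt0 mulr_gt0// ltr_wpDl.
have dM : 4 * (`|M| + 1) * delta = 1 by rewrite mulfV// gt_eqF// mulr_gt0// ltr_wpDl.
have d1 : delta <= 4^-1.
  rewrite /delta invfM -[leRHS]mulr1; apply: ler_wpM2l => //.
  by rewrite invf_le1 ?lerDr// ltr_wpDl.
exists delta; first by rewrite d0; apply: le_trans d1 _; lra.
move=> x y xd y1.
pose tau := enorm x * enorm y.
have tau0 : 0 <= tau by rewrite mulr_ge0 ?enorm_ge0.
have taud : tau <= delta.
  rewrite -[leRHS]mulr1; apply: ler_pM; rewrite ?enorm_ge0//; exact: ltW.
have tau1 : tau < 1 by lra.
rewrite zkE//.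
have Z0 : gamma c 0 * Zf 0 x y = 1.
  rewrite gamma_coefE// (_ : Zf 0 x y = 1) ?mulr1; last exact: Zonal.zpoly0.
  by rewrite /Zonal.rising; case: ifP => _; rewrite !big_ord0 !divr1 ?mulr1.
have key m : `|\sum_(0 <= k < m.+1) gamma c k * Zf k x y - 1| <= 2^-1.
  rewrite big_nat_recl// Z0 addrAC subrr add0r.
  apply: (le_trans (ler_norm_sum _ _ _)).
  apply: (@le_trans _ _ (2 * delta * \sum_(0 <= k < m.+1) `|gamma c k * @hdim R n k| * 2^-1 ^+ k)).
    rewrite big_nat_recl// mulrDr -[leLHS]add0r; apply: lerD.
      by rewrite !mulr_ge0// ltW.
    rewrite mulr_sumr; apply: ler_sum => k _.
    apply: (le_trans (Zf_term_le n2 (gamma c) k.+1 (lexx tau))).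
    rewrite mulrCA; apply: ler_wpM2l => //.
    rewrite [leLHS]exprS [(_^-1) ^+ _]exprS mulrA (_ : 2 * delta * 2^-1 = delta); last by field.
    apply: ler_pM; rewrite ?exprn_ge0//.
    by apply: lerXn2r; rewrite ?nnegrE//; lra.
  apply: (@le_trans _ _ (2 * delta * `|M|)).
    by apply: ler_wpM2l; [rewrite mulr_ge0// ltW|exact: le_trans (hM _) (ler_norm _)].
  by move: dM (normr_ge0 M); nra.
have cv := zkernel_cvg n2 gK tau1.
have : 2^-1 <= limn (series (fun k => gamma c k * Zf k x y)).
  apply: limr_ge; first exact: cv.
  near=> m; have m0 : (0 < m)%N by near: m; exists 1%N.
  by have := key m.-1; rewrite prednK// ler_norml /series /= => /andP[]; lra.
exact.
Unshelve. all: by end_near.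
Qed.

(** The weight [- alpha] has norm 1, and near the origin its image is at least half
    the integral of the weight [b - alpha]. *)
Lemma weight_integral_finite : (\int[nuf]_x (weight (b - alpha) x)%:E < +oo)%E.
Proof.
have [delta /andP[d0 d1] hd] := kernel_near_origin.
have [hD _] := hT.
pose f : T -> R := weight (- alpha).
have mf : measurable_fun setT f by exact: measurable_weight.
have fU : measurable_fun uball f by exact: measurable_funTS.
have ff : cLinfty alpha f.
  apply: (cLinfty_of_le fU); apply/(cLinfty_norm_leP alpha f ler01); apply: aeW => x x1.
  by rewrite ger0_norm ?weight_ge0// -weightD// subrr weight0.
have [[A [mA A0 hA]] _] := hD f ff.
have [x xd xI] : exists2 x, enorm x < delta &
    nu.-integrable uball (EFin \o integrand (bergman_besov c) b f x).
  apply/not_exists2P => nx.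
  have d01 : 0 < delta <= 1 by rewrite d0.
  have : nu [set x : T | enorm x < delta] = (delta ^+ n)%:E.
    rewrite -[RHS]mule1 -(@sigma_setT R n) -(nu_cone d01 (@measurableT _ _)).
    by congr (nu _); apply/seteqP; split => z /=; [split|case].
  have md : measurable [set x : T | enorm x < delta].
    rewrite (_ : mkset _ = enorm @^-1` `]-oo, delta[%classic).
      by rewrite -[X in measurable X]setTI; exact: measurable_enorm.
    by apply/seteqP; split => z; rewrite /= in_itv.
  have sub : [set x : T | enorm x < delta] `<=` A.
    move=> z zd; apply: hA => /= hz; have [//|] := nx z; apply.
    by apply: hz; exact: lt_le_trans zd d1.
  have := @le_measure _ _ _ nu _ _ (mem_set md) (mem_set mA) sub.
  move=> h1 h2; have : ((delta ^+ n)%:E <= 0%:E)%E by rewrite -h2; apply: (le_trans h1); rewrite le_eqVlt; apply/orP; left; apply/eqP; exact: A0.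
  by rewrite lee_fin leNgt exprn_gt0.
have x1 : uball x by exact: lt_le_trans xd d1.
have mU := @measurable_uball R n.
have mw : measurable_fun setT (fun y : T => (weight (b - alpha) y)%:E).
  by apply/measurable_EFinP; exact: measurable_weight.
rewrite -ge0_integral_nu_uball//; last by move=> y; rewrite lee_fin weight_ge0.
have /integrableP[mI fI] := xI.
have w0 (y : T) : (0 <= (weight (b - alpha) y)%:E)%E by rewrite lee_fin weight_ge0.
set J := (\int[_]_(_ in _) _)%E in fI.
apply: (@le_lt_trans _ _ (2%:E * J)%E); last by apply: lte_mul_pinfty.
rewrite -ge0_integralZl//; last by apply: measurableT_comp.
apply: ge0_le_integral => //.
- exact: measurable_funTS.
- by apply: emeasurable_funM => //; exact: measurableT_comp.
- move=> y y1; rewrite -EFinM lee_fin /integrand bergman_besov_zk//.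
  rewrite -mulrA normrM -weightD// [- alpha + b]addrC (ger0_norm (weight_ge0 _ _)) mulrA.
  rewrite -[leLHS]mul1r; apply: ler_wpM2r; first exact: weight_ge0.
  have h := hd x y xd y1; have := ler_norm (K x y); lra.
Qed.

(** Otherwise every shell contributes at least a fixed amount to the integral of the
    weight. *)
Lemma alpha_lt : alpha - 1 < b.
Proof.
rewrite ltNge; apply/negP => bA; pose s := b - alpha.
have s1 : s <= -1 by rewrite /s; lra.
have := weight_integral_finite; rewrite -/s => fin.
pose V := fine (\int[nuf]_x (weight s x)%:E)%E.
have VE : (\int[nuf]_x (weight s x)%:E)%E = V%:E.
  by rewrite fineK// ge0_fin_numE//; apply: integral_ge0 => x _; rewrite lee_fin weight_ge0.
pose k0 : R := 4 `^ (- `|s|) * 2 ^- n.+1.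
have k00 : 0 < k0 by rewrite mulr_gt0 ?powR_gt0 ?invr_gt0 ?exprn_gt0.
apply: (@natmul_unbounded _ k0 V k00) => J.
have mS (j : 'I_J) := @measurable_shell R n (scale_nat j).
have dS (i j : 'I_J) x : shell (scale_nat i) x -> shell (scale_nat j) x -> i = j.
  by move=> /shell_annulus hi /shell_annulus hj; apply/val_inj; exact: annulus_disjoint hi hj.
have mw : measurable_fun setT (fun y : T => (weight s y)%:E).
  by apply/measurable_EFinP; exact: measurable_weight.
have w0 (y : T) : (0 <= (weight s y)%:E)%E by rewrite lee_fin weight_ge0.
rewrite -lee_fin -VE; apply: le_trans (sum_integral_disjoint_le nuf mS dS mw w0).
rewrite mulr_natl -[X in _ *+ X](card_ord J) -sumr_const -sumEFin; apply: lee_sum => j _.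
set u : R := (scale_nat j)%:R^-1; have u0 : 0 < u by exact: scale_gt0.
apply: (@le_trans _ _ (\int[nuf]_(x in shell (scale_nat j)) (4 `^ (- `|s|) * u `^ s)%:E)%E); last first.
  apply: ge0_le_integral => //.
  - by move=> x _; rewrite lee_fin mulr_ge0 ?powR_ge0.
  - exact: measurable_funTS.
  - by move=> x /shell_annulus /(weight_annulus_ge s); rewrite lee_fin.
rewrite integral_cst// -[X in (_ * X)%E]fineK ?fin_num_measure// -EFinM lee_fin /k0 -mulrA.
apply: ler_wpM2l; first exact: powR_ge0.
have := @nu_shell_ge R n n2 _ (scale_nat_ge2 j); rewrite -/u => h.
apply: (@le_trans _ _ (u `^ s * (2 ^- n.+1 * u))); last by apply: ler_wpM2l => //; exact: powR_ge0.
rewrite mulrCA -[leLHS]mulr1; apply: ler_wpM2l => //.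
rewrite -{2}[u]powRr1 ?(ltW u0)// -powRD; last by apply/implyP => _; rewrite gt_eqF.
have u1 : u <= 1 by have := @scale_le R j; rewrite -/u; lra.
rewrite -[leLHS](powRr0 u); apply: ger_powR; [by rewrite u0|lra].
Qed.

(** Otherwise every scale contributes at least a fixed amount to the left-hand side of
    the test inequality: the mean over a cell of its own potential is of the order of
    [theta * h ^ - c], and [tau] is half of this. *)
Lemma c_lt : c < b + (beta + 1) / q - alpha.
Proof.
rewrite ltNge; apply/negP => hc.
pose s := b - alpha; have s1 : -1 < s by have := alpha_lt; rewrite /s; lra.
have bq : 0 < (beta + 1) / q by rewrite divr_gt0//; move: beta1; lra.
have sc : s + (beta + 1) / q <= c by move: hc; rewrite /s; lra.
have c1 : -1 < c by move: bq sc; set t := (beta + 1) / q; lra.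
have qs : beta + q * (s - c) + 1 <= 0.
  have : q * (s + (beta + 1) / q) <= q * c by apply: ler_wpM2l => //; exact: ltW.
  rewrite mulrDr mulrCA mulfV ?gt_eqF// mulr1; lra.
have [W hW] := test_inequality; clear hT.
have [k k0 hk] := double_integral_kernel_ge n2 c1.
pose v := (@vol R n)^-1 * (4 * n%:R) ^- n.
have v0 : 0 < v.
  by rewrite mulr_gt0 ?invr_gt0 ?vol_gt0// exprn_gt0// mulr_gt0// ltr0n.
(* [k1 * h ^ (- c)] is a lower bound for the mean over a cell of its own potential *)
pose k1 : R := k * 64 `^ (- (c + n%:R)) * v.
have k10 : 0 < k1 by apply: mulr_gt0 v0; apply: mulr_gt0 k0 _; exact: powR_gt0.
pose ks : R := 4 `^ (- `|s|); have ks0 : 0 < ks by rewrite powR_gt0.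
pose kb : R := 4 `^ (- `|beta|); have kb0 : 0 < kb by rewrite powR_gt0.
pose h (j : nat) : R := (scale_nat j)%:R^-1.
have h0 j : 0 < h j by exact: scale_gt0.
pose theta j := ks * h j `^ s.
pose omega j := kb * h j `^ beta.
pose tau j := 2^-1 * (theta j * (k1 * h j `^ (- c))).
have theta0 j : 0 < theta j by apply: mulr_gt0 ks0 _; exact: powR_gt0.
have omega0 j : 0 < omega j by apply: mulr_gt0 kb0 _; exact: powR_gt0.
have tau0 j : 0 < tau j.
  by apply: mulr_gt0 => //; apply: mulr_gt0 => //; apply: mulr_gt0 k10 _; exact: powR_gt0.
pose k2 := kb * (2^-1 * (ks * k1)) `^ q * 2 ^- n.+1.
have k20 : 0 < k2.
  apply: mulr_gt0; last by rewrite invr_gt0 exprn_gt0.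
  by apply: mulr_gt0 kb0 _; rewrite powR_gt0// mulr_gt0// mulr_gt0.
apply: (@natmul_unbounded _ k2 W k20) => J.
pose A (j : 'I_J) : finType := {ffun 'I_n -> 'I_(2 * @mesh n (scale_nat j))}.
pose Q (i : {j : 'I_J & A j}) : set T := cell (tagged i).
have Qann i x : Q i x -> annulus (tag i) x.
  exact: (cell_shell n2 (scale_nat_ge2 (tag i))).
pose rho := 1 - h J / 4.
have rho1 : rho < 1 by rewrite gtrBl divr_gt0.
have mQ i : measurable (Q i) by exact: measurable_cell.
have Qrho i x : Q i x -> enorm x <= rho.
  move=> /Qann /andP[_ h1]; apply: (le_trans h1); rewrite lerB// ler_wpM2r ?invr_ge0//.
  have := @scale_step R (tag i) J (ltn_ord _); rewrite -/(h _) -/(h _) => h2.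
  by apply: (le_trans h2); rewrite ler_pdivrMr// -[leLHS]mulr1; apply: ler_wpM2l; [exact: ltW|lra].
have dQ i i' x : Q i x -> Q i' x -> i = i'.
  move=> Qi Qi'; have e : tag i = tag i'.
    by apply/val_inj; exact: annulus_disjoint (Qann _ _ Qi) (Qann _ _ Qi').
  case: i i' e Qi Qi' => [j l] [j' l'] /= e; subst j'; rewrite /Q /= => Qi Qi'.
  by rewrite (cell_disjoint n2 (scale_nat_ge2 j) Qi Qi').
have pos (i : {j : 'I_J & A j}) : [/\ 0 <= theta (tag i), 0 < tau (tag i) & 0 <= omega (tag i)].
  by split; rewrite ?tau0// ltW.
have thW i x : Q i x -> theta (tag i) <= weight (b - alpha) x.
  by move=> /Qann; exact: weight_annulus_ge.
have omW i x : Q i x -> omega (tag i) <= weight beta x.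
  by move=> /Qann; exact: weight_annulus_ge.
have := hW {j : 'I_J & A j} Q (fun i => theta (tag i)) (fun i => tau (tag i))
  (fun i => omega (tag i)) rho rho1 mQ Qrho dQ pos thW omW.
apply: le_trans.
have hQ (i : {j : 'I_J & A j}) : omega (tag i) * tau (tag i) `^ q * fine (nuf (Q i)) <=
    omega (tag i) * tau (tag i) `^ (q - 1) *
    (theta (tag i) * double_integral nuf (Q i) (Q i) (fun p => K p.1 p.2) -
     tau (tag i) * fine (nuf (Q i))).
  set j : nat := tag i.
  have [Q0|/set0P Qn0] := eqVneq (Q i) set0.
    rewrite Q0 measure0 mulr0 /double_integral Rintegral_set0 !mulr0 subrr mulr0.
    exact: lexx.
  have nQ : v * h j ^+ n <= fine (nuf (Q i)).
    exact: (nu_cell_ge n2 (scale_nat_ge2 j) Qn0).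
  have nQ0 : 0 <= fine (nuf (Q i)) by exact: fine_ge0.
  (* a cell at the scale [h] is close enough to the sphere for the lower bound at the scale
     [64 h] to apply *)
  have h20 : 0 < 64 * h j <= 20^-1 by rewrite mulr_gt0//=; exact: scale_le.
  have dI : k * (64 * h j) `^ (- (c + n%:R)) * fine (nuf (Q i)) ^+ 2 <=
      double_integral nuf (Q i) (Q i) (fun p => K p.1 p.2).
    apply: hk => //.
      move=> x /Qann /andP[]; rewrite -/(h j) => a1 a2.
      by apply/andP; split; move: (h0 j) a1 a2; set u := h j; lra.
    move=> x y Qx Qy; have := cell_diameter n2 (scale_nat_ge2 j) Qx Qy.
    rewrite -/(h j) => hd; apply: (le_trans hd); rewrite exprMn.
    by have := sqr_ge0 (h j); set u := h j ^+ 2; lra.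
  have hc' : k1 * h j `^ (- c) * fine (nuf (Q i)) <=
      double_integral nuf (Q i) (Q i) (fun p => K p.1 p.2).
    clearbody v; apply: le_trans dI; rewrite /k1 powRM ?(ltW (h0 j))// expr2 -!mulrA.
    apply: ler_wpM2l; first exact: ltW.
    apply: ler_wpM2l; first exact: powR_ge0.
    have -> : h j `^ (- c) = h j `^ (- (c + n%:R)) * h j ^+ n.
      rewrite -powR_mulrn ?(ltW (h0 j))// -powRD; last by apply/implyP => _; rewrite gt_eqF.
      by congr (_ `^ _); ring.
    rewrite [leLHS]mulrCA -mulrA; apply: ler_wpM2l; first exact: powR_ge0.
    rewrite mulrCA mulrA; exact: ler_wpM2r.
  have tE : 2 * (tau j * fine (nuf (Q i))) = theta j * (k1 * h j `^ (- c) * fine (nuf (Q i))).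
    by rewrite {1}/tau; field.
  have hD := ler_wpM2l (ltW (theta0 j)) hc'; rewrite -tE in hD.
  have P0 : 0 <= omega j * tau j `^ (q - 1) by rewrite mulr_ge0 ?powR_ge0// ltW.
  have -> : omega j * tau j `^ q * fine (nuf (Q i)) =
      omega j * tau j `^ (q - 1) * (tau j * fine (nuf (Q i))).
    by rewrite -(mulr_powRB1 (ltW (tau0 j)) q0); ring.
  apply: (ler_wpM2l P0); move: hD; move: (theta j * _) (tau j * _) => u w; lra.
apply: (@le_trans _ _ (\sum_(i : {j : 'I_J & A j}) omega (tag i) * tau (tag i) `^ q * fine (nuf (Q i)))); last first.
  by apply: ler_sum => i _; exact: hQ.
rewrite -(sig_big_dep xpredT (fun j => xpredT) (fun (j : 'I_J) (l : A j) =>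
  omega j * tau j `^ q * fine (nuf (cell l)))) /=.
rewrite mulr_natl -[X in _ *+ X](card_ord J) -sumr_const; apply: ler_sum => j _.
rewrite -mulr_sumr; have := @sum_nu_cell_ge R n n2 _ (scale_nat_ge2 j); rewrite -/(h j) => hS.
have wt0 : 0 <= omega j * tau j `^ q by rewrite mulr_ge0 ?powR_ge0// ltW.
apply: le_trans (ler_wpM2l wt0 hS).
have hs : 1 <= h j `^ beta * (h j `^ (s - c)) `^ q * h j.
  have hD a e : h j `^ a * h j `^ e = h j `^ (a + e).
    by rewrite -powRD//; apply/implyP => _; rewrite gt_eqF.
  rewrite -powRrM -{3}[h j]powRr1 ?(ltW (h0 j))// !hD -[leLHS](powRr0 (h j)).
  apply: ger_powR; last by rewrite [(s - c) * q]mulrC.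
  by rewrite h0 /=; have := @scale_le R j; rewrite -/(h j); lra.
have -> : tau j `^ q = (2^-1 * (ks * k1)) `^ q * (h j `^ (s - c)) `^ q.
  have kk : 0 <= 2^-1 * (ks * k1) by rewrite mulr_ge0// mulr_ge0// ltW.
  rewrite -powRM ?powR_ge0//.
  congr (_ `^ _); rewrite /tau /theta powRD; last by apply/implyP => _; rewrite gt_eqF.
  by ring.
have -> : omega j * ((2^-1 * (ks * k1)) `^ q * (h j `^ (s - c)) `^ q) * (2 ^- n.+1 * h j) =
    k2 * (h j `^ beta * (h j `^ (s - c)) `^ q * h j).
  by rewrite /omega /k2; ring.
by rewrite -[leLHS]mulr1; apply: ler_wpM2l => //; exact: ltW.
Qed.

End bounded_operator.
End necessity.

Theorem theorem1p6 (R : realType) (n : nat) (b c q alpha beta : R)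
    (hn : (2 <= n)%N) (hq : 1 <= q) (hbeta : -1 < beta) :
  [<-> bounded_cLinfty_L (n := n) (bergman_besov c) b alpha beta q;
       bounded_cLinfty_L (n := n) (abs_bergman_besov c) b alpha beta q;
       alpha - 1 < b /\ c < b + (beta + 1) / q - alpha].
Proof.
have nec : bounded_cLinfty_L (n := n) (bergman_besov c) b alpha beta q ->
    alpha - 1 < b /\ c < b + (beta + 1) / q - alpha.
  by move=> hT; split; [exact: alpha_lt hT|exact: c_lt hT].
tfae.
- by move=> /nec[h1 h2]; exact: bounded_S_of_exponents.
- by move=> /(bounded_T_of_S hn hq hbeta)/nec.
- by move=> [h1 h2]; exact: bounded_T_of_exponents.
Qed.
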